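(* Let $\xi,\eta\in\mathbb{C}$ satisfy $$\Re((1-i)\xi+(1+i)\eta)>0\quad\text{and}\quad\Re((1+i)\xi+(1-i)\eta)>0 .$$ Let $\sigma\in\mathbb{C}$ be such that $|\Re\sigma|<\frac14$. Then $$K_0\left(\tfrac14(\xi^2+\eta^2)\right)=\frac{1}{2^{1/2}\pi i}\int_{\sigma-i\infty}^{\sigma+i\infty}\Gamma\left(\tfrac14-s\right)\Gamma\left(\tfrac14+s\right)D_{2s-\frac12}(\xi)\,D_{-2s-\frac12}(\eta)\,ds .$$ Here the hypotheses imply that $\xi^2+\eta^2\in\mathbb{C}\setminus(-\infty,0]$, and $K_0(z)$ on the left-hand side is evaluated in the sector $-\pi<\arg z<\pi$.
   Context: $\Gamma$ is Euler's gamma function. $U(a,b,z)$ is the confluent hypergeometric function of the second kind: the solution of $z w''+(b-z)w'-aw=0$ with $U(a,b,z)\sim z^{-a}$ as $z\to\infty$ in $|\arg z|\le\frac32\pi-\delta$ ($\delta>0$), analytic in $z$ on the Riemann surface of the logarithm. The modified Bessel function of the second kind (Macdonald function) is $K_\nu(z)=\sqrt\pi\,e^{-z}(2z)^\nu U\left(\frac12+\nu,1+2\nu,2z\right)$. The parabolic cylinder function is $D_\nu(z)=2^{\nu/2}e^{-z^2/4}U\left(-\frac{\nu}{2},\frac12,\frac12z^2\right)$ (with $\arg(z^2)=2\arg z$, extended analytically); it is analytic for all $\nu,z\in\mathbb{C}$. The integral is along the vertical line through $\sigma$. *)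

(* Defs.v *)
From Stdlib Require Export Reals ClassicalEpsilon.
From Coquelicot Require Export Coquelicot.

Open Scope R_scope.
Open Scope C_scope.

Definition Cexp (z : C) : C :=
  (exp (Re z) * cos (Im z), exp (Re z) * sin (Im z))%R.

(* Principal argument, with values in (-PI, PI] for z <> 0. *)
Definition Carg (z : C) : R :=
  if Rle_dec 0 (Im z) then acos (Re z / Cmod z) else (- acos (Re z / Cmod z))%R.

Definition Clog (z : C) : C := (ln (Cmod z), Carg z).

(* x ^ a for a positive real base x. *)
Definition Rcpow (x : R) (a : C) : C := Cexp (a * ln x).

(* Euler's integral of the second kind, of use when 0 < Re z. *)
Definition Gamma_integral (z : C) : C :=
  RInt_gen (V := C_R_CompleteNormedModule)
    (fun t : R => Rcpow t (z - 1) * exp (- t))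
    (at_right 0) (Rbar_locally p_infty).

Fixpoint rising (z : C) (n : nat) : C :=
  match n with
  | O => 1
  | S k => rising z k * (z + INR k)
  end.

(* Continuation by Gamma (z) = Gamma (z + n) / (z (z + 1) ... (z + n - 1)),
   where n is the least natural number with 0 < Re z + n; meaningless at the
   poles 0, -1, -2, ... *)
Definition CGamma (z : C) : C :=
  let n := Z.to_nat (up (- Re z)) in
  Gamma_integral (z + INR n) / rising z n.

(* A function on the Riemann surface of the logarithm is represented as a
   function W of zeta = log z ranging over C, so that z = Cexp zeta,
   arg z = Im zeta, and arguments differing by 2 PI are distinct points. The
   operator d/dz is then Cexp (- zeta) * d/dzeta. *)
Definition dz (W : C -> C) (zeta : C) : C := Cexp (- zeta) * C_derive W zeta.

Definition Cholomorphic (f : C -> C) : Prop :=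
  forall z : C, ex_derive (K := C_AbsRing) (V := C_NormedModule) f z.

Definition kummer_solution (a b : C) (W : C -> C) : Prop :=
  Cholomorphic W /\ Cholomorphic (dz W) /\
  forall zeta : C,
    Cexp zeta * dz (dz W) zeta + (b - Cexp zeta) * dz W zeta - a * W zeta = 0.

(* w(z) ~ z^(-a) as z -> oo, uniformly in |arg z| <= 3 PI / 2 - delta, for
   every delta > 0; here |z| -> oo reads Re zeta -> +oo. *)
Definition asymptotic_pow_neg (a : C) (W : C -> C) : Prop :=
  forall delta : R, (0 < delta)%R ->
  forall eps : R, (0 < eps)%R ->
  exists M : R, forall zeta : C,
    (Rabs (Im zeta) <= 3 / 2 * PI - delta)%R -> (M < Re zeta)%R ->
    (Cmod (W zeta / Cexp (- a * zeta) - 1) < eps)%R.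

Definition is_tricomiU (a b : C) (W : C -> C) : Prop :=
  kummer_solution a b W /\ asymptotic_pow_neg a W.

(* U(a, b, z) at z = Cexp zeta: the solution selected by its asymptotics. *)
Definition tricomiU (a b : C) : C -> C :=
  epsilon (inhabits (fun _ : C => RtoC 0)) (is_tricomiU a b).

(* K_nu(z) at z = Cexp zeta; 2 z has logarithm zeta + ln 2. *)
Definition besselK_log (nu zeta : C) : C :=
  sqrt PI * Cexp (- Cexp zeta) * Cexp (nu * (zeta + ln 2)) *
  tricomiU (1 / 2 + nu) (1 + 2 * nu) (zeta + ln 2).

(* Principal value of K_nu, for arg z in (-PI, PI]. *)
Definition besselK (nu z : C) : C := besselK_log nu (Clog z).

(* The defining formula of D_nu(z) at z = Cexp zeta, z <> 0; z^2 / 2 has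
   logarithm 2 zeta - ln 2. *)
Definition parcylD_log (nu zeta : C) : C :=
  Rcpow 2 (nu / 2) * Cexp (- (Cexp zeta ^ 2 / 4)) *
  tricomiU (- (nu / 2)) (1 / 2) (2 * zeta - ln 2).

(* D_nu is entire: the formula does not depend on the choice of log z, and it
   has a removable singularity at z = 0. *)
Definition parcylD (nu z : C) : C :=
  if Ceq_dec z 0 then C_lim (fun w : C => parcylD_log nu (Clog w)) 0
  else parcylD_log nu (Clog z).

(* l is the (convergent, two-sided improper) integral of f along the upward
   vertical line s = sigma + i t, with ds = i dt. *)
Definition is_vertical_integral (f : C -> C) (sigma l : C) : Prop :=
  is_RInt_gen (V := C_R_CompleteNormedModule)
    (fun t : R => f (sigma + Ci * t) * Ci)
    (Rbar_locally m_infty) (Rbar_locally p_infty) l.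

(* Main.v *)
Require Import Defs.
From Stdlib Require Import Lra Lia.

Open Scope C_scope.

(** Integrals over rays are written in logarithmic variables: an integral over a ray
    from the origin becomes an integral [CI] over a horizontal line, rotating the ray
    is shifting the line ([CI_contour]), and the product of two integrals is a
    convolution ([CI_prod_conv]).

    For 0 < Re p < 1,
      D_(-p)(z) = e^(-z^2/4) / Gamma(p) * (integral of e^(-z t - t^2/2) t^(p-1) over t > 0),
    which is [parcylD_eq]. With p = 1/2 - 2 s for xi and p = 1/2 + 2 s for eta, the
    denominators multiply to [gpair (4 s)], and the numerator Gamma(1/4 - s) Gamma(1/4
    + s) is a constant times [gpair (4 s)] times a superposition [Rhat s] of
    exponentials e^(4 i s ang(v)), with |ang v| < PI/4 ([Gamma_ratio]). So the
    integrand is, up to a constant, [Rhat s] times the product of the two Laplace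
    integrals.

    For one angle ang(v), the exponential e^(4 i s ang(v)) is what rotating the two
    rays by ang(v) and -ang(v) produces. Convolving the rotated integrals shows that
    it multiplies their product into a Fourier integral, with kernel e^(4 s w), of a
    function [merged] of w ([pcInt_merge]). Averaging over v, the integrand is a
    constant times the integral of e^(4 s w) G(w), where G = [merged_mean] decays like
    e^(-|w|) ([merged_bound]); this decay is what allows |Re s| < 1/4. The integral
    along the vertical line is therefore a Fourier inversion at w = 0
    ([Fourier_inversion]), and gives G(0) provided that G is differentiable there
    ([merged_mean_derive]). A line through sigma replaces G by e^(4 sigma w) G(w),
    with the same value at w = 0.

    Both the decay near w = 0 and the differentiability use the hypotheses on P = (1 -
    i) xi + (1 + i) eta and Q = (1 + i) xi + (1 - i) eta. In the polar coordinates of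
    a branch of hyperbola ([tau]) the pair (v, m) of integration variables becomes a
    point (x, y) of the plane, and
      G(0) = integral of exp ((x + y)/2 - (P e^x + Q e^y)/2 - e^(x+y)) dx dy.
    This double integral depends only on P Q = 2 (xi^2 + eta^2) and is PI U(1/2, 1, P
    Q / 4) ([Y_tricomi]), that is, a Macdonald function of (xi^2 + eta^2)/4.

    The functions U(a, b, z) are specified by their asymptotics in a sector. A
    solution of Kummer's equation is determined by its leading behaviour on the
    positive real axis alone ([recessive_unique]): by the Wronskian, any solution not
    proportional to a recessive one grows like e^z. Existence is by integrals. For b =
    1/2 these are the Laplace integrals above along rotated rays. For a = 1/2, b = 1
    they are double integrals [dblInt] over pairs of rays; each solves the equation
    for z in a half plane, and they are parts of one entire function of log z because
    the equation has two independent solutions that are entire in log z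
    ([entire_continuation]). *)

(** * Complex exponential *)

Lemma C_eq (z w : C) : Re z = Re w -> Im z = Im w -> z = w.
Proof. destruct z, w; simpl; intros -> ->; reflexivity. Qed.

Lemma Cexp_plus (z w : C) : Cexp (z + w) = Cexp z * Cexp w.
Proof.
  destruct z as [a b], w as [c d].
  unfold Cexp; apply C_eq; cbn; rewrite exp_plus, ?cos_plus, ?sin_plus; ring.
Qed.

Lemma Cexp_0 : Cexp 0 = 1.
Proof. unfold Cexp; apply C_eq; cbn; rewrite ?exp_0, ?cos_0, ?sin_0; ring. Qed.

Lemma Cmod_Cexp (z : C) : Cmod (Cexp z) = exp (Re z).
Proof.
  unfold Cmod, Cexp; cbn [fst snd].
  replace ((exp (Re z) * cos (Im z)) ^ 2 + (exp (Re z) * sin (Im z)) ^ 2)%R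
    with (exp (Re z) * exp (Re z) * (Rsqr (sin (Im z)) + Rsqr (cos (Im z))))%R
    by (unfold Rsqr; ring).
  rewrite sin2_cos2, Rmult_1_r. apply sqrt_square, Rlt_le, exp_pos.
Qed.

Lemma Cexp_neq_0 (z : C) : Cexp z <> 0.
Proof. apply Cmod_gt_0; rewrite Cmod_Cexp; apply exp_pos. Qed.

Lemma Cexp_opp (z : C) : Cexp (- z) = / Cexp z.
Proof.
  assert (H : Cexp z * Cexp (- z) = 1)
    by (rewrite <- Cexp_plus, Cplus_opp_r; apply Cexp_0).
  replace (Cexp (- z)) with (/ Cexp z * (Cexp z * Cexp (- z)));
    [rewrite H; ring | field; apply Cexp_neq_0].
Qed.

Lemma Cexp_R (x : R) : Cexp x = exp x.
Proof. unfold Cexp; apply C_eq; cbn; rewrite ?cos_0, ?sin_0; ring. Qed.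

Lemma Cexp_Clog (z : C) : z <> 0 -> Cexp (Clog z) = z.
Proof.
  intros Hz. assert (Hp : (0 < Cmod z)%R) by (apply Cmod_gt_0; exact Hz).
  assert (H2 : (Cmod z * Cmod z = Re z * Re z + Im z * Im z)%R).
  { replace (Cmod z * Cmod z)%R with (Cmod z ^ 2)%R by ring.
    rewrite Cmod2_alt; ring. }
  assert (Hb : (-1 <= Re z / Cmod z <= 1)%R).
  { pose proof (re_le_Cmod z) as H. apply Rabs_le_between in H.
    split; [apply (Rmult_le_reg_r (Cmod z)) | apply (Rmult_le_reg_r (Cmod z))]; auto;
      unfold Rdiv; rewrite Rmult_assoc, Rinv_l; lra. }
  assert (Hs : sin (acos (Re z / Cmod z)) = (Rabs (Im z) / Cmod z)%R).
  { rewrite sin_acos by exact Hb.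
    replace (1 - Rsqr (Re z / Cmod z))%R with (Rsqr (Rabs (Im z) / Cmod z)).
    - apply sqrt_Rsqr. apply Rdiv_le_0_compat; [apply Rabs_pos | auto].
    - assert (Ha : Rsqr (Rabs (Im z)) = Rsqr (Im z)) by (symmetry; apply Rsqr_abs).
      unfold Rsqr in *. field_simplify; [| lra | lra].
      f_equal. unfold pow; rewrite !Rmult_1_r, Ha. lra. }
  apply C_eq; unfold Cexp, Clog, Carg; cbn [Re Im fst snd]; rewrite exp_ln by exact Hp.
  - destruct (Rle_dec 0 (Im z)); rewrite ?cos_neg, cos_acos by exact Hb; field; lra.
  - destruct (Rle_dec 0 (Im z)); rewrite ?sin_neg, Hs.
    + rewrite Rabs_pos_eq by auto. field; lra.
    + rewrite Rabs_left by lra. field; lra.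
Qed.

Lemma Carg_bound (z : C) : (- PI <= Carg z <= PI)%R.
Proof.
  unfold Carg. pose proof (acos_bound (Re z / Cmod z)). pose proof PI_RGT_0.
  destruct (Rle_dec 0 (Im z)); lra.
Qed.

(** Turns estimates by the modulus into statements about the filters of real
    integration, whose codomain carries this norm. *)
Lemma norm_Cmod (z : C) : norm (K := R_AbsRing) (V := C_R_NormedModule) z = Cmod z.
Proof.
  unfold norm; simpl. unfold prod_norm, Cmod, norm; simpl. unfold abs; simpl.
  f_equal. rewrite !Rmult_1_r, <- !Rabs_mult, !Rabs_pos_eq; [reflexivity | nra | nra].
Qed.

Lemma Re_R (x : R) : Re x = x. Proof. reflexivity. Qed.
(** * Continuity of complex-valued maps *)

Section Continuity.
Context {U : UniformSpace}.
Implicit Types f g : U -> C.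

Definition contC f (x : U) : Prop := continuous (T := U) (U := C_UniformSpace) f x.

Lemma contC_pair f x :
  continuous (fun u => Re (f u)) x -> continuous (fun u => Im (f u)) x -> contC f x.
Proof.
  intros H1 H2 P [e HP].
  assert (L1 := proj1 (filterlim_locally _ _) H1 e).
  assert (L2 := proj1 (filterlim_locally _ _) H2 e).
  change (locally x (fun u => P (f u))).
  generalize (filter_and _ _ L1 L2). apply filter_imp. intros u [A B].
  apply HP. split; [exact A | exact B].
Qed.

Lemma contC_Re f x : contC f x -> continuous (fun u => Re (f u)) x.
Proof.
  intros H. apply filterlim_locally. intros e.
  generalize (proj1 (filterlim_locally _ _) H e). apply filter_imp. intros u [A _]. exact A.
Qed.

Lemma contC_Im f x : contC f x -> continuous (fun u => Im (f u)) x.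
Proof.
  intros H. apply filterlim_locally. intros e.
  generalize (proj1 (filterlim_locally _ _) H e). apply filter_imp. intros u [_ A]. exact A.
Qed.

Lemma contC_const (c : C) x : contC (fun _ => c) x.
Proof. apply continuous_const. Qed.

Lemma contC_plus f g x : contC f x -> contC g x -> contC (fun u => f u + g u) x.
Proof.
  intros Hf Hg. apply contC_pair.
  - exact (continuous_plus _ _ _ (contC_Re _ _ Hf) (contC_Re _ _ Hg)).
  - exact (continuous_plus _ _ _ (contC_Im _ _ Hf) (contC_Im _ _ Hg)).
Qed.

Lemma contC_opp f x : contC f x -> contC (fun u => - f u) x.
Proof.
  intros Hf. apply contC_pair.
  - exact (continuous_opp _ _ (contC_Re _ _ Hf)).
  - exact (continuous_opp _ _ (contC_Im _ _ Hf)).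
Qed.

Lemma contC_minus f g x : contC f x -> contC g x -> contC (fun u => f u - g u) x.
Proof. intros Hf Hg. apply contC_plus; [exact Hf | apply contC_opp; exact Hg]. Qed.

Lemma contC_mult f g x : contC f x -> contC g x -> contC (fun u => f u * g u) x.
Proof.
  intros Hf Hg.
  pose proof (contC_Re _ _ Hf) as A1. pose proof (contC_Im _ _ Hf) as A2.
  pose proof (contC_Re _ _ Hg) as B1. pose proof (contC_Im _ _ Hg) as B2.
  apply contC_pair.
  - exact (continuous_minus _ _ _ (continuous_mult _ _ _ A1 B1) (continuous_mult _ _ _ A2 B2)).
  - exact (continuous_plus _ _ _ (continuous_mult _ _ _ A1 B2) (continuous_mult _ _ _ A2 B1)).
Qed.

Lemma contC_RtoC (f : U -> R) x : continuous f x -> contC (fun u => RtoC (f u)) x.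
Proof. intros Hf. apply contC_pair; [exact Hf | apply continuous_const]. Qed.

Lemma contR_exp (f : U -> R) x : continuous f x -> continuous (fun u => exp (f u)) x.
Proof. intros Hf. apply (continuous_comp f exp); [exact Hf | apply continuous_exp]. Qed.

Lemma contR_derivable (h : R -> R) (f : U -> R) x :
  continuous f x -> ex_derive h (f x) -> continuous (fun u => h (f u)) x.
Proof.
  intros Hf Hd. apply (continuous_comp f h); [exact Hf |].
  apply (ex_derive_continuous h); exact Hd.
Qed.

Lemma contC_Cexp f x : contC f x -> contC (fun u => Cexp (f u)) x.
Proof.
  intros Hf. pose proof (contC_Re _ _ Hf) as A1. pose proof (contC_Im _ _ Hf) as A2.
  apply contC_pair.
  - refine (continuous_mult _ _ _ (contR_exp _ _ A1) _).
    apply (contR_derivable cos _ _ A2). auto_derive; auto.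
  - refine (continuous_mult _ _ _ (contR_exp _ _ A1) _).
    apply (contR_derivable sin _ _ A2). auto_derive; auto.
Qed.

Lemma cont_Cmod f x : contC f x -> continuous (fun u => Cmod (f u)) x.
Proof.
  intros Hf. apply (continuous_comp f Cmod); [exact Hf |].
  apply (filterlim_ext (FF := @filter_filter _ _ (@locally_filter C_UniformSpace (f x)))
    (norm (K := R_AbsRing) (V := C_R_NormedModule))); [exact norm_Cmod |].
  rewrite <- norm_Cmod. exact (filterlim_norm (V := C_R_NormedModule) (f x)).
Qed.

End Continuity.

Lemma contC_ball {U : UniformSpace} (f : U -> C) x :
  contC f x <-> forall e : R, (0 < e)%R -> locally x (fun u => (Cmod (f u - f x) < e)%R).
Proof.
  split.
  - intros H e He.
    assert (Hc : continuous (fun u => Cmod (f u - f x)) x)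
      by (apply cont_Cmod, contC_minus; [exact H | apply contC_const]).
    generalize (proj1 (filterlim_locally _ _) Hc (mkposreal e He)).
    apply filter_imp. intros u Hu. unfold ball in Hu; simpl in Hu.
    unfold AbsRing_ball, abs, minus, plus, opp in Hu; simpl in Hu.
    replace (f x - f x) with (RtoC 0) in Hu by ring. rewrite Cmod_0 in Hu.
    apply Rabs_lt_between in Hu. lra.
  - intros H. apply (proj2 (filterlim_locally (F := locally x) f (f x))). intros e.
    generalize (H e (cond_pos e)). apply filter_imp. intros u Hu.
    apply (C_NormedModule_mixin_compat1 (f x) (f u) e). exact Hu.
Qed.

Lemma contC_comp {U V : UniformSpace} (h : U -> V) (f : V -> C) x :
  continuous h x -> contC f (h x) -> contC (fun u => f (h u)) x.
Proof. intros H1 H2. apply (continuous_comp h f); assumption. Qed.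

Lemma cont_pair {U V W : UniformSpace} (f : U -> V) (g : U -> W) x :
  continuous f x -> continuous g x ->
  continuous (U := prod_UniformSpace V W) (fun u => (f u, g u)) x.
Proof.
  intros H1 H2 P [e HP].
  assert (L1 := proj1 (filterlim_locally _ _) H1 e).
  assert (L2 := proj1 (filterlim_locally _ _) H2 e).
  change (locally x (fun u => P (f u, g u))).
  generalize (filter_and _ _ L1 L2). apply filter_imp. intros u [A B].
  apply HP. split; [exact A | exact B].
Qed.

Lemma cont_fst {U V : UniformSpace} (p : U * V) :
  continuous (T := prod_UniformSpace U V) (U := U) fst p.
Proof. intros P [e HP]. exists e. intros q [Hq _]. apply HP, Hq. Qed.

Lemma cont_snd {U V : UniformSpace} (p : U * V) :
  continuous (T := prod_UniformSpace U V) (U := V) snd p.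
Proof. intros P [e HP]. exists e. intros q [_ Hq]. apply HP, Hq. Qed.

(** * Complex derivatives *)

(** Complex differentiability by increments: the error is measured by the modulus,
    which is what domination under an integral sign provides. *)
Definition Cd (f : C -> C) (z l : C) : Prop :=
  forall eps : R, (0 < eps)%R -> exists del : R, (0 < del)%R /\
  forall h : C, (Cmod h < del)%R -> (Cmod (f (z + h)%C - f z - l * h)%C <= eps * Cmod h)%R.

Lemma Cmod_minus_sym (z w : C) : Cmod (z - w) = Cmod (w - z).
Proof. rewrite <- (Cmod_opp (z - w)); f_equal; ring. Qed.

Lemma Cmod_triangle' (x y : C) : (Cmod (x - y) <= Cmod x + Cmod y)%R.
Proof. unfold Cminus. eapply Rle_trans; [apply Cmod_triangle|]. rewrite Cmod_opp; lra. Qed.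

Lemma C_plus_swap (z w : C) : (z + (w - z))%C = w.
Proof. ring. Qed.

Lemma Cd_is_derive (f : C -> C) (z l : C) :
  Cd f z l <-> is_derive (K := C_AbsRing) (V := C_NormedModule) f z l.
Proof.
  split.
  - intros H. split; [apply is_linear_scal_l |].
    intros x Hx e.
    assert (E : z = x).
    { exact (@is_filter_lim_locally_unique C_AbsRing (AbsRing_NormedModule C_AbsRing) z x Hx). }
    subst x. destruct (H e (cond_pos e)) as [d [Hd H1]].
    exists (mkposreal d Hd). intros y Hy.
    change (Cmod (y - z) < d)%R in Hy.
    specialize (H1 (y - z) Hy). rewrite C_plus_swap in H1.
    change (Cmod (f y - f z - (y - z) * l) <= e * Cmod (y - z))%R.
    rewrite (Cmult_comm (y - z) l). exact H1.
  - intros [_ H] e He.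
    specialize (H z (fun P HP => HP) (mkposreal e He)).
    destruct H as [d H]. exists d. split; [apply cond_pos |].
    intros h Hh. assert (Hb : @ball (AbsRing_UniformSpace C_AbsRing) z d (z + h)).
    { change (Cmod (z + h - z) < d)%R. replace (z + h - z) with h by ring. exact Hh. }
    specialize (H (z + h) Hb).
    change (Cmod (f (z + h)%C - f z - (z + h - z) * l) <= e * Cmod (z + h - z))%R in H.
    replace (z + h - z) with h in H by ring. rewrite (Cmult_comm l h). exact H.
Qed.

Lemma Cd_ext_loc (f g : C -> C) (z l : C) (r : R) : (0 < r)%R ->
  (forall w, (Cmod (w - z) < r)%R -> f w = g w) -> Cd f z l -> Cd g z l.
Proof.
  intros Hr E H e He. destruct (H e He) as [d [Hd H1]].
  exists (Rmin r d). split; [apply Rmin_pos; auto |]. intros h Hh.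
  rewrite <- !E.
  - apply H1. eapply Rlt_le_trans; [exact Hh | apply Rmin_r].
  - replace (z - z) with (RtoC 0) by ring. rewrite Cmod_0. exact Hr.
  - replace (z + h - z) with h by ring. eapply Rlt_le_trans; [exact Hh | apply Rmin_l].
Qed.

Lemma Cd_ext (f g : C -> C) (z l : C) : (forall w, f w = g w) -> Cd f z l -> Cd g z l.
Proof. intros E. apply (Cd_ext_loc _ _ _ _ 1); [lra | auto]. Qed.

Lemma Cd_eq (f : C -> C) (z l l' : C) : Cd f z l -> l = l' -> Cd f z l'.
Proof. intros H <-; exact H. Qed.

Lemma Cd_const (c z : C) : Cd (fun _ => c) z 0.
Proof.
  intros e He. exists 1%R. split; [lra |]. intros h _.
  replace (c - c - 0 * h) with (RtoC 0) by ring. rewrite Cmod_0.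
  apply Rmult_le_pos; [lra | apply Cmod_ge_0].
Qed.

Lemma Cd_id (z : C) : Cd (fun w => w) z 1.
Proof.
  intros e He. exists 1%R. split; [lra |]. intros h _.
  replace (z + h - z - 1 * h) with (RtoC 0) by ring. rewrite Cmod_0.
  apply Rmult_le_pos; [lra | apply Cmod_ge_0].
Qed.

Lemma Cd_plus (f g : C -> C) (z a b : C) :
  Cd f z a -> Cd g z b -> Cd (fun w => f w + g w) z (a + b).
Proof.
  intros Hf Hg e He.
  destruct (Hf (e / 2)%R ltac:(lra)) as [d1 [P1 H1]].
  destruct (Hg (e / 2)%R ltac:(lra)) as [d2 [P2 H2]].
  exists (Rmin d1 d2). split; [apply Rmin_pos; auto |]. intros h Hh.
  specialize (H1 h (Rlt_le_trans _ _ _ Hh (Rmin_l _ _))).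
  specialize (H2 h (Rlt_le_trans _ _ _ Hh (Rmin_r _ _))).
  replace (f (z + h) + g (z + h) - (f z + g z) - (a + b) * h)
    with ((f (z + h) - f z - a * h) + (g (z + h) - g z - b * h)) by ring.
  eapply Rle_trans; [apply Cmod_triangle | lra].
Qed.

Lemma Cd_lip (f : C -> C) (z l : C) : Cd f z l ->
  exists del, (0 < del)%R /\ forall h, (Cmod h < del)%R ->
    (Cmod (f (z + h)%C - f z)%C <= (Cmod l + 1) * Cmod h)%R.
Proof.
  intros H. destruct (H 1%R Rlt_0_1) as [d [Hd H1]]. exists d. split; [exact Hd |].
  intros h Hh. specialize (H1 h Hh).
  replace (f (z + h) - f z) with ((f (z + h) - f z - l * h) + l * h) by ring.
  eapply Rle_trans; [apply Cmod_triangle |]. rewrite Cmod_mult. lra.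
Qed.

Lemma Cd_cont (f : C -> C) (z l : C) : Cd f z l -> @contC C_UniformSpace f z.
Proof.
  intros H. destruct (Cd_lip f z l H) as [d [Hd H1]].
  apply contC_ball. intros e He.
  assert (Hl : (0 < Cmod l + 1)%R) by (pose proof (Cmod_ge_0 l); lra).
  assert (Hm : (0 < Rmin d (e / (Cmod l + 1)))%R)
    by (apply Rmin_pos; [exact Hd | apply Rdiv_lt_0_compat; lra]).
  apply locally_C. exists (mkposreal _ Hm). intros w Hw.
  change (Cmod (w - z) < Rmin d (e / (Cmod l + 1)))%R in Hw.
  specialize (H1 (w - z) (Rlt_le_trans _ _ _ Hw (Rmin_l _ _))).
  rewrite C_plus_swap in H1.
  eapply Rle_lt_trans; [exact H1 |].
  assert (Hw2 := Rlt_le_trans _ _ _ Hw (Rmin_r _ _)).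
  apply (Rmult_lt_compat_l (Cmod l + 1)) in Hw2; [| exact Hl].
  replace ((Cmod l + 1) * (e / (Cmod l + 1)))%R with e in Hw2 by (field; lra). exact Hw2.
Qed.

Lemma Cd_comp (f g : C -> C) (z a b : C) :
  Cd g (f z) b -> Cd f z a -> Cd (fun w => g (f w)) z (b * a).
Proof.
  intros Hg Hf e He. destruct (Cd_lip f z a Hf) as [d0 [P0 H0]].
  pose proof (Cmod_ge_0 a) as Ha. pose proof (Cmod_ge_0 b) as Hb.
  set (e1 := (e / 2 / (Cmod a + 1))%R). set (e2 := (e / 2 / (Cmod b + 1))%R).
  assert (He1 : (0 < e1)%R) by (repeat apply Rdiv_lt_0_compat; lra).
  assert (He2 : (0 < e2)%R) by (repeat apply Rdiv_lt_0_compat; lra).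
  destruct (Hg e1 He1) as [d1 [P1 H1]]. destruct (Hf e2 He2) as [d2 [P2 H2]].
  exists (Rmin (Rmin d0 d2) (d1 / (Cmod a + 1))).
  split. { repeat apply Rmin_pos; auto. apply Rdiv_lt_0_compat; lra. }
  intros h Hh.
  assert (h0 : (Cmod h < d0)%R) by (eapply Rlt_le_trans; [exact Hh |]; eapply Rle_trans; [apply Rmin_l | apply Rmin_l]).
  assert (h2 : (Cmod h < d2)%R) by (eapply Rlt_le_trans; [exact Hh |]; eapply Rle_trans; [apply Rmin_l | apply Rmin_r]).
  assert (h1 : (Cmod h < d1 / (Cmod a + 1))%R) by (eapply Rlt_le_trans; [exact Hh |]; apply Rmin_r).
  specialize (H0 h h0). specialize (H2 h h2).
  assert (Hk : (Cmod (f (z + h)%C - f z) < d1)%R).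
  { eapply Rle_lt_trans; [exact H0 |].
    apply (Rmult_lt_compat_l (Cmod a + 1)) in h1; [| lra].
    replace ((Cmod a + 1) * (d1 / (Cmod a + 1)))%R with d1 in h1 by (field; lra). exact h1. }
  specialize (H1 _ Hk). rewrite C_plus_swap in H1.
  replace (g (f (z + h)) - g (f z) - b * a * h)
    with ((g (f (z + h)) - g (f z) - b * (f (z + h)%C - f z)) + b * (f (z + h)%C - f z - a * h)) by ring.
  eapply Rle_trans; [apply Cmod_triangle |]. rewrite Cmod_mult.
  assert (E1 : (e1 * Cmod (f (z + h)%C - f z) <= e / 2 * Cmod h)%R).
  { eapply Rle_trans; [apply Rmult_le_compat_l; [lra | exact H0] |].
    right. unfold e1. field. lra. }
  assert (E2 : (Cmod b * Cmod (f (z + h)%C - f z - a * h) <= e / 2 * Cmod h)%R).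
  { eapply Rle_trans; [apply Rmult_le_compat_l; [lra | exact H2] |].
    unfold e2. pose proof (Cmod_ge_0 h).
    replace (Cmod b * (e / 2 / (Cmod b + 1) * Cmod h))%R
      with (e / 2 * Cmod h * (Cmod b / (Cmod b + 1)))%R by (field; lra).
    rewrite <- (Rmult_1_r (e / 2 * Cmod h)) at 2. apply Rmult_le_compat_l.
    - apply Rmult_le_pos; lra.
    - apply (Rmult_le_reg_r (Cmod b + 1)); [lra |]. field_simplify; lra. }
  lra.
Qed.

(** A product is a combination of squares, so the chain rule for the square suffices.
    *)
Lemma Cd_mult (f g : C -> C) (z a b : C) :
  Cd f z a -> Cd g z b -> Cd (fun w => f w * g w) z (a * g z + f z * b).
Proof.
  assert (Sq : forall w, Cd (fun u => u * u) w (2 * w)).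
  { intros w e He. exists e. split; [exact He |]. intros h Hh.
    replace ((w + h) * (w + h) - w * w - 2 * w * h) with (h * h) by ring.
    rewrite Cmod_mult. apply Rmult_le_compat_r; [apply Cmod_ge_0 | lra]. }
  assert (Sc : forall (k : C) (w : C), Cd (fun u => k * u) w k).
  { intros k w e He. exists 1%R. split; [lra |]. intros h _.
    replace (k * (w + h) - k * w - k * h) with (RtoC 0) by ring. rewrite Cmod_0.
    apply Rmult_le_pos; [lra | apply Cmod_ge_0]. }
  intros Hf Hg.
  assert (Hp := Cd_comp _ _ _ _ _ (Sq _) (Cd_plus _ _ _ _ _ Hf Hg)).
  assert (Hm := Cd_comp _ _ _ _ _ (Sq _)
      (Cd_plus _ _ _ _ _ Hf (Cd_comp g (fun u => - (1) * u) _ _ _ (Sc _ _) Hg))).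
  assert (H := Cd_plus _ _ _ _ _
      (Cd_comp _ _ _ _ _ (Sc (/ 4) _) Hp) (Cd_comp _ _ _ _ _ (Sc (- / 4) _) Hm)).
  assert (H4 : RtoC 4 <> 0) by (intros E; apply RtoC_inj in E; lra).
  eapply Cd_eq; [eapply Cd_ext; [| exact H] |]; intros; cbv beta; field; exact H4.
Qed.

Lemma Cd_opp (f : C -> C) (z a : C) : Cd f z a -> Cd (fun w => - f w) z (- a).
Proof.
  intros H. eapply Cd_eq; [eapply Cd_ext; [| exact (Cd_mult _ _ _ _ _ (Cd_const (- (1)) z) H)] |];
    intros; cbv beta; ring.
Qed.

Lemma Cd_minus (f g : C -> C) (z a b : C) :
  Cd f z a -> Cd g z b -> Cd (fun w => f w - g w) z (a - b).
Proof. intros Hf Hg. exact (Cd_plus _ _ _ _ _ Hf (Cd_opp _ _ _ Hg)). Qed.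

Lemma Cd_scal (k : C) (f : C -> C) (z a : C) : Cd f z a -> Cd (fun w => k * f w) z (k * a).
Proof.
  intros H. eapply Cd_eq; [exact (Cd_mult _ _ _ _ _ (Cd_const k z) H) | cbv beta; ring].
Qed.

(** * Integrals of complex-valued functions over segments *)

Definition CRI (f : R -> C) (a b : R) : C := RInt (V := C_R_CompleteNormedModule) f a b.
Definition contR (f : R -> C) : Prop := forall x : R, @contC R_UniformSpace f x.

Lemma contR_ex_RInt f a b : contR f -> ex_RInt (V := C_R_CompleteNormedModule) f a b.
Proof. intros H. apply (ex_RInt_continuous (V := C_R_CompleteNormedModule)). intros z _. apply H. Qed.

Lemma contR_is_RInt f a b : contR f -> is_RInt (V := C_R_CompleteNormedModule) f a b (CRI f a b).
Proof. intros H. apply (RInt_correct (V := C_R_CompleteNormedModule)), contR_ex_RInt, H. Qed.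

Lemma is_RInt_C_pair (f : R -> C) a b (l : C) :
  is_RInt (fun x => Re (f x)) a b (Re l) -> is_RInt (fun x => Im (f x)) a b (Im l) ->
  is_RInt (V := C_R_CompleteNormedModule) f a b l.
Proof.
  intros H1 H2. destruct l as [l1 l2].
  exact (is_RInt_fct_extend_pair (U := R_NormedModule) (V := R_NormedModule) f a b l1 l2 H1 H2).
Qed.

Lemma is_RInt_C_Re (f : R -> C) a b (l : C) :
  is_RInt (V := C_R_CompleteNormedModule) f a b l -> is_RInt (fun x => Re (f x)) a b (Re l).
Proof.
  exact (is_RInt_fct_extend_fst (U := R_NormedModule) (V := R_NormedModule) f a b l).
Qed.
Lemma is_RInt_C_Im (f : R -> C) a b (l : C) :
  is_RInt (V := C_R_CompleteNormedModule) f a b l -> is_RInt (fun x => Im (f x)) a b (Im l).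
Proof.
  exact (is_RInt_fct_extend_snd (U := R_NormedModule) (V := R_NormedModule) f a b l).
Qed.

Lemma is_RInt_C_scal (k : C) f a b l :
  is_RInt (V := C_R_CompleteNormedModule) f a b l ->
  is_RInt (V := C_R_CompleteNormedModule) (fun x => k * f x) a b (k * l).
Proof.
  intros H. pose proof (is_RInt_C_Re _ _ _ _ H) as H1. pose proof (is_RInt_C_Im _ _ _ _ H) as H2.
  apply is_RInt_C_pair.
  - exact (is_RInt_minus _ _ _ _ _ _ (is_RInt_scal _ _ _ (Re k) _ H1) (is_RInt_scal _ _ _ (Im k) _ H2)).
  - exact (is_RInt_plus _ _ _ _ _ _ (is_RInt_scal _ _ _ (Re k) _ H2) (is_RInt_scal _ _ _ (Im k) _ H1)).
Qed.

Lemma CRI_scal k f a b : contR f -> CRI (fun x => k * f x) a b = k * CRI f a b.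
Proof. intros H. apply (is_RInt_unique (V := C_R_CompleteNormedModule)), is_RInt_C_scal, contR_is_RInt, H. Qed.

Lemma CRI_plus f g a b : contR f -> contR g ->
  CRI (fun x => f x + g x) a b = CRI f a b + CRI g a b.
Proof.
  intros Hf Hg. apply (is_RInt_unique (V := C_R_CompleteNormedModule)).
  exact (is_RInt_plus _ _ _ _ _ _ (contR_is_RInt _ a b Hf) (contR_is_RInt _ a b Hg)).
Qed.

Lemma CRI_minus f g a b : contR f -> contR g ->
  CRI (fun x => f x - g x) a b = CRI f a b - CRI g a b.
Proof.
  intros Hf Hg. apply (is_RInt_unique (V := C_R_CompleteNormedModule)).
  exact (is_RInt_minus _ _ _ _ _ _ (contR_is_RInt _ a b Hf) (contR_is_RInt _ a b Hg)).
Qed.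

Lemma CRI_Chasles f a b c : contR f -> CRI f a b + CRI f b c = CRI f a c.
Proof. intros H. apply (RInt_Chasles (V := C_R_CompleteNormedModule)); apply contR_ex_RInt, H. Qed.

Lemma CRI_ext f g a b : (forall x, f x = g x) -> CRI f a b = CRI g a b.
Proof. intros H. apply (RInt_ext (V := C_R_CompleteNormedModule)). intros x _. apply H. Qed.

Lemma CRI_swap f a b : contR f -> CRI f b a = - CRI f a b.
Proof. intros H. symmetry. apply (opp_RInt_swap (V := C_R_CompleteNormedModule)), contR_ex_RInt, H. Qed.

Lemma CRI_bound f (g : R -> R) a b : (a <= b)%R -> contR f ->
  (forall x, continuous g x) -> (forall x, (a <= x <= b)%R -> (Cmod (f x) <= g x)%R) ->
  (Cmod (CRI f a b) <= RInt g a b)%R.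
Proof.
  intros Hab Hf Hg H. rewrite <- norm_Cmod.
  apply (norm_RInt_le (V := C_R_NormedModule) f g a b); auto.
  - intros x Hx. rewrite norm_Cmod. apply H, Hx.
  - apply contR_is_RInt, Hf.
  - apply (RInt_correct (V := R_CompleteNormedModule)), (ex_RInt_continuous (V := R_CompleteNormedModule)).
    intros; apply Hg.
Qed.

Lemma CRI_bound_const f M a b : (a <= b)%R -> contR f ->
  (forall x, (a <= x <= b)%R -> (Cmod (f x) <= M)%R) ->
  (Cmod (CRI f a b) <= (b - a) * M)%R.
Proof.
  intros Hab Hf H. rewrite <- norm_Cmod.
  apply (norm_RInt_le_const (V := C_R_NormedModule) f a b); auto.
  - intros x Hx. rewrite norm_Cmod. apply H, Hx.
  - apply contR_is_RInt, Hf.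
Qed.

Lemma CRI_shift f a b c : contR f ->
  CRI (fun x => f (x + c)%R) a b = CRI f (a + c) (b + c).
Proof.
  intros H.
  pose proof (RInt_comp_lin (V := C_R_CompleteNormedModule) f 1 c a b (contR_ex_RInt _ _ _ H)) as E.
  rewrite !Rmult_1_l in E. unfold CRI. rewrite <- E. apply (RInt_ext (V := C_R_CompleteNormedModule)). intros x _.
  rewrite Rmult_1_l. symmetry. exact (scal_one (V := C_R_NormedModule) (f (x + c)%R)).
Qed.

Lemma CRI_comp_lin f (k a b : R) : contR f ->
  k * CRI (fun x => f (k * x)%R) a b = CRI f (k * a) (k * b).
Proof.
  intros H.
  pose proof (RInt_comp_lin (V := C_R_CompleteNormedModule) f k 0 a b (contR_ex_RInt _ _ _ H)) as E.
  rewrite !Rplus_0_r in E. unfold CRI at 2. rewrite <- E, <- CRI_scal.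
  - apply (RInt_ext (V := C_R_CompleteNormedModule)). intros x _. rewrite Rplus_0_r. symmetry. apply scal_R_Cmult.
  - intros x. apply (contC_comp (U := R_UniformSpace) (V := R_UniformSpace) (fun x => (k * x)%R) f); [| apply H].
    apply (continuous_scal_r (V := R_NormedModule) k (fun x => x)), continuous_id.
Qed.

(** * Real derivatives of complex-valued functions *)

(** Derivative with respect to a real variable; [Cd] only makes sense for a complex
    one. *)
Definition Rd (f : R -> C) (x : R) (l : C) : Prop :=
  is_derive (K := R_AbsRing) (V := C_R_NormedModule) f x l.

Lemma Rd_pair (f : R -> C) x l :
  is_derive (fun t => Re (f t)) x (Re l) -> is_derive (fun t => Im (f t)) x (Im l) -> Rd f x l.
Proof.
  intros H1 H2.
  pose proof (is_derive_scal_l (V := C_R_NormedModule) _ x _ (1%R, 0%R) H1) as A.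
  pose proof (is_derive_scal_l (V := C_R_NormedModule) _ x _ (0%R, 1%R) H2) as B.
  pose proof (is_derive_plus _ _ _ _ _ A B) as D.
  replace l with (plus (scal (Re l) ((1%R, 0%R) : C_R_NormedModule)) (scal (Im l) ((0%R, 1%R) : C_R_NormedModule)) : C).
  - eapply is_derive_ext; [| exact D]. intros t. cbv beta.
    destruct (f t) as [u v]. apply C_eq; [change (u * 1 + v * 0 = u)%R | change (u * 0 + v * 1 = v)%R]; ring.
  - destruct l as [u v]. apply C_eq; [change (u * 1 + v * 0 = u)%R | change (u * 0 + v * 1 = v)%R]; ring.
Qed.

Lemma Rd_eps (f : R -> C) x l :
  (forall e, (0 < e)%R -> exists d, (0 < d)%R /\ forall h, (Rabs h < d)%R ->
     (Cmod (f (x + h)%R - f x - l * h) <= e * Rabs h)%R) -> Rd f x l.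
Proof.
  intros H. split; [apply is_linear_scal_l |].
  intros y Hy e.
  assert (E : x = y) by exact (@is_filter_lim_locally_unique R_AbsRing R_NormedModule x y Hy).
  subst y. destruct (H e (cond_pos e)) as [d [Hd H1]].
  exists (mkposreal d Hd). intros y Hy'.
  change (Rabs (y - x) < d)%R in Hy'. specialize (H1 (y - x)%R Hy').
  rewrite (Rplus_minus x y) in H1.
  rewrite norm_Cmod. change (norm (minus y x)) with (Rabs (y - x)).
  refine (Rle_trans _ _ _ (Req_le _ _ (f_equal Cmod _)) H1).
  rewrite (Cmult_comm l). rewrite <- scal_R_Cmult. reflexivity.
Qed.

Lemma Rd_eps_inv (f : R -> C) x l : Rd f x l ->
  (forall e, (0 < e)%R -> exists d, (0 < d)%R /\ forall h, (Rabs h < d)%R ->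
     (Cmod (f (x + h)%R - f x - l * h) <= e * Rabs h)%R).
Proof.
  intros [_ H] e He.
  destruct (H x (fun P HP => HP) (mkposreal e He)) as [d Hd].
  exists d. split; [apply cond_pos |]. intros h Hh.
  assert (Hb : @ball R_UniformSpace x d (x + h)%R).
  { change (Rabs (x + h - x) < d)%R. replace (x + h - x)%R with h by ring. exact Hh. }
  specialize (Hd _ Hb). rewrite norm_Cmod in Hd.
  change (norm (minus (x + h)%R x)) with (Rabs (x + h - x)) in Hd.
  replace (x + h - x)%R with h in Hd by ring.
  refine (Rle_trans _ _ _ (Req_le _ _ (f_equal Cmod _)) Hd).
  replace h with (x + h - x)%R at 2 by ring.
  rewrite (Cmult_comm l). rewrite <- scal_R_Cmult. reflexivity.
Qed.

Lemma Cd_Rd (f : C -> C) (z d : C) (t : R) l :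
  Cd f (z + t * d) l -> Rd (fun u : R => f (z + u * d)) t (l * d).
Proof.
  intros H. apply Rd_eps. intros e He.
  assert (Hd : (0 < Cmod d + 1)%R) by (pose proof (Cmod_ge_0 d); lra).
  destruct (H (e / (Cmod d + 1))%R) as [r [Hr H1]]. { apply Rdiv_lt_0_compat; lra. }
  exists (r / (Cmod d + 1))%R. split; [apply Rdiv_lt_0_compat; lra |].
  intros h Hh.
  assert (Hm : (Cmod (h * d) <= Rabs h * (Cmod d + 1))%R).
  { rewrite Cmod_mult, Cmod_R. apply Rmult_le_compat_l; [apply Rabs_pos | lra]. }
  assert (Hk : (Cmod (h * d) < r)%R).
  { eapply Rle_lt_trans; [exact Hm |].
    apply (Rmult_lt_compat_r (Cmod d + 1)) in Hh; [| lra].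
    replace (r / (Cmod d + 1) * (Cmod d + 1))%R with r in Hh by (field; lra). exact Hh. }
  specialize (H1 _ Hk).
  replace (z + (t + h)%R * d) with (z + t * d + h * d) by (rewrite RtoC_plus; ring).
  replace (l * d * h) with (l * (h * d)) by ring.
  eapply Rle_trans; [exact H1 |].
  eapply Rle_trans; [apply Rmult_le_compat_l; [| exact Hm] |].
  - apply Rlt_le, Rdiv_lt_0_compat; lra.
  - right. field. lra.
Qed.

Lemma Cd_Rd' (f : C -> C) (x : R) l : Cd f x l -> Rd (fun u : R => f u) x l.
Proof.
  intros H. replace l with (l * 1) by ring.
  apply (is_derive_ext (V := C_R_NormedModule) (fun u : R => f (0 + u * 1))).
  { intros t. f_equal. ring. }
  apply Cd_Rd. replace (0 + x * 1) with (RtoC x) by ring. exact H.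
Qed.

Lemma CRI_derive (f df : R -> C) a b :
  (forall x, Rd f x (df x)) -> contR df -> CRI df a b = f b - f a.
Proof.
  intros H Hc. apply (is_RInt_unique (V := C_R_CompleteNormedModule)).
  apply (is_RInt_derive (V := C_R_CompleteNormedModule) f df a b).
  - intros x _. apply H.
  - intros x _. apply Hc.
Qed.

Lemma CRI_derive_seg (f df : R -> C) a b : (a <= b)%R ->
  (forall x, (a <= x <= b)%R -> Rd f x (df x)) ->
  (forall x, (a <= x <= b)%R -> @contC R_UniformSpace df x) ->
  is_RInt (V := C_R_CompleteNormedModule) df a b (f b - f a).
Proof.
  intros Hab H Hc.
  apply (is_RInt_derive (V := C_R_CompleteNormedModule) f df a b);
    intros x Hx; rewrite Rmin_left, Rmax_right in Hx by lra.
  - apply H, Hx.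
  - apply Hc, Hx.
Qed.

Lemma Rd_mean_value (f df : R -> C) a b M : (a <= b)%R ->
  (forall x, (a <= x <= b)%R -> Rd f x (df x)) ->
  (forall x, (a <= x <= b)%R -> @contC R_UniformSpace df x) ->
  (forall x, (a <= x <= b)%R -> (Cmod (df x) <= M)%R) ->
  (Cmod (f b - f a) <= (b - a) * M)%R.
Proof.
  intros Hab H Hc HM. rewrite <- norm_Cmod.
  apply (norm_RInt_le_const (V := C_R_NormedModule) df a b); auto.
  - intros x Hx. rewrite norm_Cmod. apply HM, Hx.
  - apply CRI_derive_seg; auto.
Qed.

(** * Derivative and estimates of the exponential *)

Lemma Rd_Cexp_ray (h : C) (t : R) : Rd (fun u : R => Cexp (u * h)) t (h * Cexp (t * h)).
Proof.
  destruct h as [a b].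
  apply Rd_pair; unfold Cexp; cbn [Re Im fst snd Cmult RtoC].
  - auto_derive; [auto |]. cbn. unfold Rminus. ring.
  - auto_derive; [auto |]. cbn. unfold Rminus. ring.
Qed.

Lemma contR_Cexp_ray (h : C) : contR (fun u => Cexp (u * h)).
Proof.
  intros t. apply contC_Cexp, contC_mult; [| apply contC_const].
  apply (contC_RtoC (U := R_UniformSpace) (fun u => u)), continuous_id.
Qed.

Lemma Cmod_Cexp_m1 (h : C) : (Cmod (Cexp h - 1) <= Cmod h * exp (Rmax 0 (Re h)))%R.
Proof.
  replace (Cexp h - 1) with (Cexp (1%R * h) - Cexp (0%R * h))
    by (rewrite Cmult_1_l, Cmult_0_l, Cexp_0; reflexivity).
  replace (Cmod h * exp (Rmax 0 (Re h)))%R with ((1 - 0) * (Cmod h * exp (Rmax 0 (Re h))))%R by ring.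
  apply (Rd_mean_value (fun u : R => Cexp (u * h)) (fun t => h * Cexp (t * h)) 0 1); [lra | | |].
  - intros x _. apply Rd_Cexp_ray.
  - intros x _. apply contC_mult; [apply contC_const | apply contR_Cexp_ray].
  - intros x Hx. rewrite Cmod_mult, Cmod_Cexp, re_scal_l.
    apply Rmult_le_compat_l; [apply Cmod_ge_0 |].
    destruct (Rle_dec 0 (Re h)) as [L | L].
    + rewrite Rmax_right by lra. destruct (Req_dec (x * Re h) (Re h)) as [-> | N]; [lra | left; apply exp_increasing; nra].
    + rewrite Rmax_left by lra.
      destruct (Req_dec (x * Re h) 0) as [-> | N]; [lra | left; apply exp_increasing; nra].
Qed.

Lemma exp_le (x y : R) : (x <= y)%R -> (exp x <= exp y)%R.
Proof. intros [H | ->]; [left; apply exp_increasing, H | right; reflexivity]. Qed.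

Lemma Re_le_Cmod (z : C) : (Re z <= Cmod z)%R.
Proof. pose proof (re_le_Cmod z) as H. apply Rabs_le_between in H. lra. Qed.

Lemma Cmod_Cexp_m1' (h : C) : (Cmod (Cexp h - 1) <= Cmod h * exp (Cmod h))%R.
Proof.
  eapply Rle_trans; [apply Cmod_Cexp_m1 |]. apply Rmult_le_compat_l; [apply Cmod_ge_0 |].
  apply exp_le, Rmax_lub; [apply Cmod_ge_0 | apply Re_le_Cmod].
Qed.

(** Both this bound and the previous ones come from the mean value inequality along
    the ray from 0 to [h], and they make [Cexp] its own complex derivative. *)
Lemma Cmod_Cexp_m2 (h : C) : (Cmod (Cexp h - 1 - h) <= Cmod h * (Cmod h * exp (Cmod h)))%R.
Proof.
  set (F := fun u : R => Cexp (u * h) - u * h).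
  replace (Cexp h - 1 - h) with (F 1%R - F 0%R)
    by (unfold F; rewrite !Cmult_1_l, !Cmult_0_l, Cexp_0; ring).
  replace (Cmod h * (Cmod h * exp (Cmod h)))%R
    with ((1 - 0) * (Cmod h * (Cmod h * exp (Cmod h))))%R by ring.
  apply (Rd_mean_value F (fun t => h * Cexp (t * h) - h) 0 1); [lra | | |].
  - intros x _. unfold F. apply (is_derive_minus (V := C_R_NormedModule)); [apply Rd_Cexp_ray |].
    destruct h as [a b]. apply Rd_pair; cbn [Re Im fst snd Cmult RtoC].
    + auto_derive; [auto |]. ring.
    + auto_derive; [auto |]. ring.
  - intros x _. apply contC_minus; [| apply contC_const].
    apply contC_mult; [apply contC_const | apply contR_Cexp_ray].
  - intros x Hx. replace (h * Cexp (x * h) - h) with (h * (Cexp (x * h) - 1)) by ring.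
    rewrite Cmod_mult. apply Rmult_le_compat_l; [apply Cmod_ge_0 |].
    eapply Rle_trans; [apply Cmod_Cexp_m1' |].
    assert (Hm : (Cmod (x * h) <= Cmod h)%R).
    { rewrite Cmod_mult, Cmod_R, Rabs_pos_eq by lra. pose proof (Cmod_ge_0 h). nra. }
    apply Rmult_le_compat; auto using Cmod_ge_0, exp_le. apply Rlt_le, exp_pos.
Qed.

Lemma Cd_Cexp (z : C) : Cd Cexp z (Cexp z).
Proof.
  intros e He. pose proof (exp_pos (Re z)) as Hp. pose proof (exp_pos 1) as H1.
  exists (Rmin 1 (e / (exp (Re z) * exp 1))).
  split. { apply Rmin_pos; [lra |]. apply Rdiv_lt_0_compat; nra. }
  intros h Hh.
  assert (Ha := Rlt_le_trans _ _ _ Hh (Rmin_l _ _)).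
  assert (Hb := Rlt_le_trans _ _ _ Hh (Rmin_r _ _)).
  replace (Cexp (z + h) - Cexp z - Cexp z * h) with (Cexp z * (Cexp h - 1 - h))
    by (rewrite Cexp_plus; ring).
  rewrite Cmod_mult, Cmod_Cexp.
  apply Rle_trans with (exp (Re z) * (Cmod h * (Cmod h * exp 1)))%R.
  - apply Rmult_le_compat_l; [lra |]. eapply Rle_trans; [apply Cmod_Cexp_m2 |].
    apply Rmult_le_compat_l; [apply Cmod_ge_0 |]. apply Rmult_le_compat_l; [apply Cmod_ge_0 |].
    apply exp_le; lra.
  - apply (Rmult_lt_compat_r (exp (Re z) * exp 1)) in Hb; [| nra].
    replace (e / (exp (Re z) * exp 1) * (exp (Re z) * exp 1))%R with e in Hb by (field; lra).
    pose proof (Cmod_ge_0 h). nra.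
Qed.

Lemma Cd_Cexp_comp (f : C -> C) (z a : C) : Cd f z a -> Cd (fun w => Cexp (f w)) z (Cexp (f z) * a).
Proof. intros H. exact (Cd_comp _ _ _ _ _ (Cd_Cexp _) H). Qed.

Lemma C_zero_derive_const (f : C -> C) (z w : C) :
  (forall t : R, (0 <= t <= 1)%R -> Cd f (z + t * (w - z)) 0) -> f w = f z.
Proof.
  intros H. assert (E : (Cmod (f w - f z) <= (1 - 0) * 0)%R).
  { replace (f w) with (f (z + 1%R * (w - z))) by (f_equal; ring).
    replace (f z) with (f (z + 0%R * (w - z))) by (f_equal; ring).
    apply (Rd_mean_value (fun u : R => f (z + u * (w - z))) (fun _ => 0)); [lra | | |].
    - intros x Hx. replace (RtoC 0) with (0 * (w - z)) by ring. apply Cd_Rd, H, Hx.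
    - intros; apply contC_const.
    - intros; rewrite Cmod_0; lra. }
  assert (E0 : Cmod (f w - f z) = 0%R) by (pose proof (Cmod_ge_0 (f w - f z)); lra).
  apply Cmod_eq_0 in E0. apply (proj2 (Ceq_minus _ _)). exact E0.
Qed.

(** * Integrals over the real line of exponentially small functions *)

Definition eb (M c : R) (f : R -> C) : Prop :=
  forall x : R, (Cmod (f x) <= M * exp (- (c * Rabs x)))%R.

(** The integral over the line, as the limit over symmetric segments with integer
    ends: a total function of the integrand, meaningful when the integrand is [rapid].
    *)
Definition CI (f : R -> C) : C :=
  (real (Lim_seq (fun n => Re (CRI f (- INR n) (INR n)))),
   real (Lim_seq (fun n => Im (CRI f (- INR n) (INR n))))).

Lemma eb_M_pos M c f : eb M c f -> (0 <= M)%R.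
Proof.
  intros H. specialize (H 0%R). rewrite Rabs_R0, Rmult_0_r, Ropp_0, exp_0 in H.
  pose proof (Cmod_ge_0 (f 0%R)). lra.
Qed.

Lemma RInt_exp_lin (M k a b : R) : k <> 0%R ->
  RInt (fun x => M * exp (k * x))%R a b = (M / k * (exp (k * b) - exp (k * a)))%R.
Proof.
  intros Hk. apply is_RInt_unique.
  replace (M / k * (exp (k * b) - exp (k * a)))%R
    with (minus (M / k * exp (k * b)) (M / k * exp (k * a)))%R
    by (unfold minus, plus, opp; simpl; ring).
  apply (is_RInt_derive (fun x => M / k * exp (k * x))%R).
  - intros x _. auto_derive; [auto | field; exact Hk].
  - intros x _. apply (ex_derive_continuous (fun x => M * exp (k * x))%R). auto_derive; auto.
Qed.

Lemma cont_exp_lin M k x : continuous (fun x => M * exp (k * x))%R x.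
Proof. apply (ex_derive_continuous (fun x => M * exp (k * x))%R). auto_derive; auto. Qed.

Lemma tail_right M c f a b : contR f -> (0 < c)%R -> eb M c f -> (0 <= a <= b)%R ->
  (Cmod (CRI f a b) <= M / c * exp (- (c * a)))%R.
Proof.
  intros Hf Hc He Hab. pose proof (eb_M_pos _ _ _ He) as HM.
  eapply Rle_trans; [apply (CRI_bound f (fun x => M * exp (- c * x))%R); [lra | exact Hf | |] |].
  - intros x. apply cont_exp_lin.
  - intros x Hx. specialize (He x). rewrite Rabs_pos_eq in He by lra.
    replace (- c * x)%R with (- (c * x))%R by ring. exact He.
  - rewrite RInt_exp_lin by lra.
    replace (- c * a)%R with (- (c * a))%R by ring.
    pose proof (exp_pos (- c * b)).
    replace (M / - c * (exp (- c * b) - exp (- (c * a))))%R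
      with (M / c * exp (- (c * a)) - M / c * exp (- c * b))%R by (field; lra).
    assert (0 <= M / c)%R by (apply Rdiv_le_0_compat; lra). nra.
Qed.

Lemma tail_left M c f a b : contR f -> (0 < c)%R -> eb M c f -> (a <= b <= 0)%R ->
  (Cmod (CRI f a b) <= M / c * exp (c * b))%R.
Proof.
  intros Hf Hc He Hab. pose proof (eb_M_pos _ _ _ He) as HM.
  eapply Rle_trans; [apply (CRI_bound f (fun x => M * exp (c * x))%R); [lra | exact Hf | |] |].
  - intros x. apply cont_exp_lin.
  - intros x Hx. specialize (He x). rewrite Rabs_left1 in He by lra.
    replace (- (c * - x))%R with (c * x)%R in He by ring. exact He.
  - rewrite RInt_exp_lin by lra.
    pose proof (exp_pos (c * a)).
    assert (0 <= M / c)%R by (apply Rdiv_le_0_compat; lra). nra.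
Qed.

Lemma CRI_split M c f a a' b b' : contR f -> (0 < c)%R -> eb M c f ->
  (a' <= a <= 0)%R -> (0 <= b <= b')%R ->
  (Cmod (CRI f a' b' - CRI f a b) <= M / c * (exp (c * a) + exp (- (c * b))))%R.
Proof.
  intros Hf Hc He Ha Hb.
  rewrite <- (CRI_Chasles f a' a b' Hf), <- (CRI_Chasles f a b b' Hf).
  replace (CRI f a' a + (CRI f a b + CRI f b b') - CRI f a b)
    with (CRI f a' a + CRI f b b') by ring.
  eapply Rle_trans; [apply Cmod_triangle |].
  pose proof (tail_left M c f a' a Hf Hc He Ha).
  pose proof (tail_right M c f b b' Hf Hc He Hb). lra.
Qed.

Lemma CRI_eb M c f a b : contR f -> (0 < c)%R -> eb M c f -> (a <= 0 <= b)%R ->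
  (Cmod (CRI f a b) <= 2 * M / c)%R.
Proof.
  intros Hf Hc He Hab.
  pose proof (CRI_split M c f 0 a 0 b Hf Hc He ltac:(lra) ltac:(lra)) as H.
  assert (E : CRI f 0 0 = 0) by (exact (RInt_point (V := C_R_CompleteNormedModule) 0 f)).
  rewrite E in H. rewrite Rmult_0_r, Ropp_0, exp_0 in H.
  replace (CRI f a b - 0) with (CRI f a b) in H by ring.
  eapply Rle_trans; [exact H |]. right. field. lra.
Qed.

Lemma exp_small (c K e : R) : (0 < c)%R -> (0 < e)%R ->
  exists N : nat, forall x, (INR N <= x)%R -> (K * exp (- (c * x)) < e)%R.
Proof.
  intros Hc He.
  destruct (nfloor_ex (Rmax 0 (K / (e * c)))) as [n [Hn1 Hn2]]; [apply Rmax_l |].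
  exists (S n). intros x Hx. rewrite S_INR in Hx.
  assert (Hxk : (K / (e * c) < x)%R) by (pose proof (Rmax_r 0 (K / (e * c))); lra).
  assert (Hx0 : (0 < x)%R) by (pose proof (pos_INR n); lra).
  destruct (Rle_dec K 0) as [HK | HK].
  { pose proof (exp_pos (- (c * x))). nra. }
  assert (H1 : (1 + c * x <= exp (c * x))%R) by (left; apply exp_ineq1; nra).
  rewrite exp_Ropp. pose proof (exp_pos (c * x)).
  apply (Rmult_lt_reg_r (exp (c * x))); [lra |]. rewrite Rmult_assoc, Rinv_l by lra.
  apply (Rmult_lt_compat_r (e * c)) in Hxk; [| nra].
  replace (K / (e * c) * (e * c))%R with K in Hxk by (field; lra). nra.
Qed.

Lemma C_small (z : C) (e : R) : (Rabs (Re z) < e)%R -> (Rabs (Im z) < e)%R -> (Cmod z < 2 * e)%R.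
Proof.
  intros H1 H2. replace z with (RtoC (Re z) + Ci * RtoC (Im z)).
  - eapply Rle_lt_trans; [apply Cmod_triangle |]. rewrite Cmod_mult, !Cmod_R, Cmod_Ci. lra.
  - destruct z; apply C_eq; cbn; ring.
Qed.

Lemma Im_le_Cmod (z : C) : (Rabs (Im z) <= Cmod z)%R.
Proof. pose proof (Rmax_Cmod z) as H. eapply Rle_trans; [apply Rmax_r | exact H]. Qed.

(** The limit is taken componentwise because [Lim_seq] is real-valued; an explicit
    Cauchy rate bounds the distance to the limit, which yields the tail estimates of
    [CI]. *)
Lemma C_cauchy_lim (u : nat -> C) (r : nat -> R) :
  (forall n m, (n <= m)%nat -> (Cmod (u m - u n) <= r n)%R) ->
  (forall e, (0 < e)%R -> exists N, forall n, (N <= n)%nat -> (r n < e)%R) ->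
  forall n, (Cmod ((real (Lim_seq (fun n => Re (u n))), real (Lim_seq (fun n => Im (u n)))) - u n) <= r n)%R.
Proof.
  intros H1 H2 n.
  assert (Q : forall p : C -> R, (forall z w, p (z - w) = (p z - p w)%R) ->
     (forall z, (Rabs (p z) <= Cmod z)%R) ->
     is_lim_seq (fun n => p (u n)) (real (Lim_seq (fun n => p (u n))))).
  { intros p Hp Hb. apply Lim_seq_correct'.
    apply ex_lim_seq_cauchy_corr. intros eps.
    destruct (H2 (eps / 2)%R ltac:(pose proof (cond_pos eps); lra)) as [N HN].
    exists N. intros i j Hi Hj.
    replace (p (u i) - p (u j))%R with ((p (u i) - p (u N)) - (p (u j) - p (u N)))%R by ring.
    rewrite <- (Hp (u i) (u N)), <- (Hp (u j) (u N)).
    eapply Rle_lt_trans; [apply Rabs_triang |]. rewrite Rabs_Ropp.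
    pose proof (Hb (u i - u N)). pose proof (Hb (u j - u N)).
    pose proof (H1 N i Hi). pose proof (H1 N j Hj). pose proof (HN N (le_n _)). lra. }
  assert (Q1 := Q Re (fun z w => eq_refl) re_le_Cmod).
  assert (Q2 := Q Im (fun z w => eq_refl) Im_le_Cmod). clear Q.
  set (l := (real (Lim_seq (fun n => Re (u n))), real (Lim_seq (fun n => Im (u n)))) : C) in *.
  apply Rnot_lt_le. intros Hlt.
  set (e := ((Cmod (l - u n) - r n) / 4)%R). assert (He : (0 < e)%R) by (unfold e; lra).
  apply is_lim_seq_spec in Q1. apply is_lim_seq_spec in Q2.
  destruct (Q1 (mkposreal e He)) as [N1 HN1]. destruct (Q2 (mkposreal e He)) as [N2 HN2].
  set (m := max n (max N1 N2)).
  specialize (HN1 m ltac:(lia)). specialize (HN2 m ltac:(lia)). simpl in HN1, HN2.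
  assert (Hs : (Cmod (u m - l) < 2 * e)%R) by (apply C_small; assumption).
  specialize (H1 n m ltac:(lia)).
  assert (Ht : (Cmod (l - u n) <= Cmod (u m - l) + Cmod (u m - u n))%R).
  { rewrite (Cmod_minus_sym (u m) l).
    replace (l - u n) with ((l - u m) + (u m - u n)) by ring. apply Cmod_triangle. }
  unfold e in Hs. lra.
Qed.

Section OneIntegral.
Variables (M c : R) (f : R -> C).
Hypotheses (Hf : contR f) (Hc : (0 < c)%R) (He : eb M c f).

Lemma CI_tail_nat n : (Cmod (CI f - CRI f (- INR n) (INR n)) <= 2 * M / c * exp (- (c * INR n)))%R.
Proof.
  apply (C_cauchy_lim (fun n => CRI f (- INR n) (INR n)) (fun n => 2 * M / c * exp (- (c * INR n)))%R).
  - intros p m Hpm. apply le_INR in Hpm. pose proof (pos_INR p).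
    pose proof (CRI_split M c f (- INR p) (- INR m) (INR p) (INR m) Hf Hc He ltac:(lra) ltac:(lra)) as H0.
    replace (c * - INR p)%R with (- (c * INR p))%R in H0 by ring.
    eapply Rle_trans; [exact H0 |]. right. field. lra.
  - intros e Hpos. destruct (exp_small c (2 * M / c) e Hc Hpos) as [N HN].
    exists N. intros k Hk. apply HN, le_INR, Hk.
Qed.

Lemma CI_tail a b : (a <= 0 <= b)%R ->
  (Cmod (CI f - CRI f a b) <= M / c * (exp (c * a) + exp (- (c * b))))%R.
Proof.
  intros Hab. apply Rnot_lt_le. intros Hlt.
  set (B := (M / c * (exp (c * a) + exp (- (c * b))))%R) in *.
  destruct (exp_small c (2 * M / c) (Cmod (CI f - CRI f a b) - B) Hc ltac:(lra)) as [N HN].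
  destruct (nfloor_ex (Rmax (INR N) (Rmax (- a) b))) as [n [Hn1 Hn2]].
  { eapply Rle_trans; [apply pos_INR | apply Rmax_l]. }
  assert (L : (Rmax (INR N) (Rmax (- a) b) <= INR (S n))%R) by (rewrite S_INR; lra).
  pose proof (Rmax_l (INR N) (Rmax (- a) b)). pose proof (Rmax_r (INR N) (Rmax (- a) b)).
  pose proof (Rmax_l (- a) b). pose proof (Rmax_r (- a) b).
  pose proof (CI_tail_nat (S n)) as T.
  specialize (HN (INR (S n)) ltac:(lra)).
  pose proof (CRI_split M c f a (- INR (S n)) b (INR (S n)) Hf Hc He ltac:(lra) ltac:(lra)) as Sp.
  fold B in Sp.
  assert (Ht : (Cmod (CI f - CRI f a b) <= Cmod (CI f - CRI f (- INR (S n)) (INR (S n)))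
     + Cmod (CRI f (- INR (S n)) (INR (S n)) - CRI f a b))%R).
  { replace (CI f - CRI f a b) with ((CI f - CRI f (- INR (S n)) (INR (S n)))
       + (CRI f (- INR (S n)) (INR (S n)) - CRI f a b)) by ring. apply Cmod_triangle. }
  lra.
Qed.

Lemma CI_bound : (Cmod (CI f) <= 2 * M / c)%R.
Proof.
  pose proof (CI_tail 0 0 ltac:(lra)) as H.
  assert (E : CRI f 0 0 = 0) by (exact (RInt_point (V := C_R_CompleteNormedModule) 0 f)).
  rewrite E in H. rewrite Rmult_0_r, Ropp_0, exp_0 in H.
  replace (CI f - 0) with (CI f) in H by ring.
  eapply Rle_trans; [exact H |]. right. field. lra.
Qed.

Lemma CI_unique (l : C) :
  (forall e, (0 < e)%R -> exists N, forall n, (N <= n)%nat -> (Cmod (CRI f (- INR n) (INR n) - l) < e)%R) ->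
  CI f = l.
Proof.
  intros H. apply (proj2 (Ceq_minus _ _)), Cmod_eq_0.
  apply Rle_antisym; [| apply Cmod_ge_0]. apply Rnot_lt_le. intros Hlt.
  set (e := (Cmod (CI f - l) / 2)%R). assert (Hpos : (0 < e)%R) by (unfold e; lra).
  destruct (H e Hpos) as [N1 H1]. destruct (exp_small c (2 * M / c) e Hc Hpos) as [N2 H2].
  specialize (H1 (max N1 N2) ltac:(lia)).
  pose proof (CI_tail_nat (max N1 N2)) as T.
  specialize (H2 (INR (max N1 N2)) (le_INR N2 (max N1 N2) ltac:(lia))).
  assert (Ht : (Cmod (CI f - l) <= Cmod (CI f - CRI f (- INR (max N1 N2)) (INR (max N1 N2)))
     + Cmod (CRI f (- INR (max N1 N2)) (INR (max N1 N2)) - l))%R).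
  { replace (CI f - l) with ((CI f - CRI f (- INR (max N1 N2)) (INR (max N1 N2)))
       + (CRI f (- INR (max N1 N2)) (INR (max N1 N2)) - l)) by ring. apply Cmod_triangle. }
  unfold e in *. lra.
Qed.

Lemma CI_lim e : (0 < e)%R ->
  exists N, forall n, (N <= n)%nat -> (Cmod (CRI f (- INR n) (INR n) - CI f) < e)%R.
Proof.
  intros Hpos. destruct (exp_small c (2 * M / c) e Hc Hpos) as [N2 H2].
  exists N2. intros n Hn. rewrite Cmod_minus_sym.
  eapply Rle_lt_trans; [apply CI_tail_nat |]. apply H2, le_INR, Hn.
Qed.

End OneIntegral.

(** The class of integrands used throughout: exponential decay is stable under the
    translations, rotations and convolutions below, and makes every limit interchange
    elementary. *)
Definition rapid (f : R -> C) : Prop := contR f /\ exists M c, (0 < c)%R /\ eb M c f.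

Lemma eb_weaken M c M' c' f : (M <= M')%R -> (c' <= c)%R -> eb M c f -> eb M' c' f.
Proof.
  intros HM Hc He x. pose proof (eb_M_pos _ _ _ He).
  eapply Rle_trans; [apply He |].
  apply Rmult_le_compat; [lra | apply Rlt_le, exp_pos | lra |].
  apply exp_le. pose proof (Rabs_pos x). nra.
Qed.

Lemma rapid_common f g : rapid f -> rapid g ->
  exists M c, (0 < c)%R /\ eb M c f /\ eb M c g.
Proof.
  intros [_ [M [c [Hc H]]]] [_ [M' [c' [Hc' H']]]].
  exists (Rmax M M'), (Rmin c c'). split; [apply Rmin_pos; auto |].
  split; [eapply eb_weaken; [| | exact H] | eapply eb_weaken; [| | exact H']];
    auto using Rmax_l, Rmax_r, Rmin_l, Rmin_r.
Qed.

Lemma contR_plus f g : contR f -> contR g -> contR (fun x => f x + g x).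
Proof. intros Hf Hg x. apply contC_plus; auto. Qed.
Lemma contR_minus f g : contR f -> contR g -> contR (fun x => f x - g x).
Proof. intros Hf Hg x. apply contC_minus; auto. Qed.
Lemma contR_scal k f : contR f -> contR (fun x => k * f x).
Proof. intros Hf x. apply contC_mult; [apply contC_const | auto]. Qed.

Lemma eb_plus M M' c f g : eb M c f -> eb M' c g -> eb (M + M') c (fun x => f x + g x).
Proof.
  intros H1 H2 x. eapply Rle_trans; [apply Cmod_triangle |].
  specialize (H1 x). specialize (H2 x). lra.
Qed.
Lemma eb_minus M M' c f g : eb M c f -> eb M' c g -> eb (M + M') c (fun x => f x - g x).
Proof.
  intros H1 H2 x. eapply Rle_trans; [apply Cmod_triangle' |].
  specialize (H1 x). specialize (H2 x). lra.
Qed.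
Lemma eb_scal k M c f : eb M c f -> eb (Cmod k * M) c (fun x => k * f x).
Proof.
  intros H x. rewrite Cmod_mult, Rmult_assoc. apply Rmult_le_compat_l; [apply Cmod_ge_0 | apply H].
Qed.

Lemma rapid_plus f g : rapid f -> rapid g -> rapid (fun x => f x + g x).
Proof.
  intros Hf Hg. split; [apply contR_plus; [apply Hf | apply Hg] |].
  destruct (rapid_common f g Hf Hg) as [M [c [Hc [H1 H2]]]].
  exists (M + M)%R, c. split; [exact Hc | apply eb_plus; auto].
Qed.
Lemma rapid_minus f g : rapid f -> rapid g -> rapid (fun x => f x - g x).
Proof.
  intros Hf Hg. split; [apply contR_minus; [apply Hf | apply Hg] |].
  destruct (rapid_common f g Hf Hg) as [M [c [Hc [H1 H2]]]].
  exists (M + M)%R, c. split; [exact Hc | apply eb_minus; auto].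
Qed.
Lemma rapid_scal k f : rapid f -> rapid (fun x => k * f x).
Proof.
  intros Hf. split; [apply contR_scal, Hf |].
  destruct Hf as [_ [M [c [Hc H]]]]. exists (Cmod k * M)%R, c. split; [exact Hc | apply eb_scal, H].
Qed.

Lemma CI_ext f g : (forall x, f x = g x) -> CI f = CI g.
Proof.
  intros H. unfold CI.
  assert (E : forall n : nat, CRI f (- INR n) (INR n) = CRI g (- INR n) (INR n)) by (intros n; apply CRI_ext, H).
  rewrite (Lim_seq_ext (fun n => Re (CRI f (- INR n) (INR n))) (fun n => Re (CRI g (- INR n) (INR n)))) by (intros n; rewrite E; reflexivity).
  rewrite (Lim_seq_ext (fun n => Im (CRI f (- INR n) (INR n))) (fun n => Im (CRI g (- INR n) (INR n)))) by (intros n; rewrite E; reflexivity).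
  reflexivity.
Qed.

Lemma CI_plus f g : rapid f -> rapid g -> CI (fun x => f x + g x) = CI f + CI g.
Proof.
  intros Hf Hg. destruct (rapid_plus _ _ Hf Hg) as [Hs [M [c [Hc H]]]].
  destruct Hf as [Cf [M1 [c1 [P1 H1]]]]. destruct Hg as [Cg [M2 [c2 [P2 H2]]]].
  apply (CI_unique M c); auto. intros e Hpos.
  destruct (CI_lim M1 c1 f Cf P1 H1 (e / 2) ltac:(lra)) as [N1 L1].
  destruct (CI_lim M2 c2 g Cg P2 H2 (e / 2) ltac:(lra)) as [N2 L2].
  exists (max N1 N2). intros n Hn. rewrite CRI_plus by auto.
  specialize (L1 n ltac:(lia)). specialize (L2 n ltac:(lia)).
  replace (CRI f (- INR n) (INR n) + CRI g (- INR n) (INR n) - (CI f + CI g))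
    with ((CRI f (- INR n) (INR n) - CI f) + (CRI g (- INR n) (INR n) - CI g)) by ring.
  eapply Rle_lt_trans; [apply Cmod_triangle | lra].
Qed.

Lemma CI_scal k f : rapid f -> CI (fun x => k * f x) = k * CI f.
Proof.
  intros Hf. destruct (rapid_scal k _ Hf) as [Hs [M [c [Hc H]]]].
  destruct Hf as [Cf [M1 [c1 [P1 H1]]]].
  apply (CI_unique M c); auto. intros e Hpos.
  pose proof (Cmod_ge_0 k) as Hk.
  destruct (CI_lim M1 c1 f Cf P1 H1 (e / (Cmod k + 1)) ltac:(apply Rdiv_lt_0_compat; lra)) as [N1 L1].
  exists N1. intros n Hn. specialize (L1 n Hn). rewrite CRI_scal by auto.
  replace (k * CRI f (- INR n) (INR n) - k * CI f) with (k * (CRI f (- INR n) (INR n) - CI f)) by ring.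
  rewrite Cmod_mult. apply (Rmult_lt_compat_r (Cmod k + 1)) in L1; [| lra].
  replace (e / (Cmod k + 1) * (Cmod k + 1))%R with e in L1 by (field; lra).
  pose proof (Cmod_ge_0 (CRI f (- INR n) (INR n) - CI f)). nra.
Qed.

Lemma CI_minus f g : rapid f -> rapid g -> CI (fun x => f x - g x) = CI f - CI g.
Proof.
  intros Hf Hg. rewrite (CI_ext _ (fun x => f x + - (1) * g x)) by (intros; ring).
  rewrite CI_plus, CI_scal; auto using rapid_scal. ring.
Qed.

(** Recurrences and differential equations for parametric integrals all come from this
    vanishing. *)
Lemma CI_derive_zero f df : rapid f -> rapid df -> (forall x, Rd f x (df x)) -> CI df = 0.
Proof.
  intros [Cf [M1 [c1 [P1 H1]]]] [Cg [M2 [c2 [P2 H2]]]] Hd.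
  apply (CI_unique M2 c2); auto. intros e Hpos.
  destruct (exp_small c1 (2 * M1) e P1 Hpos) as [N HN].
  exists N. intros n Hn. rewrite (CRI_derive f df) by auto.
  apply le_INR in Hn. specialize (HN (INR n) Hn). pose proof (pos_INR n).
  replace (f (INR n) - f (- INR n)%R - 0) with (f (INR n) - f (- INR n)%R) by ring.
  eapply Rle_lt_trans; [apply Cmod_triangle' |].
  pose proof (H1 (INR n)) as A. pose proof (H1 (- INR n)%R) as B.
  rewrite Rabs_Ropp in B. rewrite Rabs_pos_eq in A, B by lra. lra.
Qed.

Lemma continuous_shift (c x : R) : continuous (fun u : R => u + c)%R x.
Proof. apply (ex_derive_continuous (fun u : R => u + c)%R). auto_derive; auto. Qed.
Lemma continuous_lin (k x : R) : continuous (fun u : R => k * u)%R x.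
Proof. apply (ex_derive_continuous (fun u : R => k * u)%R). auto_derive; auto. Qed.

Lemma contR_shift f c : contR f -> contR (fun x => f (x + c)%R).
Proof.
  intros H x. apply (contC_comp (U := R_UniformSpace) (V := R_UniformSpace) (fun u => u + c)%R f);
    [apply continuous_shift | apply H].
Qed.
Lemma contR_lin f k : contR f -> contR (fun x => f (k * x)%R).
Proof.
  intros H x. apply (contC_comp (U := R_UniformSpace) (V := R_UniformSpace) (fun u => k * u)%R f);
    [apply continuous_lin | apply H].
Qed.

Lemma eb_shift M c f d : (0 < c)%R -> eb M c f -> eb (M * exp (c * Rabs d)) c (fun x => f (x + d)%R).
Proof.
  intros Hc H x. eapply Rle_trans; [apply H |]. rewrite Rmult_assoc, <- exp_plus.
  apply Rmult_le_compat_l; [exact (eb_M_pos _ _ _ H) |]. apply exp_le.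
  pose proof (Rabs_triang (x + d) (- d)) as T. rewrite Rabs_Ropp in T.
  replace (x + d + - d)%R with x in T by ring. nra.
Qed.

Lemma rapid_shift f d : rapid f -> rapid (fun x => f (x + d)%R).
Proof.
  intros [Cf [M [c [P H]]]]. split; [apply contR_shift, Cf |].
  exists (M * exp (c * Rabs d))%R, c. split; [exact P | apply eb_shift; auto].
Qed.

Lemma CI_shift f d : rapid f -> CI (fun x => f (x + d)%R) = CI f.
Proof.
  intros Hf. destruct (rapid_shift f d Hf) as [Cs [M' [c' [P' H']]]].
  destruct Hf as [Cf [M [c [P H]]]].
  apply (CI_unique M' c'); auto. intros e Hpos.
  destruct (exp_small c (2 * M / c) e P Hpos) as [N HN].
  destruct (nfloor_ex (INR N + Rabs d)) as [K [_ HK]].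
  { pose proof (pos_INR N). pose proof (Rabs_pos d). lra. }
  exists (S K). intros n Hn. apply le_INR in Hn. rewrite S_INR in Hn.
  rewrite CRI_shift by exact Cf. rewrite Cmod_minus_sym.
  pose proof (Rle_abs d). pose proof (Rle_abs (- d)) as Q. rewrite Rabs_Ropp in Q. pose proof (pos_INR N).
  eapply Rle_lt_trans; [apply (CI_tail M c f Cf P H); lra |].
  pose proof (HN (INR n + d)%R ltac:(lra)) as A. pose proof (HN (INR n - d)%R ltac:(lra)) as B.
  replace (- (c * (INR n - d)))%R with (c * (- INR n + d))%R in B by ring.
  replace (2 * M / c)%R with (2 * (M / c))%R in A, B by (field; lra). lra.
Qed.

Lemma rapid_lin f k : k <> 0%R -> rapid f -> rapid (fun x => f (k * x)%R).
Proof.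
  intros Hk [Cf [M [c [P H]]]]. split; [apply contR_lin, Cf |].
  exists M, (c * Rabs k)%R. split; [apply Rmult_lt_0_compat; [exact P | apply Rabs_pos_lt, Hk] |].
  intros x. specialize (H (k * x)%R). rewrite Rabs_mult, <- Rmult_assoc in H. exact H.
Qed.

Lemma CI_lin f k : (0 < k)%R -> rapid f -> k * CI (fun x => f (k * x)%R) = CI f.
Proof.
  intros Hk Hf. assert (Gl := rapid_lin f k ltac:(lra) Hf). rewrite <- CI_scal by exact Gl.
  destruct (rapid_scal k _ Gl) as [Cs [M' [c' [P' H']]]].
  destruct Hf as [Cf [M [c [P H]]]].
  apply (CI_unique M' c'); auto. intros e Hpos.
  destruct (exp_small (c * k) (2 * M / c) e ltac:(nra) Hpos) as [N HN].
  exists N. intros n Hn. apply le_INR in Hn. pose proof (pos_INR N).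
  rewrite CRI_scal by apply Gl. rewrite CRI_comp_lin by exact Cf. rewrite Cmod_minus_sym.
  eapply Rle_lt_trans; [apply (CI_tail M c f Cf P H); nra |].
  specialize (HN (INR n) Hn).
  replace (c * (k * - INR n))%R with (- (c * k * INR n))%R by ring.
  replace (- (c * (k * INR n)))%R with (- (c * k * INR n))%R by ring.
  replace (2 * M / c)%R with (2 * (M / c))%R in HN by (field; lra). lra.
Qed.

(** * Integrals depending on a parameter *)

Section Param.
Context {U : UniformSpace}.

Definition joint (F : U -> R -> C) (u : U) (x : R) : Prop :=
  @contC (prod_UniformSpace U R_UniformSpace) (fun p => F (fst p) (snd p)) (u, x).

(** The usual compactness argument, on a segment: neighbourhoods of the points of {u0}
    x [a, b] contain a uniform one. *)
Lemma tube (P : U -> R -> Prop) (u0 : U) (a b : R) :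
  (forall x, (a <= x <= b)%R ->
     locally (T := prod_UniformSpace U R_UniformSpace) (u0, x) (fun p => P (fst p) (snd p))) ->
  locally u0 (fun u => forall x, (a <= x <= b)%R -> P u x).
Proof.
  intros H.
  assert (Hd : forall x, { d : posreal | (a <= x <= b)%R ->
     forall u y, ball u0 d u -> ball x d y -> P u y }).
  { intros x. apply constructive_indefinite_description.
    destruct (excluded_middle_informative (a <= x <= b)%R) as [Hx | Hx].
    - destruct (H x Hx) as [d Hd]. exists d. intros _ u y Hu Hy. exact (Hd (u, y) (conj Hu Hy)).
    - exists (mkposreal 1 Rlt_0_1). intros; contradiction. }
  destruct (compactness_value_1d a b (fun x => proj1_sig (Hd x))) as [d Hc].
  exists d. intros u Hu x Hx. apply NNPP. intros Hn. apply (Hc x Hx).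
  intros [t [Ht [Hxt Hdt]]]. apply Hn.
  destruct (Hd t) as [e He]; cbn [proj1_sig] in *.
  apply (He Ht).
  - apply ball_le with d; [exact Hdt | exact Hu].
  - exact Hxt.
Qed.

Lemma joint_locally F u0 x e : joint F u0 x -> (0 < e)%R ->
  locally (T := prod_UniformSpace U R_UniformSpace) (u0, x)
    (fun p => (Cmod (F (fst p) (snd p) - F u0 (snd p)) < e)%R).
Proof.
  intros H He.
  pose proof (proj1 (contC_ball _ _) H (e / 2)%R ltac:(lra)) as [d Hd]. cbn [fst snd] in Hd.
  exists d. intros [u y] [Hu Hy]. cbn [fst snd] in *.
  pose proof (Hd (u, y) (conj Hu Hy)) as A. pose proof (Hd (u0, y) (conj (ball_center u0 d) Hy)) as B.
  cbn [fst snd] in *.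
  replace (F u y - F u0 y) with ((F u y - F u0 x) - (F u0 y - F u0 x)) by ring.
  eapply Rle_lt_trans; [apply Cmod_triangle' | lra].
Qed.

Lemma joint_tube F u0 a b e : (forall x, (a <= x <= b)%R -> joint F u0 x) -> (0 < e)%R ->
  locally u0 (fun u => forall x, (a <= x <= b)%R -> (Cmod (F u x - F u0 x) < e)%R).
Proof.
  intros H He. apply (tube (fun u x => (Cmod (F u x - F u0 x) < e)%R)).
  intros x Hx. apply joint_locally; auto.
Qed.

Lemma joint_contR F u0 : (forall x, joint F u0 x) -> contR (F u0).
Proof.
  intros H x.
  apply (contC_comp (U := R_UniformSpace) (V := prod_UniformSpace U R_UniformSpace)
    (fun y => (u0, y)) (fun p => F (fst p) (snd p))); [| apply H].
  apply cont_pair; [apply continuous_const | apply continuous_id].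
Qed.

Lemma CRI_cont F u0 a b : (a <= b)%R -> (forall u, contR (F u)) -> (forall x, joint F u0 x) ->
  contC (fun u => CRI (F u) a b) u0.
Proof.
  intros Hab HF HJ. apply contC_ball. intros e He.
  generalize (joint_tube F u0 a b (e / (b - a + 1)) (fun x _ => HJ x) ltac:(apply Rdiv_lt_0_compat; lra)).
  apply filter_imp. intros u Hu. rewrite <- CRI_minus by auto.
  eapply Rle_lt_trans.
  - apply (CRI_bound_const _ (e / (b - a + 1)) a b Hab); [apply contR_minus; auto |].
    intros x Hx. left. apply Hu, Hx.
  - apply (Rmult_lt_reg_r (b - a + 1)); [lra |].
    replace ((b - a) * (e / (b - a + 1)) * (b - a + 1))%R with ((b - a) * e)%R by (field; lra). nra.
Qed.

(** Cut the line: the tails are uniformly small by the domination, the middle part is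
    continuous by [CRI_cont]. *)
Lemma CI_cont F u0 M c : (0 < c)%R ->
  locally u0 (fun u => contR (F u) /\ eb M c (F u)) -> (forall x, joint F u0 x) ->
  contC (fun u => CI (F u)) u0.
Proof.
  intros Hc HL HJ. apply contC_ball. intros e He.
  destruct (exp_small c (2 * M / c) (e / 3) Hc ltac:(lra)) as [N HN].
  specialize (HN (INR N) (Rle_refl _)). pose proof (pos_INR N) as PN.
  pose proof (locally_singleton _ _ HL) as [C0 E0].
  assert (Hpos : (0 < e / 3 / (2 * INR N + 1))%R) by (apply Rdiv_lt_0_compat; lra).
  generalize (filter_and _ _ HL (joint_tube F u0 (- INR N) (INR N) _ (fun x _ => HJ x) Hpos)).
  apply filter_imp. intros u [[Cu Eu] Hu].
  pose proof (CI_tail_nat M c (F u) Cu Hc Eu N) as T1.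
  pose proof (CI_tail_nat M c (F u0) C0 Hc E0 N) as T2.
  assert (T3 : (Cmod (CRI (F u) (- INR N) (INR N) - CRI (F u0) (- INR N) (INR N)) < e / 3)%R).
  { rewrite <- CRI_minus by auto. eapply Rle_lt_trans.
    - apply (CRI_bound_const _ (e / 3 / (2 * INR N + 1))); [lra | apply contR_minus; auto |].
      intros x Hx. left. apply Hu, Hx.
    - apply (Rmult_lt_reg_r (2 * INR N + 1)); [lra |].
      replace ((INR N - - INR N) * (e / 3 / (2 * INR N + 1)) * (2 * INR N + 1))%R
        with (2 * INR N * (e / 3))%R by (field; lra). nra. }
  set (A := CRI (F u) (- INR N) (INR N)) in *. set (B := CRI (F u0) (- INR N) (INR N)) in *.
  replace (CI (F u) - CI (F u0)) with ((CI (F u) - A) + ((A - B) - (CI (F u0) - B))) by ring.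
  eapply Rle_lt_trans; [apply Cmod_triangle |].
  pose proof (Cmod_triangle' (A - B) (CI (F u0) - B)). lra.
Qed.

End Param.

(** * Fubini *)

Lemma joint_swap (F : R -> R -> C) x y :
  joint (U := R_UniformSpace) F x y -> joint (U := R_UniformSpace) (fun y x => F x y) y x.
Proof.
  intros H.
  apply (contC_comp (U := prod_UniformSpace R_UniformSpace R_UniformSpace)
    (V := prod_UniformSpace R_UniformSpace R_UniformSpace)
    (fun p => (snd p, fst p)) (fun p => F (fst p) (snd p))); [| exact H].
  intros P [d Hd]. exists d. intros [a b] [Ha Hb]. apply Hd. split; [exact Hb | exact Ha].
Qed.

(** As functions of the upper limit of the outer variable, the two iterated integrals
    have the same derivative. *)
Lemma CRI_Fubini (F : R -> R -> C) a b c d : (a <= b)%R -> (c <= d)%R ->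
  (forall x y, joint (U := R_UniformSpace) F x y) ->
  CRI (fun x => CRI (F x) c d) a b = CRI (fun y => CRI (fun x => F x y) a b) c d.
Proof.
  intros Hab Hcd HJ.
  assert (HF : forall x, contR (F x)) by (intros x; apply (joint_contR (U := R_UniformSpace)); auto).
  assert (HF' : forall y, contR (fun x => F x y)).
  { intros y. apply (joint_contR (U := R_UniformSpace) (fun y x => F x y)). intros x. apply joint_swap, HJ. }
  set (phi := fun x => CRI (F x) c d).
  assert (Cphi : contR phi) by (intros x; apply CRI_cont; auto).
  assert (Cpsi : forall b, (a <= b)%R -> contR (fun y => CRI (fun x => F x y) a b)).
  { intros b' Hb y. apply (CRI_cont (U := R_UniformSpace) (fun y x => F x y)); auto.
    intros x. apply joint_swap, HJ. }
  (* increments over a short x-interval, to either side *)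
  assert (Inc : forall (g : R -> C) x h e, contR g -> (0 <= e)%R ->
      (forall y, (Rabs (y - x) <= Rabs h)%R -> (Cmod (g y - g x) <= e)%R) ->
      (Cmod (CRI g x (x + h) - g x * h) <= e * Rabs h)%R).
  { intros g x h e Cg He Hg.
    assert (Q : forall p q : R, (p <= q)%R -> (Rabs (p - x) <= Rabs h)%R -> (Rabs (q - x) <= Rabs h)%R ->
       (Cmod (CRI g p q - g x * (q - p)%R) <= (q - p) * e)%R).
    { intros p q Hpq Hp Hq.
      replace (g x * (q - p)%R) with (CRI (fun _ => g x) p q).
      - rewrite <- CRI_minus; auto; [| intros z; apply contC_const].
        apply CRI_bound_const; [exact Hpq | apply contR_minus; [exact Cg | intros z; apply contC_const] |].
        intros z Hz. apply Hg. apply Rabs_le_between. apply Rabs_le_between in Hp. apply Rabs_le_between in Hq. lra.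
      - unfold CRI. rewrite (RInt_const (V := C_R_CompleteNormedModule)).
        change (scal (q - p)%R (g x)) with (@scal R_Ring C_R_ModuleSpace (q - p)%R (g x)).
        rewrite scal_R_Cmult. ring. }
    destruct (Rle_dec 0 h) as [Hh | Hh].
    - specialize (Q x (x + h)%R ltac:(lra)). replace (x + h - x)%R with h in Q by ring.
      rewrite (Rmult_comm e). rewrite (Rabs_pos_eq h) in * by lra. apply Q; [| lra].
      replace (x - x)%R with 0%R by ring. rewrite Rabs_R0. lra.
    - specialize (Q (x + h)%R x ltac:(lra)). replace (x + h - x)%R with h in Q by ring.
      replace (x - (x + h))%R with (- h)%R in Q by ring.
      rewrite CRI_swap by exact Cg. rewrite <- (Cmod_opp).
      replace (- (- CRI g (x + h)%R x - g x * h)) with (CRI g (x + h)%R x - g x * (- h)%R)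
        by (rewrite RtoC_opp; ring).
      rewrite (Rabs_left h) in * by lra. rewrite (Rmult_comm e). apply Q; [lra |].
      replace (x - x)%R with 0%R by ring. rewrite Rabs_R0. lra. }
  set (A := fun t => CRI phi a t).
  set (B := fun t => CRI (fun y => CRI (fun x => F x y) a t) c d).
  change (A b = B b).
  (* both sides are primitives of phi; the second one by uniform continuity in y *)
  assert (Cpsi' : forall t, contR (fun y => CRI (fun x => F x y) a t)).
  { intros t. destruct (Rle_dec a t); [apply Cpsi; auto |].
    intros y. apply (continuous_ext (U := C_UniformSpace) (fun y => - CRI (fun x => F x y) t a)).
    { intros z. symmetry. apply CRI_swap, HF'. }
    apply contC_opp, (CRI_cont (U := R_UniformSpace) (fun y x => F x y)); [lra | auto |].
    intros x. apply joint_swap, HJ. }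
  assert (Cst : forall x y h, CRI (fun u => F u y) a (x + h) - CRI (fun u => F u y) a x
     = CRI (fun u => F u y) x (x + h)).
  { intros x y h. rewrite <- (CRI_Chasles (fun u => F u y) a x (x + h)) by auto. ring. }
  assert (DA : forall x, Rd A x (phi x)).
  { intros x. apply Rd_eps. intros e He.
    destruct (proj1 (contC_ball _ _) (Cphi x) e He) as [r Hr].
    exists r. split; [apply cond_pos |]. intros h Hh.
    unfold A. rewrite <- (CRI_Chasles phi a x (x + h)) by auto.
    replace (CRI phi a x + CRI phi x (x + h) - CRI phi a x - phi x * h)
      with (CRI phi x (x + h) - phi x * h) by ring.
    apply Inc; [exact Cphi | lra |]. intros y Hy. left. apply Hr.
    change (Rabs (y - x) < r)%R. lra. }
  assert (DB : forall x, Rd B x (phi x)).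
  { intros x. apply Rd_eps. intros e He.
    assert (He' : (0 < e / (d - c + 1))%R) by (apply Rdiv_lt_0_compat; lra).
    destruct (joint_tube (U := R_UniformSpace) F x c d _ (fun y _ => HJ x y) He') as [r Hr].
    exists r. split; [apply cond_pos |]. intros h Hh. unfold B, phi.
    rewrite <- CRI_minus by auto.
    rewrite (CRI_ext _ (fun y => CRI (fun u => F u y) x (x + h))) by (intros; apply Cst).
    rewrite (Cmult_comm _ h), <- CRI_scal by auto.
    assert (Cw : contR (fun y => CRI (fun u => F u y) x (x + h))).
    { intros y. apply (continuous_ext (U := C_UniformSpace)
        (fun y => CRI (fun u => F u y) a (x + h) - CRI (fun u => F u y) a x)); [intros; apply Cst |].
      apply contC_minus; apply Cpsi'. }
    rewrite <- CRI_minus; [| exact Cw | apply contR_scal; auto].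
    eapply Rle_trans.
    - apply (CRI_bound_const _ (e / (d - c + 1) * Rabs h)); [exact Hcd | apply contR_minus; [exact Cw | apply contR_scal; auto] |].
      intros y Hy. rewrite (Cmult_comm h). apply (Inc (fun u => F u y)); [auto | lra |].
      intros u Hu. left. apply (Hr u); [| exact Hy]. change (Rabs (u - x) < r)%R. lra.
    - pose proof (Rabs_pos h).
      replace ((d - c) * (e / (d - c + 1) * Rabs h))%R with ((d - c) / (d - c + 1) * (e * Rabs h))%R by (field; lra).
      rewrite <- (Rmult_1_l (e * Rabs h)) at 2. apply Rmult_le_compat_r; [nra |].
      apply (Rmult_le_reg_r (d - c + 1)); [lra |].
      replace ((d - c) / (d - c + 1) * (d - c + 1))%R with (d - c)%R by (field; lra). lra. }
  assert (E0 : A a = B a).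
  { unfold A, B. transitivity (RtoC 0); [exact (RInt_point (V := C_R_CompleteNormedModule) a phi) |].
    rewrite (CRI_ext _ (fun _ => 0)) by (intros y; exact (RInt_point (V := C_R_CompleteNormedModule) a _)).
    rewrite (CRI_ext _ (fun _ => 0 * 0)) by (intros; ring).
    rewrite CRI_scal by (intros z; apply contC_const). ring. }
  assert (Hm : (Cmod ((A b - B b) - (A a - B a)) <= (b - a) * 0)%R).
  { apply (Rd_mean_value (fun t => A t - B t) (fun _ => 0)); auto.
    - intros x _. replace (RtoC 0) with (phi x - phi x) by ring.
      exact (is_derive_minus (V := C_R_NormedModule) _ _ _ _ _ (DA x) (DB x)).
    - intros; apply contC_const.
    - intros; rewrite Cmod_0; lra. }
  rewrite E0 in Hm. replace (B a - B a) with (RtoC 0) in Hm by ring.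
  replace (A b - B b - 0) with (A b - B b) in Hm by ring.
  apply (proj2 (Ceq_minus _ _)), Cmod_eq_0. pose proof (Cmod_ge_0 (A b - B b)). lra.
Qed.

Definition eb2 (M c : R) (F : R -> R -> C) : Prop :=
  forall x y : R, (Cmod (F x y) <= M * exp (- (c * Rabs x)) * exp (- (c * Rabs y)))%R.

Definition joint2 (F : R -> R -> C) : Prop := forall x y, joint (U := R_UniformSpace) F x y.

Definition rapid2 (F : R -> R -> C) : Prop :=
  joint2 F /\ exists M c, (0 < c)%R /\ eb2 M c F.

Lemma joint2_swap F : joint2 F -> joint2 (fun y x => F x y).
Proof. intros H x y. apply joint_swap, H. Qed.

Lemma rapid2_swap F : rapid2 F -> rapid2 (fun y x => F x y).
Proof.
  intros [H [M [c [Hc He]]]]. split; [apply joint2_swap, H |].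
  exists M, c. split; [exact Hc |]. intros x y.
  eapply Rle_trans; [apply He |]. right; ring.
Qed.

Lemma joint2_contR F x : joint2 F -> contR (F x).
Proof. intros H. apply (joint_contR (U := R_UniformSpace)). intros y. apply H. Qed.

Section Fub.
Variables (M c : R) (F : R -> R -> C).
Hypotheses (HJ : joint2 F) (Hc : (0 < c)%R) (He : eb2 M c F).

Lemma eb2_M : (0 <= M)%R.
Proof.
  specialize (He 0%R 0%R). rewrite Rabs_R0, Rmult_0_r, Ropp_0, exp_0 in He.
  pose proof (Cmod_ge_0 (F 0%R 0%R)). lra.
Qed.

Lemma eb2_slice x : eb (M * exp (- (c * Rabs x))) c (F x).
Proof. intros y. apply He. Qed.

Lemma eb2_slice_unif x : eb M c (F x).
Proof.
  apply (eb_weaken (M * exp (- (c * Rabs x))) c); [| lra | apply eb2_slice].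
  pose proof eb2_M. assert (exp (- (c * Rabs x)) <= exp 0)%R.
  { apply exp_le. pose proof (Rabs_pos x). nra. }
  rewrite exp_0 in *. nra.
Qed.

Lemma CI2_eb : eb (2 * M / c) c (fun x => CI (F x)).
Proof.
  intros x. eapply Rle_trans.
  - apply (CI_bound (M * exp (- (c * Rabs x))) c (F x)); [apply joint2_contR, HJ | exact Hc | apply eb2_slice].
  - right. field. lra.
Qed.

Lemma CI2_contR : contR (fun x => CI (F x)).
Proof.
  intros x. apply (CI_cont F x M c Hc); [| intros; apply HJ].
  apply filter_forall. intros u. split; [apply joint2_contR, HJ | apply eb2_slice_unif].
Qed.

Lemma CI2_approx n :
  (Cmod (CI (fun x => CI (F x)) - CRI (fun x => CRI (F x) (- INR n) (INR n)) (- INR n) (INR n))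
    <= 8 * M / (c * c) * exp (- (c * INR n)))%R.
Proof.
  pose proof (CI_tail_nat _ c _ CI2_contR Hc CI2_eb n) as T1. pose proof (pos_INR n) as Pn.
  assert (Cr : contR (fun x => CRI (F x) (- INR n) (INR n))).
  { intros x. apply CRI_cont; [lra | intros; apply joint2_contR, HJ | intros; apply HJ]. }
  set (K := (2 * M / c * exp (- (c * INR n)))%R).
  assert (T2 : (Cmod (CRI (fun x => (CI (F x) - CRI (F x) (- INR n) (INR n))%C) (- INR n) (INR n)) <= 2 * K / c)%R).
  { apply CRI_eb; [apply contR_minus; [apply CI2_contR | exact Cr] | exact Hc | | lra].
    intros x. eapply Rle_trans; [apply (CI_tail_nat (M * exp (- (c * Rabs x))) c (F x)); [apply joint2_contR, HJ | exact Hc | apply eb2_slice] |].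
    right. unfold K. field. lra. }
  rewrite CRI_minus in T2 by (exact Cr || apply CI2_contR).
  set (X := CI (fun x => CI (F x))) in *.
  set (Y := CRI (fun x => CI (F x)) (- INR n) (INR n)) in *.
  set (Z := CRI (fun x => CRI (F x) (- INR n) (INR n)) (- INR n) (INR n)) in *.
  replace (X - Z) with ((X - Y) + (Y - Z)) by ring.
  eapply Rle_trans; [apply Cmod_triangle |].
  eapply Rle_trans; [apply Rplus_le_compat; [exact T1 | exact T2] |].
  right. unfold K. field. lra.
Qed.
End Fub.

Lemma rapid2_slice F x : rapid2 F -> rapid (F x).
Proof.
  intros [HJ [M [c [Hc He]]]]. split; [apply joint2_contR, HJ |].
  exists M, c. split; [exact Hc | apply eb2_slice_unif; auto].
Qed.

Lemma rapid2_CI F : rapid2 F -> rapid (fun x => CI (F x)).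
Proof.
  intros [HJ [M [c [Hc He]]]]. split; [apply (CI2_contR M c); auto |].
  exists (2 * M / c)%R, c. split; [exact Hc | apply CI2_eb; auto].
Qed.

(** Both iterated integrals are limits, at the rate of [CI2_approx], of the iterated
    integrals over squares. *)
Lemma CI_Fubini F : rapid2 F -> CI (fun x => CI (F x)) = CI (fun y => CI (fun x => F x y)).
Proof.
  intros HF. pose proof (rapid2_swap F HF) as HF'.
  destruct HF as [HJ [M [c [Hc He]]]]. destruct HF' as [HJ' [M' [c' [Hc' He']]]].
  apply (proj2 (Ceq_minus _ _)), Cmod_eq_0. apply Rle_antisym; [| apply Cmod_ge_0].
  apply Rnot_lt_le. intros Hlt.
  set (X := CI (fun x => CI (F x))) in *. set (Y := CI (fun y => CI (fun x => F x y))) in *.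
  destruct (exp_small c (8 * M / (c * c)) (Cmod (X - Y) / 2) Hc ltac:(lra)) as [N1 H1].
  destruct (exp_small c' (8 * M' / (c' * c')) (Cmod (X - Y) / 2) Hc' ltac:(lra)) as [N2 H2].
  specialize (H1 (INR (max N1 N2)) (le_INR N1 (max N1 N2) ltac:(lia))).
  specialize (H2 (INR (max N1 N2)) (le_INR N2 (max N1 N2) ltac:(lia))).
  pose proof (CI2_approx M c F HJ Hc He (max N1 N2)) as A1.
  pose proof (CI2_approx M' c' (fun y x => F x y) HJ' Hc' He' (max N1 N2)) as A2.
  pose proof (pos_INR (max N1 N2)).
  rewrite <- CRI_Fubini in A2 by (auto || lra).
  fold X in A1. fold Y in A2.
  set (Z := CRI (fun x => CRI (F x) (- INR (max N1 N2)) (INR (max N1 N2))) (- INR (max N1 N2)) (INR (max N1 N2))) in *.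
  assert (Ht : (Cmod (X - Y) <= Cmod (X - Z) + Cmod (Y - Z))%R).
  { replace (X - Y) with ((X - Z) - (Y - Z)) by ring. apply Cmod_triangle'. }
  lra.
Qed.

(** * Differentiation under the integral sign *)

Definition near (z0 : C) (r : R) (z : C) : Prop := (Cmod (z - z0) < r)%R.

Lemma near_seg z0 r h (t : R) : (Cmod h < r)%R -> (0 <= t <= 1)%R -> near z0 r (z0 + t * h).
Proof.
  intros Hh Ht. unfold near. replace (z0 + t * h - z0) with (t * h) by ring.
  rewrite Cmod_mult, Cmod_R, Rabs_pos_eq by lra. pose proof (Cmod_ge_0 h). nra.
Qed.

Lemma contC_seg (z0 h : C) (t : R) : contC (U := R_UniformSpace) (fun t : R => z0 + t * h) t.
Proof.
  apply contC_plus; [apply contC_const |]. apply contC_mult; [| apply contC_const].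
  apply (contC_RtoC (U := R_UniformSpace) (fun u => u)), continuous_id.
Qed.

(** An integrand bounded by [rho M] everywhere, and by a small multiple of [rho] on a
    large interval, has an integral small with respect to [rho]: the form in which
    domination is used for difference quotients and for the Riemann-Lebesgue lemma. *)
Lemma CI_remainder (M c e : R) : (0 < c)%R -> (0 < e)%R -> (0 <= M)%R ->
  exists N e1, (0 <= N)%R /\ (0 < e1)%R /\ forall D rho, (0 <= rho)%R -> contR D -> eb (rho * M) c D ->
    (forall x, (- N <= x <= N)%R -> (Cmod (D x) <= rho * e1)%R) -> (Cmod (CI D) <= e * rho)%R.
Proof.
  intros Hc He HM.
  destruct (exp_small c (2 * M / c) (e / 2) Hc ltac:(lra)) as [N HN].
  specialize (HN (INR N) (Rle_refl _)). pose proof (pos_INR N) as PN.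
  exists (INR N), (e / 2 / (2 * INR N + 1))%R. split; [exact PN |].
  assert (He1 : (0 < e / 2 / (2 * INR N + 1))%R) by (apply Rdiv_lt_0_compat; lra).
  split; [exact He1 |]. set (e1 := (e / 2 / (2 * INR N + 1))%R) in *. intros D rho Hr HD HE HX.
  pose proof (CI_tail_nat _ c D HD Hc HE N) as T1.
  pose proof (CRI_bound_const D (rho * e1) (- INR N) (INR N) ltac:(lra) HD HX) as T2.
  replace (CI D) with ((CI D - CRI D (- INR N) (INR N)) + CRI D (- INR N) (INR N)) by ring.
  eapply Rle_trans; [apply Cmod_triangle |].
  assert (B1 : (2 * (rho * M) / c * exp (- (c * INR N)) <= rho * (e / 2))%R).
  { replace (2 * (rho * M) / c * exp (- (c * INR N)))%R
      with (rho * (2 * M / c * exp (- (c * INR N))))%R by (field; lra).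
    apply Rmult_le_compat_l; lra. }
  assert (B2 : ((INR N - - INR N) * (rho * e1) <= rho * (e / 2))%R).
  { replace ((INR N - - INR N) * (rho * e1))%R with (rho * (2 * INR N * e1))%R by ring.
    apply Rmult_le_compat_l; [lra |]. unfold e1.
    apply (Rmult_le_reg_r (2 * INR N + 1)); [lra |].
    replace (2 * INR N * (e / 2 / (2 * INR N + 1)) * (2 * INR N + 1))%R with (2 * INR N * (e / 2))%R by (field; lra). nra. }
  lra.
Qed.

Lemma mean_value_remainder (g g1 : R -> C) (B : R) :
  (forall t, (0 <= t <= 1)%R -> Rd g t (g1 t)) ->
  (forall t, (0 <= t <= 1)%R -> @contC R_UniformSpace g1 t) ->
  (forall t, (0 <= t <= 1)%R -> (Cmod (g1 t - g1 0%R) <= B)%R) ->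
  (Cmod (g 1%R - g 0%R - g1 0%R) <= B)%R.
Proof.
  intros HD HC HB. set (k := fun t : R => g t - t * g1 0%R).
  replace (g 1%R - g 0%R - g1 0%R) with (k 1%R - k 0%R) by (unfold k; ring).
  replace B with ((1 - 0) * B)%R by ring.
  apply (Rd_mean_value k (fun t => g1 t - g1 0%R)); [lra | | | exact HB].
  - intros t Ht. unfold k. apply (is_derive_minus (V := C_R_NormedModule)); [apply HD, Ht |].
    change (Rd (fun t : R => t * g1 0%R) t (g1 0%R)).
    pose proof (Cd_Rd (fun w => w) 0 (g1 0%R) t 1 (Cd_id _)) as K. rewrite Cmult_1_l in K.
    eapply (is_derive_ext (V := C_R_NormedModule)); [| exact K]. intros t0; exact (Cplus_0_l _).
  - intros t Ht. apply contC_minus; [apply HC, Ht | apply contC_const].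
Qed.

(** The remainder of the first order expansion of the integrand is controlled by the
    variation of [F1], small on compact sets and dominated at infinity. *)
Lemma CI_param_derive (F F1 : C -> R -> C) (z0 : C) (r M c : R) :
  (0 < r)%R -> (0 < c)%R ->
  (forall z x, near z0 r z -> Cd (fun w => F w x) z (F1 z x)) ->
  (forall z x, near z0 r z -> joint (U := C_UniformSpace) F1 z x) ->
  (forall z, near z0 r z -> contR (F z)) ->
  (forall z, near z0 r z -> eb M c (F z) /\ eb M c (F1 z)) ->
  Cd (fun z => CI (F z)) z0 (CI (F1 z0)).
Proof.
  intros Hr Hc HD HJ HF HE e He.
  assert (Z0 : near z0 r z0) by (unfold near; replace (z0 - z0) with (RtoC 0) by ring; rewrite Cmod_0; exact Hr).
  assert (HF1 : forall z, near z0 r z -> contR (F1 z)).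
  { intros z Hz. apply (joint_contR (U := C_UniformSpace)). intros x. apply HJ, Hz. }
  pose proof (eb_M_pos _ _ _ (proj1 (HE z0 Z0))) as HM.
  destruct (CI_remainder (2 * M) c e Hc He ltac:(lra)) as [N [e1 [PN [He1 HR]]]].
  destruct (proj1 (locally_C _ _) (joint_tube (U := C_UniformSpace) F1 z0 (- N) N e1
    (fun x _ => HJ z0 x Z0) He1)) as [d1 Hd1].
  exists (Rmin r d1). split; [apply Rmin_pos; [exact Hr | apply cond_pos] |]. intros h Hh.
  assert (Hhr := Rlt_le_trans _ _ _ Hh (Rmin_l _ _)). assert (Hhd := Rlt_le_trans _ _ _ Hh (Rmin_r _ _)).
  assert (Nh : near z0 r (z0 + h)) by (replace h with (1%R * h) by ring; apply near_seg; [exact Hhr | lra]).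
  destruct (HE _ Z0) as [E0 E01]. destruct (HE _ Nh) as [Eh _].
  assert (G0 : rapid (F z0)) by (split; [auto | exists M, c; auto]).
  assert (G1 : rapid (F1 z0)) by (split; [auto | exists M, c; auto]).
  assert (Gh : rapid (F (z0 + h))) by (split; [auto | exists M, c; auto]).
  set (D := fun x => F (z0 + h) x - F z0 x - h * F1 z0 x).
  assert (ED : CI (F (z0 + h)) - CI (F z0) - CI (F1 z0) * h = CI D).
  { unfold D. rewrite CI_minus, CI_minus, CI_scal; auto using rapid_minus, rapid_scal. ring. }
  rewrite ED. assert (GD : rapid D) by (unfold D; auto using rapid_minus, rapid_scal).
  assert (MV : forall x B, (forall t, (0 <= t <= 1)%R -> (Cmod (F1 (z0 + t * h)%C x - F1 z0 x) <= B)%R) ->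
     (Cmod (D x) <= Cmod h * B)%R).
  { intros x B HB. unfold D.
    assert (Ez : z0 + 0%R * h = z0) by ring.
    replace (F (z0 + h) x - F z0 x - h * F1 z0 x)
      with (F (z0 + 1%R * h) x - F (z0 + 0%R * h) x - F1 (z0 + 0%R * h) x * h)
      by (rewrite Ez, Cmult_1_l; ring).
    apply (mean_value_remainder (fun t : R => F (z0 + t * h) x) (fun t : R => F1 (z0 + t * h) x * h)).
    - intros t Ht. apply (Cd_Rd (fun w => F w x)), HD, near_seg; auto.
    - intros t Ht. apply contC_mult; [| apply contC_const].
      apply (contC_comp (U := R_UniformSpace) (V := prod_UniformSpace C_UniformSpace R_UniformSpace)
        (fun t => (z0 + t * h, x)) (fun p => F1 (fst p) (snd p))).
      + apply (cont_pair (V := C_UniformSpace)); [apply contC_seg | apply continuous_const].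
      + apply HJ, near_seg; auto.
    - intros t Ht. rewrite Ez. replace (F1 (z0 + t * h) x * h - F1 z0 x * h) with (h * (F1 (z0 + t * h) x - F1 z0 x)) by ring.
      rewrite Cmod_mult. apply Rmult_le_compat_l; [apply Cmod_ge_0 | auto]. }
  apply HR; [apply Cmod_ge_0 | apply GD | |].
  - intros x. eapply Rle_trans; [apply (MV x (2 * M * exp (- (c * Rabs x)))%R) | right; ring].
    intros t Ht. eapply Rle_trans; [apply Cmod_triangle' |].
    pose proof (proj2 (HE _ (near_seg z0 r h t Hhr Ht)) x). pose proof (E01 x). lra.
  - intros x Hx. apply MV. intros t Ht. left.
    apply Hd1; [| exact Hx]. change (Cmod (z0 + t * h - z0) < d1)%R. apply (near_seg z0 d1 h t Hhd Ht).
Qed.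

(** A real parameter is needed for families, such as [planeKer] below, that are
    dominated along the real axis and nowhere else. *)
Lemma CI_param_Rd (F F1 : R -> R -> C) (w0 r M c : R) :
  (0 < r)%R -> (0 < c)%R ->
  (forall w x, (Rabs (w - w0) < r)%R -> Rd (fun w => F w x) w (F1 w x)) ->
  (forall w x, (Rabs (w - w0) < r)%R -> joint (U := R_UniformSpace) F1 w x) ->
  (forall w, (Rabs (w - w0) < r)%R -> contR (F w)) ->
  (forall w, (Rabs (w - w0) < r)%R -> eb M c (F w) /\ eb M c (F1 w)) ->
  Rd (fun w => CI (F w)) w0 (CI (F1 w0)).
Proof.
  intros Hr Hc HD HJ HF HE. apply Rd_eps. intros e He.
  assert (Z0 : (Rabs (w0 - w0) < r)%R) by (rewrite Rminus_diag, Rabs_R0; exact Hr).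
  assert (HF1 : forall z, (Rabs (z - w0) < r)%R -> contR (F1 z)).
  { intros z Hz. apply (joint_contR (U := R_UniformSpace)). intros x. apply HJ, Hz. }
  pose proof (eb_M_pos _ _ _ (proj1 (HE w0 Z0))) as HM.
  destruct (CI_remainder (2 * M) c e Hc He ltac:(lra)) as [N [e1 [PN [He1 HR]]]].
  destruct (joint_tube (U := R_UniformSpace) F1 w0 (- N) N e1 (fun x _ => HJ w0 x Z0) He1) as [d1 Hd1].
  exists (Rmin r d1). split; [apply Rmin_pos; [exact Hr | apply cond_pos] |]. intros h Hh.
  assert (Hhr := Rlt_le_trans _ _ _ Hh (Rmin_l _ _)). assert (Hhd := Rlt_le_trans _ _ _ Hh (Rmin_r _ _)).
  assert (Seg : forall d t, (Rabs h < d)%R -> (0 <= t <= 1)%R -> (Rabs (w0 + t * h - w0) < d)%R).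
  { intros d t Hd Ht. replace (w0 + t * h - w0)%R with (t * h)%R by ring.
    rewrite Rabs_mult, (Rabs_pos_eq t) by lra. pose proof (Rabs_pos h). nra. }
  assert (Nh : (Rabs (w0 + h - w0) < r)%R) by (replace h with (1 * h)%R by ring; apply Seg; lra).
  destruct (HE _ Z0) as [E0 E01]. destruct (HE _ Nh) as [Eh _].
  assert (G0 : rapid (F w0)) by (split; [auto | exists M, c; auto]).
  assert (G1 : rapid (F1 w0)) by (split; [auto | exists M, c; auto]).
  assert (Gh : rapid (F (w0 + h)%R)) by (split; [auto | exists M, c; auto]).
  set (D := fun x => F (w0 + h)%R x - F w0 x - h * F1 w0 x).
  assert (ED : CI (F (w0 + h)%R) - CI (F w0) - CI (F1 w0) * h = CI D).
  { unfold D. rewrite CI_minus, CI_minus, CI_scal; auto using rapid_minus, rapid_scal. ring. }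
  rewrite ED. assert (GD : rapid D) by (unfold D; auto using rapid_minus, rapid_scal).
  assert (MV : forall x B, (forall t, (0 <= t <= 1)%R -> (Cmod (F1 (w0 + t * h)%R x - F1 w0 x) <= B)%R) ->
     (Cmod (D x) <= Rabs h * B)%R).
  { intros x B HB. unfold D.
    assert (Ez : (w0 + 0 * h = w0)%R) by ring.
    replace (F (w0 + h)%R x - F w0 x - h * F1 w0 x)
      with (F (w0 + 1 * h)%R x - F (w0 + 0 * h)%R x - h * F1 (w0 + 0 * h)%R x)
      by (rewrite Ez, Rmult_1_l; ring).
    apply (mean_value_remainder (fun t : R => F (w0 + t * h)%R x) (fun t : R => h * F1 (w0 + t * h)%R x)).
    - intros t Ht. pose proof (is_derive_comp (V := C_R_NormedModule) (fun w => F w x) (fun t => w0 + t * h)%R t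
        (F1 (w0 + t * h)%R x) h (HD _ x (Seg r t Hhr Ht))) as K.
      assert (Dl : is_derive (fun t => w0 + t * h)%R t h) by (auto_derive; [auto | ring]).
      specialize (K Dl). unfold Rd. replace (h * F1 (w0 + t * h)%R x) with (@scal R_AbsRing C_R_NormedModule h (F1 (w0 + t * h)%R x)).
      + exact K.
      + apply C_eq; cbn; unfold mult; cbn; ring.
    - intros t Ht. apply contC_mult; [apply contC_const |].
      apply (contC_comp (U := R_UniformSpace) (V := prod_UniformSpace R_UniformSpace R_UniformSpace)
        (fun t => ((w0 + t * h)%R, x)) (fun p => F1 (fst p) (snd p))).
      + apply (cont_pair (V := R_UniformSpace)); [| apply continuous_const].
        apply (ex_derive_continuous (fun t => w0 + t * h)%R). auto_derive. auto.
      + apply HJ, Seg; auto.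
    - intros t Ht. rewrite Ez. replace (h * F1 (w0 + t * h)%R x - h * F1 w0 x) with (h * (F1 (w0 + t * h)%R x - F1 w0 x)) by ring.
      rewrite Cmod_mult, Cmod_R. apply Rmult_le_compat_l; [apply Rabs_pos | auto]. }
  apply HR; [apply Rabs_pos | apply GD | |].
  - intros x. eapply Rle_trans; [apply (MV x (2 * M * exp (- (c * Rabs x)))%R) | right; ring].
    intros t Ht. eapply Rle_trans; [apply Cmod_triangle' |].
    pose proof (proj2 (HE _ (Seg r t Hhr Ht)) x). pose proof (E01 x). lra.
  - intros x Hx. apply MV. intros t Ht. left.
    apply Hd1; [| exact Hx]. exact (Seg d1 t Hhd Ht).
Qed.

(** * Automation for continuity and differentiation of explicit formulas *)

Lemma contC_Re_id (z : C) : continuous (T := C_UniformSpace) (U := R_UniformSpace) (fun z : C => Re z) z.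
Proof. apply (contC_Re (U := C_UniformSpace) (fun z => z)), continuous_id. Qed.

Ltac cont_step :=
  lazymatch goal with
  | |- contR _ => intro
  | |- joint2 _ => intros ? ?
  | |- joint _ _ _ => unfold joint; cbv beta
  | |- forall _, _ => intro
  | |- contC (fun _ => ?c) _ => apply contC_const
  | |- contC (fun u => Cplus (@?a u) (@?b u)) _ => apply (contC_plus a b)
  | |- contC (fun u => Cminus (@?a u) (@?b u)) _ => apply (contC_minus a b)
  | |- contC (fun u => Cmult (@?a u) (@?b u)) _ => apply (contC_mult a b)
  | |- contC (fun u => Copp (@?a u)) _ => apply (contC_opp a)
  | |- contC (fun u => Cexp (@?a u)) _ => apply (contC_Cexp a)
  | |- contC (fun u => RtoC (@?a u)) _ => apply (contC_RtoC a)
  | |- contC (fun p => fst p) _ => apply (cont_fst (U := C_UniformSpace))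
  | |- contC (fun p => snd p) _ => apply (cont_snd (V := C_UniformSpace))
  | |- contC (fun p => p) _ => apply (continuous_id (U := C_UniformSpace))
  | |- continuous (fun _ => ?c) _ => apply continuous_const
  | |- continuous (fun u => u) _ => apply continuous_id
  | |- continuous (fun p => fst p) _ => apply (cont_fst (U := R_UniformSpace))
  | |- continuous (fun p => snd p) _ => apply (cont_snd (V := R_UniformSpace))
  | |- continuous (fun u => Rplus (@?a u) (@?b u)) _ => apply (continuous_plus (V := R_NormedModule) a b)
  | |- continuous (fun u => Rminus (@?a u) (@?b u)) _ => apply (continuous_minus (V := R_NormedModule) a b)
  | |- continuous (fun u => Rmult (@?a u) (@?b u)) _ => apply (continuous_mult (K := R_AbsRing) a b)
  | |- continuous (fun u => Ropp (@?a u)) _ => apply (continuous_opp (V := R_NormedModule) a)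
  | |- continuous (fun u => exp (@?a u)) _ => apply (contR_exp a)
  end.
Ltac ctac := repeat cont_step.

Ltac Cd_step :=
  match goal with
  | |- Cd (fun _ => ?c) _ _ => apply Cd_const
  | |- Cd (fun w => w) _ _ => apply Cd_id
  | |- Cd (fun w => Cplus (@?a w) (@?b w)) _ _ => eapply (Cd_plus a b)
  | |- Cd (fun w => Cminus (@?a w) (@?b w)) _ _ => eapply (Cd_minus a b)
  | |- Cd (fun w => Cmult ?k (@?b w)) _ _ => eapply (Cd_scal k b)
  | |- Cd (fun w => Cmult (@?a w) (@?b w)) _ _ => eapply (Cd_mult a b)
  | |- Cd (fun w => Copp (@?a w)) _ _ => eapply (Cd_opp a)
  | |- Cd (fun w => Cexp (@?a w)) _ _ => eapply (Cd_Cexp_comp a)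
  end.
Ltac dtac := repeat Cd_step.
Ltac Cd_solve := eapply Cd_eq; [dtac | cbv beta].

(** * Shifting the contour *)

Definition strip (lo hi : R) (z : C) : Prop := (lo < Im z < hi)%R.

(** Exponential decay along horizontal lines, uniform over a strip. *)
Definition sb (M c lo hi : R) (A : C -> C) : Prop :=
  forall z, strip lo hi z -> (Cmod (A z) <= M * exp (- (c * Rabs (Re z))))%R.

Lemma strip_line lo hi (x : R) z : strip lo hi z -> strip lo hi (x + z).
Proof. unfold strip. destruct z as [p q]; cbn. intros H. replace (0 + q)%R with q by ring. exact H. Qed.

Lemma strip_seg lo hi z w (t : R) : strip lo hi z -> strip lo hi w -> (0 <= t <= 1)%R ->
  strip lo hi (z + t * (w - z)).
Proof.
  unfold strip. intros [A B] [A' B'] Ht.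
  replace (Im (z + t * (w - z))) with ((1 - t) * Im z + t * Im w)%R by (destruct z, w; cbn; ring).
  destruct (Rle_dec t (1 / 2)) as [L | L]; split; nra.
Qed.

Lemma strip_near lo hi z : strip lo hi z -> exists r, (0 < r)%R /\ forall w, near z r w -> strip lo hi w.
Proof.
  unfold strip, near. intros [A B]. exists (Rmin (Im z - lo) (hi - Im z)).
  split; [apply Rmin_pos; lra |]. intros w Hw.
  pose proof (Rlt_le_trans _ _ _ Hw (Rmin_l _ _)). pose proof (Rlt_le_trans _ _ _ Hw (Rmin_r _ _)).
  pose proof (Im_le_Cmod (w - z)) as H1. change (Im (w - z)) with (Im w - Im z)%R in H1.
  apply Rabs_le_between in H1. lra.
Qed.

Lemma sb_eb M c lo hi A z : (0 < c)%R -> sb M c lo hi A -> strip lo hi z ->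
  eb (M * exp (c * Rabs (Re z))) c (fun x : R => A (x + z)).
Proof.
  intros Hc H Hz x. eapply Rle_trans; [apply H, strip_line, Hz |].
  assert (HM : (0 <= M)%R).
  { specialize (H z Hz). pose proof (Cmod_ge_0 (A z)). pose proof (exp_pos (- (c * Rabs (Re z)))). nra. }
  rewrite Rmult_assoc, <- exp_plus. apply Rmult_le_compat_l; [exact HM |]. apply exp_le.
  change (Re (x + z)) with (x + Re z)%R.
  pose proof (Rabs_triang (x + Re z) (- Re z)) as T. rewrite Rabs_Ropp in T.
  replace (x + Re z + - Re z)%R with x in T by ring. nra.
Qed.

Section Contour.
Variables (M c lo hi : R) (A A1 : C -> C).
Hypotheses (Hc : (0 < c)%R)
  (HD : forall z, strip lo hi z -> Cd A z (A1 z))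
  (HC : forall z, strip lo hi z -> @contC C_UniformSpace A1 z)
  (HA : sb M c lo hi A) (HA1 : sb M c lo hi A1).

Lemma contR_line B z : (forall z, strip lo hi z -> @contC C_UniformSpace B z) -> strip lo hi z ->
  contR (fun x : R => B (x + z)).
Proof.
  intros HB Hz x.
  apply (contC_comp (U := R_UniformSpace) (V := C_UniformSpace) (fun x : R => x + z) B).
  - change (@contC R_UniformSpace (fun x : R => x + z) x). ctac.
  - apply HB, strip_line, Hz.
Qed.

Lemma rapid_line z : strip lo hi z -> rapid (fun x : R => A (x + z)).
Proof.
  intros Hz. split.
  - apply contR_line; [| exact Hz]. intros w Hw. exact (Cd_cont _ _ _ (HD w Hw)).
  - exists (M * exp (c * Rabs (Re z)))%R, c. split; [exact Hc | eapply sb_eb; eauto].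
Qed.

(** The derivative of the integral along the line through [z], in the direction of
    [w], is the integral of a total derivative, hence 0. *)
Lemma CI_contour z w : strip lo hi z -> strip lo hi w ->
  CI (fun x : R => A (x + z)) = CI (fun x : R => A (x + w)).
Proof.
  intros Hz Hw.
  assert (Z : forall u, strip lo hi u -> Cd (fun z => CI (fun x : R => A (x + z))) u 0).
  { intros u Hu. destruct (strip_near lo hi u Hu) as [r0 [Hr0 Hr]].
    set (r := Rmin r0 1).
    assert (Hrr : (0 < r)%R) by (apply Rmin_pos; lra).
    assert (Hs : forall v, near u r v -> strip lo hi v).
    { intros v Hv. apply Hr. unfold near in *. eapply Rlt_le_trans; [exact Hv | apply Rmin_l]. }
    assert (Hre : forall v, near u r v -> (c * Rabs (Re v) <= c * (Rabs (Re u) + 1))%R).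
    { intros v Hv. apply Rmult_le_compat_l; [lra |].
      assert (H1 : (Cmod (v - u) < 1)%R) by (eapply Rlt_le_trans; [exact Hv | apply Rmin_r]).
      pose proof (re_le_Cmod (v - u)) as H2. change (Re (v - u)) with (Re v - Re u)%R in H2.
      pose proof (Rabs_triang (Re v - Re u) (Re u)) as T.
      replace (Re v - Re u + Re u)%R with (Re v) in T by ring. lra. }
    assert (HM : (0 <= M)%R).
    { specialize (HA u Hu). pose proof (Cmod_ge_0 (A u)). pose proof (exp_pos (- (c * Rabs (Re u)))). nra. }
    assert (Eb : forall B v, sb M c lo hi B -> near u r v ->
       eb (M * exp (c * (Rabs (Re u) + 1))) c (fun x : R => B (x + v))).
    { intros B v HB Hv. apply (eb_weaken (M * exp (c * Rabs (Re v))) c); [| lra | apply (sb_eb M c lo hi); auto].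
      apply Rmult_le_compat_l; [exact HM |]. apply exp_le; auto. }
    eapply Cd_eq.
    - apply (CI_param_derive (fun z (x : R) => A (x + z)) (fun z (x : R) => A1 (x + z)) u r
        (M * exp (c * (Rabs (Re u) + 1))) c Hrr Hc).
      + intros v x Hv. rewrite <- (Cmult_1_r (A1 (x + v))).
        apply (Cd_comp (fun z => x + z) A); [apply HD, strip_line; auto |].
        Cd_solve. ring.
      + intros v x Hv. unfold joint. 
        apply (contC_comp (U := prod_UniformSpace C_UniformSpace R_UniformSpace) (V := C_UniformSpace)
          (fun p => RtoC (snd p) + fst p) A1).
        * change (@contC (prod_UniformSpace C_UniformSpace R_UniformSpace) (fun p => RtoC (snd p) + fst p) (v, x)). ctac.
        * apply HC, (strip_line lo hi x v); auto.
      + intros v Hv. apply rapid_line; auto.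
      + intros v Hv. split; apply Eb; auto.
    - apply (CI_derive_zero (fun x : R => A (x + u))).
      + apply rapid_line, Hu.
      + split; [apply contR_line; auto |]. exists (M * exp (c * Rabs (Re u)))%R, c.
        split; [exact Hc | eapply sb_eb; eauto].
      + intros x. apply (Cd_Rd' (fun z => A (z + u))). rewrite <- (Cmult_1_r (A1 (x + u))).
        apply (Cd_comp (fun z => z + u) A); [apply HD, strip_line, Hu |]. Cd_solve. ring. }
  symmetry. apply (C_zero_derive_const (fun z => CI (fun x : R => A (x + z)))).
  intros t Ht. apply Z, strip_seg; auto.
Qed.

Lemma CI_contour0 z : strip lo hi 0 -> strip lo hi z ->
  CI (fun x : R => A (x + z)) = CI (fun x : R => A x).
Proof.
  intros H0 Hz. rewrite (CI_contour z 0 Hz H0). apply CI_ext. intros x. f_equal. ring.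
Qed.
End Contour.

(** * A majorant for doubly exponential integrands *)

Lemma exp_ge_sq (x : R) : (0 <= x -> x * x / 2 <= exp x)%R.
Proof.
  intros Hx.
  assert (H : forall t, (0 <= t)%R -> (0 <= exp t - t * t / 2 )%R).
  { intros t Ht. destruct (MVT_gen (fun t => exp t - t * t / 2)%R 0 t (fun t => exp t - t)%R) as [u [Hu E]].
    - intros y _. auto_derive; [auto | field].
    - intros y _. apply continuity_pt_filterlim.
      apply (ex_derive_continuous (fun t => exp t - t * t / 2)%R). auto_derive; auto.
    - rewrite exp_0 in E. rewrite Rmin_left, Rmax_right in Hu by lra.
      assert (1 + u <= exp u)%R.
      { destruct (Req_dec u 0) as [-> | N]; [rewrite exp_0; lra | left; apply exp_ineq1; lra]. }
      nra. }
  specialize (H x Hx). lra.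
Qed.

(** Logarithm of the basic majorant: exp (a x - k e^x) decays on both sides, linearly
    in the exponent on the left and faster on the right. The constant absorbs the
    region where neither term dominates. *)
Lemma expo_bound (a0 a1 a k0 k x : R) : (0 < a0)%R -> (a0 <= a <= a1)%R -> (0 < k0 <= k)%R ->
  (a * x - k * exp x <= (a0 + a1) * (a0 + a1) / (2 * k0) - a0 * Rabs x)%R.
Proof.
  intros H0 Ha Hk. pose proof (exp_pos x) as Hp.
  assert (Hq : (0 <= (a0 + a1) * (a0 + a1) / (2 * k0))%R) by (apply Rdiv_le_0_compat; nra).
  destruct (Rle_dec 0 x) as [Hx | Hx].
  - rewrite Rabs_pos_eq by exact Hx. pose proof (exp_ge_sq x Hx) as Hs.
    assert (E : (k0 * (x * x / 2) <= k * exp x)%R) by (apply Rmult_le_compat; nra).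
    assert (S : ((a0 + a1) * x - k0 * (x * x / 2) <= (a0 + a1) * (a0 + a1) / (2 * k0))%R).
    { apply (Rmult_le_reg_r (2 * k0)); [lra |].
      replace ((a0 + a1) * (a0 + a1) / (2 * k0) * (2 * k0))%R with ((a0 + a1) * (a0 + a1))%R by (field; lra).
      pose proof (Rle_0_sqr (a0 + a1 - k0 * x)) as Q. unfold Rsqr in Q. nra. }
    nra.
  - rewrite Rabs_left by lra. nra.
Qed.

Lemma Cmod_le_exp (z : C) (b : R) : (Re z <= b)%R -> (Cmod (Cexp z) <= exp b)%R.
Proof. intros H. rewrite Cmod_Cexp. apply exp_le, H. Qed.

Lemma Re_Cexp (z : C) : Re (Cexp z) = (exp (Re z) * cos (Im z))%R. Proof. reflexivity. Qed.
Lemma Im_Cexp (z : C) : Im (Cexp z) = (exp (Re z) * sin (Im z))%R. Proof. reflexivity. Qed.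

(** * The Gamma integral in logarithmic form *)

(** Euler's integrand in the variable log t; rays through the origin in the t-plane
    become horizontal lines. *)
Definition Gk (a z : C) : C := Cexp (a * z - Cexp z).
(** The Gamma function of [a], as an integral over the line. *)
Definition Gam (a : C) : C := CI (fun x : R => Gk a x).

Lemma Re_Gk a z : Re (a * z - Cexp z) = (Re a * Re z - Im a * Im z - cos (Im z) * exp (Re z))%R.
Proof. destruct a, z; cbn. ring. Qed.

Lemma cos_lower (y1 y : R) : (0 <= y1 <= PI)%R -> (Rabs y <= y1)%R -> (cos y1 <= cos y)%R.
Proof.
  intros H1 Hy. assert (E : cos y = cos (Rabs y)).
  { unfold Rabs. destruct (Rcase_abs y); [rewrite cos_neg |]; reflexivity. }
  rewrite E. apply cos_decr_1; try lra; apply Rabs_pos.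
Qed.

Lemma Gk_bound (a z : C) (y1 : R) : (0 < Re a)%R -> (0 <= y1 < PI / 2)%R -> (Rabs (Im z) < y1)%R ->
  (Cmod (Gk a z) <= exp (Rabs (Im a) * y1 + (Re a + Re a) * (Re a + Re a) / (2 * cos y1))
     * exp (- (Re a * Rabs (Re z))))%R.
Proof.
  intros Ha Hy Hz. rewrite <- exp_plus. apply Cmod_le_exp. rewrite Re_Gk.
  assert (Hcos : (0 < cos y1)%R) by (apply cos_gt_0; lra).
  pose proof (cos_lower y1 (Im z) ltac:(lra) ltac:(lra)) as Hl.
  pose proof (expo_bound (Re a) (Re a) (Re a) (cos y1) (cos (Im z)) (Re z) Ha ltac:(lra) ltac:(lra)).
  assert ((- (Im a * Im z) <= Rabs (Im a) * y1)%R).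
  { rewrite <- Rmult_comm. rewrite Ropp_mult_distr_r.
    eapply Rle_trans; [apply Rle_abs |]. rewrite Rmult_comm, Rabs_mult, Rabs_Ropp.
    apply Rmult_le_compat; try apply Rabs_pos; lra. }
  lra.
Qed.

Lemma Cd_Gk a z : Cd (Gk a) z (a * Gk a z - Gk (a + 1) z).
Proof.
  unfold Gk. Cd_solve.
  replace ((a + 1) * z - Cexp z) with (z + (a * z - Cexp z)) by ring.
  rewrite (Cexp_plus z). ring.
Qed.

Lemma Gk_sb a y1 : (0 < Re a)%R -> (0 <= y1 < PI / 2)%R ->
  exists M, sb M (Re a) (- y1) y1 (Gk a).
Proof.
  intros Ha Hy. eexists. intros z Hz. apply (Gk_bound a z y1); auto.
  apply Rabs_lt_between. exact Hz.
Qed.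

Lemma sb_weaken M c M' c' lo hi A : (0 <= M <= M')%R -> (c' <= c)%R -> sb M c lo hi A -> sb M' c' lo hi A.
Proof.
  intros HM Hc H z Hz. eapply Rle_trans; [apply H, Hz |].
  apply Rmult_le_compat; [lra | apply Rlt_le, exp_pos | lra |].
  apply exp_le. pose proof (Rabs_pos (Re z)). nra.
Qed.

Lemma sb_pos M c lo hi A z : strip lo hi z -> sb M c lo hi A -> (0 <= M)%R.
Proof.
  intros Hz H. specialize (H z Hz). pose proof (Cmod_ge_0 (A z)).
  pose proof (exp_pos (- (c * Rabs (Re z)))). nra.
Qed.

Lemma Gk_contour_data a y1 : (0 < Re a)%R -> (0 < y1 < PI / 2)%R ->
  exists M, sb M (Re a) (- y1) y1 (Gk a) /\
            sb M (Re a) (- y1) y1 (fun z => a * Gk a z - Gk (a + 1) z).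
Proof.
  intros Ha Hy.
  destruct (Gk_sb a y1 Ha ltac:(lra)) as [M1 H1].
  destruct (Gk_sb (a + 1) y1) as [M2 H2]; [change (0 < Re a + 1)%R; lra | lra |].
  assert (S0 : strip (- y1) y1 0) by (unfold strip; cbn; lra).
  pose proof (sb_pos _ _ _ _ _ _ S0 H1) as P1. pose proof (sb_pos _ _ _ _ _ _ S0 H2) as P2.
  assert (H2' : sb M2 (Re a) (- y1) y1 (Gk (a + 1))) by (apply (sb_weaken M2 (Re (a + 1))); [lra | change (Re a <= Re a + 1)%R; lra | exact H2]).
  pose proof (Cmod_ge_0 a) as Pa.
  exists (M1 + Cmod a * M1 + M2)%R. split.
  - apply (sb_weaken M1 (Re a)); [split; nra | lra | exact H1].
  - intros z Hz. eapply Rle_trans; [apply Cmod_triangle' |]. rewrite Cmod_mult.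
    specialize (H1 z Hz). specialize (H2' z Hz). pose proof (exp_pos (- (Re a * Rabs (Re z)))).
    assert (Cmod a * Cmod (Gk a z) <= Cmod a * (M1 * exp (- (Re a * Rabs (Re z)))))%R
      by (apply Rmult_le_compat_l; lra).
    nra.
Qed.

Lemma strip_choice z : (Rabs (Im z) < PI / 2)%R ->
  exists y1, (0 < y1 < PI / 2)%R /\ strip (- y1) y1 z /\ strip (- y1) y1 0.
Proof.
  intros Hz. pose proof (Rabs_pos (Im z)). exists ((Rabs (Im z) + PI / 2) / 2)%R.
  split; [lra |]. split; unfold strip; [| cbn; lra].
  apply Rabs_lt_between. lra.
Qed.

Lemma rapid_Gk_line a z : (0 < Re a)%R -> (Rabs (Im z) < PI / 2)%R -> rapid (fun x : R => Gk a (x + z)).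
Proof.
  intros Ha Hz. destruct (strip_choice z Hz) as [y1 [Hy [S1 S0]]].
  destruct (Gk_contour_data a y1 Ha Hy) as [M [H1 H2]].
  exact (rapid_line M (Re a) (- y1) y1 (Gk a) _ Ha (fun w _ => Cd_Gk a w) H1 z S1).
Qed.

Lemma Gam_rotate a z : (0 < Re a)%R -> (Rabs (Im z) < PI / 2)%R ->
  CI (fun x : R => Gk a (x + z)) = Gam a.
Proof.
  intros Ha Hz. destruct (strip_choice z Hz) as [y1 [Hy [S1 S0]]].
  destruct (Gk_contour_data a y1 Ha Hy) as [M [H1 H2]].
  apply (CI_contour0 M (Re a) (- y1) y1 (Gk a) (fun z => a * Gk a z - Gk (a + 1) z)); auto.
  - intros w _. apply Cd_Gk.
  - intros w _. unfold Gk. ctac.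
Qed.

Lemma rapid_Gk a : (0 < Re a)%R -> rapid (fun x : R => Gk a x).
Proof.
  intros Ha. destruct (rapid_Gk_line a 0 Ha) as [C1 [M [c [Hc H]]]].
  { cbn. rewrite Rabs_R0. pose proof PI_RGT_0. lra. }
  assert (E : forall x : R, x + 0 = x) by (intros; ring).
  split; [intros x; unfold Gk; ctac |]. exists M, c. split; [exact Hc |].
  intros x. specialize (H x). cbv beta in H. rewrite Cplus_0_r in H. exact H.
Qed.

Lemma rapid_ext f g : (forall x, f x = g x) -> rapid f -> rapid g.
Proof.
  intros E [Cf [M [c [Hc H]]]]. split.
  - intros x. apply (continuous_ext (U := C_UniformSpace) f g x E), Cf.
  - exists M, c. split; [exact Hc |]. intros x. rewrite <- E. apply H.
Qed.

Lemma Gam_scaled_ext (a lam : C) x :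
  Cexp (- (a * lam)) * Gk a (RtoC x + lam) = Cexp (a * x - Cexp lam * Cexp x).
Proof.
  unfold Gk. rewrite <- Cexp_plus. f_equal. rewrite Cexp_plus. ring.
Qed.

(** The integral of exp (a x - w e^x) is w^(-a) times the Gamma function of [a];
    writing w = Cexp lam makes the choice of the power explicit, and the substitution
    is a contour shift. *)
Lemma Gam_scaled (a lam : C) : (0 < Re a)%R -> (Rabs (Im lam) < PI / 2)%R ->
  CI (fun x : R => Cexp (a * x - Cexp lam * Cexp x)) = Cexp (- (a * lam)) * Gam a.
Proof.
  intros Ha Hl.
  rewrite (CI_ext _ (fun x : R => Cexp (- (a * lam)) * Gk a (x + lam)))
    by (intros; symmetry; apply Gam_scaled_ext).
  rewrite CI_scal by (apply rapid_Gk_line; auto). rewrite Gam_rotate; auto.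
Qed.

Lemma rapid_Gam_scaled (a lam : C) : (0 < Re a)%R -> (Rabs (Im lam) < PI / 2)%R ->
  rapid (fun x : R => Cexp (a * x - Cexp lam * Cexp x)).
Proof.
  intros Ha Hl. apply (rapid_ext (fun x : R => Cexp (- (a * lam)) * Gk a (x + lam))).
  - intros; apply Gam_scaled_ext.
  - apply rapid_scal, rapid_Gk_line; auto.
Qed.

(** * Euler's integral *)

(** The substitution t = exp x, carried out on segments before passing to the limit.
    *)
Lemma Gamma_integral_Gam (z : C) : (0 < Re z)%R -> Gamma_integral z = Gam z.
Proof.
  intros Hz. unfold Gamma_integral. apply (is_RInt_gen_unique (V := C_R_CompleteNormedModule)).
  intros P [e HP]. destruct (rapid_Gk z Hz) as [Cg [M [c [Hc He]]]].
  assert (Hpos : (0 < e / 2)%R) by (pose proof (cond_pos e); lra).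
  destruct (exp_small c (M / c) (e / 2) Hc Hpos) as [N HN]. pose proof (pos_INR N) as PN.
  apply (Filter_prod _ _ _ (fun a => (0 < a < exp (- INR N))%R) (fun b => (exp (INR N) < b)%R)).
  - exists (mkposreal _ (exp_pos (- INR N))). intros a Ha Ha0.
    unfold ball in Ha; simpl in Ha. unfold AbsRing_ball, abs, minus, plus, opp in Ha; simpl in Ha.
    apply Rabs_lt_between in Ha. lra.
  - exists (exp (INR N)). intros x Hx; exact Hx.
  - intros a b Ha Hb. cbn [fst snd].
    pose proof (exp_pos (INR N)) as E1.
    assert (La : (ln a <= - INR N)%R).
    { rewrite <- (ln_exp (- INR N)). apply Rlt_le, ln_increasing; lra. }
    assert (Lb : (INR N <= ln b)%R).
    { rewrite <- (ln_exp (INR N)). apply Rlt_le, ln_increasing; lra. }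
    assert (Hab : (a < b)%R).
    { assert (exp (- INR N) <= exp (INR N))%R by (apply exp_le; lra). lra. }
    exists (CRI (fun x : R => Gk z x) (ln a) (ln b)). split.
    + pose proof (is_RInt_comp (V := C_R_CompleteNormedModule) (fun x : R => Gk z x) ln (fun y => / y)%R a b) as K.
      eapply is_RInt_ext; [| apply K].
      * intros y Hy. rewrite Rmin_left, Rmax_right in Hy by lra.
        cbv beta. change (@scal R_Ring C_R_ModuleSpace (/ y)%R (Gk z (ln y)) = Rcpow y (z - 1) * exp (- y)).
        rewrite scal_R_Cmult. unfold Rcpow, Gk. rewrite <- !Cexp_R, Cexp_R.
        rewrite exp_ln by lra.
        replace (RtoC (/ y)) with (Cexp (- ln y)).
        2:{ rewrite Cexp_opp, Cexp_R, exp_ln by lra. rewrite RtoC_inv by lra; reflexivity. }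
        rewrite <- !Cexp_plus. f_equal. rewrite RtoC_opp. ring.
      * intros y _. apply Cg.
      * intros y Hy. rewrite Rmin_left, Rmax_right in Hy by lra. split.
        -- auto_derive; [lra | field; lra].
        -- apply (ex_derive_continuous (fun y => / y)%R). auto_derive. lra.
    + apply HP. apply (C_NormedModule_mixin_compat1 (Gam z) _ e).
      change (Cmod (CRI (fun x : R => Gk z x) (ln a) (ln b) - Gam z) < e)%R. rewrite Cmod_minus_sym.
      pose proof (HN (- ln a)%R ltac:(lra)) as A. pose proof (HN (ln b) ltac:(lra)) as B.
      replace (- (c * - ln a))%R with (c * ln a)%R in A by ring.
      pose proof (CI_tail M c (fun x : R => Gk z x) Cg Hc He (ln a) (ln b) ltac:(lra)) as T.
      unfold Gam. lra.
Qed.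

Lemma CGamma_Gam (z : C) : (0 < Re z < 1)%R -> CGamma z = Gam z.
Proof.
  intros Hz. unfold CGamma.
  replace (up (- Re z)) with 0%Z by (apply tech_up; simpl; lra).
  cbn [Z.to_nat rising INR]. rewrite Cplus_0_r, Gamma_integral_Gam by lra. field.
Qed.

(** * Products of integrals *)

Lemma joint2_comp f (g : R -> R -> R) : contR f ->
  (forall p, continuous (T := prod_UniformSpace R_UniformSpace R_UniformSpace) (U := R_UniformSpace)
     (fun p => g (fst p) (snd p)) p) -> joint2 (fun x y => f (g x y)).
Proof.
  intros Hf Hg x y.
  apply (contC_comp (U := prod_UniformSpace R_UniformSpace R_UniformSpace) (V := R_UniformSpace)
    (fun p => g (fst p) (snd p)) f); [apply Hg | apply Hf].
Qed.

Lemma joint2_mult F G : joint2 F -> joint2 G -> joint2 (fun x y => F x y * G x y).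
Proof. intros HF HG x y. apply contC_mult; [apply HF | apply HG]. Qed.

(** The coordinates m and w are half the sum and half the difference of the two
    variables; 2 is the Jacobian. *)
Lemma CI_prod_conv (a b : R -> C) : rapid a -> rapid b ->
  CI a * CI b = 2 * CI (fun w => CI (fun m => a (m - w)%R * b (m + w)%R)).
Proof.
  intros Ga Gb. destruct (rapid_common a b Ga Gb) as [M [c [Hc [Ha Hb]]]].
  pose proof (eb_M_pos _ _ _ Ha) as HM.
  assert (Gs : forall x, rapid (fun w => b (x + 2 * w)%R)).
  { intros x. apply (rapid_ext (fun w => b (2 * w + x)%R)); [intros; f_equal; ring |].
    apply (rapid_lin (fun y => b (y + x)%R) 2); [lra | apply rapid_shift, Gb]. }
  assert (G2 : rapid2 (fun x w => a x * b (x + 2 * w)%R)).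
  { split.
    - apply joint2_mult.
      + apply (joint2_comp a (fun x _ => x)); [apply Ga |]. intros p. apply (cont_fst (U := R_UniformSpace)).
      + apply (joint2_comp b (fun x w => x + 2 * w)%R); [apply Gb |]. intros p. ctac.
    - exists (M * M)%R, (c / 2)%R. split; [lra |]. intros x w. rewrite Cmod_mult.
      eapply Rle_trans; [apply Rmult_le_compat; [apply Cmod_ge_0 | apply Cmod_ge_0 | apply Ha | apply Hb] |].
      replace (M * exp (- (c * Rabs x)) * (M * exp (- (c * Rabs (x + 2 * w)))))%R
        with (M * M * (exp (- (c * Rabs x)) * exp (- (c * Rabs (x + 2 * w)))))%R by ring.
      rewrite (Rmult_assoc (M * M) (exp (- (c / 2 * Rabs x)))). apply Rmult_le_compat_l; [nra |]. rewrite <- !exp_plus. apply exp_le.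
      pose proof (Rabs_triang (x + 2 * w) (- x)) as T. rewrite Rabs_Ropp in T.
      replace (x + 2 * w + - x)%R with (2 * w)%R in T by ring.
      rewrite Rabs_mult, (Rabs_pos_eq 2) in T by lra. pose proof (Rabs_pos x). pose proof (Rabs_pos w).
      pose proof (Rabs_pos (x + 2 * w)). nra. }
  assert (E1 : forall x, CI (fun w => a x * b (x + 2 * w)%R) = a x * (/ 2 * CI b)).
  { intros x. rewrite (CI_scal (a x)) by apply Gs. f_equal.
    rewrite (CI_ext _ (fun w => b (2 * w + x)%R)) by (intros; f_equal; ring).
    rewrite <- (CI_shift b x Gb), <- (CI_lin (fun y => b (y + x)%R) 2 ltac:(lra) (rapid_shift b x Gb)).
    field. }
  pose proof (CI_Fubini _ G2) as F. cbv beta in F. rewrite (CI_ext _ _ E1) in F.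
  rewrite (CI_ext _ (fun x => (/ 2 * CI b) * a x)) in F by (intros; ring).
  rewrite CI_scal in F by exact Ga.
  rewrite (CI_ext (fun w => CI (fun m => a (m - w)%R * b (m + w)%R)) (fun w => CI (fun x => a x * b (x + 2 * w)%R))).
  - rewrite <- F. field.
  - intros w. pose proof (rapid2_slice _ w (rapid2_swap _ G2)) as Gw. cbv beta in Gw.
    rewrite <- (CI_shift _ (- w)%R Gw). apply CI_ext. intros m. f_equal; f_equal; ring.
Qed.

(** * Exponential integrals and the reflection formula *)

Lemma rapid_exp_lin (k : C) : (0 < Re k)%R -> rapid (fun m : R => Cexp (m - k * exp m)).
Proof.
  intros Hk. split; [ctac |]. eexists _, 1%R. split; [lra |].
  intros m. rewrite <- (exp_ln (exp _)) by apply exp_pos.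
  eapply Rle_trans; [apply Cmod_le_exp, Rle_refl |]. rewrite ln_exp, <- exp_plus. apply exp_le.
  replace (Re (m - k * exp m)) with (1 * m - Re k * exp m)%R by (destruct k; cbn; ring).
  pose proof (expo_bound 1 1 1 (Re k) (Re k) m ltac:(lra) ltac:(lra) ltac:(lra)) as H.
  eapply Rle_trans; [exact H |]. rewrite Rmult_1_l. unfold Rminus. apply Rle_refl.
Qed.

Lemma Cd_neq (k : C) : (0 < Re k)%R -> k <> 0.
Proof. intros H E. rewrite E in H. cbn in H. lra. Qed.

Lemma Cmod_Cexp_m1_neg (h : C) : (Re h <= 0)%R -> (Cmod (Cexp h - 1) <= Cmod h)%R.
Proof.
  intros H. eapply Rle_trans; [apply Cmod_Cexp_m1 |]. rewrite Rmax_left by exact H.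
  rewrite exp_0. lra.
Qed.

Lemma CI_exp_lin (k : C) : (0 < Re k)%R -> CI (fun m : R => Cexp (m - k * exp m)) = / k.
Proof.
  intros Hk. destruct (rapid_exp_lin k Hk) as [Cg [M [c [Hc He]]]].
  pose proof (Cd_neq k Hk) as Nk. assert (Pk : (0 < Cmod k)%R) by (apply Cmod_gt_0, Nk).
  apply (CI_unique M c); auto. intros e Hpos.
  destruct (exp_small 1 1 (e / 2) ltac:(lra) ltac:(lra)) as [N1 H1].
  destruct (exp_small (Re k) (/ Cmod k) (e / 2) Hk ltac:(lra)) as [N2 H2].
  exists (max N1 N2). intros n Hn.
  specialize (H1 (INR n) (le_INR N1 n ltac:(lia))). specialize (H2 (INR n) (le_INR N2 n ltac:(lia))).
  rewrite (CRI_derive (fun x : R => - / k * Cexp (- k * Cexp x)) (fun m : R => Cexp (m - k * exp m))); [| | exact Cg].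
  2:{ intros x. apply (Cd_Rd' (fun z => - / k * Cexp (- k * Cexp z))). Cd_solve.
      rewrite !Cexp_R. replace (x - k * exp x) with (- k * exp x + x) by ring. rewrite Cexp_plus, Cexp_R.
      field. exact Nk. }
  rewrite !Cexp_R. set (p := exp (INR n)). set (q := exp (- INR n)).
  replace (- / k * Cexp (- k * p) - - / k * Cexp (- k * q) - / k)
    with (/ k * ((Cexp (- k * q) - 1) - Cexp (- k * p))) by ring.
  rewrite Cmod_mult, Cmod_inv by exact Nk.
  assert (A : (Cmod (Cexp (- k * q) - 1) <= Cmod k * q)%R).
  { assert (Hq : (0 < q)%R) by apply exp_pos. eapply Rle_trans; [apply Cmod_Cexp_m1_neg |].
    - rewrite re_scal_r, re_opp. nra.
    - rewrite Cmod_mult, Cmod_opp, Cmod_R, Rabs_pos_eq by lra. lra. }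
  assert (B : (Cmod (Cexp (- k * p)) <= exp (- (Re k * INR n)))%R).
  { apply Cmod_le_exp. rewrite re_scal_r, re_opp.
    assert (INR n <= p)%R. { unfold p. pose proof (exp_ineq1_le (INR n)). lra. } nra. }
  assert (Hip : (0 < / Cmod k)%R) by (apply Rinv_0_lt_compat, Pk).
  eapply Rle_lt_trans; [apply Rmult_le_compat_l; [lra | apply Cmod_triangle'] |].
  rewrite Rmult_plus_distr_l.
  assert (A' : (/ Cmod k * Cmod (Cexp (- k * q) - 1) <= q)%R).
  { apply (Rmult_le_reg_l (Cmod k)); [exact Pk |].
    rewrite <- Rmult_assoc, Rinv_r by lra. lra. }
  assert (B' : (/ Cmod k * Cmod (Cexp (- k * p)) <= / Cmod k * exp (- (Re k * INR n)))%R)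
    by (apply Rmult_le_compat_l; lra).
  rewrite Rmult_1_l in H1. replace (- (1 * INR n))%R with (- INR n)%R in H1 by ring. fold q in H1. lra.
Qed.

(** The complex number 2 cosh (w - i psi). *)
Definition ch (w psi : R) : C := Cexp (- w + Ci * psi) + Cexp (w - Ci * psi).

Lemma Re_ch w psi : Re (ch w psi) = ((exp (- w) + exp w) * cos psi)%R.
Proof.
  unfold ch. rewrite re_plus, !Re_Cexp. cbn.
  replace (- w + (0 * psi - 1 * 0))%R with (- w)%R by ring.
  replace (- 0 + (0 * 0 + 1 * psi))%R with psi by ring.
  replace (w + - (0 * psi - 1 * 0))%R with w by ring.
  replace (0 + - (0 * 0 + 1 * psi))%R with (- psi)%R by ring.
  rewrite cos_neg. ring.
Qed.

Lemma Re_ch_pos w psi : (Rabs psi < PI / 2)%R -> (0 < Re (ch w psi))%R.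
Proof.
  intros H. rewrite Re_ch. apply Rabs_lt_between in H.
  pose proof (exp_pos w). pose proof (exp_pos (- w)). pose proof (cos_gt_0 psi ltac:(lra) ltac:(lra)). nra.
Qed.

(** Rotate the two Gamma integrals by the opposite angles -psi and psi, multiply them
    by [CI_prod_conv] and integrate m out: the rates of the two factors add up to [ch
    w psi]. *)
Lemma Gam_pair (u : C) (psi : R) : (Rabs (Re u) < 1)%R -> (Rabs psi < PI / 2)%R ->
  Cexp (Ci * psi * u) * (Gam (/ 2 - / 2 * u) * Gam (/ 2 + / 2 * u))
    = 2 * CI (fun w : R => Cexp (u * w) * / ch w psi).
Proof.
  intros Hu Hp. apply Rabs_lt_between in Hu.
  assert (Ha : (0 < Re (/ 2 - / 2 * u))%R).
  { replace (Re (/ 2 - / 2 * u)) with (1 / 2 - 1 / 2 * Re u)%R; [lra |]. destruct u; cbn; field. }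
  assert (Hb : (0 < Re (/ 2 + / 2 * u))%R).
  { replace (Re (/ 2 + / 2 * u)) with (1 / 2 + 1 / 2 * Re u)%R; [lra |]. destruct u; cbn; field. }
  assert (Hl : (Rabs (Im (Ci * psi)) < PI / 2)%R) by (cbn; replace (0 * 0 + 1 * psi)%R with psi by ring; exact Hp).
  assert (Hl' : (Rabs (Im (- (Ci * psi))) < PI / 2)%R)
    by (cbn; replace (- (0 * 0 + 1 * psi))%R with (- psi)%R by ring; rewrite Rabs_Ropp; exact Hp).
  pose proof (rapid_Gam_scaled _ _ Ha Hl) as Ga. pose proof (rapid_Gam_scaled _ _ Hb Hl') as Gb.
  pose proof (Gam_scaled _ _ Ha Hl) as Ea. pose proof (Gam_scaled _ _ Hb Hl') as Eb.
  pose proof (CI_prod_conv _ _ Ga Gb) as E. rewrite Ea, Eb in E.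
  replace (Cexp (Ci * psi * u) * (Gam (/ 2 - / 2 * u) * Gam (/ 2 + / 2 * u)))
    with (Cexp (- ((/ 2 - / 2 * u) * (Ci * psi))) * Gam (/ 2 - / 2 * u) *
      (Cexp (- ((/ 2 + / 2 * u) * - (Ci * psi))) * Gam (/ 2 + / 2 * u))).
  2:{ replace (Ci * psi * u) with (- ((/ 2 - / 2 * u) * (Ci * psi)) + - ((/ 2 + / 2 * u) * - (Ci * psi))) by field.
      rewrite Cexp_plus. ring. }
  rewrite E. f_equal. apply CI_ext. intros w.
  rewrite <- (CI_exp_lin (ch w psi)) by (apply Re_ch_pos, Hp).
  rewrite <- CI_scal by (apply rapid_exp_lin, Re_ch_pos, Hp).
  apply CI_ext. intros m. rewrite <- !Cexp_plus. f_equal. unfold ch.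
  rewrite <- (Cexp_R m), RtoC_minus, RtoC_plus, !Cexp_plus.
  replace (RtoC m - w) with (m + - w) by ring. rewrite !Cexp_plus.
  replace (w - Ci * psi) with (w + - (Ci * psi)) by ring. rewrite !Cexp_plus. field.
Qed.

Lemma rapid_pair (u : C) (psi : R) : (Rabs (Re u) < 1)%R -> (Rabs psi < PI / 2)%R ->
  rapid (fun w : R => Cexp (u * w) * / ch w psi).
Proof.
  intros Hu Hp. apply Rabs_lt_between in Hu.
  assert (Hc : (0 < cos psi)%R) by (apply Rabs_lt_between in Hp; apply cos_gt_0; lra).
  split.
  - intros w. apply contC_mult; [ctac |].
    apply (contC_comp (U := R_UniformSpace) (V := C_UniformSpace) (fun w => ch w psi) Cinv).
    + change (@contC R_UniformSpace (fun w => ch w psi) w). unfold ch. ctac.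
    + pose proof (Re_ch_pos w psi Hp) as Hr. set (z := ch w psi) in *.
      (* the inverse as a quotient of real-analytic components *)
      apply contC_pair.
      * change (continuous (T := C_UniformSpace) (fun z : C => Re z / (Re z ^ 2 + Im z ^ 2))%R z).
        apply (continuous_mult (K := R_AbsRing)); [apply contC_Re_id |].
        apply (contR_derivable (U := C_UniformSpace) Rinv (fun z : C => Re z ^ 2 + Im z ^ 2)%R).
        -- apply (continuous_plus (V := R_NormedModule)).
           ++ apply (contR_derivable (U := C_UniformSpace) (fun t => t ^ 2)%R); [apply contC_Re_id | auto_derive; auto].
           ++ apply (contR_derivable (U := C_UniformSpace) (fun t => t ^ 2)%R);
                [apply (contC_Im (U := C_UniformSpace) (fun z => z)), continuous_id | auto_derive; auto].
        -- auto_derive. nra.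
      * change (continuous (T := C_UniformSpace) (fun z : C => - Im z / (Re z ^ 2 + Im z ^ 2))%R z).
        apply (continuous_mult (K := R_AbsRing)).
        { apply (continuous_opp (V := R_NormedModule)), (contC_Im (U := C_UniformSpace) (fun z => z)), continuous_id. }
        apply (contR_derivable (U := C_UniformSpace) Rinv (fun z : C => Re z ^ 2 + Im z ^ 2)%R).
        -- apply (continuous_plus (V := R_NormedModule)).
           ++ apply (contR_derivable (U := C_UniformSpace) (fun t => t ^ 2)%R); [apply contC_Re_id | auto_derive; auto].
           ++ apply (contR_derivable (U := C_UniformSpace) (fun t => t ^ 2)%R);
                [apply (contC_Im (U := C_UniformSpace) (fun z => z)), continuous_id | auto_derive; auto].
        -- auto_derive. nra.
  - exists (/ cos psi)%R, (1 - Rabs (Re u))%R. split; [unfold Rabs; destruct (Rcase_abs (Re u)); lra |].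
    intros w. pose proof (Re_ch_pos w psi Hp) as Hr.
    rewrite Cmod_mult, Cmod_inv by (apply Cd_neq, Hr). rewrite Cmod_Cexp.
    replace (Re (u * w)) with (Re u * w)%R by (destruct u; cbn; ring).
    assert (H1 : (exp (Rabs w) * cos psi <= Cmod (ch w psi))%R).
    { eapply Rle_trans; [| apply Re_le_Cmod]. rewrite Re_ch. apply Rmult_le_compat_r; [lra |].
      pose proof (exp_pos w). pose proof (exp_pos (- w)). unfold Rabs. destruct (Rcase_abs w); lra. }
    pose proof (exp_pos (Rabs w)) as Pw.
    apply Rle_trans with (exp (Rabs (Re u) * Rabs w) * / (exp (Rabs w) * cos psi))%R.
    + apply Rmult_le_compat; [apply Rlt_le, exp_pos | | |].
      * apply Rlt_le, Rinv_0_lt_compat. eapply Rlt_le_trans; [| exact H1]. nra.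
      * apply exp_le. rewrite <- Rabs_mult. apply Rle_abs.
      * apply Rinv_le_contravar; [nra | exact H1].
    + right. replace (- ((1 - Rabs (Re u)) * Rabs w))%R with (Rabs (Re u) * Rabs w + - Rabs w)%R by ring.
      rewrite exp_plus, exp_Ropp. field. split; lra.
Qed.

(** This product is unchanged under u -> -u, and at u = 4 s it is the product of the
    Gamma factors of the two parabolic cylinder functions. *)
Definition gpair (u : C) : C := Gam (/ 2 - / 2 * u) * Gam (/ 2 + / 2 * u).

Lemma gpair_opp u : gpair (- u) = gpair u.
Proof.
  unfold gpair. replace (/ 2 - / 2 * - u) with (/ 2 + / 2 * u) by ring.
  replace (/ 2 + / 2 * - u) with (/ 2 - / 2 * u) by ring. ring.
Qed.

Lemma ch_0 w : ch w 0 = RtoC (exp (- w) + exp w).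
Proof.
  unfold ch. replace (- w + Ci * 0%R) with (RtoC (- w)) by (rewrite RtoC_opp; ring).
  replace (w - Ci * 0%R) with (RtoC w) by ring. rewrite !Cexp_R, RtoC_plus. reflexivity.
Qed.

Lemma atan_le (x : R) : (0 <= x -> 0 <= atan x <= x)%R.
Proof.
  intros Hx. split.
  - destruct (Req_dec x 0) as [-> | N]; [rewrite atan_0; lra |].
    left. rewrite <- atan_0. apply atan_increasing. lra.
  - destruct (MVT_gen atan 0 x (fun t => / (1 + t ^ 2))%R) as [u [Hu E]].
    + intros y _. apply is_derive_Reals. apply derivable_pt_lim_atan.
    + intros y _. apply derivable_continuous_pt, derivable_pt_atan.
    + rewrite atan_0 in E.
      assert (/ (1 + u ^ 2) <= 1)%R.
      { rewrite <- Rinv_1. apply Rinv_le_contravar; [lra | nra]. } nra.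
Qed.

(** The integrand 1 / (2 cosh w) is the derivative of atan (e^w). *)
Lemma gpair_0 : gpair 0 = PI.
Proof.
  pose proof (Gam_pair 0 0) as H.
  replace (Cexp (Ci * 0%R * 0)) with (RtoC 1) in H by (rewrite Cmult_0_r, Cexp_0; reflexivity).
  rewrite Cmult_1_l in H. fold (gpair 0) in H. rewrite H; clear H;
    [| cbn; rewrite Rabs_R0; lra | rewrite Rabs_R0; pose proof PI_RGT_0; lra].
  pose proof (rapid_pair 0 0) as G.
  destruct G as [Cg [M [c [Hc He]]]]; [cbn; rewrite Rabs_R0; lra | rewrite Rabs_R0; pose proof PI_RGT_0; lra |].
  assert (Cx : contR (fun w : R => Cexp (0 * w) * / ch w 0)) by exact Cg.
  rewrite (CI_unique M c _ Cg Hc He (/ 2 * PI)); [field |].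
  intros e Hpos. destruct (exp_small 1 2 e ltac:(lra) Hpos) as [N HN].
  exists N. intros n Hn. specialize (HN (INR n) (le_INR _ _ Hn)).
  rewrite (CRI_derive (fun x : R => RtoC (atan (exp x))) _ _ _); [| | exact Cg].
  - assert (E : (atan (exp (INR n)) = PI / 2 - atan (exp (- INR n)))%R).
    { rewrite <- atan_inv by apply exp_pos. rewrite <- exp_Ropp. f_equal. f_equal. ring. }
    rewrite E. pose proof (atan_le (exp (- INR n)) ltac:(left; apply exp_pos)) as B.
    replace (RtoC (PI / 2 - atan (exp (- INR n))) - RtoC (atan (exp (- INR n))) - / 2 * PI)
      with (RtoC (- (2 * atan (exp (- INR n))))).
    + rewrite Cmod_R, Rabs_Ropp, Rabs_pos_eq by lra.
      replace (- (1 * INR n))%R with (- INR n)%R in HN by ring. lra.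
    + apply C_eq; cbn; field.
  - intros x. rewrite ch_0, Cmult_0_l, Cexp_0, Cmult_1_l.
    pose proof (exp_pos x). pose proof (exp_pos (- x)).
    rewrite <- RtoC_inv by lra.
    apply Rd_pair; cbn [Re Im fst snd RtoC].
    + auto_derive; [auto |]. rewrite exp_Ropp. field. split; nra.
    + auto_derive; auto.
Qed.

Lemma ch_conj w psi : ch w (- psi) = Cconj (ch w psi).
Proof.
  unfold ch. rewrite Cplus_conj.
  assert (E : forall z, Cconj (Cexp z) = Cexp (Cconj z)).
  { intros [a b]. apply C_eq; cbn; rewrite ?cos_neg, ?sin_neg; ring. }
  rewrite !E. f_equal; f_equal; apply C_eq; cbn; ring.
Qed.

Lemma ch_normsq w psi : (Cmod (ch w psi) ^ 2 = (exp w - exp (- w)) ^ 2 + 4 * cos psi ^ 2)%R.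
Proof.
  rewrite Cmod2_alt, Re_ch.
  replace (Im (ch w psi)) with ((exp (- w) - exp w) * sin psi)%R.
  - pose proof (sin2_cos2 psi) as S. unfold Rsqr in S.
    assert (E : (exp w * exp (- w) = 1)%R) by (rewrite <- exp_plus, Rplus_opp_r; apply exp_0).
    set (a := exp w) in *. set (b := exp (- w)) in *. set (s := sin psi) in *. set (k := cos psi) in *.
    replace (((b + a) * k) ^ 2 + ((b - a) * s) ^ 2)%R
      with ((b - a) ^ 2 * (s * s + k * k) + 4 * (a * b) * k ^ 2)%R by ring.
    rewrite S, E. ring.
  - unfold ch. rewrite im_plus, !Im_Cexp. cbn.
    replace (- w + (0 * psi - 1 * 0))%R with (- w)%R by ring.
    replace (- 0 + (0 * 0 + 1 * psi))%R with psi by ring.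
    replace (w + - (0 * psi - 1 * 0))%R with w by ring.
    replace (0 + - (0 * 0 + 1 * psi))%R with (- psi)%R by ring.
    rewrite sin_neg. ring.
Qed.

Lemma Cexp_second_difference (h : C) :
  (Cmod (Cexp h + Cexp (- h) - 2) <= Cmod h ^ 2 * exp (Rabs (Re h)))%R.
Proof.
  set (k := / 2 * h).
  assert (Ek : h = k + k) by (unfold k; field).
  assert (E : Cexp h + Cexp (- h) - 2 = (Cexp k - Cexp (- k)) * (Cexp k - Cexp (- k))).
  { rewrite Ek. replace (- (k + k)) with (- k + - k) by ring. rewrite !Cexp_plus.
    assert (P : Cexp k * Cexp (- k) = 1) by (rewrite <- Cexp_plus, Cplus_opp_r; apply Cexp_0).
    replace ((Cexp k - Cexp (- k)) * (Cexp k - Cexp (- k)))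
      with (Cexp k * Cexp k + Cexp (- k) * Cexp (- k) - 2 * (Cexp k * Cexp (- k))) by ring.
    rewrite P. ring. }
  rewrite E, Cmod_mult.
  assert (B : (Cmod (Cexp k - Cexp (- k)) <= Cmod h * exp (Rabs (Re k)))%R).
  { replace (Cexp k - Cexp (- k)) with (Cexp (- k) * (Cexp h - 1)).
    - rewrite Cmod_mult, Cmod_Cexp, re_opp.
      replace (Cmod h * exp (Rabs (Re k)))%R with (exp (- Re k) * (Cmod h * exp (Rabs (Re k) + Re k)))%R.
      + apply Rmult_le_compat_l; [apply Rlt_le, exp_pos |].
        eapply Rle_trans; [apply Cmod_Cexp_m1 |]. apply Rmult_le_compat_l; [apply Cmod_ge_0 |].
        apply exp_le. rewrite Ek, re_plus. apply Rmax_lub; unfold Rabs; destruct (Rcase_abs (Re k)); lra.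
      + rewrite exp_plus, exp_Ropp. field. pose proof (exp_pos (Re k)). lra.
    - rewrite Ek, Cexp_plus.
      replace (Cexp (- k) * (Cexp k * Cexp k - 1)) with ((Cexp (- k) * Cexp k) * Cexp k - Cexp (- k)) by ring.
      rewrite <- Cexp_plus. replace (- k + k) with (RtoC 0) by ring. rewrite Cexp_0. ring. }
  replace (Cmod h ^ 2 * exp (Rabs (Re h)))%R with ((Cmod h * exp (Rabs (Re k))) * (Cmod h * exp (Rabs (Re k))))%R.
  - apply Rmult_le_compat; auto using Cmod_ge_0.
  - replace (Re h) with (2 * Re k)%R by (rewrite Ek, re_plus; ring).
    rewrite Rabs_mult, (Rabs_pos_eq 2) by lra.
    replace (2 * Rabs (Re k))%R with (Rabs (Re k) + Rabs (Re k))%R by ring. rewrite exp_plus. ring.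
Qed.

Lemma exp_absorb (d x : R) : (0 < d <= 2)%R -> (0 <= x)%R -> ((1 + x) ^ 2 <= 4 / (d * d) * exp (d * x))%R.
Proof.
  intros Hd Hx.
  assert (H1 : (d / 2 * (1 + x) <= exp (d / 2 * x))%R).
  { pose proof (exp_ineq1_le (d / 2 * x)). nra. }
  replace (exp (d * x)) with (exp (d / 2 * x) * exp (d / 2 * x))%R
    by (rewrite <- exp_plus; f_equal; field).
  assert (H2 : ((d / 2 * (1 + x)) * (d / 2 * (1 + x)) <= exp (d / 2 * x) * exp (d / 2 * x))%R)
    by (apply Rmult_le_compat; nra).
  replace ((1 + x) ^ 2)%R with (4 / (d * d) * ((d / 2 * (1 + x)) * (d / 2 * (1 + x))))%R by (field; lra).
  apply Rmult_le_compat_l; [| exact H2]. apply Rdiv_le_0_compat; nra.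
Qed.

Lemma sinh_lower (x : R) : (0 <= x)%R -> (x * exp x <= (1 + x) * (exp x - exp (- x)))%R.
Proof.
  intros Hx. assert (H : (1 + 2 * x <= exp x * exp x)%R).
  { rewrite <- exp_plus. pose proof (exp_ineq1_le (x + x)). lra. }
  pose proof (exp_pos x). rewrite exp_Ropp.
  apply (Rmult_le_reg_r (exp x)); [lra |].
  replace ((1 + x) * (exp x - / exp x) * exp x)%R with ((1 + x) * (exp x * exp x - 1))%R by (field; lra).
  nra.
Qed.

Section Reflection.
Variable u : C.
Hypothesis Hu : (Rabs (Re u) < 1)%R.

Let N (w : R) : C := Cexp (u * w) + Cexp (- u * w) - 2.
Let K (psi w : R) : C := / ch w psi + / ch w (- psi).

(** [N] vanishes to second order at w = 0, which is where the denominator of [K]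
    degenerates as psi tends to PI / 2; elsewhere [K] is of the order of cos psi. *)
Lemma reflection_kernel psi w : (0 < psi < PI / 2)%R ->
  (Cmod (N w * K psi w) <= Cmod u ^ 2 * 64 / (1 - Rabs (Re u)) ^ 2 * cos psi
     * exp (- ((1 - Rabs (Re u)) / 2 * Rabs w)))%R.
Proof.
  intros Hp. pose proof (Rabs_pos (Re u)) as Hr0. set (r := Rabs (Re u)) in *.
  assert (Hc : (0 < cos psi)%R) by (apply cos_gt_0; lra).
  assert (Hpa : (Rabs psi < PI / 2)%R) by (rewrite Rabs_pos_eq; lra).
  pose proof (Re_ch_pos w psi Hpa) as Hre. pose proof (Cd_neq _ Hre) as Hn.
  assert (Hn2 : Cconj (ch w psi) <> 0).
  { apply Cd_neq. rewrite re_conj. exact Hre. }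
  set (x := Rabs w). assert (Hx : (0 <= x)%R) by apply Rabs_pos.
  assert (EK : (Cmod (K psi w) * Cmod (ch w psi) ^ 2 = 2 * (exp x + exp (- x)) * cos psi)%R).
  { unfold K. rewrite ch_conj.
    replace (/ ch w psi + / Cconj (ch w psi)) with ((ch w psi + Cconj (ch w psi)) * / (ch w psi * Cconj (ch w psi)))
      by (field; auto).
    replace (ch w psi + Cconj (ch w psi)) with (RtoC (2 * Re (ch w psi)))
      by (destruct (ch w psi); apply C_eq; cbn; ring).
    rewrite Cmod_mult, Cmod_inv, Cmod_mult, Cmod_conj by (apply Cmult_neq_0; auto).
    rewrite Cmod_R, Re_ch.
    assert (Ex : (exp (- w) + exp w = exp x + exp (- x))%R).
    { unfold x, Rabs. destruct (Rcase_abs w); [rewrite Ropp_involutive |]; ring. }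
    rewrite Ex. pose proof (exp_pos x). pose proof (exp_pos (- x)).
    rewrite Rabs_pos_eq by (repeat apply Rmult_le_pos; lra).
    assert (0 < Cmod (ch w psi))%R by (apply Cmod_gt_0, Hn). field. lra. }
  assert (EN : (Cmod (N w) <= Cmod u ^ 2 * x ^ 2 * exp (r * x))%R).
  { unfold N. replace (- u * w) with (- (u * w)) by ring.
    eapply Rle_trans; [apply Cexp_second_difference |]. right.
    rewrite Cmod_mult, Cmod_R. fold x. replace (Re (u * w)) with (Re u * w)%R by (destruct u; cbn; ring).
    rewrite Rabs_mult. fold r x. ring. }
  pose proof (sinh_lower x Hx) as Hs. pose proof (exp_pos x) as Ep. pose proof (exp_pos (- x)) as Eq.
  assert (Eqp : (exp (- x) <= exp x)%R) by (apply exp_le; lra).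
  assert (Hch : (x ^ 2 * exp x ^ 2 <= (1 + x) ^ 2 * Cmod (ch w psi) ^ 2)%R).
  { rewrite ch_normsq.
    assert (Ex : ((exp w - exp (- w)) ^ 2 = (exp x - exp (- x)) ^ 2)%R).
    { unfold x, Rabs. destruct (Rcase_abs w); [rewrite Ropp_involutive |]; ring. }
    rewrite Ex.
    assert (((x * exp x) * (x * exp x) <= ((1 + x) * (exp x - exp (- x))) * ((1 + x) * (exp x - exp (- x))))%R)
      by (apply Rmult_le_compat; nra).
    pose proof (pow2_ge_0 ((1 + x) * cos psi)). nra. }
  assert (HK : (x ^ 2 * Cmod (K psi w) <= 4 * (1 + x) ^ 2 * cos psi * exp (- x))%R).
  { assert (Hm : (0 < Cmod (ch w psi) ^ 2)%R).
    { assert (0 < Cmod (ch w psi))%R by (apply Cmod_gt_0, Hn). nra. }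
    apply (Rmult_le_reg_r (exp x ^ 2)); [nra |].
    replace (x ^ 2 * Cmod (K psi w) * exp x ^ 2)%R with (x ^ 2 * exp x ^ 2 * Cmod (K psi w))%R by ring.
    eapply Rle_trans; [apply Rmult_le_compat_r; [apply Cmod_ge_0 | exact Hch] |].
    replace ((1 + x) ^ 2 * Cmod (ch w psi) ^ 2 * Cmod (K psi w))%R
      with ((1 + x) ^ 2 * (Cmod (K psi w) * Cmod (ch w psi) ^ 2))%R by ring.
    rewrite EK.
    replace (4 * (1 + x) ^ 2 * cos psi * exp (- x) * exp x ^ 2)%R
      with ((1 + x) ^ 2 * (4 * exp x * cos psi))%R by (rewrite exp_Ropp; field; lra).
    apply Rmult_le_compat_l; [apply pow2_ge_0 |]. nra. }
  rewrite Cmod_mult.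
  eapply Rle_trans; [apply Rmult_le_compat_r; [apply Cmod_ge_0 | exact EN] |].
  replace (Cmod u ^ 2 * x ^ 2 * exp (r * x) * Cmod (K psi w))%R
    with (Cmod u ^ 2 * exp (r * x) * (x ^ 2 * Cmod (K psi w)))%R by ring.
  pose proof (exp_pos (r * x)) as Er. pose proof (pow2_ge_0 (Cmod u)) as Pu.
  eapply Rle_trans; [apply Rmult_le_compat_l; [nra | exact HK] |].
  pose proof (exp_absorb ((1 - r) / 2) x ltac:(lra) Hx) as Ha.
  eapply Rle_trans; [apply Rmult_le_compat_l; [nra |]; apply Rmult_le_compat_r; [lra |];
    apply Rmult_le_compat_r; [lra |]; apply Rmult_le_compat_l; [lra | exact Ha] |].
  right. replace (- ((1 - r) / 2 * x))%R with (r * x + (1 - r) / 2 * x + - x)%R by field.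
  rewrite !exp_plus. field. lra.
Qed.

(** [Gam_pair] for the parameters u, -u and 0 and for both signs of psi; the parameter
    0 contributes the value [gpair 0 = PI]. *)
Lemma rapid_refl psi : (0 < psi < PI / 2)%R ->
  2 * (Cexp (Ci * psi * u) + Cexp (- (Ci * psi * u))) * gpair u - 4 * PI
   = 2 * CI (fun w : R => N w * K psi w) /\ contR (fun w : R => N w * K psi w).
Proof.
  intros Hp.
  assert (A1 : (Rabs psi < PI / 2)%R) by (rewrite Rabs_pos_eq; lra).
  assert (A2 : (Rabs (- psi) < PI / 2)%R) by (rewrite Rabs_Ropp; exact A1).
  assert (U0 : (Rabs (Re 0) < 1)%R) by (cbn; rewrite Rabs_R0; lra).
  assert (U1 : (Rabs (Re (- u)) < 1)%R) by (rewrite re_opp, Rabs_Ropp; exact Hu).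
  pose proof (rapid_pair u psi Hu A1) as G1. pose proof (rapid_pair u (- psi) Hu A2) as G2.
  pose proof (rapid_pair (- u) psi U1 A1) as G3. pose proof (rapid_pair (- u) (- psi) U1 A2) as G4.
  pose proof (rapid_pair 0 psi U0 A1) as G5. pose proof (rapid_pair 0 (- psi) U0 A2) as G6.
  pose proof (Gam_pair u psi Hu A1) as E1. pose proof (Gam_pair u (- psi) Hu A2) as E2.
  pose proof (Gam_pair (- u) psi U1 A1) as E3. pose proof (Gam_pair (- u) (- psi) U1 A2) as E4.
  pose proof (Gam_pair 0 psi U0 A1) as E5. pose proof (Gam_pair 0 (- psi) U0 A2) as E6.
  fold (gpair u) in E1, E2. fold (gpair (- u)) in E3, E4. fold (gpair 0) in E5, E6.
  rewrite gpair_opp in E3, E4. rewrite gpair_0, Cmult_0_r, Cexp_0, Cmult_1_l in E5, E6.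
  assert (Efun : forall w : R,
    (Cexp (u * w) * / ch w psi + Cexp (u * w) * / ch w (- psi)) +
    (Cexp (- u * w) * / ch w psi + Cexp (- u * w) * / ch w (- psi)) -
    2 * (Cexp (0 * w) * / ch w psi + Cexp (0 * w) * / ch w (- psi)) = N w * K psi w).
  { intros w. unfold N, K. rewrite Cmult_0_l, Cexp_0. ring. }
  split.
  - rewrite <- (CI_ext _ _ Efun).
    rewrite CI_minus, CI_plus, CI_plus, CI_plus, CI_scal, CI_plus; auto 10 using rapid_plus, rapid_scal.
    rewrite RtoC_opp in E2, E4.
    replace (Cexp (Ci * psi * u) + Cexp (- (Ci * psi * u))) with (Cexp (Ci * psi * u) + Cexp (Ci * - psi * u))
      by (f_equal; f_equal; ring).
    replace (Ci * psi * - u) with (Ci * - psi * u) in E3 by ring.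
    replace (Ci * - psi * - u) with (Ci * psi * u) in E4 by ring.
    assert (Hh : forall a b c d e f : C, 2 * (a + b + (c + d) - 2 * (e + f))
      = 2 * a + 2 * b + (2 * c + 2 * d) - 2 * (2 * e + 2 * f)) by (intros; ring).
    rewrite Hh, <- E1, <- E2, <- E3, <- E4, <- E5, <- E6.
    generalize (Cexp (Ci * psi * u)) (Cexp (Ci * - psi * u)) (gpair u) (RtoC PI). intros; ring.
  - intros w. apply (continuous_ext (U := C_UniformSpace) _ _ w Efun).
    apply contC_minus.
    + apply contC_plus; apply contC_plus;
        [exact (proj1 G1 w) | exact (proj1 G2 w) | exact (proj1 G3 w) | exact (proj1 G4 w)].
    + apply contC_mult; [apply contC_const |].
      apply contC_plus; [exact (proj1 G5 w) | exact (proj1 G6 w)].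
Qed.

Lemma reflection_approx psi : (0 < psi < PI / 2)%R ->
  (Cmod ((Cexp (Ci * psi * u) + Cexp (- (Ci * psi * u))) * gpair u - 2 * PI)
     <= Cmod u ^ 2 * 256 / (1 - Rabs (Re u)) ^ 3 * cos psi)%R.
Proof.
  intros Hp. destruct (rapid_refl psi Hp) as [E Cg].
  set (M := (Cmod u ^ 2 * 64 / (1 - Rabs (Re u)) ^ 2 * cos psi)%R).
  pose proof (CI_bound M ((1 - Rabs (Re u)) / 2) _ Cg ltac:(lra) (fun w => reflection_kernel psi w Hp)) as B.
  replace ((Cexp (Ci * psi * u) + Cexp (- (Ci * psi * u))) * gpair u - 2 * PI)
    with (CI (fun w : R => N w * K psi w)).
  - eapply Rle_trans; [exact B |]. right. unfold M. field. lra.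
  - match goal with |- _ = ?y => transitivity (/ 2 * (2 * CI (fun w : R => N w * K psi w))); [field |] end.
    rewrite <- E. field.
Qed.

(** Euler's reflection formula in the form 2 cos (PI u / 2) [gpair u] = 2 PI. The left
    side depends continuously on the angle psi, and its distance to 2 PI is of the
    order of cos psi, which vanishes at the limit angle. *)
Lemma reflection : (Cexp (Ci * (PI / 2)%R * u) + Cexp (- (Ci * (PI / 2)%R * u))) * gpair u = 2 * PI.
Proof.
  set (Q := (Cmod u ^ 2 * 256 / (1 - Rabs (Re u)) ^ 3)%R).
  set (f := fun psi : R => (Cmod ((Cexp (Ci * psi * u) + Cexp (- (Ci * psi * u))) * gpair u - 2 * PI) - Q * cos psi)%R).
  assert (Cf : continuous f (PI / 2)%R).
  { unfold f. apply (continuous_minus (V := R_NormedModule)).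
    - apply (cont_Cmod (U := R_UniformSpace)). ctac.
    - apply (continuous_mult (K := R_AbsRing)); [apply continuous_const |].
      apply (ex_derive_continuous cos). auto_derive; auto. }
  pose proof PI_RGT_0 as Ppi.
  assert (Hle : (f (PI / 2) <= 0)%R).
  { apply Rnot_lt_le. intros Hlt.
    destruct (proj1 (filterlim_locally _ _) Cf (mkposreal _ Hlt)) as [d Hd].
    set (psi := (PI / 2 - Rmin (d / 2) (PI / 4))%R).
    pose proof (cond_pos d) as Pd. pose proof (Rmin_l (d / 2) (PI / 4)). pose proof (Rmin_r (d / 2) (PI / 4)).
    assert (0 < Rmin (d / 2) (PI / 4))%R by (apply Rmin_pos; lra).
    specialize (Hd psi). assert (Hb : ball (PI / 2)%R d psi).
    { change (Rabs (psi - PI / 2) < d)%R. unfold psi. rewrite Rabs_left; lra. }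
    specialize (Hd Hb). change (Rabs (f psi - f (PI / 2)) < f (PI / 2))%R in Hd.
    apply Rabs_lt_between in Hd.
    pose proof (reflection_approx psi ltac:(unfold psi; lra)) as R1.
    fold Q in R1. assert (R2 : (f psi <= 0)%R) by (unfold f; lra). lra. }
  unfold f in Hle. rewrite cos_PI2 in Hle.
  apply (proj2 (Ceq_minus _ _)), Cmod_eq_0.
  match goal with |- ?y = _ => pose proof (Cmod_ge_0 ((Cexp (Ci * (PI / 2)%R * u) + Cexp (- (Ci * (PI / 2)%R * u))) * gpair u - 2 * PI)) end.
  lra.
Qed.
End Reflection.

Lemma Gam_neq_0 (a : C) : (0 < Re a < 1)%R -> Gam a <> 0.
Proof.
  intros Ha E.
  assert (Hu : (Rabs (Re (1 - 2 * a)) < 1)%R).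
  { replace (Re (1 - 2 * a)) with (1 - 2 * Re a)%R by (destruct a; cbn; ring). apply Rabs_def1; lra. }
  pose proof (reflection (1 - 2 * a) Hu) as R1. unfold gpair in R1.
  replace (/ 2 - / 2 * (1 - 2 * a)) with a in R1 by field. rewrite E in R1.
  assert (Z : RtoC (2 * PI) = 0) by (rewrite RtoC_mult, <- R1; ring).
  apply RtoC_inj in Z. pose proof PI_RGT_0. lra.
Qed.

Lemma Gam_half_sq : Gam (/ 2) * Gam (/ 2) = PI.
Proof.
  rewrite <- gpair_0. unfold gpair. f_equal; f_equal; ring.
Qed.

(** * Derivatives of inverses and of components *)

Lemma Cd_Cinv (z : C) : z <> 0 -> Cd Cinv z (- / (z * z)).
Proof.
  intros Hz e He. assert (Pz : (0 < Cmod z)%R) by (apply Cmod_gt_0, Hz).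
  set (r := Cmod z) in *.
  exists (Rmin (r / 2) (e * (r * r * r) / 2)).
  assert (P3 : (0 < r * r * r)%R) by (repeat apply Rmult_lt_0_compat; lra).
  split; [apply Rmin_pos; [lra | nra] |]. intros h Hh.
  assert (Ha := Rlt_le_trans _ _ _ Hh (Rmin_l _ _)). assert (Hb := Rlt_le_trans _ _ _ Hh (Rmin_r _ _)).
  assert (Hs : (r / 2 <= Cmod (z + h))%R).
  { pose proof (Cmod_triangle' (z + h) h) as T. replace (z + h - h) with z in T by ring. fold r in T. lra. }
  assert (Nz : z + h <> 0) by (apply Cmod_gt_0; lra).
  replace (/ (z + h) - / z - - / (z * z) * h) with (h * (h * / (z * z * (z + h)))) by (field; auto).
  rewrite !Cmod_mult, Cmod_inv by (repeat apply Cmult_neq_0; auto).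
  rewrite !Cmod_mult. fold r. rewrite (Rmult_comm e). apply Rmult_le_compat_l; [apply Cmod_ge_0 |].
  apply (Rmult_le_reg_r (r * r * Cmod (z + h))); [apply Rmult_lt_0_compat; nra |].
  rewrite Rmult_assoc, Rinv_l by (apply Rgt_not_eq, Rmult_lt_0_compat; nra).
  assert (e * (r * r * r) / 2 <= e * (r * r * Cmod (z + h)))%R; [| lra].
  replace (e * (r * r * r) / 2)%R with (e * (r * r * (r / 2)))%R by field.
  apply Rmult_le_compat_l; [lra |]. apply Rmult_le_compat_l; nra.
Qed.

Lemma Cd_inv (f : C -> C) (z l : C) : f z <> 0 -> Cd f z l ->
  Cd (fun w => / f w) z (- / (f z * f z) * l).
Proof. intros Hz Hf. exact (Cd_comp _ _ _ _ _ (Cd_Cinv _ Hz) Hf). Qed.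

Lemma Rd_Re (f : R -> C) x l : Rd f x l -> is_derive (fun t => Re (f t)) x (Re l).
Proof.
  intros H. pose proof (Rd_eps_inv f x l H) as E.
  apply is_derive_Reals. intros e He. destruct (E (e / 2)%R ltac:(lra)) as [d [Hd H1]].
  exists (mkposreal d Hd). intros h Hh0 Hh. specialize (H1 h Hh).
  assert (Ph : (0 < Rabs h)%R) by (apply Rabs_pos_lt, Hh0).
  pose proof (re_le_Cmod (f (x + h)%R - f x - l * h)) as H2.
  replace (Re (f (x + h)%R - f x - l * h)) with (Re (f (x + h)%R) - Re (f x) - Re l * h)%R in H2
    by (rewrite <- re_scal_r; reflexivity).
  replace ((Re (f (x + h)%R) - Re (f x)) / h - Re l)%R with ((Re (f (x + h)%R) - Re (f x) - Re l * h) / h)%R by (field; exact Hh0).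
  unfold Rdiv. rewrite Rabs_mult, Rabs_inv.
  apply (Rmult_lt_reg_r (Rabs h)); [exact Ph |]. rewrite Rmult_assoc, Rinv_l by lra. nra.
Qed.

Lemma Rd_Im (f : R -> C) x l : Rd f x l -> is_derive (fun t => Im (f t)) x (Im l).
Proof.
  intros H. pose proof (Rd_eps_inv f x l H) as E.
  apply is_derive_Reals. intros e He. destruct (E (e / 2)%R ltac:(lra)) as [d [Hd H1]].
  exists (mkposreal d Hd). intros h Hh0 Hh. specialize (H1 h Hh).
  assert (Ph : (0 < Rabs h)%R) by (apply Rabs_pos_lt, Hh0).
  pose proof (Im_le_Cmod (f (x + h)%R - f x - l * h)) as H2.
  replace (Im (f (x + h)%R - f x - l * h)) with (Im (f (x + h)%R) - Im (f x) - Im l * h)%R in H2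
    by (rewrite <- im_scal_r; reflexivity).
  replace ((Im (f (x + h)%R) - Im (f x)) / h - Im l)%R with ((Im (f (x + h)%R) - Im (f x) - Im l * h) / h)%R by (field; exact Hh0).
  unfold Rdiv. rewrite Rabs_mult, Rabs_inv.
  apply (Rmult_lt_reg_r (Rabs h)); [exact Ph |]. rewrite Rmult_assoc, Rinv_l by lra. nra.
Qed.

(** * Kummer's equation in the logarithmic variable *)

(** Kummer's equation as a first order system in the variable zeta = log z, with [W1]
    = dW / dzeta. It is regular in the whole plane. *)
Definition ksol (a b : C) (W W1 : C -> C) (z : C) : Prop :=
  Cd W z (W1 z) /\ Cd W1 z ((1 - b + Cexp z) * W1 z + a * Cexp z * W z).

Lemma kummer_of_ksol a b W W1 : (forall z, ksol a b W W1 z) -> kummer_solution a b W.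
Proof.
  intros H.
  assert (E1 : forall z, C_derive W z = W1 z).
  { intros z. apply is_C_derive_unique, Cd_is_derive, H. }
  assert (E2 : forall z, dz W z = Cexp (- z) * W1 z) by (intros z; unfold dz; rewrite E1; reflexivity).
  set (D := fun z => Cexp (- z) * W1 z).
  set (D1 := fun z => Cexp (- z) * ((- b + Cexp z) * W1 z + a * Cexp z * W z)).
  assert (H2 : forall z, Cd (dz W) z (D1 z)).
  { intros z. apply (Cd_ext D); [intros w; symmetry; apply E2 |].
    eapply Cd_eq; [unfold D; eapply (Cd_mult (fun z => Cexp (- z)) W1); [dtac | apply H] |].
    unfold D1; cbv beta. ring. }
  assert (E3 : forall z, C_derive (dz W) z = D1 z).
  { intros z. apply is_C_derive_unique, Cd_is_derive, H2. }
  split; [| split].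
  - intros z. exists (W1 z). apply Cd_is_derive, H.
  - intros z. exists (D1 z). apply Cd_is_derive, H2.
  - intros z. unfold dz at 1. rewrite E3, E2. unfold D1. rewrite Cexp_opp. field. apply Cexp_neq_0.
Qed.

Lemma ksol_of_kummer a b W : kummer_solution a b W -> exists W1, forall z, ksol a b W W1 z.
Proof.
  intros [H1 [H2 H3]]. exists (C_derive W). intros z.
  split; [apply Cd_is_derive, (C_derive_correct W z 0), H1 |].
  apply (Cd_ext (fun z => Cexp z * dz W z)).
  { intros w. unfold dz. rewrite Cexp_opp. field. apply Cexp_neq_0. }
  eapply Cd_eq.
  - apply (Cd_mult Cexp (dz W)); [apply Cd_Cexp |]. apply Cd_is_derive, (C_derive_correct _ z 0), H2.
  - specialize (H3 z). unfold dz at 1 in H3. cbv beta in *.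
    set (X := C_derive (dz W) z) in *.
    assert (EY : dz W z = Cexp (- z) * C_derive W z) by reflexivity. set (Y := dz W z) in *.
    assert (EC : C_derive W z = Cexp z * Y).
    { rewrite EY, Cexp_opp. field. apply Cexp_neq_0. }
    rewrite EC. rewrite Cexp_opp in H3. set (q := Cexp z) in *.
    assert (Nq : q <> 0) by apply Cexp_neq_0.
    assert (EX : X = a * W z - (b - q) * Y).
    { replace X with ((q * (/ q * X) + (b - q) * Y - a * W z) - (b - q) * Y + a * W z) by (field; exact Nq).
      rewrite H3. ring. }
    rewrite EX. ring.
Qed.

Lemma Re_conj_le (z w : C) : (Re z * Re w + Im z * Im w <= Cmod z * Cmod w)%R.
Proof.
  replace (Re z * Re w + Im z * Im w)%R with (Re (z * Cconj w)) by (destruct z, w; cbn; ring).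
  eapply Rle_trans; [apply Re_le_Cmod |]. rewrite Cmod_mult, Cmod_conj. lra.
Qed.

(** Gronwall's inequality for |W|^2 + |W1|^2 along the segment. *)
Lemma ksol_zero a b W W1 z0 z :
  (forall t : R, (0 <= t <= 1)%R -> ksol a b W W1 (z0 + t * (z - z0))) ->
  W z0 = 0 -> W1 z0 = 0 -> W z = 0.
Proof.
  intros H H0 H1. set (d := z - z0).
  set (B := exp (Cmod z0 + Cmod d)). set (A := (Cmod (1 - b) + B)%R). set (B' := (Cmod a * B)%R).
  set (K := (Cmod d * (1 + 2 * A + B'))%R).
  set (y := fun t : R => W (z0 + t * d)). set (v := fun t : R => W1 (z0 + t * d)).
  set (N := fun t : R => (Re (y t) * Re (y t) + Im (y t) * Im (y t) + (Re (v t) * Re (v t) + Im (v t) * Im (v t)))%R).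
  assert (HB : forall t, (0 <= t <= 1)%R -> (Cmod (Cexp (z0 + t * d)) <= B)%R).
  { intros t Ht. apply Cmod_le_exp. eapply Rle_trans; [apply Re_le_Cmod |].
    eapply Rle_trans; [apply Cmod_triangle |]. rewrite Cmod_mult, Cmod_R, Rabs_pos_eq by lra.
    pose proof (Cmod_ge_0 d). nra. }
  set (v' := fun t : R => ((1 - b + Cexp (z0 + t * d)) * v t + a * Cexp (z0 + t * d) * y t) * d).
  assert (Dy : forall t, (0 <= t <= 1)%R -> Rd y t (v t * d)) by (intros t Ht; apply Cd_Rd, H, Ht).
  assert (Dv : forall t, (0 <= t <= 1)%R -> Rd v t (v' t)) by (intros t Ht; apply Cd_Rd, H, Ht).
  set (N' := fun t : R => (2 * (Re (y t) * Re (v t * d) + Im (y t) * Im (v t * d)) + 2 * (Re (v t) * Re (v' t) + Im (v t) * Im (v' t)))%R).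
  assert (DN : forall t, (0 <= t <= 1)%R -> is_derive N t (N' t)).
  { intros t Ht. pose proof (Rd_Re _ _ _ (Dy t Ht)) as R1. pose proof (Rd_Im _ _ _ (Dy t Ht)) as R2.
    pose proof (Rd_Re _ _ _ (Dv t Ht)) as R3. pose proof (Rd_Im _ _ _ (Dv t Ht)) as R4.
    assert (Sq : forall f l, is_derive f t l -> is_derive (fun t => f t * f t)%R t (2 * (f t * l))%R).
    { intros f l Hf. replace (2 * (f t * l))%R with (l * f t + f t * l)%R by ring.
      apply (is_derive_mult f f t l l Hf Hf). intros; apply Rmult_comm. }
    unfold N, N'.
    replace (2 * (Re (y t) * Re (v t * d) + Im (y t) * Im (v t * d)) + 2 * (Re (v t) * Re (v' t) + Im (v t) * Im (v' t)))%R
      with ((2 * (Re (y t) * Re (v t * d)) + 2 * (Im (y t) * Im (v t * d))) + (2 * (Re (v t) * Re (v' t)) + 2 * (Im (v t) * Im (v' t))))%R by ring.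
    repeat apply (is_derive_plus (V := R_NormedModule)); [exact (Sq _ _ R1) | exact (Sq _ _ R2) | exact (Sq _ _ R3) | exact (Sq _ _ R4)]. }
  assert (Nsq : forall t, N t = (Cmod (y t) ^ 2 + Cmod (v t) ^ 2)%R) by (intros t; rewrite !Cmod2_alt; unfold N; ring).
  assert (PB : (0 < B)%R) by apply exp_pos.
  assert (PA : (0 <= A)%R) by (unfold A; pose proof (Cmod_ge_0 (1 - b)); lra).
  assert (PB' : (0 <= B')%R) by (unfold B'; pose proof (Cmod_ge_0 a); nra).
  pose proof (Cmod_ge_0 d) as Pd.
  assert (HN : forall t, (0 <= t <= 1)%R -> (N' t <= K * N t)%R).
  { intros t Ht. rewrite Nsq. unfold N', K.
    pose proof (Re_conj_le (y t) (v t * d)) as C1. pose proof (Re_conj_le (v t) (v' t)) as C2.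
    rewrite Cmod_mult in C1.
    assert (C3 : (Cmod (v' t) <= (A * Cmod (v t) + B' * Cmod (y t)) * Cmod d)%R).
    { unfold v'. rewrite Cmod_mult. apply Rmult_le_compat_r; [exact Pd |].
      eapply Rle_trans; [apply Cmod_triangle |]. rewrite !Cmod_mult. specialize (HB t Ht).
      pose proof (Cmod_ge_0 (v t)). pose proof (Cmod_ge_0 (y t)). pose proof (Cmod_ge_0 a).
      apply Rplus_le_compat; apply Rmult_le_compat_r; auto.
      - eapply Rle_trans; [apply Cmod_triangle | unfold A; lra].
      - unfold B'. apply Rmult_le_compat_l; lra. }
    pose proof (Cmod_ge_0 (v t)) as Pv. pose proof (Cmod_ge_0 (y t)) as Py.
    assert (C4 : (Cmod (v t) * Cmod (v' t) <= Cmod (v t) * ((A * Cmod (v t) + B' * Cmod (y t)) * Cmod d))%R)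
      by (apply Rmult_le_compat_l; auto).
    set (p := Cmod (y t)) in *. set (q := Cmod (v t)) in *. set (D := Cmod d) in *.
    assert (Q : (2 * (p * (q * D)) + 2 * (q * ((A * q + B' * p) * D)) <= D * (1 + 2 * A + B') * (p ^ 2 + q ^ 2))%R).
    { replace (2 * (p * (q * D)) + 2 * (q * ((A * q + B' * p) * D)))%R
        with (D * ((1 + B') * (2 * p * q) + 2 * A * q ^ 2))%R by ring.
      rewrite (Rmult_assoc D). apply Rmult_le_compat_l; [exact Pd |].
      assert (2 * p * q <= p ^ 2 + q ^ 2)%R by (pose proof (Rle_0_sqr (p - q)) as S; unfold Rsqr in S; nra).
      assert ((1 + B') * (2 * p * q) <= (1 + B') * (p ^ 2 + q ^ 2))%R by (apply Rmult_le_compat_l; lra).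
      assert (0 <= 2 * A * p ^ 2)%R by (apply Rmult_le_pos; nra). nra. }
    lra. }
  set (g := fun t : R => (N t * exp (- K * t))%R).
  assert (Dg : forall t, (0 <= t <= 1)%R -> is_derive g t ((N' t - K * N t) * exp (- K * t))%R).
  { intros t Ht. unfold g.
    replace ((N' t - K * N t) * exp (- K * t))%R with (N' t * exp (- K * t) + N t * (- K * exp (- K * t)))%R by ring.
    apply (is_derive_mult N (fun t => exp (- K * t))); [apply DN, Ht | auto_derive; [auto | ring] |].
    intros; apply Rmult_comm. }
  assert (Hg : (g 1 <= g 0)%R).
  { destruct (MVT_gen g 0 1 (fun t => (N' t - K * N t) * exp (- K * t))%R) as [c [Hc E]];
      rewrite ?Rmin_left, ?Rmax_right in * by lra.
    - intros x Hx. apply Dg. lra.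
    - intros x Hx. apply continuity_pt_filterlim. apply (ex_derive_continuous g). eexists. apply Dg, Hx.
    - specialize (HN c Hc). pose proof (exp_pos (- K * c)). nra. }
  assert (E0 : g 0%R = 0%R).
  { unfold g, N, y, v. rewrite Cmult_0_l, Cplus_0_r, H0, H1. cbn. ring. }
  assert (E1 : (N 1 <= 0)%R).
  { rewrite E0 in Hg. unfold g in Hg. pose proof (exp_pos (- K * 1)). nra. }
  rewrite Nsq in E1.
  replace z with (z0 + 1%R * d) by (unfold d; ring). change (y 1%R = 0).
  apply Cmod_eq_0. pose proof (Cmod_ge_0 (y 1%R)). nra.
Qed.

Lemma ksol_lin a b W W1 V V1 k l z : ksol a b W W1 z -> ksol a b V V1 z ->
  ksol a b (fun w => k * W w + l * V w) (fun w => k * W1 w + l * V1 w) z.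
Proof.
  intros [A1 A2] [B1 B2]. split; (eapply Cd_eq; [apply Cd_plus; apply Cd_scal; eassumption | ring]).
Qed.

(** * The recessive solution on the positive real axis *)

(** The trace of the prescribed asymptotics on the positive real axis; the value l = 0
    serves for differences of solutions. *)
Definition asymR (l a : C) (W : C -> C) : Prop :=
  forall e : R, (0 < e)%R -> exists M : R, forall x : R, (M < x)%R ->
    (Cmod (W x * Cexp (a * x) - l) < e)%R.

Section Recessive.
Variables (a b : C) (W W1 V V1 : C -> C).
Hypotheses (HW : forall x : R, ksol a b W W1 x) (HV : forall x : R, ksol a b V V1 x)
  (AW : asymR 1 a W) (AV : asymR 0 a V).

Let Wr (z : C) : C := W z * V1 z - W1 z * V z.

Lemma wronskian_const : exists c, forall x : R, Wr x = c * Cexp (Cexp x + (1 - b) * x).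
Proof.
  exists (Wr 0 * Cexp (- (Cexp 0 + (1 - b) * 0))). intros x.
  set (f := fun z : C => Wr z * Cexp (- (Cexp z + (1 - b) * z))).
  assert (E : f x = f 0).
  { apply C_zero_derive_const. intros t _.
    replace (0 + t * (x - 0)) with (RtoC (t * x)) by (rewrite RtoC_mult; ring).
    set (u := (t * x)%R). destruct (HW u) as [A1 A2]. destruct (HV u) as [B1 B2].
    eapply Cd_eq.
    - unfold f, Wr. apply (Cd_mult (fun z => W z * V1 z - W1 z * V z) (fun z => Cexp (- (Cexp z + (1 - b) * z)))).
      + apply Cd_minus; apply Cd_mult; eassumption.
      + dtac.
    - cbv beta. ring. }
  unfold f in E.
  replace (Wr x) with ((Wr x * Cexp (- (Cexp x + (1 - b) * x))) * Cexp (Cexp x + (1 - b) * x)).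
  - rewrite E. reflexivity.
  - rewrite <- Cmult_assoc, <- Cexp_plus.
    replace (- (Cexp x + (1 - b) * x) + (Cexp x + (1 - b) * x)) with (RtoC 0) by ring.
    rewrite Cexp_0. ring.
Qed.

Lemma recessive_large : exists X : R, forall x : R, (X < x)%R ->
  (Cmod (W x * Cexp (a * x) - 1) < 1 / 10)%R /\ (Cmod (V x * Cexp (a * x)) < 1 / 2)%R /\ W x <> 0.
Proof.
  destruct (AW (1 / 10)%R ltac:(lra)) as [M1 H1]. destruct (AV (1 / 2)%R ltac:(lra)) as [M2 H2].
  exists (Rmax M1 M2). intros x Hx.
  pose proof (Rmax_l M1 M2). pose proof (Rmax_r M1 M2).
  specialize (H1 x ltac:(lra)). specialize (H2 x ltac:(lra)).
  split; [exact H1 | split].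
  - replace (V x * Cexp (a * x)) with (V x * Cexp (a * x) - 0) by ring. exact H2.
  - intros E. rewrite E, Cmult_0_l in H1. replace (0 - 1) with (- (1)) in H1 by ring.
    rewrite Cmod_opp, Cmod_1 in H1. lra.
Qed.

Lemma Re_inv_sq (w : C) : (Cmod (w - 1) < 1 / 10)%R -> (1 / 2 <= Re (/ (w * w)))%R.
Proof.
  intros H. pose proof (re_le_Cmod (w - 1)) as H1. pose proof (Im_le_Cmod (w - 1)) as H2.
  destruct w as [p q]. cbn in H1, H2. apply Rabs_le_between in H1. apply Rabs_le_between in H2.
  cbn. assert (Hp : (9 / 10 < p < 11 / 10)%R) by lra. assert (Hq : (- 1 / 10 < q < 1 / 10)%R) by lra.
  set (D := ((p * p - q * q) * ((p * p - q * q) * 1) + (p * q + q * p) * ((p * q + q * p) * 1))%R).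
  replace D with ((p * p + q * q) * (p * p + q * q))%R by (unfold D; ring).
  assert (P1 : (81 / 100 < p * p < 121 / 100)%R) by nra. assert (Q1 : (0 <= q * q < 1 / 100)%R) by nra.
  apply (Rmult_le_reg_r ((p * p + q * q) * (p * p + q * q))); [nra |].
  unfold Rdiv. rewrite (Rmult_assoc (p * p - q * q)), Rinv_l by nra. nra.
Qed.

Let m : C := 1 - b + 2 * a.
Let phi (z : C) : C := V z * / W z * Cexp (- m * z).

(** The factor Cexp (- m x) turns the Wronskian identity for V / W into an equation
    whose forcing term is c exp (e^x) up to a factor close to 1. *)
Lemma phi_derive (c : C) (x : R) : W x <> 0 -> Wr x = c * Cexp (Cexp x + (1 - b) * x) ->
  Cd phi x (c * Cexp (Cexp x) * / ((W x * Cexp (a * x)) * (W x * Cexp (a * x))) - m * phi x).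
Proof.
  intros Hn Hc. destruct (HW x) as [A1 A2]. destruct (HV x) as [B1 B2].
  eapply Cd_eq.
  - unfold phi. apply (Cd_mult (fun z => V z * / W z) (fun z => Cexp (- m * z))); [| dtac].
    apply Cd_mult; [exact B1 | apply Cd_inv; [exact Hn | exact A1]].
  - cbv beta. unfold phi.
    transitivity (Wr x * / (W x * W x) * Cexp (- m * x) - m * (V x * / W x * Cexp (- m * x))).
    + unfold Wr. field. exact Hn.
    + rewrite Hc. f_equal.
      replace (- m * x) with (- ((1 - b) * x) + - (a * x) + - (a * x)) by (unfold m; ring).
      rewrite !Cexp_plus, !Cexp_opp.
      field. repeat split; auto using Cexp_neq_0.
Qed.

(** If c were not 0, the real part of phi / c would grow faster than exp ((k + 1) x),
    while V / W tends to 0 and phi is at most exp (k x). *)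
Lemma recessive_const_zero (c : C) : (forall x : R, Wr x = c * Cexp (Cexp x + (1 - b) * x)) -> c = 0.
Proof.
  intros Hc. destruct (Ceq_dec c 0) as [E | Nc]; [exact E | exfalso].
  destruct recessive_large as [X HX].
  set (k := (Cmod m + 1)%R). pose proof (Cmod_ge_0 m) as Pm.
  assert (Pc : (0 < Cmod c)%R) by (apply Cmod_gt_0, Nc).
  set (ic := (/ Cmod c)%R). assert (Pic : (0 < ic)%R) by (apply Rinv_0_lt_compat, Pc).
  set (C2 := (k + 1 + Cmod m * ic)%R). assert (PC2 : (1 <= C2)%R) by (unfold C2, k; nra).
  set (X2 := (Rmax (Rmax X 0) (Rmax (2 * (k + 2)) (ln (2 * C2))) + 1)%R).
  assert (B1 : (X < X2 /\ 0 < X2 /\ 2 * (k + 2) <= X2 /\ ln (2 * C2) <= X2)%R).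
  { unfold X2. pose proof (Rmax_l (Rmax X 0) (Rmax (2 * (k + 2)) (ln (2 * C2)))).
    pose proof (Rmax_r (Rmax X 0) (Rmax (2 * (k + 2)) (ln (2 * C2)))).
    pose proof (Rmax_l X 0). pose proof (Rmax_r X 0).
    pose proof (Rmax_l (2 * (k + 2)) (ln (2 * C2))). pose proof (Rmax_r (2 * (k + 2)) (ln (2 * C2))). lra. }
  destruct B1 as [B1 [B2 [B3 B4]]].
  set (rho := fun x : R => Re (/ c * phi x)).
  set (rho' := fun x : R => Re (/ c * (c * Cexp (Cexp x) * / ((W x * Cexp (a * x)) * (W x * Cexp (a * x))) - m * phi x))).
  assert (Dr : forall x : R, (X2 <= x)%R -> is_derive rho x (rho' x)).
  { intros x Hx. apply (Rd_Re (fun x : R => / c * phi x)). apply (Cd_Rd' (fun z => / c * phi z)).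
    apply Cd_scal, phi_derive; [apply HX; lra | apply Hc]. }
  assert (Bphi : forall x : R, (X2 <= x)%R -> (Cmod (phi x) <= exp (k * x))%R).
  { intros x Hx. destruct (HX x ltac:(lra)) as [H1 [H2 H3]].
    set (w := W x * Cexp (a * x)) in *. set (v := V x * Cexp (a * x)) in *.
    assert (Hw : (1 / 2 <= Cmod w)%R).
    { pose proof (Cmod_triangle' w (w - 1)) as T. replace (w - (w - 1)) with (RtoC 1) in T by ring.
      rewrite Cmod_1 in T. lra. }
    assert (Nw : w <> 0) by (apply Cmod_gt_0; lra).
    replace (phi x) with (v * / w * Cexp (- m * x))
      by (unfold phi, v, w; field; auto using Cexp_neq_0).
    rewrite !Cmod_mult, Cmod_inv by exact Nw.
    assert (Hq : (Cmod v * / Cmod w <= 1)%R).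
    { apply (Rmult_le_reg_r (Cmod w)); [lra |]. rewrite Rmult_assoc, Rinv_l by lra. lra. }
    assert (He : (Cmod (Cexp (- m * x)) <= exp (k * x))%R).
    { apply Cmod_le_exp. rewrite re_scal_r. apply Rmult_le_compat_r; [lra |].
      pose proof (Re_le_Cmod (- m)) as Hm. rewrite Cmod_opp in Hm. unfold k. lra. }
    pose proof (Cmod_ge_0 (Cexp (- m * x))). nra. }
  assert (Lr : forall x : R, (X2 <= x)%R -> ((k + 1) * exp ((k + 1) * x) <= rho' x)%R).
  { intros x Hx. unfold rho'. destruct (HX x ltac:(lra)) as [H1 [H2 H3]].
    set (w := W x * Cexp (a * x)) in *.
    replace (/ c * (c * Cexp (Cexp x) * / (w * w) - m * phi x))
      with (RtoC (exp (exp x)) * / (w * w) - / c * (m * phi x)).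
    2:{ rewrite !Cexp_R. field. split; [| exact Nc]. exact (Cmult_neq_0 _ _ H3 (Cexp_neq_0 (a * x))). }
    pose proof (Re_inv_sq w H1) as Hr.
    assert (Hn : (Re (/ c * (m * phi x)) <= Cmod m * ic * exp (k * x))%R).
    { eapply Rle_trans; [apply Re_le_Cmod |]. rewrite !Cmod_mult, Cmod_inv by exact Nc. fold ic.
      replace (ic * (Cmod m * Cmod (phi x)))%R with (Cmod m * ic * Cmod (phi x))%R by ring.
      apply Rmult_le_compat_l; [nra | apply Bphi, Hx]. }
    unfold Cminus. rewrite re_plus, re_opp, re_scal_l.
    assert (Hk : (exp (k * x) <= exp ((k + 1) * x))%R) by (apply exp_le; nra).
    assert (Hbig : (2 * C2 * exp ((k + 1) * x) <= exp (exp x))%R).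
    { rewrite <- (exp_ln (2 * C2)) by lra. rewrite <- exp_plus. apply exp_le.
      pose proof (exp_ge_sq x ltac:(lra)). unfold k in *. nra. }
    pose proof (exp_pos (exp x)). unfold C2 in Hbig.
    assert (Cmod m * ic * exp (k * x) <= Cmod m * ic * exp ((k + 1) * x))%R by (apply Rmult_le_compat_l; nra).
    nra. }
  set (S := (exp ((k + 1) * X2) + ic * exp (k * X2))%R).
  set (x := (X2 + ln (ic + S + 1))%R).
  pose proof (exp_pos ((k + 1) * X2)) as PS1. pose proof (exp_pos (k * X2)) as PS2.
  assert (PS : (0 < S)%R) by (unfold S; nra).
  assert (Lx : (0 < ln (ic + S + 1))%R) by (rewrite <- ln_1; apply ln_increasing; lra).
  assert (Hx : (X2 < x)%R) by (unfold x; lra).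
  assert (Hgrow : (exp ((k + 1) * x) - exp ((k + 1) * X2) <= rho x - rho X2)%R).
  { set (g := fun t => (rho t - exp ((k + 1) * t))%R).
    destruct (MVT_gen g X2 x (fun t => rho' t - (k + 1) * exp ((k + 1) * t))%R) as [t [Ht E]];
      rewrite ?Rmin_left, ?Rmax_right in * by lra.
    - intros t Ht. apply (is_derive_minus (V := R_NormedModule)); [apply Dr; lra | auto_derive; [auto | ring]].
    - intros t Ht. apply continuity_pt_filterlim. apply (ex_derive_continuous g). eexists.
      apply (is_derive_minus (V := R_NormedModule)); [apply Dr; lra |].
      instantiate (1 := ((k + 1) * exp ((k + 1) * t))%R). auto_derive; [auto | ring].
    - specialize (Lr t ltac:(lra)). unfold g in E. nra. }
  assert (Bx : forall t : R, (X2 <= t)%R -> (Rabs (rho t) <= ic * exp (k * t))%R).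
  { intros t Ht. unfold rho. eapply Rle_trans; [apply re_le_Cmod |]. rewrite Cmod_mult, Cmod_inv by exact Nc.
    fold ic. apply Rmult_le_compat_l; [lra | apply Bphi, Ht]. }
  pose proof (Bx x ltac:(lra)) as Q1. pose proof (Bx X2 ltac:(lra)) as Q2.
  apply Rabs_le_between in Q1. apply Rabs_le_between in Q2.
  assert (E1 : (exp ((k + 1) * x) = exp (k * x) * exp x)%R) by (rewrite <- exp_plus; f_equal; ring).
  assert (E2 : (ic + S + 1 <= exp x)%R).
  { unfold x. rewrite exp_plus, exp_ln by lra. pose proof (exp_ineq1_le X2). nra. }
  assert (E3 : (1 <= exp (k * x))%R).
  { rewrite <- exp_0. apply exp_le. unfold k. nra. }
  assert (E4 : (exp (k * x) * (ic + S + 1) <= exp (k * x) * exp x)%R) by (apply Rmult_le_compat_l; lra).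
  assert (E5 : (S <= exp (k * x) * S)%R) by nra.
  rewrite !Rmult_plus_distr_l in E4. rewrite E1 in Hgrow.
  rewrite (Rmult_comm (exp (k * x)) ic) in E4. assert (E6 : S = (exp ((k + 1) * X2) + ic * exp (k * X2))%R) by reflexivity.
  lra.
Qed.

(** With a vanishing Wronskian the quotient V / W is constant on a half line, and its
    limit is 0. *)
Lemma recessive_vanish : exists x : R, V x = 0 /\ V1 x = 0.
Proof.
  destruct wronskian_const as [c Hc]. pose proof (recessive_const_zero c Hc) as E0. subst c.
  destruct recessive_large as [X HX].
  assert (Wz : forall x : R, Wr x = 0) by (intros x; rewrite Hc; ring).
  assert (Q : forall x y : R, (X < x)%R -> (X < y)%R -> V y * / W y = V x * / W x).
  { intros x y Hx Hy. apply (C_zero_derive_const (fun z => V z * / W z)). intros t Ht.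
    replace (x + t * (y - x)) with (RtoC (x + t * (y - x))%R) by (rewrite RtoC_plus, RtoC_mult, RtoC_minus; ring).
    set (u := (x + t * (y - x))%R). assert (Hu : (X < u)%R) by (unfold u; destruct (Rle_dec t (1 / 2)); nra).
    destruct (HX u Hu) as [_ [_ Hn]]. destruct (HW u) as [A1 A2]. destruct (HV u) as [B1 B2].
    eapply Cd_eq; [apply Cd_mult; [exact B1 | apply Cd_inv; [exact Hn | exact A1]] |].
    cbv beta. transitivity (Wr u * / (W u * W u)); [unfold Wr; field; exact Hn | rewrite Wz; ring]. }
  set (x0 := (X + 1)%R). assert (Hx0 : (X < x0)%R) by (unfold x0; lra).
  assert (Z : V x0 * / W x0 = 0).
  { apply Cmod_eq_0. apply Rle_antisym; [| apply Cmod_ge_0]. apply Rnot_lt_le. intros Hlt.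
    destruct (AV (Cmod (V x0 * / W x0) / 2)%R ltac:(lra)) as [M2 H2].
    set (y := (Rmax X M2 + 1)%R).
    assert (Hy : (X < y /\ M2 < y)%R) by (unfold y; pose proof (Rmax_l X M2); pose proof (Rmax_r X M2); lra).
    destruct (HX y (proj1 Hy)) as [H1 [_ H3]]. specialize (H2 y (proj2 Hy)).
    rewrite (Q y x0) in Hlt, H2 by (lra || apply Hy).
    replace (V y * Cexp (a * y) - 0) with ((V y * / W y) * (W y * Cexp (a * y))) in H2 by (field; exact H3).
    rewrite Cmod_mult in H2. set (w := W y * Cexp (a * y)) in *.
    assert (Hw : (9 / 10 <= Cmod w)%R).
    { pose proof (Cmod_triangle' w (w - 1)) as T. replace (w - (w - 1)) with (RtoC 1) in T by ring.
      rewrite Cmod_1 in T. lra. }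
    nra. }
  destruct (HX x0 Hx0) as [_ [_ Hn]].
  assert (EV : V x0 = 0).
  { replace (V x0) with (V x0 * / W x0 * W x0) by (field; exact Hn). rewrite Z. ring. }
  exists x0. split; [exact EV |].
  specialize (Wz x0). unfold Wr in Wz. rewrite EV in Wz.
  replace (V1 x0) with ((W x0 * V1 x0 - W1 x0 * 0) * / W x0) by (field; exact Hn). rewrite Wz. ring.
Qed.
End Recessive.

(** The difference of the two solutions is a solution with vanishing leading
    coefficient, so it has zero Cauchy data somewhere on the real axis. *)
Lemma recessive_unique lo hi a b W W1 V V1 : (lo < 0 < hi)%R ->
  (forall z, strip lo hi z -> ksol a b W W1 z) -> (forall z, strip lo hi z -> ksol a b V V1 z) ->
  asymR 1 a W -> asymR 1 a V -> forall z, strip lo hi z -> W z = V z.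
Proof.
  intros H0 HW HV AW AV.
  assert (SR : forall x : R, strip lo hi x) by (intros x; unfold strip; cbn; lra).
  set (D := fun z => 1 * V z + - (1) * W z). set (D1 := fun z => 1 * V1 z + - (1) * W1 z).
  assert (HD : forall z, strip lo hi z -> ksol a b D D1 z).
  { intros z Hz. apply ksol_lin; auto. }
  assert (AD : asymR 0 a D).
  { intros e He. destruct (AW (e / 2)%R ltac:(lra)) as [M1 H1]. destruct (AV (e / 2)%R ltac:(lra)) as [M2 H2].
    exists (Rmax M1 M2). intros x Hx. pose proof (Rmax_l M1 M2). pose proof (Rmax_r M1 M2).
    specialize (H1 x ltac:(lra)). specialize (H2 x ltac:(lra)).
    replace (D x * Cexp (a * x) - 0) with ((V x * Cexp (a * x) - 1) - (W x * Cexp (a * x) - 1))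
      by (unfold D; ring).
    eapply Rle_lt_trans; [apply Cmod_triangle' | lra]. }
  destruct (recessive_vanish a b W W1 D D1 (fun x => HW _ (SR x)) (fun x => HD _ (SR x)) AW AD) as [x0 [E0 E1]].
  intros z Hz. assert (E : D z = 0).
  { apply (ksol_zero a b D D1 x0 z); auto. intros t Ht. apply HD, strip_seg; auto. }
  unfold D in E. replace (W z) with (V z - (1 * V z + - (1) * W z)) by ring. rewrite E. ring.
Qed.

Lemma asymptotic_asymR a W : asymptotic_pow_neg a W -> asymR 1 a W.
Proof.
  intros H e He. destruct (H PI PI_RGT_0 e He) as [M HM]. exists M. intros x Hx.
  specialize (HM x). cbn [Im RtoC snd Re fst] in HM. rewrite Rabs_R0 in HM.
  pose proof PI_RGT_0. specialize (HM ltac:(lra) Hx).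
  unfold Cdiv in HM. rewrite <- Cexp_opp in HM. replace (- (- a * x)) with (a * x) in HM by ring. exact HM.
Qed.

(** Two functions that satisfy the specification agree on strips of any width by
    [recessive_unique]. *)
Lemma tricomiU_eq a b W : is_tricomiU a b W -> forall z, tricomiU a b z = W z.
Proof.
  intros HW z.
  assert (HT : is_tricomiU a b (tricomiU a b)) by exact (epsilon_spec _ (is_tricomiU a b) (ex_intro _ W HW)).
  destruct (ksol_of_kummer _ _ _ (proj1 HW)) as [W1 KW]. destruct (ksol_of_kummer _ _ _ (proj1 HT)) as [T1 KT].
  apply (recessive_unique (- (Rabs (Im z) + 1)) (Rabs (Im z) + 1) a b _ T1 _ W1); auto.
  - pose proof (Rabs_pos (Im z)). lra.
  - apply asymptotic_asymR, HT.
  - apply asymptotic_asymR, HW.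
  - unfold strip. unfold Rabs. destruct (Rcase_abs (Im z)); lra.
Qed.

(** * Parabolic cylinder functions of negative order *)

(** The integrand of the Laplace type integral of exp (- Z t - t^2 / 2) t^(p - 1), in
    the variable z = log t. *)
Definition pcKer (p Z z : C) : C := Cexp (p * z - Z * Cexp z - / 2 * Cexp (z + z)).

(** The same integral along the ray of argument [phi]; it converges as long as |phi| <
    PI / 4. *)
Definition pcInt (p : C) (phi : R) (Z : C) : C := CI (fun x : R => pcKer p Z (x + Ci * phi)).

Lemma pcKer_succ p Z z : Cexp z * pcKer p Z z = pcKer (p + 1) Z z.
Proof. unfold pcKer. rewrite <- Cexp_plus. f_equal. ring. Qed.

Lemma Cd_pcKer p Z z : Cd (pcKer p Z) z (p * pcKer p Z z - Z * pcKer (p + 1) Z z - pcKer (p + 1 + 1) Z z).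
Proof.
  rewrite <- !pcKer_succ. eapply Cd_eq; [unfold pcKer; dtac |]. unfold pcKer. rewrite (Cexp_plus z z). field.
Qed.

Lemma Cd_pcKer_param p z Z : Cd (fun Z => pcKer p Z z) Z (- pcKer (p + 1) Z z).
Proof. rewrite <- pcKer_succ. eapply Cd_eq; [unfold pcKer; dtac |]. unfold pcKer. ring. Qed.

Lemma Re_pcKer_arg p Z z : Re (p * z - Z * Cexp z - / 2 * Cexp (z + z)) =
  (Re p * Re z - Im p * Im z - Re (Z * Cexp z) - / 2 * (exp (Re z + Re z) * cos (Im z + Im z)))%R.
Proof.
  unfold Cminus. rewrite !re_plus, !re_opp, re_mult.
  replace (/ 2 : C) with (RtoC (/ 2)) by (rewrite RtoC_inv; [reflexivity | lra]).
  rewrite re_scal_l, Re_Cexp, re_plus, im_plus. ring.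
Qed.

Lemma mul_bound (u v B : R) : (Rabs v <= B)%R -> (- (u * v) <= Rabs u * B)%R.
Proof.
  intros H. eapply Rle_trans; [apply Rle_abs |]. rewrite Rabs_Ropp, Rabs_mult.
  apply Rmult_le_compat_l; [apply Rabs_pos | exact H].
Qed.

(** Completing the square lets half of the Gaussian term absorb the linear one; the
    other half provides the decay. *)
Lemma pcKer_bound p B f1 : (0 < Re p)%R -> (0 <= f1 < PI / 4)%R ->
  exists M, forall Z z, (Cmod Z <= B)%R -> (Rabs (Im z) <= f1)%R ->
    (Cmod (pcKer p Z z) <= M * exp (- (Re p * Rabs (Re z))))%R.
Proof.
  intros Hp Hf. set (k := (cos (f1 + f1) / 4)%R).
  assert (Hk : (0 < k)%R) by (unfold k; assert (0 < cos (f1 + f1))%R by (apply cos_gt_0; lra); lra).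
  exists (exp (Rabs (Im p) * f1 + B * B / (4 * k) + (Re p / 2 + Re p / 2) * (Re p / 2 + Re p / 2) / (2 * k)))%R.
  intros Z z HZ Hz. rewrite <- exp_plus. apply Cmod_le_exp. rewrite Re_pcKer_arg.
  pose proof (mul_bound (Im p) (Im z) f1 Hz) as T1.
  assert (T2 : (- Re (Z * Cexp z) <= B * exp (Re z))%R).
  { rewrite <- re_opp. eapply Rle_trans; [apply Re_le_Cmod |]. rewrite Cmod_opp, Cmod_mult, Cmod_Cexp.
    apply Rmult_le_compat_r; [apply Rlt_le, exp_pos | exact HZ]. }
  assert (T3 : (4 * k <= cos (Im z + Im z))%R).
  { replace (4 * k)%R with (cos (f1 + f1)) by (unfold k; field). apply cos_lower; [lra |].
    eapply Rle_trans; [apply Rabs_triang | lra]. }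
  pose proof (exp_pos (Re z + Re z)) as E2.
  assert (T4 : (k * 2 * exp (Re z + Re z) <= / 2 * (exp (Re z + Re z) * cos (Im z + Im z)))%R) by nra.
  assert (T5 : (B * exp (Re z) - k * exp (Re z + Re z) <= B * B / (4 * k))%R).
  { rewrite exp_plus. apply (Rmult_le_reg_r (4 * k)); [lra |].
    replace (B * B / (4 * k) * (4 * k))%R with (B * B)%R by (field; lra).
    pose proof (Rle_0_sqr (B - 2 * k * exp (Re z))) as S. unfold Rsqr in S. nra. }
  pose proof (expo_bound (Re p / 2) (Re p / 2) (Re p / 2) k k (Re z + Re z) ltac:(lra) ltac:(lra) ltac:(lra)) as T6.
  replace (Re z + Re z)%R with (2 * Re z)%R in T6 at 3 by ring.
  rewrite Rabs_mult, (Rabs_pos_eq 2) in T6 by lra. lra.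
Qed.

(** The derivative of the kernel is a combination of these three kernels, so that
    [CI_contour] and [CI_param_derive] apply. *)
Lemma pcKer_bound3 p B f1 : (0 < Re p)%R -> (0 <= f1 < PI / 4)%R ->
  exists M, forall Z z, (Cmod Z <= B)%R -> (Rabs (Im z) <= f1)%R ->
    (Cmod (pcKer p Z z) <= M * exp (- (Re p * Rabs (Re z))))%R /\
    (Cmod (pcKer (p + 1) Z z) <= M * exp (- (Re p * Rabs (Re z))))%R /\
    (Cmod (pcKer (p + 1 + 1) Z z) <= M * exp (- (Re p * Rabs (Re z))))%R.
Proof.
  intros Hp Hf.
  assert (R1 : Re (p + 1) = (Re p + 1)%R) by reflexivity.
  assert (R2 : Re (p + 1 + 1) = (Re p + 1 + 1)%R) by reflexivity.
  destruct (pcKer_bound p B f1 Hp Hf) as [M0 H0].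
  destruct (pcKer_bound (p + 1) B f1 ltac:(lra) Hf) as [M1 H1].
  destruct (pcKer_bound (p + 1 + 1) B f1 ltac:(lra) Hf) as [M2 H2].
  exists (Rmax M0 (Rmax M1 M2)). intros Z z HZ Hz.
  assert (W : forall q m c, (Re p <= c)%R -> (Cmod q <= m * exp (- (c * Rabs (Re z))))%R ->
     (m <= Rmax M0 (Rmax M1 M2))%R -> (Cmod q <= Rmax M0 (Rmax M1 M2) * exp (- (Re p * Rabs (Re z))))%R).
  { intros q m c Hc Hq Hm. eapply Rle_trans; [exact Hq |].
    assert (0 <= m)%R by (pose proof (Cmod_ge_0 q); pose proof (exp_pos (- (c * Rabs (Re z)))); nra).
    apply Rmult_le_compat; [lra | apply Rlt_le, exp_pos | exact Hm |].
    apply exp_le. pose proof (Rabs_pos (Re z)). nra. }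
  pose proof (Rmax_l M0 (Rmax M1 M2)). pose proof (Rmax_r M0 (Rmax M1 M2)).
  pose proof (Rmax_l M1 M2). pose proof (Rmax_r M1 M2).
  repeat split.
  - apply (W _ M0 (Re p)); [lra | apply H0; auto | lra].
  - apply (W _ M1 (Re (p + 1))); [lra | apply H1; auto | lra].
  - apply (W _ M2 (Re (p + 1 + 1))); [lra | apply H2; auto | lra].
Qed.

Lemma Im_line (x phi : R) : Im (x + Ci * phi) = phi. Proof. cbn. ring. Qed.
Lemma Re_line (x phi : R) : Re (x + Ci * phi) = x. Proof. cbn. ring. Qed.

Lemma rapid_pcKer p phi Z : (0 < Re p)%R -> (Rabs phi < PI / 4)%R ->
  rapid (fun x : R => pcKer p Z (x + Ci * phi)).
Proof.
  intros Hp Hf. destruct (pcKer_bound p (Cmod Z) (Rabs phi) Hp) as [M HM]; [split; [apply Rabs_pos | exact Hf] |].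
  split; [unfold pcKer; ctac |]. exists M, (Re p). split; [exact Hp |]. intros x.
  specialize (HM Z (x + Ci * phi) (Rle_refl _)). rewrite Im_line, Re_line in HM. apply HM, Rle_refl.
Qed.

Lemma Cd_pcInt p phi Z : (0 < Re p)%R -> (Rabs phi < PI / 4)%R ->
  Cd (pcInt p phi) Z (- pcInt (p + 1) phi Z).
Proof.
  intros Hp Hf. destruct (pcKer_bound3 p (Cmod Z + 1) (Rabs phi) Hp) as [M HM]; [split; [apply Rabs_pos | exact Hf] |].
  assert (Hp1 : (0 < Re (p + 1))%R) by (change (0 < Re p + 1)%R; lra).
  replace (- pcInt (p + 1) phi Z) with (CI (fun x : R => - (1) * pcKer (p + 1) Z (x + Ci * phi)))
    by (rewrite CI_scal by (apply rapid_pcKer; auto); unfold pcInt; ring).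
  assert (Nr : forall z, near Z 1 z -> (Cmod z <= Cmod Z + 1)%R).
  { intros z Hz. replace z with (Z + (z - Z)) by ring. eapply Rle_trans; [apply Cmod_triangle |].
    unfold near in Hz. lra. }
  apply (CI_param_derive (fun z (x : R) => pcKer p z (x + Ci * phi)) (fun z (x : R) => - (1) * pcKer (p + 1) z (x + Ci * phi))
     Z 1 M (Re p)); auto; [lra | | | |].
  - intros z x _. eapply Cd_eq; [apply Cd_pcKer_param | ring].
  - intros z x _. unfold pcKer. ctac.
  - intros z _. unfold pcKer. ctac.
  - intros z Hz. split; intros x; destruct (HM z (x + Ci * phi) (Nr z Hz)) as [A1 [A2 _]];
      rewrite ?Im_line; try apply Rle_refl; rewrite Re_line in *.
    + exact A1.
    + rewrite Cmod_mult, Cmod_opp, Cmod_1, Rmult_1_l. exact A2.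
Qed.

(** The integral of the total derivative of the kernel vanishes. *)
Lemma pcInt_rec p phi Z : (0 < Re p)%R -> (Rabs phi < PI / 4)%R ->
  p * pcInt p phi Z - Z * pcInt (p + 1) phi Z - pcInt (p + 1 + 1) phi Z = 0.
Proof.
  intros Hp Hf.
  assert (Hp1 : (0 < Re (p + 1))%R) by (change (0 < Re p + 1)%R; lra).
  assert (Hp2 : (0 < Re (p + 1 + 1))%R) by (change (0 < Re p + 1 + 1)%R; lra).
  pose proof (rapid_pcKer p phi Z Hp Hf) as G0. pose proof (rapid_pcKer (p + 1) phi Z Hp1 Hf) as G1.
  pose proof (rapid_pcKer (p + 1 + 1) phi Z Hp2 Hf) as G2.
  unfold pcInt. rewrite <- (CI_scal p), <- (CI_scal Z), <- !CI_minus; auto using rapid_scal, rapid_minus.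
  apply (CI_derive_zero (fun x : R => pcKer p Z (x + Ci * phi))); auto using rapid_scal, rapid_minus.
  intros x. apply (Cd_Rd' (fun z => pcKer p Z (z + Ci * phi))).
  eapply Cd_eq; [apply (Cd_comp (fun z => z + Ci * phi) (pcKer p Z)); [apply Cd_pcKer | dtac] |]. ring.
Qed.

Lemma pcInt_rotate p phi Z : (0 < Re p)%R -> (Rabs phi < PI / 4)%R -> pcInt p phi Z = pcInt p 0 Z.
Proof.
  intros Hp Hf. pose proof PI_RGT_0 as Ppi. pose proof (Rabs_pos phi) as Pf.
  set (f1 := ((Rabs phi + PI / 4) / 2)%R). assert (Hf1 : (0 < f1 < PI / 4)%R) by (unfold f1; lra).
  destruct (pcKer_bound3 p (Cmod Z) f1 Hp ltac:(lra)) as [M HM].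
  assert (HS : forall z, strip (- f1) f1 z -> (Rabs (Im z) <= f1)%R) by (intros z [A B]; apply Rabs_le_between; lra).
  assert (S0 : sb M (Re p) (- f1) f1 (pcKer p Z)) by (intros z Hz; exact (proj1 (HM Z z (Rle_refl _) (HS z Hz)))).
  assert (Sp : forall psi, (Rabs psi <= Rabs phi)%R -> strip (- f1) f1 (Ci * psi)).
  { intros psi Hpsi. unfold strip. replace (Im (Ci * psi)) with psi by (cbn; ring).
    apply Rabs_le_between in Hpsi. unfold f1. lra. }
  pose proof (sb_pos _ _ _ _ _ _ (Sp phi (Rle_refl _)) S0) as PM.
  pose proof (Cmod_ge_0 p) as Pp. pose proof (Cmod_ge_0 Z) as PZ.
  set (N := (M + Cmod p * M + Cmod Z * M + M)%R).
  unfold pcInt. apply (CI_contour N (Re p) (- f1) f1 (pcKer p Z)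
    (fun z => p * pcKer p Z z - Z * pcKer (p + 1) Z z - pcKer (p + 1 + 1) Z z)); auto.
  - intros w _. apply Cd_pcKer.
  - intros w _. unfold pcKer. ctac.
  - apply (sb_weaken M (Re p)); [split; [exact PM | unfold N; nra] | lra | exact S0].
  - intros z Hz. destruct (HM Z z (Rle_refl _) (HS z Hz)) as [A0 [A1 A2]].
    set (X := exp (- (Re p * Rabs (Re z)))) in *. assert (PX : (0 < X)%R) by apply exp_pos.
    eapply Rle_trans; [apply Cmod_triangle' |].
    eapply Rle_trans; [apply Rplus_le_compat_r, Cmod_triangle' |]. rewrite !Cmod_mult.
    assert (B0 : (Cmod p * Cmod (pcKer p Z z) <= Cmod p * (M * X))%R) by (apply Rmult_le_compat_l; auto).
    assert (B1 : (Cmod Z * Cmod (pcKer (p + 1) Z z) <= Cmod Z * (M * X))%R) by (apply Rmult_le_compat_l; auto).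
    unfold N. nra.
  - apply Sp. rewrite ?Rabs_R0. lra.
  - apply Sp. rewrite ?Rabs_R0. lra.
Qed.

(** In the variable zeta with Z^2 / 2 = Cexp zeta, this becomes a solution of Kummer's
    equation with parameters p / 2 and 1 / 2. *)
Definition HW (p : C) (phi : R) (zeta : C) : C := pcInt p phi (Cexp (/ 2 * (zeta + ln 2))).

Lemma HW_ksol p phi : (0 < Re p)%R -> (Rabs phi < PI / 4)%R -> forall z,
  ksol (/ 2 * p) (/ 2) (HW p phi)
    (fun z => - / 2 * Cexp (/ 2 * (z + ln 2)) * pcInt (p + 1) phi (Cexp (/ 2 * (z + ln 2)))) z.
Proof.
  intros Hp Hf z.
  assert (Hp1 : (0 < Re (p + 1))%R) by (change (0 < Re p + 1)%R; lra).
  assert (DZ : Cd (fun z => Cexp (/ 2 * (z + ln 2))) z (/ 2 * Cexp (/ 2 * (z + ln 2)))).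
  { Cd_solve. ring. }
  set (Z := Cexp (/ 2 * (z + ln 2))) in *.
  split.
  - eapply Cd_eq; [apply (Cd_comp (fun z => Cexp (/ 2 * (z + ln 2))) (pcInt p phi)); [apply Cd_pcInt; auto | exact DZ] |].
    fold Z. ring.
  - eapply Cd_eq.
    + apply (Cd_mult (fun z => - / 2 * Cexp (/ 2 * (z + ln 2))) (fun z => pcInt (p + 1) phi (Cexp (/ 2 * (z + ln 2))))).
      * apply Cd_scal, DZ.
      * apply (Cd_comp (fun z => Cexp (/ 2 * (z + ln 2))) (pcInt (p + 1) phi)); [apply Cd_pcInt; auto | exact DZ].
    + cbv beta. unfold HW. fold Z.
      assert (EZ : Cexp z = / 2 * (Z * Z)).
      { unfold Z. rewrite <- Cexp_plus. replace (/ 2 * (z + ln 2) + / 2 * (z + ln 2)) with (z + ln 2) by field.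
        rewrite Cexp_plus, Cexp_R, exp_ln by lra. field. }
      rewrite EZ.
      pose proof (pcInt_rec p phi Z Hp Hf) as Rc.
      assert (E2 : pcInt (p + 1 + 1) phi Z = p * pcInt p phi Z - Z * pcInt (p + 1) phi Z).
      { replace (pcInt (p + 1 + 1) phi Z) with (p * pcInt p phi Z - Z * pcInt (p + 1) phi Z -
          (p * pcInt p phi Z - Z * pcInt (p + 1) phi Z - pcInt (p + 1 + 1) phi Z)) by ring. rewrite Rc. ring. }
      rewrite E2. field.
Qed.

(** Dropping the Gaussian factor leaves a Gamma integral along a ray of argument Im
    zeta / 2 + phi. At the point x, the relative error of dropping it is e^(2 x),
    which amounts to 1 / Z^2 after integration. The free angle phi lets zeta range
    over the whole sector. *)
Lemma HW_asym p y1 : (0 < Re p < 1)%R -> (0 < y1 < PI / 2)%R ->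
  exists K, forall (phi : R) zeta, (Rabs (Im zeta) <= 3 / 2 * PI)%R -> (Rabs phi < PI / 4)%R ->
    (Rabs (Im zeta / 2 + phi) <= y1)%R ->
    (Cmod (Cexp (/ 2 * p * ln 2) * / Gam p * HW p phi zeta * Cexp (/ 2 * p * zeta) - 1) <= K * exp (- Re zeta))%R.
Proof.
  intros Hp Hy. set (k := cos y1). assert (Hk : (0 < k)%R) by (apply cos_gt_0; lra).
  pose proof (Gam_neq_0 p Hp) as NG. assert (PG : (0 < Cmod (Gam p))%R) by (apply Cmod_gt_0, NG).
  set (a2 := (Re p + 2)%R). set (M0 := exp (Rabs (Im p) * PI + (a2 + a2) * (a2 + a2) / (2 * k))%R).
  exists (/ Cmod (Gam p) * (2 * M0 / a2) * exp (Rabs (Im p) * PI))%R.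
  intros phi zeta Hz Hf Ha.
  set (lam := / 2 * (zeta + ln 2) + Ci * phi).
  assert (Il : Im lam = (Im zeta / 2 + phi)%R) by (unfold lam; destruct zeta; cbn; field).
  assert (Rl : Re lam = (/ 2 * (Re zeta + ln 2))%R) by (unfold lam; destruct zeta; cbn; field).
  assert (Hl : (Rabs (Im lam) < PI / 2)%R) by (rewrite Il; lra).
  set (Z := Cexp (/ 2 * (zeta + ln 2))).
  assert (EZ : forall z, Z * Cexp (z + Ci * phi) = Cexp (z + lam)).
  { intros z. unfold Z, lam. rewrite <- Cexp_plus. f_equal. ring. }
  (* the leading integrand *)
  set (L := fun x : R => Cexp (- p * (/ 2 * (zeta + ln 2))) * Gk p (x + lam)).
  assert (GL : rapid L) by (unfold L; apply rapid_scal, rapid_Gk_line; [lra | exact Hl]).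
  assert (EL : CI L = Cexp (- p * (/ 2 * (zeta + ln 2))) * Gam p).
  { unfold L. rewrite CI_scal by (apply rapid_Gk_line; [lra | exact Hl]). rewrite Gam_rotate; [reflexivity | lra | exact Hl]. }
  assert (GH : rapid (fun x : R => pcKer p Z (x + Ci * phi))) by (apply rapid_pcKer; [lra | exact Hf]).
  set (D := fun x : R => pcKer p Z (x + Ci * phi) - L x).
  assert (GD : rapid D) by (apply rapid_minus; auto).
  assert (ED : HW p phi zeta - CI L = CI D) by (unfold D; rewrite CI_minus; auto).
  assert (FD : forall x, D x = L x * (Cexp (- (/ 2 * Cexp ((x + Ci * phi) + (x + Ci * phi)))) - 1)).
  { intros x. unfold D, L, pcKer, Gk. rewrite EZ.
    replace (p * (x + Ci * phi) - Cexp (x + lam) - / 2 * Cexp (x + Ci * phi + (x + Ci * phi)))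
      with (- p * (/ 2 * (zeta + ln 2)) + (p * (x + lam) - Cexp (x + lam)) + - (/ 2 * Cexp (x + Ci * phi + (x + Ci * phi))))
      by (unfold lam; ring).
    rewrite !Cexp_plus. ring. }
  (* after shifting x by - Re lam the remainder is uniformly small *)
  assert (BD : eb (M0 * exp (- (a2 * Re lam))) a2 (fun x : R => D (x + - Re lam)%R)).
  { intros x. rewrite FD, Cmod_mult.
    assert (B1 : (Cmod (Cexp (- (/ 2 * Cexp (RtoC (x + - Re lam) + Ci * phi + (RtoC (x + - Re lam) + Ci * phi)))) - 1)
       <= exp (2 * x - 2 * Re lam))%R).
    { set (w := RtoC (x + - Re lam) + Ci * phi + (RtoC (x + - Re lam) + Ci * phi)).
      assert (Rw : Re w = (2 * x - 2 * Re lam)%R) by (unfold w; cbn; ring).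
      assert (Iw : Im w = (2 * phi)%R) by (unfold w; cbn; ring).
      assert (Hh : - (/ 2 * Cexp w) = RtoC (- / 2) * Cexp w) by (rewrite RtoC_opp, RtoC_inv by lra; ring).
      rewrite Hh. eapply Rle_trans; [apply Cmod_Cexp_m1_neg |].
      - rewrite re_scal_l, Re_Cexp, Iw. apply Rabs_lt_between in Hf.
        pose proof (cos_gt_0 (2 * phi) ltac:(lra) ltac:(lra)). pose proof (exp_pos (Re w)). nra.
      - rewrite Cmod_mult, Cmod_R, Cmod_Cexp, Rw. rewrite Rabs_left by lra.
        pose proof (exp_pos (2 * x - 2 * Re lam)). lra. }
    assert (B2 : (Cmod (L (x + - Re lam)%R) <= exp (- (Re p * Re lam) + Rabs (Im p) * PI + Re p * x - k * exp x))%R).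
    { unfold L, Gk. rewrite <- Cexp_plus. apply Cmod_le_exp. rewrite re_plus, Re_Gk.
      replace (Re (RtoC (x + - Re lam) + lam)) with x by (cbn; ring).
      replace (Im (RtoC (x + - Re lam) + lam)) with (Im lam) by (cbn; ring).
      replace (Re (- p * (/ 2 * (zeta + ln 2)))) with (- (Re p * Re lam) + Im p * (Im lam - phi))%R
        by (rewrite Rl, Il; destruct p, zeta; cbn; field).
      assert (Hc : (k <= cos (Im lam))%R) by (apply cos_lower; [lra | rewrite Il; exact Ha]).
      assert (Hpi : (- (Im p * phi) <= Rabs (Im p) * PI)%R) by (apply mul_bound; pose proof PI_RGT_0; lra).
      pose proof (exp_pos x). nra. }
    eapply Rle_trans; [apply Rmult_le_compat; [apply Cmod_ge_0 | apply Cmod_ge_0 | exact B2 | exact B1] |].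
    unfold M0. rewrite <- !exp_plus. apply exp_le.
    pose proof (expo_bound a2 a2 a2 k k x ltac:(unfold a2; lra) ltac:(lra) ltac:(lra)) as E.
    unfold a2 in *. lra. }
  assert (CD : (Cmod (CI D) <= 2 * (M0 * exp (- (a2 * Re lam))) / a2)%R).
  { rewrite <- (CI_shift D (- Re lam)%R GD).
    apply CI_bound; [apply (proj1 (rapid_shift D (- Re lam)%R GD)) | unfold a2; lra | exact BD]. }
  replace (Cexp (/ 2 * p * ln 2) * / Gam p * HW p phi zeta * Cexp (/ 2 * p * zeta) - 1)
    with (Cexp (/ 2 * p * (zeta + ln 2)) * / Gam p * CI D).
  2:{ rewrite <- ED, EL. replace (/ 2 * p * (zeta + ln 2)) with (/ 2 * p * ln 2 + / 2 * p * zeta) by ring.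
      assert (Ei : Cexp (- p * (/ 2 * (zeta + ln 2))) = / (Cexp (/ 2 * p * ln 2) * Cexp (/ 2 * p * zeta))).
      { rewrite <- Cexp_plus, <- Cexp_opp. f_equal. ring. }
      rewrite Ei, Cexp_plus. field. auto using Cexp_neq_0. }
  rewrite !Cmod_mult, Cmod_inv, Cmod_Cexp by exact NG.
  assert (Re1 : (Re (/ 2 * p * (zeta + ln 2)) <= Re p * Re lam + Rabs (Im p) * PI)%R).
  { replace (Re (/ 2 * p * (zeta + ln 2))) with (Re p * Re lam - Im p * (Im zeta / 2))%R
      by (rewrite Rl; destruct p, zeta; cbn; field).
    assert (- (Im p * (Im zeta / 2)) <= Rabs (Im p) * PI)%R; [| lra].
    apply mul_bound. unfold Rdiv. rewrite Rabs_mult, (Rabs_pos_eq (/ 2)) by lra. pose proof PI_RGT_0. lra. }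
  assert (Hfin : (exp (Re p * Re lam + Rabs (Im p) * PI) * exp (- (a2 * Re lam)) <= exp (Rabs (Im p) * PI) * exp (- Re zeta))%R).
  { rewrite <- !exp_plus. apply exp_le. unfold a2. rewrite Rl.
    assert (0 < ln 2)%R by (rewrite <- ln_1; apply ln_increasing; lra). lra. }
  assert (PM : (0 < M0)%R) by apply exp_pos. assert (Pa : (0 < a2)%R) by (unfold a2; lra).
  assert (Hex : (exp (Re (/ 2 * p * (zeta + ln 2))) <= exp (Re p * Re lam + Rabs (Im p) * PI))%R) by (apply exp_le, Re1).
  assert (Pi : (0 < / Cmod (Gam p))%R) by (apply Rinv_0_lt_compat, PG).
  apply Rle_trans with (exp (Re p * Re lam + Rabs (Im p) * PI) * / Cmod (Gam p) * (2 * (M0 * exp (- (a2 * Re lam))) / a2))%R.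
  - apply Rmult_le_compat; [apply Rmult_le_pos; [apply Rlt_le, exp_pos | lra] | apply Cmod_ge_0 | | exact CD].
    apply Rmult_le_compat_r; lra.
  - replace (exp (Re p * Re lam + Rabs (Im p) * PI) * / Cmod (Gam p) * (2 * (M0 * exp (- (a2 * Re lam))) / a2))%R
      with (/ Cmod (Gam p) * (2 * M0 / a2) * (exp (Re p * Re lam + Rabs (Im p) * PI) * exp (- (a2 * Re lam))))%R by (field; lra).
    rewrite (Rmult_assoc _ (exp (Rabs (Im p) * PI))). apply Rmult_le_compat_l; [| exact Hfin].
    apply Rmult_le_pos; [lra |]. apply Rdiv_le_0_compat; lra.
Qed.

(** The normalisation makes the leading term Cexp (- (p / 2) zeta). *)
Definition HU (p : C) (phi : R) (zeta : C) : C := Cexp (/ 2 * p * ln 2) * / Gam p * HW p phi zeta.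

Lemma HU_ksol p phi : (0 < Re p)%R -> (Rabs phi < PI / 4)%R ->
  exists W1, forall z, ksol (/ 2 * p) (/ 2) (HU p phi) W1 z.
Proof.
  intros Hp Hf. eexists. intros z. pose proof (HW_ksol p phi Hp Hf z) as H.
  destruct (ksol_lin _ _ _ _ _ _ (Cexp (/ 2 * p * ln 2) * / Gam p) 0 z H H) as [A B].
  split.
  - eapply Cd_ext; [| exact A]. intros w. unfold HU. ring.
  - eapply Cd_eq; [exact B |]. cbv beta. unfold HU. ring.
Qed.

Lemma exp_neg_small K e : (0 < e)%R -> exists M : R, (0 <= M)%R /\ forall x : R, (M < x)%R -> (K * exp (- x) < e)%R.
Proof.
  intros He. destruct (exp_small 1 K e ltac:(lra) He) as [N HN]. exists (INR N).
  split; [apply pos_INR |]. intros x Hx. specialize (HN x ltac:(lra)).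
  replace (- (1 * x))%R with (- x)%R in HN by ring. exact HN.
Qed.

Lemma HU_rotate p phi zeta : (0 < Re p < 1)%R -> (Rabs phi < PI / 4)%R -> HU p phi zeta = HU p 0 zeta.
Proof. intros Hp Hf. unfold HU, HW. rewrite pcInt_rotate; [reflexivity | lra | exact Hf]. Qed.

(** All the rotated integrals are the same function, so at each zeta the asymptotics
    may be read off with the angle phi = - Im zeta / 6, for which both constraints of
    [HW_asym] hold. *)
Lemma tricomiU_half p zeta : (0 < Re p < 1)%R -> tricomiU (/ 2 * p) (/ 2) zeta = HU p 0 zeta.
Proof.
  intros Hp. assert (H0 : (Rabs 0 < PI / 4)%R) by (rewrite Rabs_R0; pose proof PI_RGT_0; lra).
  apply tricomiU_eq. split.
  - destruct (HU_ksol p 0 ltac:(lra) H0) as [W1 HW1]. apply (kummer_of_ksol _ _ _ W1 HW1).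
  - intros d0 Hd0 e He. pose proof PI_RGT_0 as Ppi.
    set (d := Rmin d0 (PI / 4)). assert (Hd : (0 < d <= PI / 4)%R).
    { unfold d. split; [apply Rmin_pos; lra | apply Rmin_r]. }
    destruct (HW_asym p (PI / 2 - d / 6) Hp ltac:(lra)) as [K HK].
    destruct (exp_neg_small K e He) as [M [_ HM]]. exists M. intros z Hz HzM.
    assert (Hz' : (Rabs (Im z) <= 3 / 2 * PI - d)%R) by (pose proof (Rmin_l d0 (PI / 4)); unfold d; lra).
    set (phi := (- Im z / 6)%R).
    assert (Hphi : (Rabs phi = Rabs (Im z) / 6)%R).
    { unfold phi, Rdiv. rewrite Rabs_mult, Rabs_Ropp, (Rabs_pos_eq (/ 6)) by lra. reflexivity. }
    rewrite <- (HU_rotate p phi z Hp) by lra.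
    unfold Cdiv. rewrite <- Cexp_opp. replace (- (- (/ 2 * p) * z)) with (/ 2 * p * z) by ring.
    eapply Rle_lt_trans; [| apply (HM _ HzM)].
    apply HK; [lra | lra |].
    unfold phi. replace (Im z / 2 + - Im z / 6)%R with (Im z * / 3)%R by field.
    rewrite Rabs_mult, (Rabs_pos_eq (/ 3)) by lra. lra.
Qed.

(** * The parabolic cylinder function as a Laplace integral *)

Definition pcLaplace (p z : C) : C := / Gam p * Cexp (- (/ 4 * (z * z))) * pcInt p 0 z.

Lemma Csq (z : C) : z ^ 2 = z * z. Proof. cbn. ring. Qed.

Lemma parcylD_log_eq p zeta : (0 < Re p < 1)%R -> parcylD_log (- p) zeta = pcLaplace p (Cexp zeta).
Proof.
  intros Hp. unfold parcylD_log.
  replace (- (- p / 2)) with (/ 2 * p) by field.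
  replace (1 / 2) with (/ 2 : C) by (unfold Cdiv; ring).
  rewrite tricomiU_half by exact Hp. unfold HU, HW, pcLaplace, Rcpow.
  replace (/ 2 * (2 * zeta - ln 2 + ln 2)) with zeta by field.
  replace (- p / 2 * ln 2) with (- (/ 2 * p * ln 2)) by field.
  rewrite Cexp_opp, Csq. replace (Cexp zeta * Cexp zeta / 4) with (/ 4 * (Cexp zeta * Cexp zeta)) by field.
  field. split; [apply Gam_neq_0, Hp | apply Cexp_neq_0].
Qed.

Lemma contC_DI p z : (0 < Re p < 1)%R -> @contC C_UniformSpace (pcLaplace p) z.
Proof.
  intros Hp. unfold pcLaplace. apply contC_mult; [ctac |].
  eapply Cd_cont. apply Cd_pcInt; [lra | rewrite Rabs_R0; pose proof PI_RGT_0; lra].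
Qed.

(** At z = 0 the left side is a limit, and the right side is continuous. *)
Lemma parcylD_eq p z : (0 < Re p < 1)%R -> parcylD (- p) z = pcLaplace p z.
Proof.
  intros Hp. unfold parcylD. destruct (Ceq_dec z 0) as [E | N].
  - subst z. apply is_C_lim_unique. pose proof (contC_DI p (RtoC 0) Hp) as Cn.
    intros P HP. specialize (Cn P HP).
    destruct Cn as [d Hd]. exists d. intros w Hw Hn.
    rewrite parcylD_log_eq by exact Hp. rewrite Cexp_Clog by exact Hn. apply Hd, Hw.
  - rewrite parcylD_log_eq by exact Hp. rewrite Cexp_Clog by exact N. reflexivity.
Qed.

(** * Gamma integrals along a fixed ray, as functions of the rate *)

(** The Gamma kernel with a complex rate P; [rayInt] below integrates it along the ray
    of argument [be], and converges for Re (P e^(i be)) > 0. *)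
Definition rayKer (q P w : C) : C := Cexp (q * w - P * Cexp w).
Definition rayInt (q : C) (be : R) (P : C) : C := CI (fun y : R => rayKer q P (y + Ci * be)).

Lemma rayKer_succ q P w : Cexp w * rayKer q P w = rayKer (q + 1) P w.
Proof. unfold rayKer. rewrite <- Cexp_plus. f_equal. ring. Qed.

Lemma Cexp_line (x be : R) : Cexp (x + Ci * be) = RtoC (exp x) * Cexp (Ci * be).
Proof. rewrite Cexp_plus, Cexp_R. reflexivity. Qed.

Definition ekM (q0 qi k be : R) : R := exp (qi * be + (q0 + q0) * (q0 + q0) / (2 * k))%R.

Lemma rayKer_bound q P (be k y : R) : (0 < Re q)%R -> (0 < k)%R -> (k <= Re (P * Cexp (Ci * be)))%R ->
  (Cmod (rayKer q P (y + Ci * be)) <= ekM (Re q) (Rabs (Im q)) k (Rabs be) * exp (- (Re q * Rabs y)))%R.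
Proof.
  intros Hq Hk HP. unfold ekM. rewrite <- exp_plus. apply Cmod_le_exp.
  rewrite Cexp_line.
  replace (P * (RtoC (exp y) * Cexp (Ci * be))) with (RtoC (exp y) * (P * Cexp (Ci * be))) by ring.
  unfold Cminus. rewrite re_plus, re_opp, re_scal_l, re_mult, Re_line, Im_line.
  pose proof (mul_bound (Im q) be (Rabs be) (Rle_refl _)).
  pose proof (expo_bound (Re q) (Re q) (Re q) k _ y Hq ltac:(lra) (conj Hk HP)). lra.
Qed.

Lemma rapid_rayKer q P (be : R) : (0 < Re q)%R -> (0 < Re (P * Cexp (Ci * be)))%R ->
  rapid (fun y : R => rayKer q P (y + Ci * be)).
Proof.
  intros Hq HP. split; [unfold rayKer; ctac |].
  eexists _, (Re q). split; [exact Hq |]. intros y. apply (rayKer_bound q P be _ y Hq HP (Rle_refl _)).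
Qed.

Lemma rayInt_bound q P (be : R) k : (0 < Re q)%R -> (0 < k)%R -> (k <= Re (P * Cexp (Ci * be)))%R ->
  (Cmod (rayInt q be P) <= 2 * ekM (Re q) (Rabs (Im q)) k (Rabs be) / Re q)%R.
Proof.
  intros Hq Hk HP. apply CI_bound; [apply rapid_rayKer; lra | exact Hq |].
  intros y. apply rayKer_bound; auto.
Qed.

Lemma Cmod_Ci_exp (be : R) : Cmod (Cexp (Ci * be)) = 1%R.
Proof. rewrite Cmod_Cexp. replace (Re (Ci * be)) with 0%R by (cbn; ring). apply exp_0. Qed.

Lemma Cd_rayInt q (be : R) P : (0 < Re q)%R -> (0 < Re (P * Cexp (Ci * be)))%R ->
  Cd (rayInt q be) P (- rayInt (q + 1) be P).
Proof.
  intros Hq HP. assert (Hq1 : (0 < Re (q + 1))%R) by (change (0 < Re q + 1)%R; lra).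
  set (k := (Re (P * Cexp (Ci * be)) / 2)%R). assert (Hk : (0 < k)%R) by (unfold k; lra).
  replace (- rayInt (q + 1) be P) with (CI (fun y : R => - (1) * rayKer (q + 1) P (y + Ci * be)))
    by (rewrite CI_scal by (apply rapid_rayKer; auto); unfold rayInt; ring).
  assert (Nr : forall z, near P k z -> (k <= Re (z * Cexp (Ci * be)))%R).
  { intros z Hz. unfold near in Hz.
    replace (z * Cexp (Ci * be)) with (P * Cexp (Ci * be) + (z - P) * Cexp (Ci * be)) by ring.
    rewrite re_plus. pose proof (re_le_Cmod ((z - P) * Cexp (Ci * be))) as B.
    rewrite Cmod_mult, Cmod_Ci_exp in B. apply Rabs_le_between in B. unfold k in *. lra. }
  set (M1 := ekM (Re q) (Rabs (Im q)) k (Rabs be)). set (M2 := ekM (Re (q + 1)) (Rabs (Im (q + 1))) k (Rabs be)).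
  apply (CI_param_derive (fun z (y : R) => rayKer q z (y + Ci * be)) (fun z (y : R) => - (1) * rayKer (q + 1) z (y + Ci * be))
     P k (Rmax M1 M2) (Re q)); auto.
  - intros z y _. rewrite <- rayKer_succ. eapply Cd_eq; [unfold rayKer; dtac |]. unfold rayKer. ring.
  - intros z y _. unfold rayKer. ctac.
  - intros z _. unfold rayKer. ctac.
  - intros z Hz. pose proof (Nr z Hz) as Hn. split.
    + apply (eb_weaken M1 (Re q)); [apply Rmax_l | lra |]. intros y. apply rayKer_bound; auto.
    + apply (eb_weaken M2 (Re (q + 1))); [apply Rmax_r | change (Re q <= Re q + 1)%R; lra |]. intros y.
      rewrite Cmod_mult, Cmod_opp, Cmod_1, Rmult_1_l. apply rayKer_bound; auto.
Qed.

Lemma rayInt_rec q (be : R) P : (0 < Re q)%R -> (0 < Re (P * Cexp (Ci * be)))%R ->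
  P * rayInt (q + 1) be P = q * rayInt q be P.
Proof.
  intros Hq HP. assert (Hq1 : (0 < Re (q + 1))%R) by (change (0 < Re q + 1)%R; lra).
  pose proof (rapid_rayKer q P be Hq HP) as G0. pose proof (rapid_rayKer (q + 1) P be Hq1 HP) as G1.
  assert (E : q * rayInt q be P - P * rayInt (q + 1) be P = 0).
  { unfold rayInt. rewrite <- (CI_scal q), <- (CI_scal P), <- CI_minus; auto using rapid_scal.
    apply (CI_derive_zero (fun y : R => rayKer q P (y + Ci * be))); auto using rapid_scal, rapid_minus.
    intros x. apply (Cd_Rd' (fun z => rayKer q P (z + Ci * be))).
    rewrite <- rayKer_succ. eapply Cd_eq; [unfold rayKer; dtac |]. unfold rayKer. ring. }
  replace (q * rayInt q be P) with ((q * rayInt q be P - P * rayInt (q + 1) be P) + P * rayInt (q + 1) be P) by ring.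
  rewrite E. ring.
Qed.

(** * Kummer's equation with a = 1/2, b = 1: a double integral representation *)

(** [al] and [be] are the arguments of the rays of integration for p = e^(x + i al)
    and q = e^(y + i be). The condition makes the rate 1 + p of the inner integral
    admissible all along the outer ray. *)
Definition admis al be : Prop := (Rabs be < PI / 2)%R /\ (Rabs (al + be) < PI / 2)%R.

(** The double integral of exp (- z p - q - p q) (p q)^(1 / 2) dp dq / (p q) with z =
    Cexp zeta, and with an extra power of p in general: [dblKer] is the outer
    integrand. Keeping the inner integral avoids a choice of the square root of 1 + p.
    *)
Definition dblKer (q : C) (be : R) (zeta w : C) : C :=
  Cexp (q * w - Cexp zeta * Cexp w) * rayInt (/ 2) be (1 + Cexp w).
Definition dblInt (q : C) (al be : R) (zeta : C) : C := CI (fun x : R => dblKer q be zeta (x + Ci * al)).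

Lemma rate_lower (be : R) w : (Rabs be < PI / 2)%R -> (Rabs (Im w + be) < PI / 2)%R ->
  (cos be <= Re ((1 + Cexp w) * Cexp (Ci * be)))%R.
Proof.
  intros H1 H2. rewrite Cmult_plus_distr_r, Cmult_1_l, <- Cexp_plus, re_plus, !Re_Cexp.
  replace (Re (Ci * be)) with 0%R by (cbn; ring). replace (Im (Ci * be)) with be by (cbn; ring).
  replace (Im (w + Ci * be)) with (Im w + be)%R by (destruct w; cbn; ring).
  rewrite exp_0. apply Rabs_lt_between in H2.
  pose proof (cos_gt_0 (Im w + be) ltac:(lra) ltac:(lra)). pose proof (exp_pos (Re (w + Ci * be))). nra.
Qed.

Lemma cos_pos_abs y : (Rabs y < PI / 2)%R -> (0 < cos y)%R.
Proof. intros H. apply Rabs_lt_between in H. apply cos_gt_0; lra. Qed.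

Lemma rate_pos (be : R) w : (Rabs be < PI / 2)%R -> (Rabs (Im w + be) < PI / 2)%R ->
  (0 < Re ((1 + Cexp w) * Cexp (Ci * be)))%R.
Proof. intros H1 H2. eapply Rlt_le_trans; [apply (cos_pos_abs be H1) | apply rate_lower; auto]. Qed.

Lemma Re_half : Re (/ 2) = (/ 2)%R.
Proof. rewrite <- RtoC_inv by lra. reflexivity. Qed.
Lemma Im_half : Im (/ 2) = 0%R.
Proof. rewrite <- RtoC_inv by lra. reflexivity. Qed.

Lemma dblKer_succ q (be : R) zeta w : Cexp w * dblKer q be zeta w = dblKer (q + 1) be zeta w.
Proof. unfold dblKer. rewrite Cmult_assoc, <- Cexp_plus. f_equal. f_equal. ring. Qed.

Lemma outer_bound (q : C) (y1 B : R) (zeta w : C) : (0 < Re q)%R -> (0 <= y1 < PI / 2)%R ->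
  (0 < B <= exp (Re zeta))%R -> (Rabs (Im zeta + Im w) <= y1)%R -> (Rabs (Im w) <= PI)%R ->
  (Cmod (Cexp (q * w - Cexp zeta * Cexp w)) <=
    exp (Rabs (Im q) * PI + (Re q + Re q) * (Re q + Re q) / (2 * (B * cos y1))) * exp (- (Re q * Rabs (Re w))))%R.
Proof.
  intros Hq Hy HB Hc Hwp.
  assert (Hcy : (0 < cos y1)%R) by (apply cos_gt_0; lra).
  rewrite <- exp_plus. apply Cmod_le_exp. unfold Cminus. rewrite re_plus, re_opp, re_mult.
  rewrite <- Cexp_plus, Re_Cexp, re_plus, im_plus, exp_plus.
  pose proof (mul_bound (Im q) (Im w) PI Hwp) as T1.
  pose proof (cos_lower y1 (Im zeta + Im w) ltac:(lra) Hc) as T2.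
  assert (Bc : (B * cos y1 <= exp (Re zeta) * cos (Im zeta + Im w))%R) by (apply Rmult_le_compat; lra).
  pose proof (expo_bound (Re q) (Re q) (Re q) (B * cos y1) (exp (Re zeta) * cos (Im zeta + Im w)) (Re w) Hq ltac:(lra)
    ltac:(split; [nra | exact Bc])). lra.
Qed.

(** The outer kernel is a Gamma kernel times an inner integral that stays bounded,
    because the real part of the rotated rate is at least cos be. *)
Lemma dblKer_bound q (be : R) (y1 : R) : (0 < Re q)%R -> (Rabs be < PI / 2)%R -> (0 <= y1 < PI / 2)%R ->
  exists M, forall B zeta w, (0 < B)%R -> (Rabs (Im w + be) < PI / 2)%R -> (B <= exp (Re zeta))%R ->
    (Rabs (Im zeta + Im w) <= y1)%R -> (Rabs (Im w) <= PI)%R ->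
    (Cmod (dblKer q be zeta w) <= exp (Rabs (Im q) * PI + (Re q + Re q) * (Re q + Re q) / (2 * (B * cos y1))) * M
       * exp (- (Re q * Rabs (Re w))))%R.
Proof.
  intros Hq Hb Hy. exists (2 * ekM (/ 2) (Rabs 0) (cos be) (Rabs be) / / 2)%R.
  intros B zeta w HB Hw HBz Hc Hwp.
  unfold dblKer. rewrite Cmod_mult.
  rewrite Rmult_assoc, (Rmult_comm (2 * ekM (/ 2) (Rabs 0) (cos be) (Rabs be) / / 2)), <- Rmult_assoc.
  apply Rmult_le_compat; try apply Cmod_ge_0.
  - apply outer_bound; auto.
  - pose proof (rayInt_bound (/ 2) (1 + Cexp w) be (cos be)) as T. rewrite Re_half, Im_half in T.
    apply T; [lra | apply cos_pos_abs, Hb | apply rate_lower; auto].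
Qed.

(** Where the outer integral converges: a strip around Im zeta = - al. The strips for
    different [al] overlap and cover the sector |Im zeta| < 3 PI / 2. *)
Definition jdom (al be : R) (zeta : C) : Prop := admis al be /\ (Rabs (Im zeta + al) < PI / 2)%R.

Lemma jdom_al (al be : R) zeta : jdom al be zeta -> (Rabs al <= PI)%R.
Proof.
  intros [[H1 H2] _]. replace al with ((al + be) - be)%R by ring.
  eapply Rle_trans; [apply Rabs_triang |]. rewrite Rabs_Ropp. lra.
Qed.

Lemma dblKer_contR q (al be : R) zeta : admis al be -> contR (fun x : R => dblKer q be zeta (x + Ci * al)).
Proof.
  intros [H1 H2] x. unfold dblKer. apply contC_mult; [ctac |].
  apply (contC_comp (U := R_UniformSpace) (V := C_UniformSpace) (fun x : R => 1 + Cexp (x + Ci * al)) (rayInt (/ 2) be)).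
  - change (@contC R_UniformSpace (fun x : R => 1 + Cexp (x + Ci * al)) x). ctac.
  - eapply Cd_cont. apply Cd_rayInt; [rewrite Re_half; lra | apply rate_pos; [exact H1 | rewrite Im_line; exact H2]].
Qed.

Lemma rapid_dblKer q (al be : R) zeta : (0 < Re q)%R -> jdom al be zeta -> rapid (fun x : R => dblKer q be zeta (x + Ci * al)).
Proof.
  intros Hq HJ. pose proof (jdom_al _ _ _ HJ) as Hal. destruct HJ as [[H1 H2] H3].
  split; [apply dblKer_contR; split; auto |].
  destruct (dblKer_bound q be (Rabs (Im zeta + al)) Hq H1 ltac:(split; [apply Rabs_pos | exact H3])) as [M HM].
  eexists _, (Re q). split; [exact Hq |]. intros x.
  pose proof (HM (exp (Re zeta)) zeta (x + Ci * al) (exp_pos _)) as T.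
  rewrite Im_line, Re_line in T. apply T; auto; apply Rle_refl.
Qed.

Lemma Cd_dblInt q (al be : R) zeta : (0 < Re q)%R -> jdom al be zeta ->
  Cd (dblInt q al be) zeta (- Cexp zeta * dblInt (q + 1) al be zeta).
Proof.
  intros Hq HJ. pose proof (jdom_al _ _ _ HJ) as Hal. pose proof HJ as [[H1 H2] H3].
  assert (Hq1 : (0 < Re (q + 1))%R) by (change (0 < Re q + 1)%R; lra).
  set (y1 := ((Rabs (Im zeta + al) + PI / 2) / 2)%R). pose proof (Rabs_pos (Im zeta + al)).
  assert (Hy1 : (0 <= y1 < PI / 2)%R) by (unfold y1; lra).
  destruct (dblKer_bound q be y1 Hq H1 Hy1) as [M0 HM0]. destruct (dblKer_bound (q + 1) be y1 Hq1 H1 Hy1) as [M1 HM1].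
  set (r := Rmin 1 (y1 - Rabs (Im zeta + al))). assert (Hr : (0 < r)%R) by (apply Rmin_pos; unfold y1; lra).
  set (B := exp (Re zeta - 1)%R). set (B2 := exp (Re zeta + 1)%R).
  assert (Nr : forall z, near zeta r z -> (B <= exp (Re z))%R /\ (exp (Re z) <= B2)%R /\ (Rabs (Im z + al) <= y1)%R).
  { intros z Hz. unfold near in Hz. pose proof (Rlt_le_trans _ _ _ Hz (Rmin_l _ _)) as Z1.
    pose proof (Rlt_le_trans _ _ _ Hz (Rmin_r _ _)) as Z2.
    pose proof (re_le_Cmod (z - zeta)) as R1. pose proof (Im_le_Cmod (z - zeta)) as I1.
    change (Re (z - zeta)) with (Re z - Re zeta)%R in R1. change (Im (z - zeta)) with (Im z - Im zeta)%R in I1.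
    assert (Rabs (Re z - Re zeta) <= 1)%R as R2 by lra. apply Rabs_le_between in R2.
    repeat split; [apply exp_le; lra | apply exp_le; lra |].
    replace (Im z + al)%R with ((Im z - Im zeta) + (Im zeta + al))%R by ring.
    eapply Rle_trans; [apply Rabs_triang | lra]. }
  replace (- Cexp zeta * dblInt (q + 1) al be zeta) with (CI (fun x : R => - Cexp zeta * dblKer (q + 1) be zeta (x + Ci * al)))
    by (rewrite CI_scal by (apply rapid_dblKer; auto); reflexivity).
  set (N0 := (exp (Rabs (Im q) * PI + (Re q + Re q) * (Re q + Re q) / (2 * (B * cos y1))) * M0)%R).
  set (N1 := (exp (Rabs (Im (q + 1)) * PI + (Re (q + 1) + Re (q + 1)) * (Re (q + 1) + Re (q + 1)) / (2 * (B * cos y1))) * M1)%R).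
  assert (Eb0 : forall z, near zeta r z -> eb N0 (Re q) (fun x : R => dblKer q be z (x + Ci * al))).
  { intros z Hz x. destruct (Nr z Hz) as [A1 [A2 A3]].
    pose proof (HM0 B z (x + Ci * al) (exp_pos _)) as T. rewrite Im_line, Re_line in T. apply T; auto. }
  assert (Eb1 : forall z, near zeta r z -> eb N1 (Re (q + 1)) (fun x : R => dblKer (q + 1) be z (x + Ci * al))).
  { intros z Hz x. destruct (Nr z Hz) as [A1 [A2 A3]].
    pose proof (HM1 B z (x + Ci * al) (exp_pos _)) as T. rewrite Im_line, Re_line in T. apply T; auto. }
  apply (CI_param_derive (fun z (x : R) => dblKer q be z (x + Ci * al)) (fun z (x : R) => - Cexp z * dblKer (q + 1) be z (x + Ci * al))
     zeta r (Rmax N0 (B2 * N1)) (Re q)); auto.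
  - intros z x _. rewrite <- dblKer_succ. unfold dblKer.
    eapply Cd_eq; [apply (Cd_mult (fun z => Cexp (q * (x + Ci * al) - Cexp z * Cexp (x + Ci * al))) (fun _ => rayInt (/ 2) be (1 + Cexp (x + Ci * al)))); dtac |].
    cbv beta. ring.
  - intros z x _. unfold dblKer. unfold joint; cbv beta.
    apply contC_mult; [ctac |]. apply contC_mult; [ctac |].
    apply (contC_comp (U := prod_UniformSpace C_UniformSpace R_UniformSpace) (V := C_UniformSpace)
      (fun p => 1 + Cexp (snd p + Ci * al)) (rayInt (/ 2) be)).
    + change (@contC (prod_UniformSpace C_UniformSpace R_UniformSpace) (fun p => 1 + Cexp (snd p + Ci * al)) (z, x)). ctac.
    + eapply Cd_cont. apply Cd_rayInt; [rewrite Re_half; lra | apply rate_pos; [exact H1 | rewrite Im_line; exact H2]].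
  - intros z _. apply dblKer_contR; split; auto.
  - intros z Hz. split.
    + apply (eb_weaken N0 (Re q)); [apply Rmax_l | lra | apply Eb0, Hz].
    + destruct (Nr z Hz) as [A1 [A2 A3]].
      apply (eb_weaken (B2 * N1) (Re (q + 1))); [apply Rmax_r | change (Re q <= Re q + 1)%R; lra |].
      intros x. rewrite Cmod_mult, Cmod_opp, Cmod_Cexp. rewrite Rmult_assoc.
      apply Rmult_le_compat; [apply Rlt_le, exp_pos | apply Cmod_ge_0 | exact A2 | apply Eb1, Hz].
Qed.

(** The total derivative is that of (1 + p) p^(1/2) e^(- z p) times the inner
    integral; the factor 1 + p is what [rayInt_rec] needs. *)
Lemma dblInt_rec (al be : R) zeta : jdom al be zeta ->
  dblInt (/ 2 + 1) al be zeta + / 2 * dblInt (/ 2) al be zeta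
   - Cexp zeta * dblInt (/ 2 + 1) al be zeta - Cexp zeta * dblInt (/ 2 + 1 + 1) al be zeta = 0.
Proof.
  intros HJ. pose proof HJ as [[H1 H2] H3].
  assert (Q0 : (0 < Re (/ 2))%R) by (rewrite Re_half; lra).
  assert (Q1 : (0 < Re (/ 2 + 1))%R) by (rewrite re_plus, Re_half; cbn; lra).
  assert (Q2 : (0 < Re (/ 2 + 1 + 1))%R) by (rewrite !re_plus, Re_half; cbn; lra).
  pose proof (rapid_dblKer _ _ _ _ Q0 HJ) as G0. pose proof (rapid_dblKer _ _ _ _ Q1 HJ) as G1. pose proof (rapid_dblKer _ _ _ _ Q2 HJ) as G2.
  unfold dblInt. rewrite <- !CI_scal, <- CI_plus, <- !CI_minus; auto 10 using rapid_scal, rapid_plus, rapid_minus.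
  apply (CI_derive_zero (fun x : R => dblKer (/ 2) be zeta (x + Ci * al) + dblKer (/ 2 + 1) be zeta (x + Ci * al)));
    auto 10 using rapid_scal, rapid_plus, rapid_minus.
  intros x.
  set (A := fun z : C => (1 + Cexp (z + Ci * al)) * (Cexp (/ 2 * (z + Ci * al) - Cexp zeta * Cexp (z + Ci * al)) * rayInt (/ 2) be (1 + Cexp (z + Ci * al)))).
  apply (is_derive_ext (V := C_R_NormedModule) (fun x : R => A x)).
  { intros t. match goal with |- @eq _ ?l ?r => change (@eq C l r) end.
    unfold A. rewrite <- dblKer_succ. unfold dblKer. ring. }
  apply (Cd_Rd' A). set (w := x + Ci * al).
  assert (HP : (0 < Re ((1 + Cexp w) * Cexp (Ci * be)))%R) by (apply rate_pos; [exact H1 | unfold w; rewrite Im_line; exact H2]).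
  unfold A. eapply Cd_eq.
  - apply (Cd_mult (fun z => 1 + Cexp (z + Ci * al)) (fun z => Cexp (/ 2 * (z + Ci * al) - Cexp zeta * Cexp (z + Ci * al)) * rayInt (/ 2) be (1 + Cexp (z + Ci * al)))); [dtac |].
    apply (Cd_mult (fun z => Cexp (/ 2 * (z + Ci * al) - Cexp zeta * Cexp (z + Ci * al))) (fun z => rayInt (/ 2) be (1 + Cexp (z + Ci * al)))); [dtac |].
    apply (Cd_comp (fun z => 1 + Cexp (z + Ci * al)) (rayInt (/ 2) be)); [apply Cd_rayInt; [exact Q0 | exact HP] | dtac].
  - cbv beta. fold w. rewrite <- !dblKer_succ. unfold dblKer.
    pose proof (rayInt_rec (/ 2) be (1 + Cexp w) Q0 HP) as R1.
    set (X := rayInt (/ 2) be (1 + Cexp w)) in *. set (X3 := rayInt (/ 2 + 1) be (1 + Cexp w)) in *.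
    set (Ex := Cexp (/ 2 * w - Cexp zeta * Cexp w)). set (p := Cexp w) in *. set (z := Cexp zeta).
    match goal with |- ?l = _ => replace l with
      (p * Ex * X + (1 + p) * (Ex * (/ 2 - z * p) * X) - Ex * p * ((1 + p) * X3)) by ring end.
    rewrite R1. field.
Qed.

Lemma dblInt_ksol (al be : R) zeta : jdom al be zeta ->
  ksol (/ 2) 1 (dblInt (/ 2) al be) (fun z => - Cexp z * dblInt (/ 2 + 1) al be z) zeta.
Proof.
  intros HJ. pose proof (dblInt_rec al be zeta HJ) as Rc.
  assert (Q0 : (0 < Re (/ 2))%R) by (rewrite Re_half; lra).
  assert (Q1 : (0 < Re (/ 2 + 1))%R) by (rewrite re_plus, Re_half; cbn; lra).
  split; [apply Cd_dblInt; auto |].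
  eapply Cd_eq.
  - apply (Cd_mult (fun z => - Cexp z) (dblInt (/ 2 + 1) al be)); [dtac | apply Cd_dblInt; auto].
  - cbv beta. set (z := Cexp zeta) in *.
    set (J0 := dblInt (/ 2) al be zeta) in *. set (J1 := dblInt (/ 2 + 1) al be zeta) in *. set (J2 := dblInt (/ 2 + 1 + 1) al be zeta) in *.
    assert (E : z * (z * J2) = z * (J1 + / 2 * J0 - z * J1)).
    { replace (z * (z * J2)) with (z * (J1 + / 2 * J0 - z * J1) - z * (J1 + / 2 * J0 - z * J1 - z * J2)) by ring.
      rewrite Rc. ring. }
    transitivity (- z * J1 + z * (z * J2)); [ring | rewrite E; ring].
Qed.

(** * Entire solutions of Kummer's equation with a = 1/2, b = 1 *)

(** With t = lgt x, the measure sch x dx is dt / sqrt (t (1 - t)), and the integral of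
    exp (z t) against it is PI times Kummer's function M(1/2, 1, z). *)
Definition lgt (x : R) : R := (exp x / (exp x + exp (- x)))%R.
Definition sch (x : R) : R := (2 / (exp x + exp (- x)))%R.
Definition lch (x : R) : R := ln (exp x + exp (- x)).

(** The weights g = [g1] and g = [g2] produce two solutions that are entire in zeta: z
    occurs through e^(z t) with 0 <= t <= 1 only. *)
Definition AK (g : R -> C) (z : C) (x : R) : C := g x * Cexp (Cexp z * lgt x).
Definition AA (g : R -> C) (z : C) : C := CI (AK g z).

Lemma Rd_eq (f : R -> C) x l l' : Rd f x l -> l = l' -> Rd f x l'.
Proof. intros H <-; exact H. Qed.

Lemma Rd_mult (f g : R -> C) x a b : Rd f x a -> Rd g x b -> Rd (fun t => f t * g t) x (a * g x + f x * b).
Proof.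
  intros Hf Hg. pose proof (Rd_Re _ _ _ Hf) as F1. pose proof (Rd_Im _ _ _ Hf) as F2.
  pose proof (Rd_Re _ _ _ Hg) as G1. pose proof (Rd_Im _ _ _ Hg) as G2.
  assert (P : forall u v p q, is_derive u x p -> is_derive v x q -> is_derive (fun t => u t * v t)%R x (p * v x + u x * q)%R).
  { intros u v p q Hu Hv. apply (is_derive_mult u v x p q Hu Hv). intros; apply Rmult_comm. }
  apply Rd_pair.
  - replace (Re (a * g x + f x * b)) with ((Re a * Re (g x) + Re (f x) * Re b) - (Im a * Im (g x) + Im (f x) * Im b))%R
      by (rewrite re_plus, !re_mult; ring).
    apply (is_derive_minus (V := R_NormedModule) (fun t => Re (f t) * Re (g t))%R (fun t => Im (f t) * Im (g t))%R); apply P; assumption.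
  - replace (Im (a * g x + f x * b)) with ((Re a * Im (g x) + Re (f x) * Im b) + (Im a * Re (g x) + Im (f x) * Re b))%R
      by (rewrite im_plus, !im_mult; ring).
    apply (is_derive_plus (V := R_NormedModule) (fun t => Re (f t) * Im (g t))%R (fun t => Im (f t) * Re (g t))%R); apply P; assumption.
Qed.

Lemma Rd_comp_real (F : C -> C) (h : R -> R) x l d : Cd F (h x) l -> is_derive h x d ->
  Rd (fun t => F (h t)) x (l * d).
Proof.
  intros HF Hh. pose proof (is_derive_comp (V := C_R_NormedModule) (fun u : R => F u) h x _ _ (Cd_Rd' F (h x) l HF) Hh) as K.
  rewrite (Cmult_comm l). rewrite <- (scal_R_Cmult d l). exact K.
Qed.

Lemma Rd_RtoC (h : R -> R) x d : is_derive h x d -> Rd (fun t => RtoC (h t)) x (RtoC d).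
Proof.
  intros H. apply Rd_pair; [exact H |]. cbn. apply (is_derive_const (V := R_NormedModule)).
Qed.

Lemma epe_pos x : (0 < exp x + exp (- x))%R.
Proof. pose proof (exp_pos x). pose proof (exp_pos (- x)). lra. Qed.

Lemma lgt_bounds x : (0 <= lgt x <= 1)%R.
Proof.
  pose proof (exp_pos x). pose proof (exp_pos (- x)). pose proof (epe_pos x). unfold lgt.
  split; [apply Rdiv_le_0_compat; lra |].
  apply (Rmult_le_reg_r (exp x + exp (- x))); [lra |]. unfold Rdiv. rewrite Rmult_assoc, Rinv_l by lra. lra.
Qed.

Lemma is_derive_lgt x : is_derive lgt x (2 * lgt x * (1 - lgt x))%R.
Proof.
  pose proof (epe_pos x). unfold lgt. auto_derive; [lra |]. field. lra.
Qed.
Lemma is_derive_sch x : is_derive sch x (- (2 * lgt x - 1) * sch x)%R.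
Proof.
  pose proof (epe_pos x). unfold sch, lgt. auto_derive; [lra |]. field. lra.
Qed.
Lemma is_derive_lch x : is_derive lch x (2 * lgt x - 1)%R.
Proof.
  pose proof (epe_pos x). unfold lch, lgt. auto_derive; [lra |]. field. lra.
Qed.

Lemma cont_lgt x : continuous lgt x.
Proof. apply (ex_derive_continuous lgt). eexists. apply is_derive_lgt. Qed.
Lemma cont_sch x : continuous sch x.
Proof. apply (ex_derive_continuous sch). eexists. apply is_derive_sch. Qed.
Lemma cont_lch x : continuous lch x.
Proof. apply (ex_derive_continuous lch). eexists. apply is_derive_lch. Qed.

Lemma sch_eb x : (0 <= sch x <= 2 * exp (- Rabs x))%R.
Proof.
  pose proof (epe_pos x). unfold sch. split; [apply Rdiv_le_0_compat; lra |].
  rewrite (exp_Ropp (Rabs x)). apply Rmult_le_compat_l; [lra |].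
  apply Rinv_le_contravar; [apply exp_pos |].
  pose proof (exp_pos x). pose proof (exp_pos (- x)). unfold Rabs. destruct (Rcase_abs x); lra.
Qed.

Lemma lch_bound x : (Rabs (lch x) <= 1 + Rabs x)%R.
Proof.
  unfold lch. pose proof (exp_pos x). pose proof (exp_pos (- x)).
  assert (B : (exp (Rabs x) <= exp x + exp (- x) <= exp (1 + Rabs x))%R).
  { pose proof (exp_ineq1_le 1) as E1. rewrite exp_plus.
    assert (Q : (exp x <= exp (Rabs x) /\ exp (- x) <= exp (Rabs x))%R).
    { split; apply exp_le; [apply Rle_abs |]. rewrite <- Rabs_Ropp. apply Rle_abs. }
    pose proof (exp_pos (Rabs x)).
    split; [unfold Rabs; destruct (Rcase_abs x); lra | nra]. }
  destruct B as [B1 B2]. pose proof (Rabs_pos x). pose proof (exp_pos (Rabs x)).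
  assert (L1 : (Rabs x <= ln (exp x + exp (- x)))%R).
  { rewrite <- (ln_exp (Rabs x)). apply ln_le; lra. }
  assert (L2 : (ln (exp x + exp (- x)) <= 1 + Rabs x)%R).
  { rewrite <- (ln_exp (1 + Rabs x)). apply ln_le; lra. }
  rewrite Rabs_pos_eq; lra.
Qed.

Lemma AK_contR g z : contR g -> contR (AK g z).
Proof.
  intros Hg x. unfold AK. apply contC_mult; [apply Hg |]. ctac. apply cont_lgt.
Qed.

Lemma AK_bound g z x B : (Cmod (Cexp z) <= B)%R -> (Cmod (AK g z x) <= Cmod (g x) * exp B)%R.
Proof.
  intros HB. unfold AK. rewrite Cmod_mult. apply Rmult_le_compat_l; [apply Cmod_ge_0 |].
  apply Cmod_le_exp. rewrite re_scal_r. pose proof (lgt_bounds x). pose proof (Re_le_Cmod (Cexp z)) as H1.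
  pose proof (Cmod_ge_0 (Cexp z)). nra.
Qed.

Lemma AK_eb M c g z B : eb M c g -> (Cmod (Cexp z) <= B)%R -> eb (exp B * M) c (AK g z).
Proof.
  intros He HB x. eapply Rle_trans; [apply AK_bound, HB |].
  rewrite Rmult_comm, Rmult_assoc. apply Rmult_le_compat_l; [apply Rlt_le, exp_pos | apply He].
Qed.

Lemma rapid_AK g z : rapid g -> rapid (AK g z).
Proof.
  intros [Cg [M [c [Hc He]]]]. split; [apply AK_contR, Cg |].
  exists (exp (Cmod (Cexp z)) * M)%R, c. split; [exact Hc | apply AK_eb; [exact He | lra]].
Qed.

Lemma rapid_lgt g : rapid g -> rapid (fun x => lgt x * g x).
Proof.
  intros [Cg [M [c [Hc He]]]]. split.
  - intros x. apply contC_mult; [ctac; apply cont_lgt | apply Cg].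
  - exists M, c. split; [exact Hc |]. intros x. rewrite Cmod_mult, Cmod_R.
    pose proof (lgt_bounds x). rewrite Rabs_pos_eq by lra. specialize (He x).
    pose proof (Cmod_ge_0 (g x)). nra.
Qed.

Lemma Cd_AA g z : rapid g -> Cd (AA g) z (Cexp z * AA (fun x => lgt x * g x) z).
Proof.
  intros Hg. pose proof (rapid_lgt g Hg) as Hl. pose proof Hg as [Cg [M [c [Hc He]]]].
  set (B := exp (Re z + 1)). pose proof (eb_M_pos _ _ _ He) as HM.
  replace (Cexp z * AA (fun x => lgt x * g x) z) with (CI (fun x => Cexp z * AK (fun x => lgt x * g x) z x))
    by (rewrite CI_scal by (apply rapid_AK, Hl); reflexivity).
  assert (Nr : forall w, near z 1 w -> (Cmod (Cexp w) <= B)%R).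
  { intros w Hw. apply Cmod_le_exp. unfold near in Hw. pose proof (Re_le_Cmod (w - z)) as R1.
    change (Re (w - z)) with (Re w - Re z)%R in R1. lra. }
  assert (Hel : eb M c (fun x => lgt x * g x)).
  { intros x. rewrite Cmod_mult, Cmod_R. pose proof (lgt_bounds x). rewrite Rabs_pos_eq by lra.
    specialize (He x). pose proof (Cmod_ge_0 (g x)). nra. }
  assert (PB : (0 < B)%R) by apply exp_pos. assert (PE : (0 < exp B)%R) by apply exp_pos.
  apply (CI_param_derive (AK g) (fun w x => Cexp w * AK (fun x => lgt x * g x) w x) z 1 (Rmax (exp B * M) (B * (exp B * M))) c);
    [lra | exact Hc | | | |].
  - intros w x _. unfold AK. eapply Cd_eq; [dtac |]. ring.
  - intros w x _. unfold AK, joint; cbv beta.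
    assert (Cs : @contC (prod_UniformSpace C_UniformSpace R_UniformSpace) (fun p => g (snd p)) (w, x)).
    { apply (contC_comp (U := prod_UniformSpace C_UniformSpace R_UniformSpace) (V := R_UniformSpace) snd g);
        [apply (cont_snd (U := C_UniformSpace)) | apply Cg]. }
    assert (Cl : @continuous (prod_UniformSpace C_UniformSpace R_UniformSpace) R_UniformSpace (fun p => lgt (snd p)) (w, x)).
    { apply (continuous_comp (U := prod_UniformSpace C_UniformSpace R_UniformSpace) (V := R_UniformSpace) (W := R_UniformSpace) snd lgt); [apply (cont_snd (U := C_UniformSpace)) | apply cont_lgt]. }
    ctac; assumption.
  - intros w _. apply AK_contR, Cg.
  - intros w Hw. pose proof (Nr w Hw) as Hn. split.
    + apply (eb_weaken (exp B * M) c); [apply Rmax_l | lra | apply AK_eb; auto].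
    + apply (eb_weaken (B * (exp B * M)) c); [apply Rmax_r | lra |].
      intros x. rewrite Cmod_mult, Rmult_assoc. apply Rmult_le_compat; [apply Cmod_ge_0 | apply Cmod_ge_0 | exact Hn |].
      apply (AK_eb M c); auto.
Qed.

Definition g1 (x : R) : C := RtoC (sch x).
(** The factor lch = ln (e^x + e^-x) comes from differentiating the weight with
    respect to an exponent: - 2 lch is the logarithm of t (1 - t). *)
Definition g2 (x : R) : C := RtoC (lch x * sch x)%R.

Lemma rapid_g1 : rapid g1.
Proof.
  split; [intros x; unfold g1; ctac; apply cont_sch |]. exists 2%R, 1%R. split; [lra |].
  intros x. unfold g1. rewrite Cmod_R. pose proof (sch_eb x). rewrite Rabs_pos_eq, Rmult_1_l; lra.
Qed.

Lemma rapid_g2 : rapid g2.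
Proof.
  split; [intros x; unfold g2; ctac; [apply cont_lch | apply cont_sch] |].
  exists 8%R, (1 / 2)%R. split; [lra |]. intros x. unfold g2. rewrite Cmod_R, Rabs_mult.
  pose proof (sch_eb x) as S. pose proof (lch_bound x) as L. rewrite (Rabs_pos_eq (sch x)) by lra.
  pose proof (Rabs_pos x) as P. pose proof (exp_ineq1_le (1 / 2 * Rabs x)) as E.
  set (a := Rabs x) in *. pose proof (exp_pos (- a)).
  apply Rle_trans with ((1 + a) * (2 * exp (- a)))%R.
  - apply Rmult_le_compat; [apply Rabs_pos | lra | lra | lra].
  - replace (exp (- a)) with (exp (1 / 2 * a) * (exp (- (1 / 2 * a)) * exp (- (1 / 2 * a))) * exp (- (1 / 2 * a)))%R
      by (rewrite <- !exp_plus; f_equal; field).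
    assert (E1 : (exp (1 / 2 * a) * exp (- (1 / 2 * a)) = 1)%R) by (rewrite <- exp_plus, Rplus_opp_r; apply exp_0).
    set (u := exp (1 / 2 * a)) in *. set (v := exp (- (1 / 2 * a))) in *.
    assert (Pv : (0 < v)%R) by apply exp_pos.
    replace ((1 + a) * (2 * (u * (v * v) * v)))%R with (2 * ((1 + a) * v) * (u * v) * v)%R by ring. rewrite E1.
    apply Rmult_le_compat_r; [lra |].
    assert ((1 + a) * v <= 2)%R; [| lra].
    apply Rle_trans with (2 * u * v)%R; [apply Rmult_le_compat_r; lra | rewrite Rmult_assoc, E1; lra].
Qed.

Notation tg g := (fun x : R => RtoC (lgt x) * g x).

(** Total derivative of g(x) exp (z lgt x), where the derivative of lgt is 2 lgt (1 -
    lgt). *)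
Lemma AK_rel g g' z : rapid g -> rapid g' -> (forall x, Rd g x (g' x)) ->
  AA g' z + 2 * Cexp z * AA (tg g) z - 2 * Cexp z * AA (tg (tg g)) z = 0.
Proof.
  intros Hg Hg' Hd. pose proof (rapid_lgt g Hg) as H1. pose proof (rapid_lgt _ H1) as H2.
  unfold AA. rewrite <- !(CI_scal (2 * Cexp z)), <- CI_plus, <- CI_minus; auto using rapid_AK, rapid_scal, rapid_plus.
  apply (CI_derive_zero (AK g z)); auto using rapid_AK, rapid_scal, rapid_plus, rapid_minus.
  intros x. unfold AK.
  pose proof (Rd_comp_real (fun w => Cexp (Cexp z * w)) lgt x _ _ (ltac:(dtac)) (is_derive_lgt x)) as E.
  pose proof (Rd_mult _ _ _ _ _ (Hd x) E) as P. cbv beta in P.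
  eapply Rd_eq; [exact P |]. rewrite !RtoC_mult, RtoC_minus. ring.
Qed.

Lemma AA_minus g h z : rapid g -> rapid h -> AA (fun x => g x - h x) z = AA g z - AA h z.
Proof.
  intros Hg Hh. unfold AA. rewrite <- CI_minus by (apply rapid_AK; auto).
  apply CI_ext. intros x. unfold AK. ring.
Qed.
Lemma AA_scal k g z : rapid g -> AA (fun x => k * g x) z = k * AA g z.
Proof.
  intros Hg. unfold AA. rewrite <- CI_scal by (apply rapid_AK; auto).
  apply CI_ext. intros x. unfold AK. ring.
Qed.

Lemma AA_rel1 z : AA g1 z - 2 * AA (tg g1) z + 2 * Cexp z * AA (tg g1) z - 2 * Cexp z * AA (tg (tg g1)) z = 0.
Proof.
  pose proof rapid_g1 as G. pose proof (rapid_lgt _ G) as G'.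
  rewrite <- AA_scal, <- AA_minus by auto using rapid_scal.
  apply (AK_rel g1 (fun x => g1 x - 2 * tg g1 x)); auto using rapid_minus, rapid_scal.
  intros x. eapply Rd_eq; [apply Rd_RtoC, is_derive_sch |].
  unfold g1. rewrite !RtoC_mult, RtoC_opp, RtoC_minus, RtoC_mult. ring.
Qed.

Lemma AA_rel2 z : (2 * AA (tg g1) z - AA g1 z) - (2 * AA (tg g2) z - AA g2 z)
   + 2 * Cexp z * AA (tg g2) z - 2 * Cexp z * AA (tg (tg g2)) z = 0.
Proof.
  pose proof rapid_g1 as G. pose proof (rapid_lgt _ G) as G'.
  pose proof rapid_g2 as K. pose proof (rapid_lgt _ K) as K'.
  rewrite <- (AA_scal 2 (tg g1)), <- (AA_scal 2 (tg g2)), <- !AA_minus by auto using rapid_scal, rapid_minus.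
  apply (AK_rel g2 (fun x => (2 * tg g1 x - g1 x) - (2 * tg g2 x - g2 x))); auto using rapid_minus, rapid_scal.
  intros x. eapply Rd_eq.
  - apply Rd_RtoC. apply (is_derive_mult lch sch x _ _ (is_derive_lch x) (is_derive_sch x)). intros; apply Rmult_comm.
  - unfold g1, g2. apply C_eq; cbn; unfold plus, mult; simpl; ring.
Qed.

(** A multiple of M(1/2, 1, z), which is single-valued in z. *)
Definition F1 (z : C) : C := AA g1 z.
Definition F1d (z : C) : C := Cexp z * AA (tg g1) z.
(** A second solution, with the logarithmic term zeta F1. *)
Definition F2 (z : C) : C := z * AA g1 z - 2 * AA g2 z.
Definition F2d (z : C) : C := AA g1 z + z * (Cexp z * AA (tg g1) z) - 2 * (Cexp z * AA (tg g2) z).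

Lemma F1_ksol z : ksol (/ 2) 1 F1 F1d z.
Proof.
  pose proof rapid_g1 as G. pose proof (rapid_lgt _ G) as G'. pose proof (AA_rel1 z) as R1.
  split; [apply Cd_AA, G |].
  eapply Cd_eq; [unfold F1d; apply (Cd_mult Cexp (AA (tg g1))); [apply Cd_Cexp | apply Cd_AA, G'] |].
  unfold F1d, F1. set (q := Cexp z) in *.
  set (A := AA g1 z) in *. set (T := AA (tg g1) z) in *. set (S := AA (tg (tg g1)) z) in *.
  assert (E : q * S = / 2 * A - T + q * T).
  { transitivity (/ 2 * A - T + q * T - / 2 * (A - 2 * T + 2 * q * T - 2 * q * S)); [field | rewrite R1; ring]. }
  transitivity (q * T + q * (q * S)); [ring |]. rewrite E. field.
Qed.

Lemma F2_ksol z : ksol (/ 2) 1 F2 F2d z.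
Proof.
  pose proof rapid_g1 as G. pose proof (rapid_lgt _ G) as G'. pose proof (AA_rel1 z) as R1.
  pose proof rapid_g2 as K. pose proof (rapid_lgt _ K) as K'. pose proof (AA_rel2 z) as R2.
  split.
  - eapply Cd_eq.
    + unfold F2. apply (Cd_minus (fun z => z * AA g1 z) (fun z => 2 * AA g2 z)).
      * apply (Cd_mult (fun z => z) (AA g1)); [apply Cd_id | apply Cd_AA, G].
      * apply Cd_scal, Cd_AA, K.
    + unfold F2d. ring.
  - eapply Cd_eq.
    + unfold F2d. apply (Cd_minus (fun z => AA g1 z + z * (Cexp z * AA (tg g1) z)) (fun z => 2 * (Cexp z * AA (tg g2) z))).
      * apply (Cd_plus (AA g1) (fun z => z * (Cexp z * AA (tg g1) z))); [apply Cd_AA, G |].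
        apply (Cd_mult (fun z => z) (fun z => Cexp z * AA (tg g1) z)); [apply Cd_id |].
        apply (Cd_mult Cexp (AA (tg g1))); [apply Cd_Cexp | apply Cd_AA, G'].
      * apply Cd_scal. apply (Cd_mult Cexp (AA (tg g2))); [apply Cd_Cexp | apply Cd_AA, K'].
    + cbv beta. unfold F2d, F2. set (q := Cexp z) in *.
      set (A := AA g1 z) in *. set (T := AA (tg g1) z) in *. set (S := AA (tg (tg g1)) z) in *.
      set (A2 := AA g2 z) in *. set (T2 := AA (tg g2) z) in *. set (S2 := AA (tg (tg g2)) z) in *.
      assert (E : q * S = / 2 * A - T + q * T).
      { transitivity (/ 2 * A - T + q * T - / 2 * (A - 2 * T + 2 * q * T - 2 * q * S)); [field | rewrite R1; ring]. }
      assert (E2 : q * S2 = T - / 2 * A - T2 + / 2 * A2 + q * T2).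
      { transitivity (T - / 2 * A - T2 + / 2 * A2 + q * T2 - / 2 * ((2 * T - A) - (2 * T2 - A2) + 2 * q * T2 - 2 * q * S2));
          [field | rewrite R2; ring]. }
      transitivity (q * T + (q * T + z * (q * T + q * (q * S))) - 2 * (q * T2 + q * (q * S2))); [ring |].
      rewrite E, E2. field.
Qed.

Lemma CI_nonneg f : rapid f -> (forall x, (0 <= Re (f x))%R) -> (0 <= Re (CI f))%R.
Proof.
  intros [Cf [M [c [Hc He]]]] Hp. apply Rnot_lt_le. intros Hlt.
  destruct (CI_lim M c f Cf Hc He (- Re (CI f)) ltac:(lra)) as [n Hn]. specialize (Hn n (le_n _)).
  pose proof (re_le_Cmod (CRI f (- INR n) (INR n) - CI f)) as H1.
  change (Re (CRI f (- INR n) (INR n) - CI f)) with (Re (CRI f (- INR n) (INR n)) - Re (CI f))%R in H1.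
  assert (H2 : (0 <= Re (CRI f (- INR n) (INR n)))%R).
  { pose proof (is_RInt_C_Re _ _ _ _ (contR_is_RInt f (- INR n) (INR n) Cf)) as I.
    pose proof (pos_INR n).
    rewrite <- (is_RInt_unique _ _ _ _ I). apply RInt_ge_0; [lra | eexists; exact I | intros; apply Hp]. }
  apply Rabs_le_between in H1. lra.
Qed.

Lemma F1_0 : (0 < Re (F1 0))%R.
Proof.
  assert (E : CI g1 = PI).
  { pose proof gpair_0 as P. unfold gpair in P. pose proof (Gam_pair 0 0) as H.
    replace (Cexp (Ci * 0%R * 0)) with (RtoC 1) in H by (rewrite Cmult_0_r, Cexp_0; reflexivity).
    rewrite Cmult_1_l, P in H.
    assert (H0 : (Rabs (Re 0) < 1)%R) by (cbn; rewrite Rabs_R0; lra).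
    assert (H1 : (Rabs 0 < PI / 2)%R) by (rewrite Rabs_R0; pose proof PI_RGT_0; lra).
    rewrite (H H0 H1). rewrite <- CI_scal by (apply rapid_pair; auto). apply CI_ext.
    intros x. rewrite ch_0, Cmult_0_l, Cexp_0. unfold g1, sch.
    pose proof (epe_pos x). rewrite (Rplus_comm (exp (- x))). rewrite RtoC_div by lra. unfold Cdiv. ring. }
  pose proof (rapid_AK g1 0 rapid_g1) as GA.
  assert (N : (0 <= Re (CI (fun x => (AK g1 0 x - g1 x)%C)))%R).
  { apply CI_nonneg; [apply rapid_minus; [exact GA | exact rapid_g1] |].
    intros x. unfold AK, g1. rewrite Cexp_0, Cmult_1_l, Cexp_R, <- RtoC_mult, <- RtoC_minus, Re_R.
    pose proof (sch_eb x). pose proof (lgt_bounds x). pose proof (exp_ineq1_le (lgt x)). nra. }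
  rewrite CI_minus in N by (exact GA || exact rapid_g1). rewrite E in N.
  change (CI (AK g1 0)) with (F1 0) in N. change (Re (F1 0 - PI)) with (Re (F1 0) - PI)%R in N.
  pose proof PI_RGT_0. lra.
Qed.

Lemma Cexp_2PI : Cexp (Ci * (2 * PI)%R) = 1.
Proof.
  apply C_eq; rewrite ?Re_Cexp, ?Im_Cexp;
    replace (Re (Ci * (2 * PI)%R)) with 0%R by (cbn; ring);
    replace (Im (Ci * (2 * PI)%R)) with (2 * PI)%R by (cbn; ring);
    rewrite exp_0, ?cos_2PI, ?sin_2PI; cbn; ring.
Qed.

(** Continuation around the origin fixes [F1] and adds 2 PI i F1 to [F2], so the two
    are not proportional: a combination with zero Cauchy data at 0 would vanish at 2
    PI i. *)
Lemma F_wronskian : F1 0 * F2d 0 - F1d 0 * F2 0 <> 0.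
Proof.
  intros E.
  set (k := - F2 0). set (l := F1 0).
  set (D := fun z => k * F1 z + l * F2 z). set (D1 := fun z => k * F1d z + l * F2d z).
  assert (HD : forall z, ksol (/ 2) 1 D D1 z) by (intros z; apply ksol_lin; [apply F1_ksol | apply F2_ksol]).
  set (w := Ci * (2 * PI)%R).
  assert (Z : D w = 0).
  { apply (ksol_zero (/ 2) 1 D D1 0 w).
    - intros t _. apply HD.
    - unfold D, k, l. ring.
    - unfold D1, k, l. transitivity (F1 0 * F2d 0 - F1d 0 * F2 0); [ring | exact E]. }
  assert (Ew : forall g, AA g w = AA g 0).
  { intros g. unfold AA. apply CI_ext. intros x. unfold AK. unfold w. rewrite Cexp_2PI, Cexp_0. reflexivity. }
  unfold D, F1, F2 in Z. rewrite !Ew in Z.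
  assert (Q : F1 0 * (F1 0 * w) = 0).
  { transitivity (k * AA g1 0 + l * (w * AA g1 0 - 2 * AA g2 0)); [unfold k, l, F1, F2; ring | exact Z]. }
  pose proof (Cd_neq _ F1_0) as N1.
  assert (Nw : w <> 0).
  { unfold w. apply Cmult_neq_0; [exact Ci_nz |]. intros E0. apply RtoC_inj in E0. pose proof PI_RGT_0. lra. }
  exact (Cmult_neq_0 _ _ N1 (Cmult_neq_0 _ _ N1 Nw) Q).
Qed.

(** Match the Cauchy data at 0 by a combination of [F1] and [F2]. *)
Lemma entire_continuation lo hi V V1 : (lo < 0 < hi)%R ->
  (forall z, strip lo hi z -> ksol (/ 2) 1 V V1 z) ->
  exists W W1, (forall z, ksol (/ 2) 1 W W1 z) /\ (forall z, strip lo hi z -> W z = V z).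
Proof.
  intros H0 HV. pose proof F_wronskian as Nd. set (d := F1 0 * F2d 0 - F1d 0 * F2 0) in *.
  set (k := (V 0 * F2d 0 - V1 0 * F2 0) * / d). set (l := (F1 0 * V1 0 - F1d 0 * V 0) * / d).
  exists (fun z => k * F1 z + l * F2 z), (fun z => k * F1d z + l * F2d z).
  assert (HW : forall z, ksol (/ 2) 1 (fun z => k * F1 z + l * F2 z) (fun z => k * F1d z + l * F2d z) z)
    by (intros z; apply ksol_lin; [apply F1_ksol | apply F2_ksol]).
  split; [exact HW |]. intros z Hz.
  assert (S0 : strip lo hi 0) by (unfold strip; cbn; lra).
  assert (E : 1 * (k * F1 z + l * F2 z) + - (1) * V z = 0).
  { apply (ksol_zero (/ 2) 1 (fun z => 1 * (k * F1 z + l * F2 z) + - (1) * V z)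
      (fun z => 1 * (k * F1d z + l * F2d z) + - (1) * V1 z) 0 z).
    - intros t Ht. apply ksol_lin; [apply HW | apply HV, strip_seg; auto].
    - unfold k, l. transitivity (V 0 * (d * / d) - V 0); [unfold d; ring | rewrite Cinv_r by exact Nd; ring].
    - unfold k, l. transitivity (V1 0 * (d * / d) - V1 0); [unfold d; ring | rewrite Cinv_r by exact Nd; ring]. }
  transitivity ((1 * (k * F1 z + l * F2 z) + - (1) * V z) + V z); [ring | rewrite E; ring].
Qed.

(** * Asymptotics of the double integral, and rotation of its outer ray *)

Lemma Re_32 : Re (/ 2 + 1) = (3 / 2)%R.
Proof. rewrite re_plus, Re_half. cbn. field. Qed.
Lemma Im_32 : Im (/ 2 + 1) = 0%R.
Proof. rewrite im_plus, Im_half. cbn. ring. Qed.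

Lemma rayInt_one (be : R) : (Rabs be < PI / 2)%R -> rayInt (/ 2) be 1 = Gam (/ 2).
Proof.
  intros Hb. rewrite <- (Gam_rotate (/ 2) (Ci * be)).
  - unfold rayInt. apply CI_ext. intros y. unfold rayKer, Gk. rewrite Cmult_1_l. reflexivity.
  - rewrite Re_half. lra.
  - replace (Im (Ci * be)) with be by (cbn; ring). exact Hb.
Qed.

(** Mean value inequality in the rate, along the segment from 1 to 1 + p. *)
Lemma rayInt_near_one (be y1 : R) w : (0 <= y1 < PI / 2)%R -> (Rabs be <= y1)%R -> (Rabs (Im w + be) <= y1)%R ->
  (Cmod (rayInt (/ 2) be (1 + Cexp w) - rayInt (/ 2) be 1) <= 2 * ekM (3 / 2) 0 (cos y1) (Rabs be) / (3 / 2) * exp (Re w))%R.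
Proof.
  intros Hy Hb Hw.
  assert (Q0 : (0 < Re (/ 2))%R) by (rewrite Re_half; lra).
  assert (Hc : (0 < cos y1)%R) by (apply cos_gt_0; lra).
  assert (Hcb : (cos y1 <= cos be)%R) by (apply cos_lower; lra).
  assert (R1 : Re (1 * Cexp (Ci * be)) = cos be).
  { rewrite Cmult_1_l, Re_Cexp. replace (Re (Ci * be)) with 0%R by (cbn; ring).
    replace (Im (Ci * be)) with be by (cbn; ring). rewrite exp_0. ring. }
  pose proof (rate_pos be w ltac:(lra) ltac:(lra)) as P1.
  assert (P0 : (0 < Re (1 * Cexp (Ci * be)))%R) by lra.
  unfold rayInt. rewrite <- CI_minus by (apply rapid_rayKer; auto).
  set (N := ekM (3 / 2) 0 (cos y1) (Rabs be)).
  assert (G : contR (fun y : R => rayKer (/ 2) (1 + Cexp w) (y + Ci * be) - rayKer (/ 2) 1 (y + Ci * be)))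
    by (unfold rayKer; ctac).
  eapply Rle_trans; [apply (CI_bound (exp (Re w) * N) (3 / 2) _ G); [lra |] |].
  2:{ right. field. }
  intros y. set (v := y + Ci * be).
  replace (rayKer (/ 2) (1 + Cexp w) v - rayKer (/ 2) 1 v) with (rayKer (/ 2) 1 v * (Cexp (- Cexp (w + v)) - 1)).
  2:{ unfold rayKer. rewrite (Cexp_plus w v).
      replace (/ 2 * v - (1 + Cexp w) * Cexp v) with ((/ 2 * v - 1 * Cexp v) + - (Cexp w * Cexp v)) by ring.
      rewrite (Cexp_plus (/ 2 * v - 1 * Cexp v)). ring. }
  assert (Ev : (Cmod (Cexp (- Cexp (w + v)) - 1) <= exp (Re w) * Cmod (Cexp v))%R).
  { eapply Rle_trans; [apply Cmod_Cexp_m1_neg |].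
    - rewrite re_opp, Re_Cexp. replace (Im (w + v)) with (Im w + be)%R by (unfold v; rewrite im_plus, Im_line; reflexivity).
      pose proof (cos_pos_abs (Im w + be) ltac:(lra)). pose proof (exp_pos (Re (w + v))). nra.
    - rewrite Cmod_opp, Cexp_plus, Cmod_mult, (Cmod_Cexp w). lra. }
  rewrite Cmod_mult.
  eapply Rle_trans; [apply Rmult_le_compat_l; [apply Cmod_ge_0 | exact Ev] |].
  replace (Cmod (rayKer (/ 2) 1 v) * (exp (Re w) * Cmod (Cexp v)))%R with (exp (Re w) * Cmod (rayKer (/ 2 + 1) 1 v))%R
    by (rewrite <- rayKer_succ, Cmod_mult; ring).
  rewrite Rmult_assoc. apply Rmult_le_compat_l; [apply Rlt_le, exp_pos |].
  pose proof (rayKer_bound (/ 2 + 1) 1 be (cos y1) y) as T. rewrite Re_32, Im_32, Rabs_R0, R1 in T.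
  apply T; lra.
Qed.

(** Large z forces p to be small, and there the inner integral is close to its value
    Gamma (1/2) at p = 0; the outer one is then a Gamma integral too. *)
Lemma dblInt_asym y1 : (0 < y1 < PI / 2)%R ->
  exists K, forall (al be : R) zeta, (Rabs be <= y1)%R -> (Rabs (al + be) <= y1)%R ->
    (Rabs (Im zeta + al) <= y1)%R ->
    (Cmod (/ PI * dblInt (/ 2) al be zeta * Cexp (/ 2 * zeta) - 1) <= K * exp (- Re zeta))%R.
Proof.
  intros Hy. pose proof PI_RGT_0 as Ppi. assert (Hc : (0 < cos y1)%R) by (apply cos_gt_0; lra).
  set (N := (2 * ekM (3 / 2) 0 (cos y1) y1 / (3 / 2))%R).
  set (E0 := exp ((3 / 2 + 3 / 2) * (3 / 2 + 3 / 2) / (2 * cos y1))%R).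
  exists (/ PI * (2 * (E0 * N) / (3 / 2)))%R. intros al be zeta Hb Hab Hz.
  assert (HJ : jdom al be zeta) by (split; [split |]; lra).
  assert (Q0 : (0 < Re (/ 2))%R) by (rewrite Re_half; lra).
  set (lam := zeta + Ci * al).
  assert (Il : Im lam = (Im zeta + al)%R) by (unfold lam; destruct zeta; cbn; ring).
  assert (Rl : Re lam = Re zeta) by (unfold lam; destruct zeta; cbn; ring).
  set (L := fun x : R => (Cexp (- (/ 2 * zeta)) * Gam (/ 2)) * Gk (/ 2) (x + lam)).
  assert (GG : rapid (fun x : R => Gk (/ 2) (x + lam))) by (apply rapid_Gk_line; [exact Q0 | rewrite Il; lra]).
  assert (GL : rapid L) by (apply rapid_scal, GG).
  assert (EL : CI L = Cexp (- (/ 2 * zeta)) * PI).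
  { unfold L. rewrite CI_scal by exact GG. rewrite Gam_rotate by (exact Q0 || (rewrite Il; lra)).
    rewrite <- Gam_half_sq. ring. }
  pose proof (rapid_dblKer (/ 2) al be zeta Q0 HJ) as GJ.
  set (D := fun x : R => dblKer (/ 2) be zeta (x + Ci * al) - L x).
  assert (GD : rapid D) by (apply rapid_minus; auto).
  assert (FD : forall x : R, D x = Cexp (/ 2 * (x + Ci * al) - Cexp (x + lam)) * (rayInt (/ 2) be (1 + Cexp (x + Ci * al)) - rayInt (/ 2) be 1)).
  { intros x. unfold D, L, dblKer, Gk. rewrite rayInt_one by lra. rewrite <- Cexp_plus.
    replace (zeta + (x + Ci * al)) with (x + lam) by (unfold lam; ring).
    replace (/ 2 * (x + Ci * al) - Cexp (x + lam)) with (- (/ 2 * zeta) + (/ 2 * (x + lam) - Cexp (x + lam))) by (unfold lam; field).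
    rewrite (Cexp_plus (- (/ 2 * zeta))). ring. }
  assert (BD : eb (E0 * N * exp (- (3 / 2 * Re zeta))) (3 / 2) (fun x : R => D (x + - Re zeta)%R)).
  { intros x. rewrite FD, Cmod_mult. set (t := (x + - Re zeta)%R).
    pose proof (rayInt_near_one be y1 (t + Ci * al) ltac:(lra) Hb ltac:(rewrite Im_line; exact Hab)) as B1. rewrite Re_line in B1.
    assert (B1' : (Cmod (rayInt (/ 2) be (1 + Cexp (t + Ci * al)) - rayInt (/ 2) be 1) <= N * exp t)%R).
    { eapply Rle_trans; [exact B1 |]. apply Rmult_le_compat_r; [apply Rlt_le, exp_pos |].
      unfold N. apply Rmult_le_compat_r; [lra |]. apply Rmult_le_compat_l; [lra |].
      unfold ekM. apply exp_le. lra. }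
    assert (B2 : (Cmod (Cexp (/ 2 * (t + Ci * al) - Cexp (t + lam))) <= exp (/ 2 * t - cos y1 * exp x))%R).
    { apply Cmod_le_exp. unfold Cminus. rewrite re_plus, re_opp, Re_Cexp, re_mult, Re_half, Im_half, Re_line.
      replace (Re (t + lam)) with x by (rewrite re_plus, Rl; unfold t; cbn; ring).
      replace (Im (t + lam)) with (Im lam) by (rewrite im_plus; cbn; ring). rewrite Il.
      pose proof (cos_lower y1 (Im zeta + al) ltac:(lra) Hz). pose proof (exp_pos x). nra. }
    eapply Rle_trans; [apply Rmult_le_compat; [apply Cmod_ge_0 | apply Cmod_ge_0 | exact B2 | exact B1'] |].
    assert (PN : (0 < N)%R).
    { unfold N, ekM. apply Rdiv_lt_0_compat; [| lra]. apply Rmult_lt_0_compat; [lra | apply exp_pos]. }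
    replace (exp (/ 2 * t - cos y1 * exp x) * (N * exp t))%R with (N * exp (3 / 2 * t - cos y1 * exp x))%R.
    2:{ replace (3 / 2 * t - cos y1 * exp x)%R with ((/ 2 * t - cos y1 * exp x) + t)%R by field. rewrite exp_plus. ring. }
    replace (E0 * N * exp (- (3 / 2 * Re zeta)) * exp (- (3 / 2 * Rabs x)))%R
      with (N * (E0 * (exp (- (3 / 2 * Re zeta)) * exp (- (3 / 2 * Rabs x)))))%R by ring.
    apply Rmult_le_compat_l; [lra |]. unfold E0. rewrite <- !exp_plus. apply exp_le.
    pose proof (expo_bound (3 / 2) (3 / 2) (3 / 2) (cos y1) (cos y1) x ltac:(lra) ltac:(lra) ltac:(lra)).
    unfold t. lra. }
  assert (CD : (Cmod (CI D) <= 2 * (E0 * N * exp (- (3 / 2 * Re zeta))) / (3 / 2))%R).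
  { rewrite <- (CI_shift D (- Re zeta)%R GD).
    apply CI_bound; [apply (proj1 (rapid_shift D (- Re zeta)%R GD)) | lra | exact BD]. }
  assert (NPI : RtoC PI <> 0) by (intros E; apply RtoC_inj in E; lra).
  replace (/ PI * dblInt (/ 2) al be zeta * Cexp (/ 2 * zeta) - 1) with (/ PI * (CI D * Cexp (/ 2 * zeta))).
  2:{ unfold D. rewrite CI_minus by auto. rewrite EL. unfold dblInt. rewrite Cexp_opp. field.
      split; [exact NPI | apply Cexp_neq_0]. }
  rewrite !Cmod_mult, Cmod_inv, Cmod_R, Rabs_pos_eq, Cmod_Cexp by (exact NPI || lra).
  rewrite (Rmult_assoc (/ PI)). apply Rmult_le_compat_l; [apply Rlt_le, Rinv_0_lt_compat, Ppi |].
  replace (Re (/ 2 * zeta)) with (/ 2 * Re zeta)%R by (rewrite re_mult, Re_half, Im_half; ring).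
  eapply Rle_trans; [apply Rmult_le_compat_r; [apply Rlt_le, exp_pos | exact CD] |].
  right. replace (- Re zeta)%R with (- (3 / 2 * Re zeta) + / 2 * Re zeta)%R by field. rewrite exp_plus. field.
Qed.

Lemma dblInt_rotate q (al al' be : R) zeta : (0 < Re q)%R -> jdom al be zeta -> jdom al' be zeta ->
  dblInt q al be zeta = dblInt q al' be zeta.
Proof.
  intros Hq HJ HJ'. pose proof HJ as [[H1 H2] H3]. pose proof HJ' as [[_ H2'] H3'].
  assert (Hq1 : (0 < Re (q + 1))%R) by (change (0 < Re q + 1)%R; lra).
  (* a strip containing both rays on which the estimates are uniform *)
  set (m := (Rmax (Rmax (Rabs (al + be)) (Rabs (al' + be))) (Rmax (Rabs (Im zeta + al)) (Rabs (Im zeta + al'))))%R).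
  assert (Hm : (0 <= m < PI / 2 /\ Rabs (al + be) <= m /\ Rabs (al' + be) <= m /\ Rabs (Im zeta + al) <= m /\ Rabs (Im zeta + al') <= m)%R).
  { unfold m. pose proof (Rabs_pos (al + be)).
    repeat split.
    - eapply Rle_trans; [| apply Rmax_l]. eapply Rle_trans; [| apply Rmax_l]. exact H.
    - repeat apply Rmax_lub_lt; auto.
    - eapply Rle_trans; [| apply Rmax_l]. apply Rmax_l.
    - eapply Rle_trans; [| apply Rmax_l]. apply Rmax_r.
    - eapply Rle_trans; [| apply Rmax_r]. apply Rmax_l.
    - eapply Rle_trans; [| apply Rmax_r]. apply Rmax_r. }
  destruct Hm as [Hm0 [M1 [M2 [M3 M4]]]].
  apply Rabs_le_between in M1. apply Rabs_le_between in M2. apply Rabs_le_between in M3. apply Rabs_le_between in M4.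
  set (y1 := ((m + PI / 2) / 2)%R). set (e := (y1 - m)%R).
  assert (He : (0 < e)%R) by (unfold e, y1; lra). assert (Hy1 : (0 <= y1 < PI / 2)%R) by (unfold y1; lra).
  set (lo := (Rmin al al' - e)%R). set (hi := (Rmax al al' + e)%R).
  assert (Hs : forall w, strip lo hi w -> (Rabs (Im w + be) <= y1 /\ Rabs (Im zeta + Im w) <= y1 /\ Rabs (Im w) <= PI)%R).
  { intros w [W1 W2].
    assert (A1 : (Rabs (Im w + be) <= y1)%R).
    { apply Rabs_le_between. unfold lo, hi, Rmin, Rmax in *. destruct (Rle_dec al al'); unfold e in *; lra. }
    assert (A2 : (Rabs (Im zeta + Im w) <= y1)%R).
    { apply Rabs_le_between. unfold lo, hi, Rmin, Rmax in *. destruct (Rle_dec al al'); unfold e in *; lra. }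
    repeat split; auto. replace (Im w) with ((Im w + be) - be)%R by ring.
    eapply Rle_trans; [apply Rabs_triang |]. rewrite Rabs_Ropp. lra. }
  set (B := exp (Re zeta)).
  destruct (dblKer_bound q be y1 Hq H1 Hy1) as [K0 HK0]. destruct (dblKer_bound (q + 1) be y1 Hq1 H1 Hy1) as [K1 HK1].
  set (Bq := (exp (Rabs (Im q) * PI + (Re q + Re q) * (Re q + Re q) / (2 * (B * cos y1))))%R).
  set (Bq1 := (exp (Rabs (Im (q + 1)) * PI + (Re (q + 1) + Re (q + 1)) * (Re (q + 1) + Re (q + 1)) / (2 * (B * cos y1))))%R).
  set (E3 := (2 * ekM (3 / 2) 0 (cos be) (Rabs be) / (3 / 2))%R).
  assert (PE3 : (0 < E3)%R).
  { unfold E3, ekM. apply Rdiv_lt_0_compat; [| lra]. apply Rmult_lt_0_compat; [lra | apply exp_pos]. }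
  assert (PB : (0 < B)%R) by apply exp_pos.
  assert (Pq : (0 < Bq)%R) by apply exp_pos. assert (Pq1 : (0 < Bq1)%R) by apply exp_pos.
  set (A := dblKer q be zeta).
  set (A1 := fun w => q * dblKer q be zeta w - Cexp zeta * dblKer (q + 1) be zeta w
      - Cexp ((q + 1) * w - Cexp zeta * Cexp w) * rayInt (/ 2 + 1) be (1 + Cexp w)).
  set (M := (Rmax (Bq * K0) (Cmod q * (Bq * K0) + B * (Bq1 * K1) + Bq1 * E3))%R).
  assert (S0 : sb (Bq * K0) (Re q) lo hi A).
  { intros w Hw. destruct (Hs w Hw) as [A11 [A12 A13]]. apply (HK0 B zeta w); auto; [lra | apply Rle_refl]. }
  assert (S1 : sb (Bq1 * K1) (Re (q + 1)) lo hi (dblKer (q + 1) be zeta)).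
  { intros w Hw. destruct (Hs w Hw) as [A11 [A12 A13]]. apply (HK1 B zeta w); auto; [lra | apply Rle_refl]. }
  assert (Sal : strip lo hi (Ci * al)).
  { unfold strip, lo, hi. replace (Im (Ci * al)) with al by (cbn; ring).
    pose proof (Rmin_l al al'). pose proof (Rmax_l al al'). lra. }
  assert (Sal' : strip lo hi (Ci * al')).
  { unfold strip, lo, hi. replace (Im (Ci * al')) with al' by (cbn; ring).
    pose proof (Rmin_r al al'). pose proof (Rmax_r al al'). lra. }
  pose proof (sb_pos _ _ _ _ _ _ Sal S0) as PS0. pose proof (sb_pos _ _ _ _ _ _ Sal S1) as PS1.
  assert (HPos : forall w, strip lo hi w -> (0 < Re ((1 + Cexp w) * Cexp (Ci * be)))%R).
  { intros w Hw. destruct (Hs w Hw) as [A11 _]. apply rate_pos; [exact H1 | lra]. }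
  assert (Q32 : (0 < Re (/ 2 + 1))%R) by (rewrite Re_32; lra).
  assert (Q12 : (0 < Re (/ 2))%R) by (rewrite Re_half; lra).
  unfold dblInt. apply (CI_contour M (Re q) lo hi A A1); auto.
  - intros w Hw. unfold A, A1. eapply Cd_eq.
    + unfold dblKer. apply (Cd_mult (fun w => Cexp (q * w - Cexp zeta * Cexp w)) (fun w => rayInt (/ 2) be (1 + Cexp w))); [dtac |].
      apply (Cd_comp (fun w => 1 + Cexp w) (rayInt (/ 2) be)); [apply Cd_rayInt; [exact Q12 | apply HPos, Hw] | dtac].
    + cbv beta. rewrite <- dblKer_succ. unfold dblKer.
      replace ((q + 1) * w - Cexp zeta * Cexp w) with (w + (q * w - Cexp zeta * Cexp w)) by ring.
      rewrite (Cexp_plus w). ring.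
  - intros w Hw. unfold A1, dblKer.
    assert (C1 : @contC C_UniformSpace (fun w => rayInt (/ 2) be (1 + Cexp w)) w).
    { eapply Cd_cont. apply (Cd_comp (fun w => 1 + Cexp w) (rayInt (/ 2) be)); [apply Cd_rayInt; [exact Q12 | apply HPos, Hw] | dtac]. }
    assert (C2 : @contC C_UniformSpace (fun w => rayInt (/ 2 + 1) be (1 + Cexp w)) w).
    { eapply Cd_cont. apply (Cd_comp (fun w => 1 + Cexp w) (rayInt (/ 2 + 1) be)); [apply Cd_rayInt; [exact Q32 | apply HPos, Hw] | dtac]. }
    apply contC_minus; [apply contC_minus; (apply contC_mult; [ctac | apply contC_mult; [ctac | exact C1]]) |].
    apply contC_mult; [ctac | exact C2].
  - apply (sb_weaken (Bq * K0) (Re q)); [split; [exact PS0 | apply Rmax_l] | lra | exact S0].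
  - intros w Hw. destruct (Hs w Hw) as [A11 [A12 A13]].
    apply Rle_trans with ((Cmod q * (Bq * K0) + B * (Bq1 * K1) + Bq1 * E3) * exp (- (Re q * Rabs (Re w))))%R.
    2:{ apply Rmult_le_compat_r; [apply Rlt_le, exp_pos | apply Rmax_r]. }
    assert (Ew : (exp (- (Re (q + 1) * Rabs (Re w))) <= exp (- (Re q * Rabs (Re w))))%R).
    { apply exp_le. change (Re (q + 1)) with (Re q + 1)%R. pose proof (Rabs_pos (Re w)). nra. }
    set (X := exp (- (Re q * Rabs (Re w)))) in *. set (X1 := exp (- (Re (q + 1) * Rabs (Re w)))) in *.
    assert (T1 : (Cmod (q * dblKer q be zeta w) <= Cmod q * (Bq * K0) * X)%R).
    { rewrite Cmod_mult, Rmult_assoc. apply Rmult_le_compat_l; [apply Cmod_ge_0 | apply S0, Hw]. }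
    assert (T2 : (Cmod (Cexp zeta * dblKer (q + 1) be zeta w) <= B * (Bq1 * K1) * X)%R).
    { rewrite Cmod_mult, Cmod_Cexp, Rmult_assoc. fold B. apply Rmult_le_compat_l; [lra |].
      eapply Rle_trans; [apply S1, Hw |]. apply Rmult_le_compat_l; [exact PS1 | exact Ew]. }
    assert (T3 : (Cmod (Cexp ((q + 1) * w - Cexp zeta * Cexp w) * rayInt (/ 2 + 1) be (1 + Cexp w)) <= Bq1 * E3 * X)%R).
    { rewrite Cmod_mult.
      pose proof (outer_bound (q + 1) y1 B zeta w Hq1 Hy1 (conj PB (Rle_refl _)) A12 A13) as O1. fold Bq1 X1 in O1.
      pose proof (rayInt_bound (/ 2 + 1) (1 + Cexp w) be (cos be) Q32 (cos_pos_abs be H1)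
        (rate_lower be w H1 ltac:(lra))) as O2. rewrite Re_32, Im_32, Rabs_R0 in O2. fold E3 in O2.
      apply Rle_trans with ((Bq1 * X1) * E3)%R.
      - apply Rmult_le_compat; auto using Cmod_ge_0.
      - replace (Bq1 * E3 * X)%R with ((Bq1 * X) * E3)%R by ring.
        apply Rmult_le_compat_r; [lra |]. apply Rmult_le_compat_l; lra. }
    unfold A1. eapply Rle_trans; [apply Cmod_triangle' |].
    eapply Rle_trans; [apply Rplus_le_compat_r, Cmod_triangle' |]. lra.
Qed.

(** * The function U(1/2, 1, z) *)

Lemma PI_neq_0 : RtoC PI <> 0.
Proof. intros E; apply RtoC_inj in E. pose proof PI_RGT_0. lra. Qed.

Lemma dblInt_asymR al be : (Rabs al < PI / 2)%R -> admis al be -> asymR 1 (/ 2) (fun z => / PI * dblInt (/ 2) al be z).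
Proof.
  intros Ha [Hb Hab] e He. pose proof PI_RGT_0 as Ppi.
  set (m := Rmax (Rabs al) (Rmax (Rabs be) (Rabs (al + be)))).
  assert (Hm : (0 <= m < PI / 2)%R).
  { unfold m. split; [eapply Rle_trans; [apply Rabs_pos | apply Rmax_l] | repeat apply Rmax_lub_lt; auto]. }
  set (y1 := ((m + PI / 2) / 2)%R).
  assert (Q1 : (Rabs al <= m)%R) by apply Rmax_l.
  assert (Q2 : (Rabs be <= m)%R) by (eapply Rle_trans; [apply Rmax_l | apply Rmax_r]).
  assert (Q3 : (Rabs (al + be) <= m)%R) by (eapply Rle_trans; [apply Rmax_r | apply Rmax_r]).
  destruct (dblInt_asym y1 ltac:(unfold y1; lra)) as [K HK].
  destruct (exp_neg_small K e He) as [M [_ HM]]. exists M. intros x Hx.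
  eapply Rle_lt_trans; [| apply (HM x Hx)].
  apply (HK al be x); unfold y1; [lra | lra |].
  cbn [Im RtoC snd]. rewrite Rplus_0_l. lra.
Qed.

Lemma ksol_scal a b W W1 k z : ksol a b W W1 z -> ksol a b (fun w => k * W w) (fun w => k * W1 w) z.
Proof.
  intros H. destruct (ksol_lin a b W W1 W W1 k 0 z H H) as [A B]. split.
  - eapply Cd_eq; [eapply Cd_ext; [| exact A] |]; [intros w; cbv beta; ring | cbv beta; ring].
  - eapply Cd_eq; [eapply Cd_ext; [| exact B] |]; [intros w; cbv beta; ring | cbv beta; ring].
Qed.

Lemma jdom_strip al be z : admis al be -> strip (- al - PI / 2) (- al + PI / 2) z -> jdom al be z.
Proof. intros H [A B]. split; [exact H |]. apply Rabs_lt_between. lra. Qed.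

Lemma admis_0 : admis 0 0.
Proof. unfold admis. rewrite Rplus_0_l, Rabs_R0. pose proof PI_RGT_0. lra. Qed.

(** The integral with al = be = 0 solves the equation on a strip and extends to an
    entire solution W. For |al| < PI / 2 the integral with angle al is recessive on
    the real axis, so it equals W there; for the other angles it agrees with the
    integral of angle al / 2 on the overlap of their strips. The asymptotics follow
    with al = - 2 Im zeta / 3 and be = Im zeta / 3, which makes the three relevant
    arguments equal to a third of |Im zeta|. *)
Lemma tricomi_half_one : exists V, is_tricomiU (/ 2) 1 V /\
  forall al be z, jdom al be z -> dblInt (/ 2) al be z = PI * V z.
Proof.
  pose proof PI_RGT_0 as Ppi.
  set (V0 := fun z => / PI * dblInt (/ 2) 0 0 z). set (V1 := fun z => / PI * (- Cexp z * dblInt (/ 2 + 1) 0 0 z)).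
  destruct (entire_continuation (- PI / 2) (PI / 2) V0 V1 ltac:(lra)) as [W [W1 [HW EW]]].
  { intros z Hz. apply ksol_scal, dblInt_ksol, jdom_strip; [apply admis_0 |].
    unfold strip in *. lra. }
  assert (AW : asymR 1 (/ 2) W).
  { intros e He. destruct (dblInt_asymR 0 0 ltac:(rewrite Rabs_R0; lra) admis_0 e He) as [M HM].
    exists M. intros x Hx. rewrite EW by (unfold strip; cbn; lra). apply HM, Hx. }
  assert (EJ0 : forall al be z, (Rabs al < PI / 2)%R -> jdom al be z -> / PI * dblInt (/ 2) al be z = W z).
  { intros al be z Ha [Had Hz].
    apply (recessive_unique (- al - PI / 2) (- al + PI / 2) (/ 2) 1 (fun z => / PI * dblInt (/ 2) al be z)
      (fun z => / PI * (- Cexp z * dblInt (/ 2 + 1) al be z)) W W1).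
    - apply Rabs_lt_between in Ha. lra.
    - intros w Hw. apply ksol_scal, dblInt_ksol, jdom_strip; auto.
    - intros w _. apply HW.
    - apply dblInt_asymR; auto.
    - exact AW.
    - apply Rabs_lt_between in Hz. unfold strip. lra. }
  assert (EJ : forall al be z, jdom al be z -> / PI * dblInt (/ 2) al be z = W z).
  { intros al be z HJ. pose proof (jdom_al _ _ _ HJ) as Hal. destruct HJ as [[Hb Hab] Hz].
    (* compare on the overlap with the ray of half the argument *)
    set (al' := (al / 2)%R). set (z0 := Ci * (- (3 / 4) * al)%R).
    assert (I0 : Im z0 = (- (3 / 4) * al)%R) by (unfold z0; cbn; ring).
    apply Rabs_lt_between in Hb. apply Rabs_lt_between in Hab. apply Rabs_lt_between in Hz.
    assert (Had' : admis al' be) by (unfold al'; split; apply Rabs_lt_between; lra).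
    assert (Ha' : (Rabs al' < PI / 2)%R) by (unfold al'; apply Rabs_lt_between; lra).
    assert (Had : admis al be) by (split; apply Rabs_lt_between; lra).
    assert (J0 : jdom al be z0) by (split; [exact Had | rewrite I0; apply Rabs_lt_between; lra]).
    assert (J0' : jdom al' be z0) by (split; [exact Had' | rewrite I0; unfold al'; apply Rabs_lt_between; lra]).
    set (A := fun w => 1 * (/ PI * dblInt (/ 2) al be w) + - (1) * W w).
    set (A1 := fun w => 1 * (/ PI * (- Cexp w * dblInt (/ 2 + 1) al be w)) + - (1) * W1 w).
    assert (Q12 : (0 < Re (/ 2))%R) by (rewrite Re_half; lra).
    assert (Q32 : (0 < Re (/ 2 + 1))%R) by (rewrite Re_32; lra).
    assert (E : A z = 0).
    { apply (ksol_zero (/ 2) 1 A A1 z0 z).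
      - intros t Ht. apply ksol_lin; [| apply HW]. apply ksol_scal, dblInt_ksol, jdom_strip; [exact Had |].
        apply strip_seg; [unfold strip; rewrite I0; lra | unfold strip; lra | exact Ht].
      - unfold A. rewrite (dblInt_rotate (/ 2) al al' be z0) by auto. rewrite EJ0 by auto. ring.
      - unfold A1. rewrite (dblInt_rotate (/ 2 + 1) al al' be z0) by auto.
        (* the derivatives agree because the functions agree near z0 *)
        assert (D : W1 z0 = / PI * (- Cexp z0 * dblInt (/ 2 + 1) al' be z0)).
        { destruct (strip_near (- al' - PI / 2) (- al' + PI / 2) z0) as [r [Hr Hn]].
          { unfold strip. rewrite I0. unfold al'. lra. }
          pose proof (proj1 (HW z0)) as D1.
          pose proof (proj1 (ksol_scal _ _ _ _ (/ PI) _ (dblInt_ksol al' be z0 J0'))) as D2.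
          assert (D3 : Cd W z0 (/ PI * (- Cexp z0 * dblInt (/ 2 + 1) al' be z0))).
          { apply (Cd_ext_loc (fun w => / PI * dblInt (/ 2) al' be w) W z0 _ r Hr); [| exact D2].
            intros w Hw. apply EJ0; [exact Ha' |]. apply jdom_strip; [exact Had' | apply Hn, Hw]. }
          apply Cd_is_derive, is_C_derive_unique in D1. apply Cd_is_derive, is_C_derive_unique in D3.
          rewrite <- D1, <- D3. reflexivity. }
        rewrite D. ring. }
    unfold A in E. transitivity ((1 * (/ PI * dblInt (/ 2) al be z) + - (1) * W z) + W z); [ring | rewrite E; ring]. }
  exists W. split; [split |].
  - apply (kummer_of_ksol _ _ _ W1 HW).
  - intros d0 Hd0 e He.
    set (d := Rmin d0 (PI / 4)). assert (Hd : (0 < d <= PI / 4)%R).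
    { unfold d. split; [apply Rmin_pos; lra | apply Rmin_r]. }
    destruct (dblInt_asym (PI / 2 - d / 3) ltac:(lra)) as [K HK].
    destruct (exp_neg_small K e He) as [M [_ HM]]. exists M. intros z Hz HzM.
    assert (Hz' : (Rabs (Im z) <= 3 / 2 * PI - d)%R) by (pose proof (Rmin_l d0 (PI / 4)); unfold d; lra).
    assert (T : forall y k, (0 <= k)%R -> y = (k * Im z)%R \/ y = (- k * Im z)%R -> (Rabs y = k * Rabs (Im z))%R).
    { intros y k Hk [-> | ->]; rewrite Rabs_mult, ?Rabs_Ropp, (Rabs_pos_eq k) by lra; reflexivity. }
    set (al := (- (2 / 3) * Im z)%R). set (be := (/ 3 * Im z)%R).
    assert (B1 : (Rabs be = / 3 * Rabs (Im z))%R) by (apply T; [lra | left; unfold be; ring]).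
    assert (B2 : (Rabs (al + be) = / 3 * Rabs (Im z))%R) by (apply T; [lra | right; unfold al, be; field]).
    assert (B3 : (Rabs (Im z + al) = / 3 * Rabs (Im z))%R) by (apply T; [lra | left; unfold al; field]).
    rewrite <- (EJ al be z) by (split; [split |]; lra).
    unfold Cdiv. rewrite <- Cexp_opp. replace (- (- (/ 2) * z)) with (/ 2 * z) by ring.
    eapply Rle_lt_trans; [| apply (HM _ HzM)]. apply HK; lra.
  - intros al be z HJ. rewrite <- (EJ al be z HJ). field. apply PI_neq_0.
Qed.

Lemma tricomiU_half_one al be z : jdom al be z -> PI * tricomiU (/ 2) 1 z = dblInt (/ 2) al be z.
Proof.
  intros HJ. destruct tricomi_half_one as [V [HV EV]].
  rewrite (tricomiU_eq _ _ _ HV). symmetry. apply EV, HJ.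
Qed.

(** * The double integral with two free rates *)

(** The kernel at w = 0 of the family [planeKer] below. *)
Definition planeKer0 (P Q : C) (x y : R) : C :=
  Cexp (/ 2 * (x + y) - / 2 * (P * exp x + Q * exp y) - exp (x + y)).

Lemma Clog_unique w : (- PI < Im w < PI)%R -> Clog (Cexp w) = w.
Proof.
  intros H. unfold Clog. rewrite Cmod_Cexp, ln_exp. destruct w as [x y]. cbn [Im snd Re fst] in *.
  apply C_eq; [reflexivity |]. cbn [Im snd]. unfold Carg. rewrite Cmod_Cexp, Re_Cexp, Im_Cexp. cbn [Im snd Re fst].
  pose proof (exp_pos x) as Ex.
  replace (exp x * cos y / exp x)%R with (cos y) by (field; lra).
  destruct (Rle_dec 0 (exp x * sin y)) as [L | L].
  - assert (0 <= y)%R.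
    { apply Rnot_lt_le. intros Hy. pose proof (sin_lt_0_var y ltac:(lra) ltac:(lra)). nra. }
    apply acos_cos. lra.
  - assert (y < 0)%R.
    { apply Rnot_le_lt. intros Hy. apply L. apply Rmult_le_pos; [lra |]. apply sin_ge_0; lra. }
    rewrite <- (cos_neg y), acos_cos by lra. ring.
Qed.

Lemma Carg_half z : (0 < Re z)%R -> (Rabs (Carg z) < PI / 2)%R.
Proof.
  intros Hz. assert (Nz : z <> 0) by (apply Cd_neq, Hz).
  pose proof (Cexp_Clog z Nz) as E. apply (f_equal Re) in E. rewrite Re_Cexp in E.
  change (Im (Clog z)) with (Carg z) in E. pose proof (exp_pos (Re (Clog z))) as Ex.
  assert (Hc : (0 < cos (Carg z))%R) by nra.
  pose proof (Carg_bound z) as B. apply Rabs_lt_between.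
  split; apply Rnot_le_lt; intros Hle.
  - rewrite <- cos_neg in Hc. pose proof (cos_le_0 (- Carg z) ltac:(lra) ltac:(lra)). lra.
  - pose proof (cos_le_0 (Carg z) ltac:(lra) ltac:(lra)). lra.
Qed.

(** Scaling p and q shows that the double integral depends on the product P Q only.
    Both rays are rotated by the arguments of P and Q, so that the rates become
    positive. *)
Lemma Y_tricomi (P Q : C) : (0 < Re P)%R -> (0 < Re Q)%R ->
  CI (fun x => CI (fun y => planeKer0 P Q x y)) = PI * tricomiU (/ 2) 1 (Clog P + Clog Q - ln 4).
Proof.
  intros HP HQ.
  pose proof (Carg_half P HP) as AP. pose proof (Carg_half Q HQ) as AQ.
  pose proof (Cd_neq P HP) as NP. pose proof (Cd_neq Q HQ) as NQ.
  set (z := Clog P + Clog Q - ln 4). set (be := Carg Q). set (al := (- be)%R).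
  set (lq := (ln (Cmod Q) - ln 2)%R).
  assert (Iz : (Im z + al = Carg P)%R) by (unfold z, al, be; cbn; ring).
  assert (HJ : jdom al be z).
  { split; [split |]; [exact AQ | unfold al; rewrite Rplus_opp_l, Rabs_R0; pose proof PI_RGT_0; lra | rewrite Iz; exact AP]. }
  rewrite (tricomiU_half_one al be z HJ).
  assert (Q12 : (0 < Re (/ 2))%R) by (rewrite Re_half; lra).
  (* q = e^(y + i be) with y real gives (Q / 2) e^y after the shift by lq; p likewise *)
  assert (Eq : Cexp (lq + Ci * be) = / 2 * Q).
  { unfold lq. rewrite RtoC_minus. replace (RtoC (ln (Cmod Q)) - ln 2 + Ci * be) with (Clog Q - ln 2)
      by (apply C_eq; cbn; unfold be; ring).
    unfold Cminus. rewrite Cexp_plus, Cexp_Clog by exact NQ. rewrite Cexp_opp, Cexp_R, exp_ln by lra. ring. }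
  assert (Ez : Cexp z * Cexp (- (lq + Ci * be)) = / 2 * P).
  { rewrite Cexp_opp, Eq. unfold z, Cminus. rewrite !Cexp_plus, !Cexp_Clog by auto.
    rewrite Cexp_opp, Cexp_R, exp_ln by lra. field. exact NQ. }
  unfold dblInt.
  pose proof (rapid_dblKer (/ 2) al be z Q12 HJ) as GJ.
  rewrite <- (CI_shift _ (- lq)%R GJ). apply CI_ext. intros x.
  unfold dblKer, rayInt.
  assert (HR : (0 < Re ((1 + Cexp (RtoC (x + - lq) + Ci * al)) * Cexp (Ci * be)))%R).
  { apply rate_pos; [exact AQ |]. rewrite Im_line. unfold al. rewrite Rplus_opp_l, Rabs_R0. pose proof PI_RGT_0; lra. }
  pose proof (rapid_rayKer (/ 2) _ be Q12 HR) as GE.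
  rewrite <- (CI_shift _ lq GE). rewrite <- CI_scal by (apply (rapid_shift _ lq GE)).
  apply CI_ext. intros y. unfold planeKer0, rayKer. rewrite <- Cexp_plus. f_equal.
  replace (RtoC (x + - lq) + Ci * al) with (x + - (lq + Ci * be)) by (unfold al; rewrite RtoC_plus, !RtoC_opp; ring).
  replace (RtoC (y + lq) + Ci * be) with (y + (lq + Ci * be)) by (rewrite RtoC_plus; ring).
  replace (RtoC (exp (x + y))) with (Cexp x * Cexp y) by (rewrite <- Cexp_plus, <- RtoC_plus, Cexp_R; reflexivity).
  set (u := lq + Ci * be) in *.
  assert (Eu : Cexp (- u) * Cexp u = 1).
  { rewrite <- Cexp_plus. replace (- u + u) with (RtoC 0) by ring. apply Cexp_0. }
  rewrite !(Cexp_plus _ u), !(Cexp_plus _ (- u)), <- !Cexp_R.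
  transitivity (/ 2 * (x + y) - (Cexp z * Cexp (- u)) * Cexp x - (Cexp u) * Cexp y - Cexp x * (Cexp (- u) * Cexp u) * Cexp y).
  - rewrite Eu, Ez, Eq. ring.
  - ring.
Qed.

(** * A parametrised quarter turn *)

Definition th (v : R) : R := ((exp v - 1) / (exp v + 1))%R.
Definition ang (v : R) : R := atan (th v).
(** [rad v] and [ang v] are the logarithm of the modulus and the argument of [tau v];
    the weight [om] is 1 / |tau|. *)
Definition rad (v : R) : R := (/ 2 * ln ((exp v + exp (- v)) / 2))%R.
Definition om (v : R) : R := exp (- rad v).

Lemma th_bounds v : (- 1 < th v < 1)%R.
Proof.
  unfold th. pose proof (exp_pos v).
  split; apply (Rmult_lt_reg_r (exp v + 1)); try lra;
    unfold Rdiv; rewrite Rmult_assoc, Rinv_l by lra; lra.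
Qed.

Lemma ang_bound v : (Rabs (ang v) < PI / 4)%R.
Proof.
  pose proof (th_bounds v). unfold ang. apply Rabs_lt_between.
  rewrite <- atan_1, <- atan_opp. split; apply atan_increasing; lra.
Qed.

Lemma cont_ang v : continuous ang v.
Proof.
  unfold ang. apply (contR_derivable (U := R_UniformSpace) atan th).
  - apply (ex_derive_continuous th). unfold th. auto_derive. pose proof (exp_pos v). lra.
  - eexists. apply is_derive_atan.
Qed.

Lemma cont_rad v : continuous rad v.
Proof.
  apply (ex_derive_continuous rad). unfold rad. auto_derive. pose proof (epe_pos v). lra.
Qed.

Lemma cont_om v : continuous om v.
Proof.
  unfold om. apply contR_exp. apply (continuous_opp (V := R_NormedModule)), cont_rad.
Qed.

Lemma exp_2rad v : (exp (rad v + rad v) = (exp v + exp (- v)) / 2)%R.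
Proof.
  unfold rad. replace (/ 2 * ln ((exp v + exp (- v)) / 2) + / 2 * ln ((exp v + exp (- v)) / 2))%R
    with (ln ((exp v + exp (- v)) / 2)) by field.
  apply exp_ln. pose proof (epe_pos v). lra.
Qed.

Lemma om_bound v : (0 < om v <= 2 * exp (- (/ 2 * Rabs v)))%R.
Proof.
  unfold om. split; [apply exp_pos |].
  assert (L : (Rabs v / 2 - ln 2 <= rad v)%R).
  { unfold rad. pose proof (exp_pos (Rabs v)) as E. pose proof (exp_pos v). pose proof (exp_pos (- v)).
    assert (B : (exp (Rabs v) / 2 <= (exp v + exp (- v)) / 2)%R) by (unfold Rabs; destruct (Rcase_abs v); lra).
    pose proof (ln_le (exp (Rabs v) / 2) ((exp v + exp (- v)) / 2) ltac:(lra) B) as L.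
    rewrite ln_div, ln_exp in L by lra.
    assert (0 < ln 2)%R by (rewrite <- ln_1; apply ln_increasing; lra). lra. }
  apply Rle_trans with (exp (ln 2 + - (/ 2 * Rabs v)))%R; [apply exp_le; lra |].
  rewrite exp_plus, exp_ln by lra. lra.
Qed.

(** [tau v] runs along the branch Re (tau^2) = 1, Re tau > 0 of a hyperbola, from the
    direction of 1 - i to that of 1 + i: its square is 1 + i sinh v. *)
Definition tau (v : R) : C := / 2 * ((1 - Ci) * exp (- (v / 2)) + (1 + Ci) * exp (v / 2)).

Lemma tau_polar v : Cexp (rad v + Ci * ang v) = tau v.
Proof.
  set (a := exp (v / 2)). set (b := exp (- (v / 2))).
  assert (Pa : (0 < a)%R) by apply exp_pos. assert (Pb : (0 < b)%R) by apply exp_pos.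
  assert (Eab : (a * b = 1)%R) by (unfold a, b; rewrite <- exp_plus, Rplus_opp_r; apply exp_0).
  assert (Ev : (exp v = a * a)%R) by (unfold a; rewrite <- exp_plus; f_equal; field).
  assert (Ev' : (exp (- v) = b * b)%R) by (unfold b; rewrite <- exp_plus; f_equal; field).
  assert (T : (th v = (a - b) / (a + b))%R).
  { unfold th. rewrite Ev. replace (a * a - 1)%R with (a * (a - b))%R by lra.
    replace (a * a + 1)%R with (a * (a + b))%R by lra. field. lra. }
  assert (Hc : (exp (rad v) * cos (ang v) = (a + b) / 2)%R).
  { assert (Pc : (0 < cos (ang v))%R).
    { pose proof (ang_bound v) as B. apply Rabs_lt_between in B. pose proof PI_RGT_0. apply cos_gt_0; lra. }
    pose proof (exp_pos (rad v)) as Pr.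
    apply Rsqr_inj; [nra | lra |]. unfold Rsqr.
    replace (exp (rad v) * cos (ang v) * (exp (rad v) * cos (ang v)))%R
      with (exp (rad v + rad v) * (cos (ang v) * cos (ang v)))%R by (rewrite exp_plus; ring).
    rewrite exp_2rad, Ev, Ev'. unfold ang. rewrite cos_atan, T.
    assert (P1 : (0 < 1 + ((a - b) / (a + b))²)%R) by (pose proof (Rle_0_sqr ((a - b) / (a + b))); lra).
    replace (1 / sqrt (1 + ((a - b) / (a + b))²) * (1 / sqrt (1 + ((a - b) / (a + b))²)))%R
      with (/ (sqrt (1 + ((a - b) / (a + b))²) * sqrt (1 + ((a - b) / (a + b))²)))%R
      by (field; apply Rgt_not_eq, sqrt_lt_R0, P1).
    rewrite sqrt_sqrt by lra. unfold Rsqr. field. split; [lra |]. nra. }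
  assert (Hs : (exp (rad v) * sin (ang v) = (a - b) / 2)%R).
  { assert (E : (sin (ang v) = th v * cos (ang v))%R).
    { unfold ang. rewrite sin_atan, cos_atan. field.
      apply Rgt_not_eq, sqrt_lt_R0. pose proof (Rle_0_sqr (th v)). lra. }
    rewrite E, T. replace (exp (rad v) * ((a - b) / (a + b) * cos (ang v)))%R
      with ((a - b) / (a + b) * (exp (rad v) * cos (ang v)))%R by ring.
    rewrite Hc. field. lra. }
  unfold tau. fold a b. apply C_eq.
  - rewrite Re_Cexp. replace (Re (rad v + Ci * ang v)) with (rad v) by (cbn; ring).
    replace (Im (rad v + Ci * ang v)) with (ang v) by (cbn; ring). rewrite Hc.
    rewrite <- RtoC_inv by lra. rewrite re_scal_l. cbn. field.
  - rewrite Im_Cexp. replace (Re (rad v + Ci * ang v)) with (rad v) by (cbn; ring).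
    replace (Im (rad v + Ci * ang v)) with (ang v) by (cbn; ring). rewrite Hs.
    rewrite <- RtoC_inv by lra. rewrite im_scal_l. cbn. field.
Qed.

Lemma tau_polar_conj v : Cexp (rad v - Ci * ang v) = / 2 * ((1 + Ci) * exp (- (v / 2)) + (1 - Ci) * exp (v / 2)).
Proof.
  pose proof (tau_polar v) as E. apply (f_equal Cconj) in E.
  transitivity (Cconj (Cexp (rad v + Ci * ang v))).
  - apply C_eq; cbn; rewrite ?Rmult_0_l, ?Rmult_1_l, ?Rmult_0_r;
      replace (rad v + - (0 - 0))%R with (rad v + (0 - 0))%R by ring;
      replace (0 + - (0 + ang v))%R with (- (0 + (0 + ang v)))%R by ring;
      rewrite ?cos_neg, ?sin_neg; ring.
  - rewrite E. unfold tau. rewrite <- RtoC_inv by lra. apply C_eq; cbn; field.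
Qed.

(** * Change of variables on the plane *)

(** The coordinates are the difference v of the two variables and their mean m. *)
Lemma CI2_rotate (f : R -> R -> C) : rapid2 f ->
  CI (fun x => CI (f x)) = CI (fun v => CI (fun m => f (m - v / 2)%R (m + v / 2)%R)).
Proof.
  intros Gf. pose proof Gf as [HJ [M [c [Hc He]]]].
  pose proof (eb2_M M c f He) as HM.
  assert (G2 : rapid2 (fun x v => f x (x + v)%R)).
  { split.
    - intros x v.
      apply (contC_comp (U := prod_UniformSpace R_UniformSpace R_UniformSpace)
        (V := prod_UniformSpace R_UniformSpace R_UniformSpace) (fun p => (fst p, (fst p + snd p)%R)) (fun p => f (fst p) (snd p))).
      + apply cont_pair; [apply (cont_fst (U := R_UniformSpace)) |].
        apply (continuous_plus (V := R_NormedModule)); [apply (cont_fst (U := R_UniformSpace)) | apply (cont_snd (V := R_UniformSpace))].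
      + apply HJ.
    - exists M, (c / 2)%R. split; [lra |]. intros x v. eapply Rle_trans; [apply He |].
      rewrite !Rmult_assoc. apply Rmult_le_compat_l; [exact HM |]. rewrite <- !exp_plus. apply exp_le.
      pose proof (Rabs_triang (x + v) (- x)) as T. rewrite Rabs_Ropp in T.
      replace (x + v + - x)%R with v in T by ring. pose proof (Rabs_pos x). pose proof (Rabs_pos (x + v)). nra. }
  transitivity (CI (fun x => CI (fun v => f x (x + v)%R))).
  - apply CI_ext. intros x. rewrite <- (CI_shift (f x) x (rapid2_slice _ x Gf)).
    apply CI_ext. intros v. f_equal. ring.
  - rewrite (CI_Fubini _ G2). apply CI_ext. intros v.
    pose proof (rapid2_slice _ v (rapid2_swap _ G2)) as Gv. cbv beta in Gv.
    rewrite <- (CI_shift _ (- (v / 2))%R Gv). apply CI_ext. intros m. f_equal; field.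
Qed.

Lemma rapid2_prod f g : rapid f -> rapid g -> rapid2 (fun x y => f x * g y).
Proof.
  intros Gf Gg. destruct (rapid_common f g Gf Gg) as [M [c [Hc [H1 H2]]]].
  split.
  - apply joint2_mult.
    + apply (joint2_comp f (fun x _ => x)); [apply Gf |]. intros p. apply (cont_fst (U := R_UniformSpace)).
    + apply (joint2_comp g (fun _ y => y)); [apply Gg |]. intros p. apply (cont_snd (V := R_UniformSpace)).
  - exists (M * M)%R, c. split; [exact Hc |]. intros x y. rewrite Cmod_mult.
    eapply Rle_trans; [apply Rmult_le_compat; [apply Cmod_ge_0 | apply Cmod_ge_0 | apply H1 | apply H2] |].
    right; ring.
Qed.

(** * A quotient of Gamma products *)

(** The multiplier by which a product of Gamma functions at 1/4 differs from [gpair (4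
    s)], as a superposition of the exponentials that rotating rays produces. *)
Definition Rhat (s : C) : C := CI (fun v => om v * Cexp (4 * s * (Ci * ang v))).

Lemma Re_4s s : Re (4 * s) = (4 * Re s)%R.
Proof. destruct s; cbn; ring. Qed.

Lemma rapid_Rhat s : rapid (fun v => om v * Cexp (4 * s * (Ci * ang v))).
Proof.
  split; [ctac; [apply cont_om | apply cont_ang] |].
  exists (2 * exp (4 * Rabs (Im s) * PI))%R, (/ 2)%R. split; [lra |]. intros v.
  rewrite Cmod_mult, Cmod_R, Cmod_Cexp. pose proof (om_bound v) as B. rewrite Rabs_pos_eq by lra.
  assert (E : (exp (Re (4 * s * (Ci * ang v))) <= exp (4 * Rabs (Im s) * PI))%R).
  { apply exp_le. replace (Re (4 * s * (Ci * ang v))) with (4 * (- (Im s * ang v)))%R by (destruct s; cbn; ring).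
    pose proof (ang_bound v). pose proof PI_RGT_0.
    pose proof (mul_bound (Im s) (ang v) PI ltac:(lra)). lra. }
  pose proof (exp_pos (Re (4 * s * (Ci * ang v)))).
  replace (2 * exp (4 * Rabs (Im s) * PI) * exp (- (/ 2 * Rabs v)))%R
    with ((2 * exp (- (/ 2 * Rabs v))) * exp (4 * Rabs (Im s) * PI))%R by ring.
  apply Rmult_le_compat; lra.
Qed.

Lemma contC_Cinv {U : UniformSpace} (f : U -> C) x : f x <> 0 -> contC f x -> contC (fun u => / f u) x.
Proof.
  intros Hn Hf. apply (contC_comp (V := C_UniformSpace) f Cinv); [exact Hf |].
  eapply Cd_cont. apply Cd_Cinv, Hn.
Qed.

Lemma Cmod_ch_lower w psi : (Rabs psi < PI / 4)%R -> (exp (Rabs w) / 2 <= Cmod (ch w psi))%R.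
Proof.
  intros H. eapply Rle_trans; [| apply Re_le_Cmod]. rewrite Re_ch. pose proof PI_RGT_0.
  assert (Hc : (/ 2 <= cos psi)%R).
  { replace (/ 2)%R with (cos (PI / 3)) by (rewrite cos_PI3; field). apply cos_lower; lra. }
  pose proof (exp_pos w). pose proof (exp_pos (- w)).
  assert (exp (Rabs w) <= exp (- w) + exp w)%R by (unfold Rabs; destruct (Rcase_abs w); lra).
  pose proof (exp_pos (Rabs w)). nra.
Qed.

Lemma rapid2_ratio s : (Rabs (Re s) < 1 / 4)%R ->
  rapid2 (fun v w => om v * (Cexp (4 * s * w) * / ch w (ang v))).
Proof.
  intros Hs. pose proof PI_RGT_0 as Ppi.
  assert (Nz : forall w v, ch w (ang v) <> 0).
  { intros w v. apply Cd_neq, Re_ch_pos. pose proof (ang_bound v). lra. }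
  split.
  - intros v w. unfold joint; cbv beta.
    assert (Ca : @continuous (prod_UniformSpace R_UniformSpace R_UniformSpace) R_UniformSpace (fun p => ang (fst p)) (v, w)).
    { apply (continuous_comp (U := prod_UniformSpace R_UniformSpace R_UniformSpace) (V := R_UniformSpace) (W := R_UniformSpace) fst ang);
        [apply (cont_fst (U := R_UniformSpace)) | apply cont_ang]. }
    apply contC_mult.
    + ctac. apply (continuous_comp (U := prod_UniformSpace R_UniformSpace R_UniformSpace) (V := R_UniformSpace) (W := R_UniformSpace) fst om);
        [apply (cont_fst (U := R_UniformSpace)) | apply cont_om].
    + apply contC_mult; [ctac |]. apply contC_Cinv; [apply Nz |]. unfold ch. ctac; assumption.
  - exists 4%R, (Rmin (/ 2) (1 - 4 * Rabs (Re s))). split; [apply Rmin_pos; lra |].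
    intros v w. rewrite !Cmod_mult, Cmod_R, Cmod_inv, Cmod_Cexp by apply Nz.
    pose proof (om_bound v) as B. rewrite Rabs_pos_eq by lra.
    set (c := Rmin (/ 2) (1 - 4 * Rabs (Re s))).
    assert (B1 : (om v <= 2 * exp (- (c * Rabs v)))%R).
    { eapply Rle_trans; [apply B |]. apply Rmult_le_compat_l; [lra |]. apply exp_le.
      pose proof (Rmin_l (/ 2) (1 - 4 * Rabs (Re s))). fold c in H. pose proof (Rabs_pos v). nra. }
    assert (B2 : (exp (Re (4 * s * w)) * / Cmod (ch w (ang v)) <= 2 * exp (- (c * Rabs w)))%R).
    { pose proof (Cmod_ch_lower w (ang v) (ang_bound v)) as L. pose proof (exp_pos (Rabs w)) as Pw.
      apply Rle_trans with (exp (4 * Rabs (Re s) * Rabs w) * / (exp (Rabs w) / 2))%R.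
      - apply Rmult_le_compat; [apply Rlt_le, exp_pos | apply Rlt_le, Rinv_0_lt_compat; lra | |].
        + apply exp_le. rewrite re_scal_r, Re_4s. rewrite !Rmult_assoc. apply Rmult_le_compat_l; [lra |].
          rewrite <- Rabs_mult. apply Rle_abs.
        + apply Rinv_le_contravar; lra.
      - replace (exp (4 * Rabs (Re s) * Rabs w) * / (exp (Rabs w) / 2))%R
          with (2 * exp (4 * Rabs (Re s) * Rabs w + - Rabs w))%R by (rewrite exp_plus, exp_Ropp; field; lra).
        apply Rmult_le_compat_l; [lra |]. apply exp_le.
        pose proof (Rmin_r (/ 2) (1 - 4 * Rabs (Re s))) as R1. fold c in R1. pose proof (Rabs_pos w). nra. }
    replace (4 * exp (- (c * Rabs v)) * exp (- (c * Rabs w)))%R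
      with ((2 * exp (- (c * Rabs v))) * (2 * exp (- (c * Rabs w))))%R by ring.
    apply Rmult_le_compat; [lra | | exact B1 | exact B2].
    apply Rmult_le_pos; [apply Rlt_le, exp_pos |]. apply Rlt_le, Rinv_0_lt_compat, Cmod_gt_0, Nz.
Qed.

(** This is [tau (2 w)]: exchanging the roles of v and w turns the rate [ch w (ang v)]
    into the two rates [cc w] and its conjugate. *)
Definition cc (w : R) : C := / 2 * ((1 - Ci) * exp (- w) + (1 + Ci) * exp w).

Lemma Re_cc w : (0 < Re (cc w))%R.
Proof.
  unfold cc. rewrite <- RtoC_inv by lra. rewrite re_scal_l. cbn.
  pose proof (exp_pos w). pose proof (exp_pos (- w)). lra.
Qed.

Lemma Cmod_cc w : Cmod (cc w) = exp (rad (w + w)).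
Proof.
  pose proof (tau_polar (w + w)) as E. replace ((w + w) / 2)%R with w in E by field.
  replace (Cmod (cc w)) with (Cmod (tau (w + w))) by (unfold tau, cc; do 5 f_equal; f_equal; f_equal; field).
  rewrite <- tau_polar, Cmod_Cexp. f_equal. cbn. ring.
Qed.

Lemma CI_half_rate (k : C) : (0 < Re k)%R ->
  CI (fun x : R => Cexp (/ 2 * x - k * Cexp x)) = Cexp (- (/ 2 * Clog k)) * Gam (/ 2) /\
  rapid (fun x : R => Cexp (/ 2 * x - k * Cexp x)).
Proof.
  intros Hk. assert (Q : (0 < Re (/ 2))%R) by (rewrite Re_half; lra).
  pose proof (Carg_half k Hk) as HA. change (Carg k) with (Im (Clog k)) in HA.
  pose proof (Gam_scaled (/ 2) (Clog k) Q HA) as E. pose proof (rapid_Gam_scaled (/ 2) (Clog k) Q HA) as G.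
  rewrite Cexp_Clog in E, G by (apply Cd_neq, Hk). split; assumption.
Qed.

(** Write 1 / ch as an integral over m; in the coordinates of [CI2_rotate] the double
    integral splits into two Gamma integrals with the conjugate rates [cc w]. *)
Lemma ratio_inner (w : R) : CI (fun v => om v * / ch w (ang v)) = PI * om (w + w).
Proof.
  pose proof (Re_cc w) as Hc.
  assert (Hc' : (0 < Re (Cconj (cc w)))%R) by (rewrite re_conj; exact Hc).
  destruct (CI_half_rate _ Hc) as [E1 G1]. destruct (CI_half_rate _ Hc') as [E2 G2].
  set (f := fun x y : R => Cexp (/ 2 * x - cc w * Cexp x) * Cexp (/ 2 * y - Cconj (cc w) * Cexp y)).
  pose proof (rapid2_prod _ _ G1 G2) as GF. change (rapid2 f) in GF.
  transitivity (CI (fun x => CI (f x))).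
  - rewrite (CI2_rotate f GF). apply CI_ext. intros v.
    assert (Hr : (0 < Re (ch w (ang v)))%R).
    { apply Re_ch_pos. pose proof (ang_bound v). pose proof PI_RGT_0. lra. }
    rewrite <- (CI_exp_lin (ch w (ang v)) Hr).
    pose proof (rapid_exp_lin (ch w (ang v)) Hr) as GE.
    rewrite <- (CI_shift _ (rad v) GE), <- CI_scal by (apply (rapid_shift _ (rad v) GE)).
    apply CI_ext. intros m. unfold f, om. rewrite <- !Cexp_R, <- !Cexp_plus. f_equal.
    rewrite !RtoC_plus, !RtoC_minus, RtoC_opp, Cexp_plus.
    pose proof (tau_polar v) as T1. pose proof (tau_polar_conj v) as T2.
    assert (EC : ch w (ang v) * Cexp (rad v) = Cexp (- w) * Cexp (rad v + Ci * ang v) + Cexp w * Cexp (rad v - Ci * ang v)).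
    { unfold ch. unfold Cminus. rewrite !Cexp_plus. ring. }
    replace (- rad v + (m + rad v - ch w (ang v) * (Cexp m * Cexp (rad v))))
      with (m - Cexp m * (ch w (ang v) * Cexp (rad v))) by ring.
    rewrite EC, T1, T2. unfold tau, cc.
    replace (RtoC (v / 2)) with (/ 2 * v) by (rewrite RtoC_div by lra; unfold Cdiv; ring).
    replace (Cexp (m - / 2 * v)) with (Cexp m * RtoC (exp (- (v / 2)))).
    2:{ unfold Cminus. rewrite Cexp_plus. f_equal. rewrite <- Cexp_R. f_equal.
        rewrite RtoC_opp, RtoC_div by lra. unfold Cdiv. ring. }
    replace (Cexp (m + / 2 * v)) with (Cexp m * RtoC (exp (v / 2))).
    2:{ rewrite Cexp_plus. f_equal. rewrite <- Cexp_R. f_equal. rewrite RtoC_div by lra. unfold Cdiv. ring. }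
    replace (Cexp (- w)) with (RtoC (exp (- w))) by (rewrite <- Cexp_R, RtoC_opp; reflexivity).
    rewrite !Cexp_R.
    replace (Cconj (/ 2 * ((1 - Ci) * exp (- w) + (1 + Ci) * exp w)))
      with (/ 2 * ((1 + Ci) * exp (- w) + (1 - Ci) * exp w))
      by (rewrite <- RtoC_inv by lra; apply C_eq; cbn; ring).
    assert (I2 : Ci * Ci = - (1)) by (apply C_eq; cbn; ring).
    generalize (RtoC (exp m)) (RtoC (exp (- w))) (RtoC (exp w)) (RtoC (exp (- (v / 2)))) (RtoC (exp (v / 2))).
    intros. field.
  - unfold f. rewrite (CI_ext _ (fun x => CI (fun y : R => Cexp (/ 2 * y - Cconj (cc w) * Cexp y)) * Cexp (/ 2 * x - cc w * Cexp x))).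
    2:{ intros x. rewrite CI_scal by exact G2. ring. }
    rewrite CI_scal by exact G1. rewrite E1, E2.
    transitivity (Cexp (- (/ 2 * Clog (Cconj (cc w)))) * Cexp (- (/ 2 * Clog (cc w))) * (Gam (/ 2) * Gam (/ 2))); [ring |].
    rewrite Gam_half_sq, <- Cexp_plus, Cmult_comm. f_equal.
    unfold om. rewrite <- Cexp_R.
    replace (RtoC (- rad (w + w))) with (- RtoC (ln (Cmod (cc w)))).
    2:{ rewrite Cmod_cc, ln_exp, RtoC_opp. reflexivity. }
    (* the two principal arguments are opposite *)
    assert (EL : Clog (Cconj (cc w)) = Cconj (Clog (cc w))).
    { pose proof (Carg_half _ Hc) as A. change (Carg (cc w)) with (Im (Clog (cc w))) in A. apply Rabs_lt_between in A.
      rewrite <- (Clog_unique (Cconj (Clog (cc w)))) by (rewrite im_conj; pose proof PI_RGT_0; lra).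
      f_equal. rewrite <- (Cexp_Clog (cc w)) at 1 by (apply Cd_neq, Hc).
      destruct (Clog (cc w)) as [p q]. apply C_eq; cbn; rewrite ?cos_neg, ?sin_neg; ring. }
    rewrite EL. f_equal. unfold Clog. rewrite <- !RtoC_inv by lra. apply C_eq; cbn; field.
Qed.

(** Both sides are Fourier integrals in w of [om]. On the left, multiplying the two
    Gamma integrals gives the frequency 2 s and the weight (2 cosh w)^(-1/2). On the
    right, [Gam_pair] at angle [ang v] and [ratio_inner] give the frequency 4 s and
    the weight [om (2 w)]. *)
Lemma Gamma_ratio s : (Rabs (Re s) < 1 / 4)%R ->
  PI * (Gam (/ 4 - s) * Gam (/ 4 + s)) = sqrt 2 * Gam (/ 2) * (Rhat s * gpair (4 * s)).
Proof.
  intros Hs. pose proof PI_RGT_0 as Ppi.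
  assert (Hu : (Rabs (Re (4 * s)) < 1)%R) by (rewrite Re_4s, Rabs_mult, Rabs_pos_eq by lra; lra).
  pose proof (rapid2_ratio s Hs) as G2.
  set (X := CI (fun w : R => Cexp (4 * s * w) * om (w + w))).
  assert (EX : Rhat s * gpair (4 * s) = 2 * (PI * X)).
  { transitivity (CI (fun v => CI (fun w => 2 * (om v * (Cexp (4 * s * w) * / ch w (ang v)))))).
    - rewrite Cmult_comm. unfold Rhat. rewrite <- CI_scal by apply rapid_Rhat. apply CI_ext. intros v.
      assert (Hp : (Rabs (ang v) < PI / 2)%R) by (pose proof (ang_bound v); lra).
      pose proof (rapid_pair (4 * s) (ang v) Hu Hp) as GP.
      rewrite (CI_ext _ (fun w => 2 * om v * (Cexp (4 * s * w) * / ch w (ang v)))) by (intros; ring).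
      rewrite CI_scal by exact GP. pose proof (Gam_pair (4 * s) (ang v) Hu Hp) as E. fold (gpair (4 * s)) in E.
      replace (4 * s * (Ci * ang v)) with (Ci * ang v * (4 * s)) by ring.
      transitivity (om v * (Cexp (Ci * ang v * (4 * s)) * gpair (4 * s))); [ring | rewrite E; ring].
    - rewrite (CI_ext _ (fun v => 2 * CI (fun w => om v * (Cexp (4 * s * w) * / ch w (ang v)))))
        by (intros v; apply CI_scal, (rapid2_slice _ v G2)).
      rewrite CI_scal by (apply rapid2_CI, G2). f_equal. rewrite (CI_Fubini _ G2).
      assert (GX : rapid (fun w : R => Cexp (4 * s * w) * (PI * om (w + w)))).
      { apply (rapid_ext (fun w => CI (fun v => om v * (Cexp (4 * s * w) * / ch w (ang v))))).
        - intros w. rewrite <- ratio_inner. rewrite (CI_ext _ (fun v => Cexp (4 * s * w) * (om v * / ch w (ang v)))) by (intros; ring).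
          apply CI_scal. apply (rapid_ext (fun v => / Cexp (4 * s * w) * (om v * (Cexp (4 * s * w) * / ch w (ang v))))).
          + intros v. field. split; [| apply Cexp_neq_0].
            apply Cd_neq, Re_ch_pos. pose proof (ang_bound v). lra.
          + apply rapid_scal. apply (rapid2_slice _ w (rapid2_swap _ G2)).
        - apply (rapid2_CI _ (rapid2_swap _ G2)). }
      transitivity (CI (fun w : R => Cexp (4 * s * w) * (PI * om (w + w)))).
      + apply CI_ext. intros w. rewrite <- ratio_inner.
        rewrite (CI_ext _ (fun v => Cexp (4 * s * w) * (om v * / ch w (ang v)))) by (intros; ring).
        apply CI_scal. apply (rapid_ext (fun v => / Cexp (4 * s * w) * (om v * (Cexp (4 * s * w) * / ch w (ang v))))).
        * intros v. field. split; [| apply Cexp_neq_0].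
          apply Cd_neq, Re_ch_pos. pose proof (ang_bound v). lra.
        * apply rapid_scal. apply (rapid2_slice _ w (rapid2_swap _ G2)).
      + unfold X. rewrite <- CI_scal.
        * apply CI_ext. intros; ring.
        * apply (rapid_ext (fun w : R => / PI * (Cexp (4 * s * w) * (PI * om (w + w))))).
          -- intros w. field. apply PI_neq_0.
          -- apply rapid_scal, GX. }
  apply Rabs_lt_between in Hs.
  assert (Ha : (0 < Re (/ 4 - s))%R).
  { replace (Re (/ 4 - s)) with (/ 4 - Re s)%R; [lra |]. rewrite <- RtoC_inv by lra. reflexivity. }
  assert (Hb : (0 < Re (/ 4 + s))%R).
  { replace (Re (/ 4 + s)) with (/ 4 + Re s)%R; [lra |]. rewrite <- RtoC_inv by lra. reflexivity. }
  assert (Es : (sqrt 2 * exp (- (/ 2 * ln 2)) = 1)%R).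
  { rewrite <- (Rpower_sqrt 2) by lra. unfold Rpower. rewrite <- exp_plus. replace (/ 2 * ln 2 + - (/ 2 * ln 2))%R with 0%R by ring. apply exp_0. }
  assert (Es2 : (sqrt 2 * sqrt 2 = 2)%R) by (apply sqrt_sqrt; lra).
  assert (EY : sqrt 2 * (Gam (/ 4 - s) * Gam (/ 4 + s)) = 4 * Gam (/ 2) * X).
  { unfold Gam at 1 2. rewrite (CI_prod_conv _ _ (rapid_Gk _ Ha) (rapid_Gk _ Hb)).
    assert (EI : forall w : R, CI (fun m : R => Gk (/ 4 - s) (m - w)%R * Gk (/ 4 + s) (m + w)%R)
       = (Gam (/ 2) * exp (- (/ 2 * ln 2))%R) * (Cexp (2 * s * w) * om w)).
    { intros w. set (k := (exp (- w) + exp w)%R).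
      assert (Pk : (0 < k)%R) by (unfold k; pose proof (exp_pos w); pose proof (exp_pos (- w)); lra).
      assert (Hk : (0 < Re (RtoC k))%R) by exact Pk.
      destruct (CI_half_rate k Hk) as [E G].
      rewrite (CI_ext _ (fun m : R => Cexp (2 * s * w) * Cexp (/ 2 * m - k * Cexp m))).
      - rewrite CI_scal by exact G. rewrite E.
        replace (Clog k) with (RtoC (ln 2) + RtoC (rad w + rad w)).
        + rewrite Cmult_plus_distr_l, Copp_plus_distr, Cexp_plus. unfold om. rewrite RtoC_plus.
          replace (- (/ 2 * (rad w + rad w))) with (- RtoC (rad w)) by field.
          replace (- (/ 2 * ln 2)) with (RtoC (- (/ 2 * ln 2))) by (rewrite RtoC_opp, RtoC_mult, RtoC_inv by lra; reflexivity).
          rewrite <- RtoC_opp, !Cexp_R. ring.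
        + rewrite <- (Clog_unique (RtoC (ln 2) + RtoC (rad w + rad w))) by (cbn; lra).
          f_equal. rewrite Cexp_plus, !Cexp_R, exp_ln, exp_2rad by lra.
          rewrite <- RtoC_mult. f_equal. unfold k. field.
      - intros m. unfold Gk. rewrite <- !Cexp_plus. f_equal. unfold k.
        rewrite RtoC_minus, !RtoC_plus. replace (Cexp (m - w)) with (Cexp m * Cexp (- w)) by (unfold Cminus; rewrite Cexp_plus; reflexivity). rewrite !Cexp_plus.
        replace (Cexp (- w)) with (RtoC (exp (- w))) by (rewrite <- Cexp_R, RtoC_opp; reflexivity).
        rewrite !Cexp_R. field. }
    rewrite (CI_ext _ _ EI).
    assert (G4 : rapid (fun w : R => Cexp (2 * s * w) * om w)).
    { split; [ctac; apply cont_om |]. exists 2%R, (/ 2 - 2 * Rabs (Re s))%R.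
      assert (Rabs (Re s) < 1 / 4)%R by (apply Rabs_lt_between; lra). split; [lra |].
      intros w. rewrite Cmod_mult, Cmod_R, Cmod_Cexp. pose proof (om_bound w) as B. rewrite Rabs_pos_eq by lra.
      assert (E : (exp (Re (2 * s * w)) <= exp (2 * Rabs (Re s) * Rabs w))%R).
      { apply exp_le. replace (Re (2 * s * w)) with (2 * (Re s * w))%R by (destruct s; cbn; ring).
        rewrite Rmult_assoc. apply Rmult_le_compat_l; [lra |]. rewrite <- Rabs_mult. apply Rle_abs. }
      pose proof (exp_pos (Re (2 * s * w))).
      replace (2 * exp (- ((/ 2 - 2 * Rabs (Re s)) * Rabs w)))%R
        with (exp (2 * Rabs (Re s) * Rabs w) * (2 * exp (- (/ 2 * Rabs w))))%R.
      - apply Rmult_le_compat; lra.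
      - replace (- ((/ 2 - 2 * Rabs (Re s)) * Rabs w))%R with (2 * Rabs (Re s) * Rabs w + - (/ 2 * Rabs w))%R by ring.
        rewrite exp_plus. ring. }
    rewrite CI_scal by exact G4. rewrite <- (CI_lin _ 2 ltac:(lra) G4).
    replace (CI (fun x : R => Cexp (2 * s * (2 * x)%R) * om (2 * x))) with X.
    2:{ unfold X. apply CI_ext. intros w. rewrite RtoC_mult. f_equal; [f_equal; ring | f_equal; f_equal; ring]. }
    transitivity (RtoC (sqrt 2 * exp (- (/ 2 * ln 2))) * (4 * Gam (/ 2) * X)); [rewrite RtoC_mult; ring |].
    rewrite Es. ring. }
  transitivity (/ 2 * (sqrt 2 * sqrt 2)%R * (PI * (Gam (/ 4 - s) * Gam (/ 4 + s)))); [rewrite Es2; field |].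
  rewrite EX, RtoC_mult.
  transitivity (/ 2 * sqrt 2 * PI * (sqrt 2 * (Gam (/ 4 - s) * Gam (/ 4 + s)))); [ring |].
  rewrite EY. field.
Qed.

(** * The kernel obtained by merging the two parabolic cylinder integrals *)

(** The kernel [pcKer] with a free coefficient K of the quadratic term. Merging the
    kernels of two parabolic cylinder functions along the rotated rays gives such a
    kernel with p = 1. *)
Definition quadKer (p : R) (Z K z : C) : C := Cexp (p * z - Z * Cexp z - K * Cexp (z + z)).

Lemma quadKer_succ (p : R) Z K z : Cexp z * quadKer p Z K z = quadKer (p + 1) Z K z.
Proof. unfold quadKer. rewrite <- Cexp_plus. f_equal. rewrite RtoC_plus. ring. Qed.

Lemma Cd_quadKer (p : R) Z K z :
  Cd (quadKer p Z K) z (p * quadKer p Z K z - Z * quadKer (p + 1) Z K z - 2 * K * quadKer (p + 1 + 1) Z K z).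
Proof.
  rewrite <- !quadKer_succ. eapply Cd_eq; [unfold quadKer; dtac |]. unfold quadKer. rewrite (Cexp_plus z z). ring.
Qed.

Lemma Re_quadKer_arg (p : R) Z K z : Re (p * z - Z * Cexp z - K * Cexp (z + z)) =
  (p * Re z - Re (Z * Cexp z) - Re (K * Cexp (Ci * (Im z + Im z)%R)) * exp (Re z + Re z))%R.
Proof.
  unfold Cminus. rewrite !re_plus, !re_opp, re_scal_l.
  replace (K * Cexp (z + z)) with (K * Cexp (Ci * (Im z + Im z)%R) * exp (Re z + Re z)).
  - rewrite re_scal_r. ring.
  - rewrite <- Cmult_assoc, <- Cexp_R, <- Cexp_plus. f_equal. f_equal. destruct z; apply C_eq; cbn; ring.
Qed.

Lemma Re_mult_Cexp_lower Z z B : (Cmod Z <= B)%R -> (- Re (Z * Cexp z) <= B * exp (Re z))%R.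
Proof.
  intros HZ. rewrite <- re_opp. eapply Rle_trans; [apply Re_le_Cmod |]. rewrite Cmod_opp, Cmod_mult, Cmod_Cexp.
  apply Rmult_le_compat_r; [apply Rlt_le, exp_pos | exact HZ].
Qed.

(** Half of the quadratic term absorbs the linear one; what counts is the real part of
    its coefficient after rotation by Im z. *)
Lemma quadKer_bound_quad (p : R) B k Z K z : (0 < p)%R -> (0 < k)%R -> (Cmod Z <= B)%R ->
  (k <= Re (K * Cexp (Ci * (Im z + Im z)%R)))%R ->
  (Cmod (quadKer p Z K z) <= exp (B * B / (2 * k) + p * p / k) * exp (- (p * Rabs (Re z))))%R.
Proof.
  intros Hp Hk HZ HK. rewrite <- exp_plus. apply Cmod_le_exp. rewrite Re_quadKer_arg.
  pose proof (Re_mult_Cexp_lower Z z B HZ) as T2.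
  pose proof (exp_pos (Re z + Re z)) as E2.
  assert (T4 : (k * exp (Re z + Re z) <= Re (K * Cexp (Ci * (Im z + Im z)%R)) * exp (Re z + Re z))%R) by nra.
  assert (T5 : (B * exp (Re z) - k / 2 * exp (Re z + Re z) <= B * B / (2 * k))%R).
  { rewrite exp_plus. apply (Rmult_le_reg_r (2 * k)); [lra |].
    replace (B * B / (2 * k) * (2 * k))%R with (B * B)%R by (field; lra).
    pose proof (Rle_0_sqr (B - k * exp (Re z))) as S. unfold Rsqr in S. nra. }
  pose proof (expo_bound (p / 2) (p / 2) (p / 2) (k / 2) (k / 2) (Re z + Re z) ltac:(lra) ltac:(lra) ltac:(lra)) as T6.
  replace ((p / 2 + p / 2) * (p / 2 + p / 2) / (2 * (k / 2)))%R with (p * p / k)%R in T6 by (field; lra).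
  replace (Re z + Re z)%R with (2 * Re z)%R in T6 at 3 by ring.
  rewrite Rabs_mult, (Rabs_pos_eq 2) in T6 by lra. lra.
Qed.

(** On the real axis, and uniformly in K, a linear term with positive real part gives
    the decay. *)
Lemma quadKer_bound_lin c Z K (x : R) : (0 < c)%R -> (c <= Re Z)%R -> (0 <= Re K)%R ->
  (Cmod (quadKer 1 Z K x) <= exp (2 / c) * exp (- (1 * Rabs x)))%R.
Proof.
  intros Hc HZ HK. rewrite <- exp_plus. apply Cmod_le_exp. rewrite Re_quadKer_arg, Cexp_R, re_scal_r.
  replace (Im x + Im x)%R with 0%R by (cbn; ring). rewrite Cmult_0_r, Cexp_0, Cmult_1_r. cbn [Re RtoC fst].
  pose proof (exp_pos x). pose proof (exp_pos (x + x)).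
  pose proof (expo_bound 1 1 1 c (Re Z) x ltac:(lra) ltac:(lra) ltac:(lra)) as E.
  replace ((1 + 1) * (1 + 1) / (2 * c))%R with (2 / c)%R in E by (field; lra).
  change (Re x) with x. unfold Re in *. cbn [fst] in *. nra.
Qed.

Lemma contC_qk {U : UniformSpace} p (fZ fK fz : U -> C) u : contC fZ u -> contC fK u -> contC fz u ->
  contC (fun u => quadKer p (fZ u) (fK u) (fz u)) u.
Proof. intros HZ HK Hz. unfold quadKer. ctac; assumption. Qed.

(** ** The coefficients *)

(** Coefficients of the merged kernel, as functions of u = w - i al where al is the
    angle of rotation and w half the difference of the two variables. *)
Definition Zu (xi eta u : C) : C := xi * Cexp (- u) + eta * Cexp u.
Definition Ku (u : C) : C := / 2 * (Cexp (- (u + u)) + Cexp (u + u)).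

Definition merged (xi eta u : C) : C := CI (fun m : R => quadKer 1 (Zu xi eta u) (Ku u) m).

Lemma merged_swap xi eta u : merged xi eta u = merged eta xi (- u).
Proof.
  unfold merged. apply CI_ext. intros m. unfold Zu, Ku.
  replace (- (- u)) with u by ring. replace (- (- u + - u)) with (u + u) by ring.
  replace (- u + - u) with (- (u + u)) by ring. f_equal; ring.
Qed.

Definition uu (w al : R) : C := w - Ci * al.

Lemma Cmod_Zu xi eta w al : (Cmod (Zu xi eta (uu w al)) <= (Cmod xi + Cmod eta) * exp (Rabs w))%R.
Proof.
  unfold Zu. eapply Rle_trans; [apply Cmod_triangle |]. rewrite !Cmod_mult, !Cmod_Cexp.
  replace (Re (- uu w al)) with (- w)%R by (unfold uu; cbn; ring).
  replace (Re (uu w al)) with w by (unfold uu; cbn; ring).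
  rewrite Rmult_plus_distr_r. apply Rplus_le_compat; (apply Rmult_le_compat_l; [apply Cmod_ge_0 | apply exp_le]).
  - rewrite <- Rabs_Ropp. apply Rle_abs.
  - apply Rle_abs.
Qed.

Lemma Re_Ku_rot (w al y : R) : Re (Ku (uu w al) * Cexp (Ci * y)) =
  (/ 2 * (exp (- (w + w)) * cos (al + al + y) + exp (w + w) * cos (y - (al + al))))%R.
Proof.
  unfold Ku. rewrite <- Cmult_assoc, <- RtoC_inv, re_scal_l by lra. f_equal.
  rewrite Cmult_plus_distr_r, re_plus, <- !Cexp_plus, !Re_Cexp. unfold uu.
  f_equal; f_equal; f_equal; cbn; ring.
Qed.

Lemma Re_Ku_rot' (w al y : R) : Re (Ku (uu w al) * Cexp (Ci * y)) =
  (/ 2 * (exp (- (w + w)) + exp (w + w)) * (cos (al + al) * cos y)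
   + / 2 * (exp (w + w) - exp (- (w + w))) * (sin (al + al) * sin y))%R.
Proof. rewrite Re_Ku_rot, cos_plus, cos_minus. ring. Qed.

Lemma two_cosh x : (2 <= exp (- x) + exp x)%R.
Proof.
  pose proof (exp_pos x) as P. assert (E : (exp (- x) * exp x = 1)%R) by (rewrite <- exp_plus, Rplus_opp_l; apply exp_0).
  pose proof (Rle_0_sqr (exp x - 1)) as S. unfold Rsqr in S. nra.
Qed.

Lemma Re_Ku w al : (cos (al + al) <= Re (Ku (uu w al)) \/ cos (al + al) < 0)%R.
Proof.
  destruct (Rlt_dec (cos (al + al)) 0); [right; auto | left].
  pose proof (Re_Ku_rot' w al 0) as E. rewrite Cmult_0_r, Cexp_0, Cmult_1_r, cos_0, sin_0 in E. rewrite E.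
  pose proof (two_cosh (w + w)). nra.
Qed.

Lemma cos2_pos al : (Rabs al < PI / 4)%R -> (0 < cos (al + al))%R.
Proof. intros H. apply Rabs_lt_between in H. apply cos_gt_0; lra. Qed.

Lemma Re_Ku_pos w al : (Rabs al < PI / 4)%R -> (cos (al + al) <= Re (Ku (uu w al)))%R.
Proof. intros H. pose proof (cos2_pos al H). destruct (Re_Ku w al); lra. Qed.

Lemma rapid_merged xi eta w al : (Rabs al < PI / 4)%R ->
  rapid (fun m : R => quadKer 1 (Zu xi eta (uu w al)) (Ku (uu w al)) m).
Proof.
  intros H. pose proof (cos2_pos al H) as Pc. split.
  - intros x. apply (contC_qk (U := R_UniformSpace) 1 (fun _ => Zu xi eta (uu w al)) (fun _ => Ku (uu w al)) (fun m : R => RtoC m)); ctac.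
  - set (ZZ := Zu xi eta (uu w al)). exists (exp (Cmod ZZ * Cmod ZZ / (2 * cos (al + al)) + 1 * 1 / cos (al + al))), 1%R. split; [lra |]. intros x. eapply Rle_trans.
    + apply (quadKer_bound_quad 1 (Cmod ZZ) (cos (al + al))); [lra | exact Pc | apply Rle_refl |].
      replace (Im x + Im x)%R with 0%R by (cbn; ring). rewrite Cmult_0_r, Cexp_0, Cmult_1_r. apply Re_Ku_pos, H.
    + apply Rle_refl.
Qed.

(** Rotating the variable by [al] makes the dominant term exp (2 w) / 2 of the
    quadratic coefficient real. The convergence in between follows from Re (K e^(2 i
    y)) = cosh (2 w) cos (2 al) cos (2 y) + sinh (2 w) sin (2 al) sin (2 y), where the
    second term is nonnegative for w >= 0 and y between 0 and al. *)
Lemma merged_rotate xi eta w al : (Rabs al < PI / 4)%R -> (0 <= w)%R ->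
  merged xi eta (uu w al) = CI (fun m : R => quadKer 1 (Zu xi eta (uu w al)) (Ku (uu w al)) (m - uu w al)).
Proof.
  intros H Hw. pose proof PI_RGT_0 as Ppi. pose proof (Rabs_pos al) as Pal.
  set (f1 := ((Rabs al + PI / 4) / 2)%R). assert (Hf1 : (Rabs al < f1 < PI / 4)%R) by (unfold f1; lra).
  set (c1 := cos (f1 + f1)). assert (Hc1 : (0 < c1)%R) by (apply cos_gt_0; lra).
  set (e := Rmin (f1 - Rabs al) (c1 * c1 / 8)).
  assert (He : (0 < e)%R) by (apply Rmin_pos; nra).
  assert (He1 : (e <= f1 - Rabs al)%R) by apply Rmin_l.
  assert (He2 : (e <= c1 * c1 / 8)%R) by apply Rmin_r.
  set (lo := (Rmin 0 al - e)%R). set (hi := (Rmax 0 al + e)%R).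
  set (Z := Zu xi eta (uu w al)). set (K := Ku (uu w al)).
  assert (KB : forall z, strip lo hi z -> (c1 * c1 / 2 <= Re (K * Cexp (Ci * (Im z + Im z)%R)))%R).
  { intros z [L1 L2]. unfold K. rewrite Re_Ku_rot'. set (y := Im z) in *.
    assert (Hy : (Rabs y <= f1)%R).
    { apply Rabs_le_between. unfold lo, hi, Rmin, Rmax in *. clearbody y e f1.
      destruct (Rle_dec 0 al); [rewrite Rabs_pos_eq in * by lra | rewrite Rabs_left in * by lra];
        split; destruct (Rle_dec 0 al); lra. }
    assert (C1 : (c1 <= cos (y + y))%R) by (apply cos_lower; [lra | eapply Rle_trans; [apply Rabs_triang | lra]]).
    assert (C2 : (c1 <= cos (al + al))%R) by (apply cos_lower; [lra | eapply Rle_trans; [apply Rabs_triang | lra]]).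
    set (sh := (/ 2 * (exp (w + w) - exp (- (w + w))))%R).
    set (co := (/ 2 * (exp (- (w + w)) + exp (w + w)))%R).
    assert (Hsh : (0 <= sh <= co)%R).
    { unfold sh, co. pose proof (exp_le (- (w + w)) (w + w) ltac:(lra)). pose proof (exp_pos (- (w + w))). lra. }
    assert (Hco : (1 <= co)%R) by (unfold co; pose proof (two_cosh (w + w)); lra).
    assert (CC : (c1 * c1 <= cos (al + al) * cos (y + y))%R) by (apply Rmult_le_compat; lra).
    assert (SS : (- (c1 * c1 / 2) <= sin (al + al) * sin (y + y))%R).
    { assert (G : forall a b, (0 <= a < PI / 4)%R -> (- e < b < PI / 4)%R -> (- (4 * e) <= sin (a + a) * sin (b + b))%R).
      { intros a b Ha Hb. pose proof (sin_ge_0 (a + a) ltac:(lra) ltac:(lra)). pose proof (SIN_bound (a + a)).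
        destruct (Rle_dec 0 b).
        - pose proof (sin_ge_0 (b + b) ltac:(lra) ltac:(lra)). nra.
        - assert (- (2 * e) <= sin (b + b))%R; [| nra].
          pose proof (sin_lt_x (- (b + b)) ltac:(lra)) as L. rewrite sin_neg in L. lra. }
      apply Rle_trans with (- (4 * e))%R; [lra |]. apply Rabs_le_between in Hy.
      unfold lo, hi, Rmin, Rmax in *. destruct (Rle_dec 0 al).
      - apply G; [rewrite Rabs_pos_eq in H by lra; lra | lra].
      - replace (sin (al + al) * sin (y + y))%R with (sin (- al + - al) * sin (- y + - y))%R.
        + rewrite Rabs_left in H by lra. apply G; lra.
        + replace (- al + - al)%R with (- (al + al))%R by ring. replace (- y + - y)%R with (- (y + y))%R by ring.
          rewrite !sin_neg. ring. }
    nra. }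
  set (X := fun p : R => exp (Cmod Z * Cmod Z / (2 * (c1 * c1 / 2)) + p * p / (c1 * c1 / 2))%R).
  assert (QB : forall p z, (1 <= p)%R -> strip lo hi z ->
     (Cmod (quadKer p Z K z) <= X p * exp (- (1 * Rabs (Re z))))%R).
  { intros p z Hp Hz. eapply Rle_trans; [apply (quadKer_bound_quad p (Cmod Z) (c1 * c1 / 2)); [lra | nra | apply Rle_refl | apply KB, Hz] |].
    apply Rmult_le_compat_l; [apply Rlt_le, exp_pos |]. apply exp_le. pose proof (Rabs_pos (Re z)). nra. }
  set (N := (X 1 + Cmod Z * X (1 + 1) + 2 * Cmod K * X (1 + 1 + 1))%R).
  assert (PX : forall p, (0 < X p)%R) by (intros; apply exp_pos).
  pose proof (Cmod_ge_0 Z) as PZ. pose proof (Cmod_ge_0 K) as PK.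
  assert (S0 : strip lo hi 0).
  { unfold strip, lo, hi, Rmin, Rmax. cbn. destruct (Rle_dec 0 al); lra. }
  assert (S1 : strip lo hi (- uu w al)).
  { unfold strip, lo, hi, Rmin, Rmax, uu. replace (Im (- (w - Ci * al))) with al by (cbn; ring).
    destruct (Rle_dec 0 al); lra. }
  unfold merged. fold Z K. symmetry.
  apply (CI_contour0 N 1 lo hi (quadKer 1 Z K) (fun z => 1%R * quadKer 1 Z K z - Z * quadKer (1 + 1) Z K z - 2 * K * quadKer (1 + 1 + 1) Z K z));
    try assumption; [lra | | | |].
  - intros z _. apply Cd_quadKer.
  - intros z _. assert (Cq : forall p, @contC C_UniformSpace (quadKer p Z K) z) by (intros p; apply (contC_qk (U := C_UniformSpace) p (fun _ => Z) (fun _ => K) (fun z => z)); ctac).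
    ctac; apply Cq.
  - intros z Hz. eapply Rle_trans; [apply (QB 1%R z); [lra | exact Hz] |].
    apply Rmult_le_compat_r; [apply Rlt_le, exp_pos |]. unfold N. pose proof (PX (1 + 1)%R). pose proof (PX (1 + 1 + 1)%R). nra.
  - intros z Hz. set (x := exp (- (1 * Rabs (Re z)))).
    pose proof (QB 1%R z ltac:(lra) Hz) as B0. pose proof (QB (1 + 1)%R z ltac:(lra) Hz) as B1.
    pose proof (QB (1 + 1 + 1)%R z ltac:(lra) Hz) as B2. fold x in B0, B1, B2.
    eapply Rle_trans; [apply Cmod_triangle' |].
    eapply Rle_trans; [apply Rplus_le_compat_r, Cmod_triangle' |]. rewrite !Cmod_mult, !Cmod_R, !Rabs_pos_eq by lra.
    pose proof (Rmult_le_compat_l _ _ _ PZ B1). pose proof (Rmult_le_compat_l _ _ _ PK B2).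
    unfold N. lra.
Qed.

(** * Decay and continuity of the merged kernel *)

Lemma quadKer_shift (p : R) Z K z d :
  quadKer p Z K (z - d) = Cexp (- (p * d)) * quadKer p (Z * Cexp (- d)) (K * Cexp (- (d + d))) z.
Proof.
  unfold quadKer. rewrite <- Cexp_plus. f_equal.
  replace (Cexp (z - d)) with (Cexp z * Cexp (- d)) by (rewrite <- Cexp_plus; reflexivity).
  replace (Cexp (z - d + (z - d))) with (Cexp (z + z) * Cexp (- (d + d))) by (rewrite <- Cexp_plus; f_equal; ring).
  ring.
Qed.

(** After the rotation and the translation by -w the coefficients are bounded in terms
    of d alone, and the differential contributes the factor e^(-w). *)
Lemma merged_bound_far xi eta d w al : (0 < d <= w)%R -> (Rabs al < PI / 4)%R ->
  let k := (/ 2 * (1 - exp (- (4 * d))))%R in let B := (Cmod xi + Cmod eta)%R in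
  (Cmod (merged xi eta (uu w al)) <= 2 * exp (B * B / (2 * k) + 1 * 1 / k) * exp (- w))%R.
Proof.
  intros Hd Hal k B. rewrite merged_rotate by (auto; lra). set (Z := Zu xi eta (uu w al)). set (K := Ku (uu w al)).
  assert (Pk : (0 < k)%R).
  { unfold k. pose proof (exp_increasing (- (4 * d)) 0 ltac:(lra)) as E. rewrite exp_0 in E. lra. }
  assert (Eq : forall m : R, quadKer 1 Z K (m - uu w al) =
    Cexp (- w) * quadKer 1 (Z * Cexp (- w)) (K * Cexp (- (w + w))) (m + Ci * al)).
  { intros m. replace (m - uu w al) with (m + Ci * al - w) by (unfold uu; ring).
    rewrite quadKer_shift. do 2 f_equal. ring. }
  assert (Bd : eb (exp (B * B / (2 * k) + 1 * 1 / k) * exp (- w)) 1 (fun m : R => quadKer 1 Z K (m - uu w al))).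
  { intros m. rewrite Eq, Cmod_mult, Cmod_Cexp. replace (Re (- w)) with (- w)%R by reflexivity.
    rewrite (Rmult_comm (exp (B * B / (2 * k) + 1 * 1 / k))), Rmult_assoc.
    apply Rmult_le_compat_l; [apply Rlt_le, exp_pos |].
    rewrite <- (Re_line m al) at 2. apply (quadKer_bound_quad 1 B k); [lra | exact Pk | |].
    - rewrite Cmod_mult, Cmod_Cexp. replace (Re (- w)) with (- w)%R by reflexivity.
      pose proof (Cmod_Zu xi eta w al) as HZ. fold Z B in HZ. rewrite Rabs_pos_eq in HZ by lra.
      pose proof (exp_pos (- w)). apply Rle_trans with (B * exp w * exp (- w))%R; [apply Rmult_le_compat_r; lra |].
      rewrite Rmult_assoc, <- exp_plus, Rplus_opp_r, exp_0. lra.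
    - rewrite Im_line. replace (- (w + w)) with (RtoC (- (w + w))) by (rewrite RtoC_opp, RtoC_plus; reflexivity).
      rewrite Cexp_R. rewrite <- Cmult_assoc, (Cmult_comm (RtoC _)), Cmult_assoc, re_scal_r. unfold K. rewrite Re_Ku_rot.
      replace (al + al - (al + al))%R with 0%R by ring. rewrite cos_0.
      pose proof (COS_bound (al + al + (al + al))). pose proof (exp_pos (- (w + w))) as Pe.
      assert (E1 : (exp (w + w) * exp (- (w + w)) = 1)%R) by (rewrite <- exp_plus, Rplus_opp_r; apply exp_0).
      assert (E2 : (exp (- (w + w)) * exp (- (w + w)) <= exp (- (4 * d)))%R) by (rewrite <- exp_plus; apply exp_le; lra).
      unfold k. set (c := cos (al + al + (al + al))) in *.
      replace (/ 2 * (exp (- (w + w)) * c + exp (w + w) * 1) * exp (- (w + w)))%R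
        with (/ 2 * (c * (exp (- (w + w)) * exp (- (w + w))) + exp (w + w) * exp (- (w + w))))%R by ring.
      rewrite E1. assert (0 < exp (- (w + w)) * exp (- (w + w)))%R by nra. nra. }
  replace (2 * exp (B * B / (2 * k) + 1 * 1 / k) * exp (- w))%R
    with (2 * (exp (B * B / (2 * k) + 1 * 1 / k) * exp (- w)) / 1)%R by field.
  apply CI_bound; [| lra | exact Bd].
  intros m. apply (contC_qk (U := R_UniformSpace) 1 (fun _ => Z) (fun _ => K) (fun m : R => m - uu w al)); ctac.
Qed.

Lemma merged_bound_near xi eta c w al : (0 < c)%R -> (Rabs al < PI / 4)%R ->
  (c <= Re (Zu xi eta (uu w al)))%R -> (Cmod (merged xi eta (uu w al)) <= 2 * exp (2 / c))%R.
Proof.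
  intros Hc Hal HZ. replace (2 * exp (2 / c))%R with (2 * exp (2 / c) / 1)%R by field.
  apply CI_bound; [apply (proj1 (rapid_merged xi eta w al Hal)) | lra |].
  intros x. apply quadKer_bound_lin; [exact Hc | exact HZ |].
  pose proof (Re_Ku_pos w al Hal). pose proof (cos2_pos al Hal). lra.
Qed.

(** The two linear forms of the hypotheses, deformed by w. *)
Definition Pw (xi eta : C) (w : R) : C := (1 - Ci) * xi * exp (- w) + (1 + Ci) * eta * exp w.
Definition Qw (xi eta : C) (w : R) : C := (1 + Ci) * xi * exp (- w) + (1 - Ci) * eta * exp w.

(** The linear coefficient at angle [ang v] is a combination, with positive
    coefficients, of the two linear forms: this is where the hypotheses on xi and eta
    come in. *)
Lemma Re_Zu xi eta (w v : R) : Re (Zu xi eta (uu w (ang v))) =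
  (cos (ang v) * (/ 2 * ((1 - th v) * Re (Pw xi eta w) + (1 + th v) * Re (Qw xi eta w))))%R.
Proof.
  assert (E : (sin (ang v) = th v * cos (ang v))%R).
  { unfold ang. rewrite sin_atan, cos_atan. field.
    apply Rgt_not_eq, sqrt_lt_R0. pose proof (Rle_0_sqr (th v)). lra. }
  unfold Zu. rewrite re_plus, !re_mult, !Re_Cexp, !Im_Cexp.
  replace (Re (- uu w (ang v))) with (- w)%R by (unfold uu; cbn; ring).
  replace (Re (uu w (ang v))) with w by (unfold uu; cbn; ring).
  replace (Im (- uu w (ang v))) with (ang v) by (unfold uu; cbn; ring).
  replace (Im (uu w (ang v))) with (- ang v)%R by (unfold uu; cbn; ring).
  rewrite cos_neg, sin_neg, E. unfold Pw, Qw. destruct xi as [a b], eta as [a' b']. cbn. field.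
Qed.

Lemma cos_ang_lower v : (/ 2 <= cos (ang v))%R.
Proof.
  pose proof PI_RGT_0. pose proof (ang_bound v).
  replace (/ 2)%R with (cos (PI / 3)) by (rewrite cos_PI3; field). apply cos_lower; lra.
Qed.

Lemma Re_Zu_lower xi eta w v c : (0 < c)%R -> (c <= Re (Pw xi eta w))%R -> (c <= Re (Qw xi eta w))%R ->
  (c / 2 <= Re (Zu xi eta (uu w (ang v))))%R.
Proof.
  intros Hc HP HQ. rewrite Re_Zu. pose proof (cos_ang_lower v). pose proof (th_bounds v).
  assert (c <= / 2 * ((1 - th v) * Re (Pw xi eta w) + (1 + th v) * Re (Qw xi eta w)))%R by nra. nra.
Qed.

Lemma pos_near (a b : R) : (0 < a + b)%R ->
  exists d c, (0 < d)%R /\ (0 < c)%R /\ forall w, (Rabs w < d)%R -> (c <= a * exp (- w) + b * exp w)%R.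
Proof.
  intros H.
  assert (Cf : continuous (fun w => a * exp (- w) + b * exp w)%R 0%R).
  { apply (ex_derive_continuous (fun w => a * exp (- w) + b * exp w)%R). auto_derive. auto. }
  destruct (proj1 (filterlim_locally _ _) Cf (mkposreal ((a + b) / 2) ltac:(lra))) as [d Hd].
  exists d, ((a + b) / 2)%R. split; [apply cond_pos |]. split; [lra |]. intros w Hw.
  specialize (Hd w). cbn in Hd. unfold ball in Hd. cbn in Hd. unfold AbsRing_ball, abs, minus, plus, opp in Hd. cbn in Hd.
  rewrite Ropp_0, Rplus_0_r, exp_0 in Hd. specialize (Hd Hw). apply Rabs_lt_between in Hd. lra.
Qed.

Lemma PQ_near xi eta : (0 < Re ((1 - Ci) * xi + (1 + Ci) * eta))%R -> (0 < Re ((1 + Ci) * xi + (1 - Ci) * eta))%R ->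
  exists d c, (0 < d)%R /\ (0 < c)%R /\
    forall w, (Rabs w < d)%R -> (c <= Re (Pw xi eta w))%R /\ (c <= Re (Qw xi eta w))%R.
Proof.
  intros HP HQ. rewrite re_plus in HP, HQ.
  destruct (pos_near _ _ HP) as [d1 [c1 [D1 [C1 H1]]]]. destruct (pos_near _ _ HQ) as [d2 [c2 [D2 [C2 H2]]]].
  exists (Rmin d1 d2), (Rmin c1 c2). split; [apply Rmin_pos; auto |]. split; [apply Rmin_pos; auto |].
  intros w Hw. pose proof (Rmin_l d1 d2). pose proof (Rmin_r d1 d2). pose proof (Rmin_l c1 c2). pose proof (Rmin_r c1 c2).
  specialize (H1 w ltac:(lra)). specialize (H2 w ltac:(lra)).
  unfold Pw, Qw. rewrite !re_plus, !re_scal_r. lra.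
Qed.

(** Away from w = 0 the quadratic term decides, near w = 0 the linear one does; the
    quadratic coefficient degenerates there as |v| grows. *)
Lemma merged_bound xi eta : (0 < Re ((1 - Ci) * xi + (1 + Ci) * eta))%R -> (0 < Re ((1 + Ci) * xi + (1 - Ci) * eta))%R ->
  exists M, forall w v, (Cmod (merged xi eta (uu w (ang v))) <= M * exp (- Rabs w))%R.
Proof.
  intros HP HQ. destruct (PQ_near xi eta HP HQ) as [d0 [c [D0 [C0 HW]]]].
  set (d := (d0 / 2)%R).
  set (k := (/ 2 * (1 - exp (- (4 * d))))%R). set (B := (Cmod xi + Cmod eta)%R).
  set (M1 := (2 * exp (B * B / (2 * k) + 1 * 1 / k))%R). set (M2 := (2 * exp (2 / (c / 2)) * exp d)%R).
  assert (P1 : (0 < M1)%R) by (unfold M1; pose proof (exp_pos (B * B / (2 * k) + 1 * 1 / k)); lra).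
  assert (P2 : (0 < M2)%R) by (unfold M2; pose proof (exp_pos (2 / (c / 2))); pose proof (exp_pos d); nra).
  exists (M1 + M2)%R. intros w v. pose proof (exp_pos (- Rabs w)) as Pe. pose proof (ang_bound v) as Ha.
  rewrite Rmult_plus_distr_r.
  destruct (Rle_dec d (Rabs w)) as [L | L].
  - apply Rle_trans with (M1 * exp (- Rabs w))%R; [| nra].
    unfold Rabs in L |- *. destruct (Rcase_abs w) as [N | N].
    + rewrite merged_swap. replace (- uu w (ang v)) with (uu (- w) (- ang v)) by (unfold uu; rewrite !RtoC_opp; ring).
      unfold M1, B. rewrite (Rplus_comm (Cmod xi)). apply (merged_bound_far eta xi d (- w)); [unfold d in *; lra |].
      rewrite Rabs_Ropp. exact Ha.
    + apply (merged_bound_far xi eta d w); [unfold d in *; lra | exact Ha].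
  - destruct (HW w ltac:(unfold d in *; lra)) as [H1 H2].
    pose proof (merged_bound_near xi eta (c / 2) w (ang v) ltac:(lra) Ha (Re_Zu_lower xi eta w v c C0 H1 H2)) as E.
    apply Rle_trans with (M2 * exp (- Rabs w))%R; [| nra].
    unfold M2. rewrite Rmult_assoc, <- exp_plus. apply Rle_trans with (2 * exp (2 / (c / 2)) * 1)%R; [lra |].
    apply Rmult_le_compat_l; [pose proof (exp_pos (2 / (c / 2))); lra |]. rewrite <- exp_0. apply exp_le. lra.
Qed.

Lemma Rabs_near (w w0 : R) : (Rabs (w + - w0) < 1)%R -> (Rabs w <= Rabs w0 + 1)%R.
Proof.
  intros H. pose proof (Rabs_triang (w + - w0) w0) as T. replace (w + - w0 + w0)%R with w in T by ring. lra.
Qed.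

Lemma merged_joint xi eta : joint2 (fun v w => merged xi eta (uu w (ang v))).
Proof.
  intros v0 w0. unfold joint.
  set (T := prod_UniformSpace R_UniformSpace R_UniformSpace).
  assert (Ca : forall p : T, @continuous T R_UniformSpace (fun p => ang (fst p)) p).
  { intros p. apply (continuous_comp (U := T) (V := R_UniformSpace) (W := R_UniformSpace) fst ang);
      [apply (cont_fst (U := R_UniformSpace)) | apply cont_ang]. }
  assert (Cc : @continuous T R_UniformSpace (fun p => cos (ang (fst p) + ang (fst p))) (v0, w0)).
  { apply (continuous_comp (U := T) (V := R_UniformSpace) (W := R_UniformSpace) (fun p => ang (fst p) + ang (fst p))%R cos).
    - apply (continuous_plus (V := R_NormedModule)); apply Ca.
    - apply continuous_cos. }
  set (c := cos (ang v0 + ang v0)). assert (Pc : (0 < c)%R) by (apply cos2_pos, ang_bound).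
  set (B := ((Cmod xi + Cmod eta) * exp (Rabs w0 + 1))%R).
  apply (CI_cont (U := T) (fun p (m : R) => quadKer 1 (Zu xi eta (uu (snd p) (ang (fst p)))) (Ku (uu (snd p) (ang (fst p)))) m)
    (v0, w0) (exp (B * B / (2 * (c / 2)) + 1 * 1 / (c / 2))) 1); [lra | |].
  - pose proof (proj1 (filterlim_locally _ _) Cc (mkposreal (c / 2) ltac:(lra))) as L1.
    pose proof (proj1 (filterlim_locally _ _) (cont_snd (V := R_UniformSpace) (U := R_UniformSpace) (v0, w0)) (mkposreal 1 ltac:(lra))) as L2.
    generalize (filter_and _ _ L1 L2). apply filter_imp. intros [v w] [H1 H2].
    cbn in H1, H2. unfold ball in H1, H2. cbn in H1, H2. unfold AbsRing_ball, abs, minus, plus, opp in H1, H2. cbn in H1, H2.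
    fold c in H1. apply Rabs_lt_between in H1. cbn [fst snd].
    split; [apply (proj1 (rapid_merged xi eta w (ang v) (ang_bound v))) |].
    intros x. apply (quadKer_bound_quad 1 B (c / 2) (Zu xi eta (uu w (ang v))) (Ku (uu w (ang v))) x); [lra | lra | |].
    + eapply Rle_trans; [apply Cmod_Zu |]. unfold B. apply Rmult_le_compat_l.
      * pose proof (Cmod_ge_0 xi). pose proof (Cmod_ge_0 eta). lra.
      * apply exp_le, Rabs_near, H2.
    + replace (Im x + Im x)%R with 0%R by (cbn; ring). rewrite Cmult_0_r, Cexp_0, Cmult_1_r.
      pose proof (Re_Ku_pos w (ang v) (ang_bound v)). lra.
  - intros m. unfold joint. unfold quadKer, Zu, Ku, uu.
    set (T2 := prod_UniformSpace T R_UniformSpace).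
    assert (C1 : forall p : T2, @continuous T2 R_UniformSpace (fun p => snd (fst p)) p).
    { intros p. apply (continuous_comp (U := T2) (V := T) (W := R_UniformSpace) fst snd);
        [apply (cont_fst (U := T)) | apply (cont_snd (V := R_UniformSpace))]. }
    assert (C2 : forall p : T2, @continuous T2 R_UniformSpace (fun p => ang (fst (fst p))) p).
    { intros p. apply (continuous_comp (U := T2) (V := T) (W := R_UniformSpace) fst (fun p => ang (fst p)));
        [apply (cont_fst (U := T)) | apply Ca]. }
    ctac;
      lazymatch goal with
      | |- continuous (fun p => ang _) _ => exact (C2 _)
      | |- continuous (fun p => snd (fst p)) _ => exact (C1 _)
      | _ => apply (cont_snd (U := T) (V := R_UniformSpace))
      end.
Qed.

Definition merged_mean (xi eta : C) (w : R) : C := CI (fun v => om v * merged xi eta (uu w (ang v))).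

Lemma joint2_om : joint2 (fun v _ => RtoC (om v)).
Proof.
  apply (joint2_comp (fun v => RtoC (om v)) (fun v _ => v)).
  - ctac. apply cont_om.
  - intros p. apply (cont_fst (U := R_UniformSpace)).
Qed.

Lemma rapid2_om_merged xi eta (s : C) : (Rabs (Re s) < 1 / 4)%R ->
  (0 < Re ((1 - Ci) * xi + (1 + Ci) * eta))%R -> (0 < Re ((1 + Ci) * xi + (1 - Ci) * eta))%R ->
  rapid2 (fun v (w : R) => Cexp (4 * s * w) * (om v * merged xi eta (uu w (ang v)))).
Proof.
  intros Hs HP HQ. destruct (merged_bound xi eta HP HQ) as [M HM]. split.
  - apply joint2_mult.
    + apply (joint2_comp (fun w : R => Cexp (4 * s * w)) (fun _ w => w)); [ctac |].
      intros p. apply (cont_snd (V := R_UniformSpace)).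
    + apply joint2_mult; [apply joint2_om | apply merged_joint].
  - set (c := Rmin (/ 2) (1 - 4 * Rabs (Re s))).
    assert (Hc1 : (c <= / 2)%R) by apply Rmin_l. assert (Hc2 : (c <= 1 - 4 * Rabs (Re s))%R) by apply Rmin_r.
    exists (2 * M)%R, c. split; [apply Rmin_pos; lra |]. intros v w.
    pose proof (om_bound v) as B. specialize (HM w v). pose proof (Rabs_pos v) as Pv. pose proof (Rabs_pos w) as Pw0.
    rewrite !Cmod_mult, Cmod_R, Cmod_Cexp, (Rabs_pos_eq (om v)) by lra.
    assert (PM : (0 <= M)%R).
    { pose proof (Cmod_ge_0 (merged xi eta (uu w (ang v)))). pose proof (exp_pos (- Rabs w)). nra. }
    assert (B1 : (om v <= 2 * exp (- (c * Rabs v)))%R).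
    { eapply Rle_trans; [apply B |]. apply Rmult_le_compat_l; [lra |]. apply exp_le. nra. }
    assert (B2 : (exp (Re (4 * s * w)) * exp (- Rabs w) <= exp (- (c * Rabs w)))%R).
    { rewrite <- exp_plus. apply exp_le. rewrite re_scal_r, Re_4s.
      pose proof (Rle_abs (Re s * w)) as A. rewrite Rabs_mult in A. nra. }
    apply Rle_trans with ((2 * exp (- (c * Rabs v))) * (M * (exp (Re (4 * s * w)) * exp (- Rabs w))))%R.
    + replace (exp (Re (4 * s * w)) * (om v * Cmod (merged xi eta (uu w (ang v)))))%R
        with (om v * (exp (Re (4 * s * w)) * Cmod (merged xi eta (uu w (ang v)))))%R by ring.
      pose proof (exp_pos (Re (4 * s * w))).
      apply Rmult_le_compat; [lra | apply Rmult_le_pos; [lra | apply Cmod_ge_0] | exact B1 |].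
      replace (M * (exp (Re (4 * s * w)) * exp (- Rabs w)))%R with (exp (Re (4 * s * w)) * (M * exp (- Rabs w)))%R by ring.
      apply Rmult_le_compat_l; lra.
    + replace (2 * M * exp (- (c * Rabs v)) * exp (- (c * Rabs w)))%R
        with (2 * exp (- (c * Rabs v)) * (M * exp (- (c * Rabs w))))%R by ring.
      apply Rmult_le_compat_l; [pose proof (exp_pos (- (c * Rabs v))); lra |].
      apply Rmult_le_compat_l; lra.
Qed.

(** Rotate the two rays by opposite angles before convolving: the powers of the two
    variables combine to exp (4 s w), since their exponents add up to 1. *)
Lemma pcInt_merge xi eta s al : (Rabs (Re s) < 1 / 4)%R -> (Rabs al < PI / 4)%R ->
  rapid (fun w : R => Cexp (4 * s * w) * merged xi eta (uu w al)) ->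
  Cexp (4 * s * (Ci * al)) * (pcInt (/ 2 - 2 * s) 0 xi * pcInt (/ 2 + 2 * s) 0 eta)
  = 2 * CI (fun w : R => Cexp (4 * s * w) * merged xi eta (uu w al)).
Proof.
  intros Hs Hal GG. apply Rabs_lt_between in Hs.
  assert (H1 : (0 < Re (/ 2 - 2 * s))%R).
  { replace (Re (/ 2 - 2 * s)) with (/ 2 - 2 * Re s)%R; [lra |]. rewrite <- RtoC_inv by lra. destruct s; cbn; ring. }
  assert (H2 : (0 < Re (/ 2 + 2 * s))%R).
  { replace (Re (/ 2 + 2 * s)) with (/ 2 + 2 * Re s)%R; [lra |]. rewrite <- RtoC_inv by lra. destruct s; cbn; ring. }
  assert (Hal' : (Rabs (- al) < PI / 4)%R) by (rewrite Rabs_Ropp; exact Hal).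
  rewrite <- (pcInt_rotate _ al xi H1 Hal), <- (pcInt_rotate _ (- al) eta H2 Hal').
  unfold pcInt. pose proof (rapid_pcKer _ al xi H1 Hal) as G1. pose proof (rapid_pcKer _ (- al) eta H2 Hal') as G2.
  rewrite (CI_prod_conv _ _ G1 G2).
  assert (Eq : forall w m : R, pcKer (/ 2 - 2 * s) xi ((m - w)%R + Ci * al) * pcKer (/ 2 + 2 * s) eta ((m + w)%R + Ci * (- al)%R)
     = Cexp (- (4 * s * (Ci * al))) * Cexp (4 * s * w) * quadKer 1 (Zu xi eta (uu w al)) (Ku (uu w al)) m).
  { intros w m. unfold pcKer, quadKer, Zu, Ku. rewrite <- !Cexp_plus. f_equal.
    replace (RtoC (m - w) + Ci * al) with (m + - uu w al) by (unfold uu; rewrite RtoC_minus; ring).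
    replace (RtoC (m + w) + Ci * (- al)%R) with (m + uu w al) by (unfold uu; rewrite RtoC_plus, RtoC_opp; ring).
    replace (m + - uu w al + (m + - uu w al)) with ((m + m) + - (uu w al + uu w al)) by ring.
    replace (m + uu w al + (m + uu w al)) with ((m + m) + (uu w al + uu w al)) by ring.
    rewrite !(Cexp_plus m), !(Cexp_plus (m + m)).
    replace (4 * s * w) with (4 * s * (uu w al + Ci * al)) by (unfold uu; ring). rewrite ?(Cexp_plus m m). field. }
  assert (Eq2 : forall w : R, CI (fun m : R => pcKer (/ 2 - 2 * s) xi ((m - w)%R + Ci * al) * pcKer (/ 2 + 2 * s) eta ((m + w)%R + Ci * (- al)%R))
     = Cexp (- (4 * s * (Ci * al))) * (Cexp (4 * s * w) * merged xi eta (uu w al))).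
  { intros w. rewrite (CI_ext _ _ (Eq w)), CI_scal by (apply rapid_merged, Hal). unfold merged. ring. }
  rewrite (CI_ext _ _ Eq2). pose proof (Cexp_neq_0 (4 * s * (Ci * al))) as NE.
  rewrite CI_scal by exact GG. rewrite Cexp_opp. field. exact NE.
Qed.

(** * Double integrals depending on a real parameter *)

Definition cont3 (F : R -> R -> R -> C) : Prop :=
  forall p, @contC (prod_UniformSpace (prod_UniformSpace R_UniformSpace R_UniformSpace) R_UniformSpace)
    (fun p => F (fst (fst p)) (snd (fst p)) (snd p)) p.

Lemma cont3_joint2 F w : cont3 F -> joint2 (F w).
Proof.
  intros H x y. unfold joint.
  apply (contC_comp (U := prod_UniformSpace R_UniformSpace R_UniformSpace)
    (V := prod_UniformSpace (prod_UniformSpace R_UniformSpace R_UniformSpace) R_UniformSpace)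
    (fun p => ((w, fst p), snd p)) (fun p => F (fst (fst p)) (snd (fst p)) (snd p))); [| apply H].
  apply (cont_pair (U := prod_UniformSpace R_UniformSpace R_UniformSpace) (V := prod_UniformSpace R_UniformSpace R_UniformSpace) (W := R_UniformSpace)).
  - apply (cont_pair (U := prod_UniformSpace R_UniformSpace R_UniformSpace) (V := R_UniformSpace) (W := R_UniformSpace)).
    + apply continuous_const.
    + apply (cont_fst (U := R_UniformSpace)).
  - apply (cont_snd (V := R_UniformSpace)).
Qed.

Lemma CI2_param_Rd (F F1 : R -> R -> R -> C) (w0 r M c : R) :
  (0 < r)%R -> (0 < c)%R ->
  (forall w x y, Rd (fun w => F w x y) w (F1 w x y)) -> cont3 F -> cont3 F1 ->
  (forall w, (Rabs (w - w0) < r)%R -> eb2 M c (F w) /\ eb2 M c (F1 w)) ->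
  Rd (fun w => CI (fun x => CI (F w x))) w0 (CI (fun x => CI (F1 w0 x))).
Proof.
  intros Hr Hc HD HC HC1 HE.
  set (T := prod_UniformSpace R_UniformSpace R_UniformSpace).
  assert (G0 : forall w, (Rabs (w - w0) < r)%R -> rapid2 (F w)).
  { intros w Hw. split; [apply cont3_joint2, HC |]. exists M, c. split; [exact Hc | apply HE, Hw]. }
  assert (J1 : forall w x y, joint (U := T) (fun p => F1 (fst p) (snd p)) (w, x) y) by (intros; apply HC1).
  apply (CI_param_Rd (fun w x => CI (F w x)) (fun w x => CI (F1 w x)) w0 r (2 * M / c) c Hr Hc).
  - intros w x Hw.
    apply (CI_param_Rd (fun w => F w x) (fun w => F1 w x) w (r - Rabs (w - w0)) M c); [lra | exact Hc | | | |].
    + intros w' y _. apply HD.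
    + intros w' y _. unfold joint.
      apply (contC_comp (U := T) (V := prod_UniformSpace T R_UniformSpace)
        (fun p => ((fst p, x), snd p)) (fun p => F1 (fst (fst p)) (snd (fst p)) (snd p))); [| apply HC1].
      apply (cont_pair (U := T) (V := T) (W := R_UniformSpace)); [| apply (cont_snd (V := R_UniformSpace))].
      apply (cont_pair (U := T) (V := R_UniformSpace) (W := R_UniformSpace)); [apply (cont_fst (U := R_UniformSpace)) | apply continuous_const].
    + intros w' Hw'. apply joint2_contR, cont3_joint2, HC.
    + intros w' Hw'. assert (H' : (Rabs (w' - w0) < r)%R).
      { replace (w' - w0)%R with ((w' - w) + (w - w0))%R by ring. eapply Rle_lt_trans; [apply Rabs_triang |]. lra. }
      destruct (HE w' H') as [E0 E1]. split; apply eb2_slice_unif; assumption.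
  - intros w x Hw. unfold joint.
    apply (CI_cont (U := T) (fun p => F1 (fst p) (snd p)) (w, x) M c Hc).
    + assert (Cf : @continuous T R_UniformSpace (fun p => fst p - w0)%R (w, x)).
      { apply (continuous_minus (V := R_NormedModule)); [apply (cont_fst (U := R_UniformSpace)) | apply continuous_const]. }
      pose proof (proj1 (filterlim_locally _ _) Cf (mkposreal (r - Rabs (w - w0)) ltac:(lra))) as L.
      revert L. apply filter_imp. intros [w' x'] H'.
      cbn in H'. unfold ball in H'. cbn in H'. unfold AbsRing_ball, abs, minus, plus, opp in H'. cbn in H'. cbn [fst snd].
      split; [apply joint2_contR, cont3_joint2, HC1 |].
      apply (eb2_slice_unif M c); [exact Hc |]. apply HE. clear - H'.
      replace (w' - w0)%R with ((w' - w0 + - (w - w0)) + (w - w0))%R by (clear; ring).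
      eapply Rle_lt_trans; [apply Rabs_triang | lra].
    + intros y. apply J1.
  - intros w Hw. apply (rapid2_CI (F w)), G0, Hw.
  - intros w Hw. destruct (HE w Hw) as [E0 E1]. split; apply CI2_eb; auto using cont3_joint2.
Qed.

(** * The merged kernel near w = 0 *)

Section Plane.
Variables xi eta : C.

Definition PC (W : C) : C := (1 - Ci) * xi * Cexp (- W) + (1 + Ci) * eta * Cexp W.
Definition QC (W : C) : C := (1 + Ci) * xi * Cexp (- W) + (1 - Ci) * eta * Cexp W.
Definition PC1 (W : C) : C := - ((1 - Ci) * xi * Cexp (- W)) + (1 + Ci) * eta * Cexp W.
Definition QC1 (W : C) : C := - ((1 + Ci) * xi * Cexp (- W)) + (1 - Ci) * eta * Cexp W.
(** The exponent of the merged kernel in the coordinates of [CI2_rotate]. Its last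
    term is imaginary for real W, and that is why [planeKer] is dominated on the real
    axis of W only. *)
Definition Eexp (W : C) (x y : R) : C :=
  / 2 * (x + y) - / 2 * (PC W * exp x + QC W * exp y)
  - / 2 * (Cexp (- (W + W)) + Cexp (W + W)) * (exp x * exp y)%R
  + / 4 * Ci * (Cexp (W + W) - Cexp (- (W + W))) * (exp y * exp y - exp x * exp x)%R.
Definition Eexp1 (W : C) (x y : R) : C :=
  - (/ 2 * (PC1 W * exp x + QC1 W * exp y))
  - (Cexp (W + W) - Cexp (- (W + W))) * (exp x * exp y)%R
  + / 2 * Ci * (Cexp (W + W) + Cexp (- (W + W))) * (exp y * exp y - exp x * exp x)%R.
Definition planeKer (w x y : R) : C := Cexp (Eexp w x y).
Definition planeKer1 (w x y : R) : C := Cexp (Eexp w x y) * Eexp1 w x y.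

Lemma Rd_planeKer w x y : Rd (fun w => planeKer w x y) w (planeKer1 w x y).
Proof.
  apply (Cd_Rd' (fun W => Cexp (Eexp W x y))). unfold planeKer1.
  assert (D : Cd (fun W => Eexp W x y) w (Eexp1 w x y)).
  { unfold Eexp, PC, QC. eapply Cd_eq; [dtac |]. unfold Eexp1, PC1, QC1. field. }
  eapply Cd_eq; [apply (Cd_Cexp_comp (fun W => Eexp W x y) w _ D) |]. reflexivity.
Qed.

Lemma PC_Pw (w : R) : PC w = Pw xi eta w /\ QC w = Qw xi eta w.
Proof. unfold PC, QC, Pw, Qw. rewrite <- RtoC_opp, !Cexp_R. split; reflexivity. Qed.

Lemma Cexp_dbl (w : R) : Cexp (w + w) = exp (w + w) /\ Cexp (- (w + w)) = exp (- (w + w)).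
Proof. rewrite <- RtoC_plus, <- RtoC_opp, !Cexp_R. split; reflexivity. Qed.

Lemma Re_Eexp (w x y : R) : Re (Eexp w x y) =
  (/ 2 * (x + y) - / 2 * (Re (Pw xi eta w) * exp x + Re (Qw xi eta w) * exp y)
   - / 2 * (exp (- (w + w)) + exp (w + w)) * (exp x * exp y))%R.
Proof.
  unfold Eexp. destruct (PC_Pw w) as [-> ->]. destruct (Cexp_dbl w) as [-> ->].
  rewrite <- !RtoC_inv by lra. destruct (Pw xi eta w), (Qw xi eta w). cbn. ring.
Qed.

Lemma Cmod_Ci : Cmod Ci = 1%R.
Proof. unfold Cmod. cbn. replace (0 * (0 * 1) + 1 * (1 * 1))%R with 1%R by ring. apply sqrt_1. Qed.

Lemma Cmod_1_Ci : (Cmod (1 - Ci) <= 2)%R /\ (Cmod (1 + Ci) <= 2)%R.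
Proof.
  pose proof Cmod_Ci.
  split; [eapply Rle_trans; [apply Cmod_triangle' |] | eapply Rle_trans; [apply Cmod_triangle |]]; rewrite Cmod_1; lra.
Qed.

Definition B0 : R := ((Cmod xi + Cmod eta) * exp 1)%R.

Lemma Cmod_lincomb (a b k l : C) (w : R) : (Cmod k <= 2)%R -> (Cmod l <= 2)%R -> (Rabs w <= 1)%R ->
  (Cmod (k * a * Cexp (- w)) + Cmod (l * b * Cexp w) <= 2 * ((Cmod a + Cmod b) * exp 1))%R.
Proof.
  intros Hk Hl Hw. rewrite !Cmod_mult, !Cmod_Cexp. apply Rabs_le_between in Hw.
  assert (E1 : (exp (Re (- w)) <= exp 1)%R) by (apply exp_le; cbn; lra).
  assert (E2 : (exp (Re w) <= exp 1)%R) by (apply exp_le; cbn; lra).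
  pose proof (exp_pos (Re (- w))). pose proof (exp_pos (Re w)).
  pose proof (Cmod_ge_0 a). pose proof (Cmod_ge_0 b). pose proof (Cmod_ge_0 k). pose proof (Cmod_ge_0 l).
  assert (Cmod k * Cmod a * exp (Re (- w)) <= 2 * Cmod a * exp 1)%R by (apply Rmult_le_compat; nra).
  assert (Cmod l * Cmod b * exp (Re w) <= 2 * Cmod b * exp 1)%R by (apply Rmult_le_compat; nra). lra.
Qed.

Lemma Eexp1_bound (w x y : R) : (Rabs w <= 1)%R ->
  (Cmod (Eexp1 w x y) <= (2 * B0 + 2 * exp 2) *
     ((1 + exp x + exp x * exp x) * (1 + exp y + exp y * exp y)))%R.
Proof.
  intros Hw. destruct Cmod_1_Ci as [K1 K2].
  assert (HP : (Cmod (PC1 w) <= 2 * B0)%R).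
  { unfold PC1. eapply Rle_trans; [apply Cmod_triangle |]. rewrite Cmod_opp. apply Cmod_lincomb; auto. }
  assert (HQ : (Cmod (QC1 w) <= 2 * B0)%R).
  { unfold QC1. eapply Rle_trans; [apply Cmod_triangle |]. rewrite Cmod_opp. apply Cmod_lincomb; auto. }
  apply Rabs_le_between in Hw.
  assert (E1 : (exp (w + w) <= exp 2)%R) by (apply exp_le; lra).
  assert (E2 : (exp (- (w + w)) <= exp 2)%R) by (apply exp_le; lra).
  pose proof (exp_pos (w + w)) as P1. pose proof (exp_pos (- (w + w))) as P2.
  unfold Eexp1. destruct (Cexp_dbl w) as [-> ->].
  pose proof (exp_pos x) as Px. pose proof (exp_pos y) as Py.
  set (u := exp x) in *. set (v := exp y) in *.
  assert (T1 : (Cmod (- (/ 2 * (PC1 w * u + QC1 w * v))) <= B0 * (u + v))%R).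
  { rewrite Cmod_opp, Cmod_mult, <- RtoC_inv, Cmod_R, Rabs_pos_eq by lra.
    pose proof (Cmod_triangle (PC1 w * u) (QC1 w * v)) as T. rewrite !Cmod_mult, !Cmod_R, !Rabs_pos_eq in T by lra. nra. }
  assert (T2 : (Cmod ((exp (w + w) - exp (- (w + w))) * (u * v)%R) <= 2 * exp 2 * (u * v))%R).
  { rewrite <- RtoC_minus, <- RtoC_mult, Cmod_R, Rabs_mult. rewrite (Rabs_pos_eq (u * v)) by nra.
    apply Rmult_le_compat_r; [nra |]. apply Rabs_le_between. lra. }
  assert (T3 : (Cmod (/ 2 * Ci * (exp (w + w) + exp (- (w + w))) * (v * v - u * u)%R) <= exp 2 * (u * u + v * v))%R).
  { replace (/ 2 * Ci * (exp (w + w) + exp (- (w + w))) * (v * v - u * u)%R)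
      with (Ci * RtoC (/ 2 * (exp (w + w) + exp (- (w + w))) * (v * v - u * u))).
    2:{ rewrite !RtoC_mult, RtoC_plus, RtoC_inv by lra. ring. }
    rewrite Cmod_mult, Cmod_R. rewrite Cmod_Ci, Rmult_1_l, Rabs_mult, (Rabs_pos_eq (/ 2 * _)) by lra. pose proof (exp_pos 2).
    assert (Rabs (v * v - u * u) <= u * u + v * v)%R by (apply Rabs_le_between; nra).
    apply Rmult_le_compat; [lra | apply Rabs_pos | lra | assumption]. }
  eapply Rle_trans; [apply Cmod_triangle |].
  eapply Rle_trans; [apply Rplus_le_compat_r, Cmod_triangle' |].
  assert (PB : (0 <= B0)%R) by (pose proof (Cmod_ge_0 (PC1 w)); lra). pose proof (exp_pos 2) as P3.
  assert (Q1 : (u + v + u * v + u * u + v * v <= (1 + u + u * u) * (1 + v + v * v))%R).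
  { assert (0 <= u * v)%R by nra. assert (0 <= u * (v * v))%R by nra. assert (0 <= v * (u * u))%R by nra.
    assert (0 <= (u * u) * (v * v))%R by nra. nra. }
  apply Rle_trans with ((2 * B0 + 2 * exp 2) * (u + v + u * v + u * u + v * v))%R; [| apply Rmult_le_compat_l; lra].
  assert (0 <= B0 * (u * v + u * u + v * v))%R by (apply Rmult_le_pos; nra). nra.
Qed.

Lemma poly_exp_bound c : (0 < c)%R -> exists K, (0 < K)%R /\ forall x,
  ((1 + exp x + exp x * exp x) * exp (/ 2 * x - c / 2 * exp x) <= K * exp (- (/ 2 * Rabs x)))%R.
Proof.
  intros Hc. exists ((1 + 4 / c + 32 / (c * c)) * exp (2 / c))%R.
  assert (P0 : (0 < 1 + 4 / c + 32 / (c * c))%R).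
  { assert (0 < 4 / c)%R by (apply Rdiv_lt_0_compat; lra). assert (0 < 32 / (c * c))%R by (apply Rdiv_lt_0_compat; nra). lra. }
  split; [pose proof (exp_pos (2 / c)); nra |]. intros x. set (u := exp x). assert (Pu : (0 < u)%R) by apply exp_pos.
  set (t := (c / 4 * u)%R). assert (Pt : (0 < t)%R) by (unfold t; nra).
  pose proof (exp_ge_sq t ltac:(lra)) as S2. pose proof (exp_ineq1_le t) as S1.
  assert (Hu : (u = 4 / c * t)%R) by (unfold t; field; lra).
  assert (L : (1 + u + u * u <= (1 + 4 / c + 32 / (c * c)) * exp t)%R).
  { assert (A1 : (u <= 4 / c * exp t)%R) by (rewrite Hu; apply Rmult_le_compat_l; [apply Rdiv_le_0_compat; lra | lra]).
    assert (A2 : (u * u <= 32 / (c * c) * exp t)%R).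
    { rewrite Hu. replace (4 / c * t * (4 / c * t))%R with (32 / (c * c) * (t * t / 2))%R by (field; lra).
      apply Rmult_le_compat_l; [apply Rdiv_le_0_compat; nra | exact S2]. }
    lra. }
  pose proof (expo_bound (/ 2) (/ 2) (/ 2) (c / 4) (c / 4) x ltac:(lra) ltac:(lra) ltac:(lra)) as E. fold u t in E.
  replace ((/ 2 + / 2) * (/ 2 + / 2) / (2 * (c / 4)))%R with (2 / c)%R in E by (field; lra).
  apply Rle_trans with ((1 + 4 / c + 32 / (c * c)) * exp t * exp (/ 2 * x - c / 2 * u))%R.
  { apply Rmult_le_compat_r; [apply Rlt_le, exp_pos | exact L]. }
  rewrite !Rmult_assoc, <- !exp_plus. apply Rmult_le_compat_l; [lra |]. apply exp_le.
  replace (c / 2 * u)%R with (t + t)%R by (unfold t; field). lra.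
Qed.

(** Near w = 0 the linear forms have real parts bounded below; they absorb the
    polynomial in e^x and e^y brought by the derivative, half of the decay being kept.
    *)
Lemma planeKer_bounds : (0 < Re ((1 - Ci) * xi + (1 + Ci) * eta))%R -> (0 < Re ((1 + Ci) * xi + (1 - Ci) * eta))%R ->
  exists r M, (0 < r)%R /\ forall w, (Rabs w < r)%R -> eb2 M (/ 2) (planeKer w) /\ eb2 M (/ 2) (planeKer1 w).
Proof.
  intros HP HQ. destruct (PQ_near xi eta HP HQ) as [r [c [Hr [Hc HW]]]].
  destruct (poly_exp_bound c Hc) as [K [PK HK]].
  assert (PB : (0 < 1 + 2 * B0 + 2 * exp 2)%R).
  { pose proof (exp_pos 2). unfold B0. pose proof (Cmod_ge_0 xi). pose proof (Cmod_ge_0 eta). pose proof (exp_pos 1). nra. }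
  exists (Rmin r 1), ((1 + 2 * B0 + 2 * exp 2) * (K * K))%R. split; [apply Rmin_pos; lra |].
  intros w Hw. pose proof (Rmin_l r 1). pose proof (Rmin_r r 1).
  destruct (HW w ltac:(lra)) as [H1 H2].
  assert (X : forall x y, (Cmod (planeKer w x y) * ((1 + exp x + exp x * exp x) * (1 + exp y + exp y * exp y))
    <= K * K * exp (- (/ 2 * Rabs x)) * exp (- (/ 2 * Rabs y)))%R).
  { intros x y. pose proof (exp_pos x) as Px. pose proof (exp_pos y) as Py.
    assert (E : (Cmod (planeKer w x y) <= exp (/ 2 * x - c / 2 * exp x) * exp (/ 2 * y - c / 2 * exp y))%R).
    { unfold planeKer. rewrite <- exp_plus. apply Cmod_le_exp. rewrite Re_Eexp.
      pose proof (exp_pos (w + w)). pose proof (exp_pos (- (w + w))).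
      assert (0 <= / 2 * (exp (- (w + w)) + exp (w + w)) * (exp x * exp y))%R by (apply Rmult_le_pos; nra). nra. }
    set (a := (1 + exp x + exp x * exp x)%R) in *. set (b := (1 + exp y + exp y * exp y)%R) in *.
    assert (Pa : (0 < a)%R) by (unfold a; nra). assert (Pb : (0 < b)%R) by (unfold b; nra).
    pose proof (HK x) as Kx. pose proof (HK y) as Ky. fold a in Kx. fold b in Ky.
    apply Rle_trans with ((a * exp (/ 2 * x - c / 2 * exp x)) * (b * exp (/ 2 * y - c / 2 * exp y)))%R.
    - replace ((a * exp (/ 2 * x - c / 2 * exp x)) * (b * exp (/ 2 * y - c / 2 * exp y)))%R
        with ((exp (/ 2 * x - c / 2 * exp x) * exp (/ 2 * y - c / 2 * exp y)) * (a * b))%R by ring.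
      apply Rmult_le_compat_r; [nra | exact E].
    - replace (K * K * exp (- (/ 2 * Rabs x)) * exp (- (/ 2 * Rabs y)))%R
        with ((K * exp (- (/ 2 * Rabs x))) * (K * exp (- (/ 2 * Rabs y))))%R by ring.
      apply Rmult_le_compat; auto; apply Rmult_le_pos; try lra; apply Rlt_le, exp_pos. }
  assert (W : forall x y, (1 <= (1 + exp x + exp x * exp x) * (1 + exp y + exp y * exp y))%R).
  { intros x y. pose proof (exp_pos x). pose proof (exp_pos y).
    assert (1 <= 1 + exp x + exp x * exp x)%R by nra. assert (1 <= 1 + exp y + exp y * exp y)%R by nra. nra. }
  assert (PKK : forall x y : R, (0 <= K * K * exp (- (/ 2 * Rabs x)) * exp (- (/ 2 * Rabs y)))%R).
  { intros x y. pose proof (exp_pos (- (/ 2 * Rabs x))). pose proof (exp_pos (- (/ 2 * Rabs y))).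
    apply Rmult_le_pos; [apply Rmult_le_pos; nra | lra]. }
  pose proof (exp_pos 2). assert (0 <= B0)%R by (unfold B0; pose proof (Cmod_ge_0 xi); pose proof (Cmod_ge_0 eta); pose proof (exp_pos 1); nra).
  split; intros x y; specialize (X x y); specialize (W x y); specialize (PKK x y);
    rewrite (Rmult_assoc (1 + 2 * B0 + 2 * exp 2)), (Rmult_assoc (1 + 2 * B0 + 2 * exp 2));
    set (R0 := (K * K * exp (- (/ 2 * Rabs x)) * exp (- (/ 2 * Rabs y)))%R) in *.
  - pose proof (Cmod_ge_0 (planeKer w x y)). nra.
  - unfold planeKer1. fold (planeKer w x y). rewrite Cmod_mult.
    pose proof (Eexp1_bound w x y ltac:(lra)) as E.
    pose proof (Cmod_ge_0 (planeKer w x y)) as P0.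
    pose proof (Rmult_le_compat_l _ _ _ P0 E) as E'.
    eapply Rle_trans; [exact E' |].
    replace (Cmod (planeKer w x y) * ((2 * B0 + 2 * exp 2) * ((1 + exp x + exp x * exp x) * (1 + exp y + exp y * exp y))))%R
      with ((2 * B0 + 2 * exp 2) * (Cmod (planeKer w x y) * ((1 + exp x + exp x * exp x) * (1 + exp y + exp y * exp y))))%R by ring.
    apply Rle_trans with ((2 * B0 + 2 * exp 2) * R0)%R; [apply Rmult_le_compat_l; lra | nra].
Qed.

Lemma cont3_planeKer : cont3 planeKer /\ cont3 planeKer1.
Proof.
  set (T := prod_UniformSpace R_UniformSpace R_UniformSpace).
  set (T2 := prod_UniformSpace T R_UniformSpace).
  assert (C1 : forall p : T2, @continuous T2 R_UniformSpace (fun p => fst (fst p)) p).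
  { intros p. apply (continuous_comp (U := T2) (V := T) (W := R_UniformSpace) fst fst);
      [apply (cont_fst (U := T)) | apply (cont_fst (U := R_UniformSpace))]. }
  assert (C2 : forall p : T2, @continuous T2 R_UniformSpace (fun p => snd (fst p)) p).
  { intros p. apply (continuous_comp (U := T2) (V := T) (W := R_UniformSpace) fst snd);
      [apply (cont_fst (U := T)) | apply (cont_snd (V := R_UniformSpace))]. }
  assert (C3 : forall p : T2, @continuous T2 R_UniformSpace (fun p => snd p) p) by (intros p; apply (cont_snd (U := T) (V := R_UniformSpace))).
  split; intros p; unfold planeKer, planeKer1, Eexp, Eexp1, PC, QC, PC1, QC1; ctac;
    lazymatch goal with
    | |- continuous (fun p => fst (fst p)) _ => exact (C1 _)
    | |- continuous (fun p => snd (fst p)) _ => exact (C2 _)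
    | _ => exact (C3 _)
    end.
Qed.

(** Translating m by [rad v] cancels the weight [om v] and turns e^(i ang v) into [tau
    v], which is the sum of two real exponentials with complex coefficients. In this
    form the function is differentiable at w = 0. *)
Lemma merged_mean_plane r M w : (forall w, (Rabs w < r)%R -> eb2 M (/ 2) (planeKer w)) -> (Rabs w < r)%R ->
  merged_mean xi eta w = CI (fun x => CI (fun y => planeKer w x y)).
Proof.
  intros HB Hw.
  assert (G2 : rapid2 (planeKer w)).
  { split; [apply cont3_joint2, (proj1 cont3_planeKer) |]. exists M, (/ 2)%R. split; [lra | apply HB, Hw]. }
  change (merged_mean xi eta w = CI (fun x => CI (planeKer w x))). rewrite (CI2_rotate (planeKer w) G2). unfold merged_mean. apply CI_ext. intros v.
  pose proof (rapid_merged xi eta w (ang v) (ang_bound v)) as GG. unfold merged.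
  rewrite <- (CI_shift _ (rad v) GG), <- CI_scal by (apply (rapid_shift _ (rad v) GG)).
  apply CI_ext. intros m. unfold planeKer, quadKer, om. rewrite <- Cexp_R, <- Cexp_plus. f_equal.
  pose proof (tau_polar v) as T1. pose proof (tau_polar_conj v) as T2. unfold tau in T1.
  set (a := Cexp (rad v + Ci * ang v)) in *. set (b := Cexp (rad v - Ci * ang v)) in *.
  assert (EZ : Zu xi eta (uu w (ang v)) * Cexp (RtoC (m + rad v)) = (xi * Cexp (- w) * a + eta * Cexp w * b) * Cexp m).
  { unfold Zu, uu, a, b. rewrite RtoC_plus. rewrite !Cmult_plus_distr_r.
    rewrite <- !Cmult_assoc, <- !Cexp_plus. f_equal; f_equal; f_equal; ring. }
  assert (EK : Ku (uu w (ang v)) * Cexp (RtoC (m + rad v) + RtoC (m + rad v)) =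
    / 2 * (Cexp (- (w + w)) * (a * a) + Cexp (w + w) * (b * b)) * (Cexp m * Cexp m)).
  { unfold Ku, uu, a, b. rewrite RtoC_plus, !Cmult_plus_distr_l, !Cmult_plus_distr_r.
    rewrite <- !Cmult_assoc, <- !Cexp_plus. f_equal; f_equal; f_equal; ring. }
  rewrite EZ, EK, T1, T2. unfold Eexp, PC, QC.
  rewrite !RtoC_minus, !RtoC_plus, !RtoC_mult.
  assert (Ex : RtoC (exp (m - v / 2)) = Cexp m * exp (- (v / 2))) by (rewrite Cexp_R, <- RtoC_mult, <- exp_plus; reflexivity).
  assert (Ey : RtoC (exp (m + v / 2)) = Cexp m * exp (v / 2)) by (rewrite Cexp_R, <- RtoC_mult, <- exp_plus; reflexivity).
  rewrite Ex, Ey. rewrite RtoC_opp.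
  assert (E1 : RtoC (exp (- (v / 2))) * RtoC (exp (v / 2)) = 1) by (rewrite <- RtoC_mult, <- exp_plus, Rplus_opp_l, exp_0; reflexivity).
  assert (I2 : Ci * Ci = - (1)) by (apply C_eq; cbn; ring).
  generalize dependent (RtoC (exp (- (v / 2)))). intros e1. generalize (RtoC (exp (v / 2))). intros e2 E1.
  generalize (Cexp (- (w + w))) (Cexp (w + w)) (Cexp (- w)) (Cexp w) (Cexp m) (RtoC (rad v)) (RtoC (v / 2)).
  intros A B A1 B1 X rv v2.
  intros _ _ _.
  assert (S1 : ((1 - Ci) * e1 + (1 + Ci) * e2) * ((1 - Ci) * e1 + (1 + Ci) * e2) = 4 * (e1 * e2) + 2 * Ci * (e2 * e2 - e1 * e1)) by ring [I2].
  assert (S2 : ((1 + Ci) * e1 + (1 - Ci) * e2) * ((1 + Ci) * e1 + (1 - Ci) * e2) = 4 * (e1 * e2) - 2 * Ci * (e2 * e2 - e1 * e1)) by ring [I2].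
  replace (/ 2 * ((1 - Ci) * e1 + (1 + Ci) * e2) * (/ 2 * ((1 - Ci) * e1 + (1 + Ci) * e2)))
    with (/ 2 * / 2 * (((1 - Ci) * e1 + (1 + Ci) * e2) * ((1 - Ci) * e1 + (1 + Ci) * e2))) by ring.
  replace (/ 2 * ((1 + Ci) * e1 + (1 - Ci) * e2) * (/ 2 * ((1 + Ci) * e1 + (1 - Ci) * e2)))
    with (/ 2 * / 2 * (((1 + Ci) * e1 + (1 - Ci) * e2) * ((1 + Ci) * e1 + (1 - Ci) * e2))) by ring.
  rewrite S1, S2. field.
Qed.

End Plane.

(** * The averaged kernel *)

Lemma merged_mean_derive xi eta :
  (0 < Re ((1 - Ci) * xi + (1 + Ci) * eta))%R -> (0 < Re ((1 + Ci) * xi + (1 - Ci) * eta))%R ->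
  exists l, Rd (merged_mean xi eta) 0%R l.
Proof.
  intros HP HQ. destruct (planeKer_bounds xi eta HP HQ) as [r [M [Hr HB]]].
  exists (CI (fun x => CI (planeKer1 xi eta 0 x))).
  assert (D : Rd (fun w => CI (fun x => CI (planeKer xi eta w x))) 0%R (CI (fun x => CI (planeKer1 xi eta 0 x)))).
  { pose proof (CI2_param_Rd (planeKer xi eta) (planeKer1 xi eta) 0%R r M (/ 2) Hr ltac:(lra) (Rd_planeKer xi eta)
      (proj1 (cont3_planeKer xi eta)) (proj2 (cont3_planeKer xi eta))) as K. apply K. clear K.
    intros w Hw. apply HB. rewrite Rminus_0_r in Hw. exact Hw. }
  eapply (is_derive_ext_loc (V := C_R_NormedModule)); [| exact D].
  exists (mkposreal r Hr). intros w Hw. cbn in Hw. unfold ball in Hw. cbn in Hw.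
  unfold AbsRing_ball, abs, minus, plus, opp in Hw. cbn in Hw. rewrite Ropp_0, Rplus_0_r in Hw.
  symmetry. apply (merged_mean_plane xi eta r M w); [intros w' Hw'; apply HB, Hw' | exact Hw].
Qed.

(** At w = 0 the quadratic terms e^(2 x) and e^(2 y) disappear and only e^(x + y) is
    left. *)
Lemma merged_mean_0 xi eta :
  let P := (1 - Ci) * xi + (1 + Ci) * eta in let Q := (1 + Ci) * xi + (1 - Ci) * eta in
  (0 < Re P)%R -> (0 < Re Q)%R -> merged_mean xi eta 0%R = PI * tricomiU (/ 2) 1 (Clog P + Clog Q - ln 4).
Proof.
  intros P Q HP HQ. destruct (planeKer_bounds xi eta HP HQ) as [r [M [Hr HB]]].
  rewrite <- (Y_tricomi P Q HP HQ), (merged_mean_plane xi eta r M 0%R); [| intros w' Hw'; apply HB, Hw' | rewrite Rabs_R0; exact Hr].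
  apply CI_ext. intros x. apply CI_ext. intros y. unfold planeKer, planeKer0. f_equal.
  unfold Eexp, PC, QC. replace (- RtoC 0) with (RtoC 0) by ring. rewrite Cplus_0_l, Copp_0, Cexp_0.
  rewrite exp_plus. unfold P, Q. field.
Qed.

Lemma rapid_merged_mean xi eta (s : C) : (Rabs (Re s) < 1 / 4)%R ->
  (0 < Re ((1 - Ci) * xi + (1 + Ci) * eta))%R -> (0 < Re ((1 + Ci) * xi + (1 - Ci) * eta))%R ->
  rapid (fun w : R => Cexp (4 * s * w) * merged_mean xi eta w) /\
  Rhat s * (pcInt (/ 2 - 2 * s) 0 xi * pcInt (/ 2 + 2 * s) 0 eta) = 2 * CI (fun w : R => Cexp (4 * s * w) * merged_mean xi eta w).
Proof.
  intros Hs HP HQ. pose proof (rapid2_om_merged xi eta s Hs HP HQ) as G2.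
  assert (Gv : forall w : R, rapid (fun v => om v * merged xi eta (uu w (ang v)))).
  { intros w. pose proof (rapid2_slice _ w (rapid2_swap _ G2)) as Gs. cbv beta in Gs.
    apply (rapid_ext (fun v => / Cexp (4 * s * w) * (Cexp (4 * s * w) * (om v * merged xi eta (uu w (ang v)))))).
    - intros v. field. apply Cexp_neq_0.
    - apply rapid_scal, Gs. }
  assert (E : forall w : R, CI (fun v => Cexp (4 * s * w) * (om v * merged xi eta (uu w (ang v)))) = Cexp (4 * s * w) * merged_mean xi eta w).
  { intros w. apply CI_scal, Gv. }
  assert (GG : rapid (fun w : R => Cexp (4 * s * w) * merged_mean xi eta w)).
  { apply (rapid_ext _ _ E). apply (rapid2_CI _ (rapid2_swap _ G2)). }
  split; [exact GG |].
  unfold Rhat. rewrite Cmult_comm, <- CI_scal by apply rapid_Rhat.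
  rewrite (CI_ext _ (fun v => 2 * CI (fun w : R => Cexp (4 * s * w) * (om v * merged xi eta (uu w (ang v)))))).
  - rewrite CI_scal by apply (rapid2_CI _ G2). apply (f_equal (Cmult 2)). rewrite (CI_Fubini _ G2). apply CI_ext, E.
  - intros v. pose proof (om_bound v) as Bo.
    assert (No : RtoC (om v) <> 0) by (intros H; apply RtoC_inj in H; lra).
    assert (Gg : rapid (fun w : R => Cexp (4 * s * w) * merged xi eta (uu w (ang v)))).
    { pose proof (rapid2_slice _ v G2) as Gs. cbv beta in Gs.
      apply (rapid_ext (fun w : R => / om v * (Cexp (4 * s * w) * (om v * merged xi eta (uu w (ang v)))))).
      - intros w. field. exact No.
      - apply rapid_scal, Gs. }
    rewrite (CI_ext (fun w : R => Cexp (4 * s * w) * (om v * merged xi eta (uu w (ang v))))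
      (fun w : R => om v * (Cexp (4 * s * w) * merged xi eta (uu w (ang v))))) by (intros; ring).
    rewrite CI_scal by exact Gg.
    pose proof (pcInt_merge xi eta s (ang v) Hs (ang_bound v) Gg) as HM.
    transitivity (om v * (Cexp (4 * s * (Ci * ang v)) * (pcInt (/ 2 - 2 * s) 0 xi * pcInt (/ 2 + 2 * s) 0 eta))); [ring |].
    rewrite HM. ring.
Qed.

(** * Fourier inversion at a point of differentiability *)

Lemma is_RInt_gen_criterion f (L : C) : contR f ->
  (forall e, (0 < e)%R -> exists A, forall a b, (a < - A)%R -> (A < b)%R -> (Cmod (CRI f a b - L) < e)%R) ->
  is_RInt_gen (V := C_R_CompleteNormedModule) f (Rbar_locally m_infty) (Rbar_locally p_infty) L.
Proof.
  intros Hf H P [e HP]. destruct (H e (cond_pos e)) as [A HA].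
  apply (Filter_prod _ _ _ (fun a => (a < - A)%R) (fun b => (A < b)%R)).
  - exists (- A)%R. intros x Hx; exact Hx.
  - exists A. intros x Hx; exact Hx.
  - intros a b Ha Hb. cbn [fst snd]. exists (CRI f a b). split; [apply contR_is_RInt, Hf |].
    apply HP. apply (C_NormedModule_mixin_compat1 L (CRI f a b) e). apply HA; assumption.
Qed.

(** The frequency 4 t is that of exp (4 s w) along s = sigma + i t. *)
Definition wave (t w : R) : C := Cexp (Ci * (4 * t * w)%R).

Lemma Cmod_wave t w : Cmod (wave t w) = 1%R.
Proof. unfold wave. rewrite Cmod_Cexp. replace (Re (Ci * (4 * t * w)%R)) with 0%R by (cbn; ring). apply exp_0. Qed.

Definition fourier (g : R -> C) (t : R) : C := CI (fun w => wave t w * g w).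

Lemma eb_wave M c g t : eb M c g -> eb M c (fun w => wave t w * g w).
Proof. intros H w. rewrite Cmod_mult, Cmod_wave, Rmult_1_l. apply H. Qed.

Lemma contR_wave g t : contR g -> contR (fun w => wave t w * g w).
Proof. intros H w. unfold wave. apply contC_mult; [ctac | apply H]. Qed.

Lemma rapid_wave g t : rapid g -> rapid (fun w => wave t w * g w).
Proof.
  intros [Hc [M [c [H1 H2]]]]. split; [apply contR_wave, Hc |]. exists M, c. split; [exact H1 | apply eb_wave, H2].
Qed.

Lemma contR_snd_joint g t w : contR g -> joint (U := R_UniformSpace) (fun t w => wave t w * g w) t w.
Proof.
  intros Hg. revert t w. apply joint2_mult.
  - unfold wave. ctac.
  - apply (joint2_comp g (fun _ w => w)); [exact Hg |]. intros p. apply (cont_snd (V := R_UniformSpace)).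
Qed.

Lemma contR_TF g : rapid g -> contR (fourier g).
Proof.
  intros [Hc [M [c [H1 H2]]]] t.
  apply (CI_cont (U := R_UniformSpace) (fun t w => wave t w * g w) t M c H1).
  - apply filter_forall. intros t'. split; [apply contR_wave, Hc | apply eb_wave, H2].
  - intros w. apply contR_snd_joint, Hc.
Qed.

(** Translating by half a period changes the sign of the wave, so twice the transform
    is the transform of a small difference. *)
Lemma Riemann_Lebesgue g e : rapid g -> (0 < e)%R ->
  exists A, (0 < A)%R /\ forall t, (A < Rabs t)%R -> (Cmod (fourier g t) < e)%R.
Proof.
  intros Gg He. pose proof Gg as [Hc [M [c [H1 H2]]]]. pose proof (eb_M_pos _ _ _ H2) as PM.
  set (M' := (M + M * exp (c * 1))%R). assert (PM' : (0 <= M')%R) by (unfold M'; pose proof (exp_pos (c * 1)); nra).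
  destruct (CI_remainder M' c e H1 He PM') as [N [e1 [PN [He1 HR]]]].
  assert (J : forall x, (- N <= x <= N)%R -> joint (U := R_UniformSpace) (fun a w => g (w + a)%R) 0%R x).
  { intros x _. revert x. assert (J2 : joint2 (fun a w => g (w + a)%R)) by (apply (joint2_comp g (fun a w => w + a)%R); [exact Hc | intros p; ctac]).
    intros x. apply J2. }
  destruct (joint_tube (U := R_UniformSpace) (fun a w => g (w + a)%R) 0%R (- N) N e1 J He1) as [d Hd].
  pose proof PI_RGT_0 as Ppi. pose proof (cond_pos d) as Pd.
  exists (PI / Rmin 1 d)%R.
  assert (Pm : (0 < Rmin 1 d)%R) by (apply Rmin_pos; lra). pose proof (Rmin_l 1 d). pose proof (Rmin_r 1 d).
  split; [apply Rdiv_lt_0_compat; lra |]. intros t Ht.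
  assert (Pt : (0 < Rabs t)%R) by (eapply Rlt_trans; [| exact Ht]; apply Rdiv_lt_0_compat; lra).
  assert (Nt : t <> 0%R) by (intros ->; rewrite Rabs_R0 in Pt; lra).
  set (a := (PI / (4 * t))%R).
  assert (Ha : (Rabs a < Rmin 1 d)%R).
  { unfold a, Rdiv. rewrite Rabs_mult, Rabs_inv, Rabs_mult, (Rabs_pos_eq PI), (Rabs_pos_eq 4) by lra.
    apply (Rmult_lt_reg_r (4 * Rabs t)); [lra |]. rewrite Rmult_assoc, Rinv_l by lra.
    apply (Rmult_lt_compat_r (Rmin 1 d)) in Ht; [| exact Pm]. unfold Rdiv in Ht. rewrite Rmult_assoc, Rinv_l in Ht by lra. nra. }
  assert (Gs : rapid (fun w => g (w + a)%R)) by apply rapid_shift, Gg.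
  assert (E : fourier g t = - CI (fun w => wave t w * g (w + a)%R)).
  { unfold fourier. rewrite <- (CI_shift _ a (rapid_wave g t Gg)).
    rewrite (CI_ext _ (fun w => - (1) * (wave t w * g (w + a)%R))).
    - rewrite CI_scal by apply (rapid_wave _ t Gs). ring.
    - intros w. replace (wave t (w + a)) with (- wave t w); [ring |].
      unfold wave. replace (Ci * (4 * t * (w + a))%R) with (Ci * (4 * t * w)%R + Ci * PI).
      + rewrite Cexp_plus. replace (Cexp (Ci * PI)) with (- (1)); [ring |].
        unfold Cexp. replace (Re (Ci * PI)) with 0%R by (cbn; ring). replace (Im (Ci * PI)) with PI by (cbn; ring).
        rewrite exp_0, cos_PI, sin_PI. apply C_eq; cbn; ring.
      + rewrite <- Cmult_plus_distr_l, <- RtoC_plus. do 2 f_equal. unfold a. field. exact Nt. }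
  assert (E2 : 2 * fourier g t = - CI (fun w => wave t w * (g (w + a)%R - g w))).
  { rewrite (CI_ext (fun w => wave t w * (g (w + a)%R - g w)) (fun w => wave t w * g (w + a)%R - wave t w * g w)) by (intros; ring).
    rewrite CI_minus by (apply rapid_wave; assumption). fold (fourier g t). 
    transitivity (fourier g t + fourier g t); [ring |]. rewrite E at 1. ring. }
  assert (B : (Cmod (CI (fun w => wave t w * (g (w + a)%R - g w))%C) <= e * 1)%R).
  { apply HR; [lra | | |].
    - apply contR_wave, contR_minus; [apply Gs | exact Hc].
    - apply eb_wave. rewrite Rmult_1_l. intros w. eapply Rle_trans; [apply Cmod_triangle' |].
      pose proof (eb_shift M c g a H1 H2 w) as B1. pose proof (H2 w) as B2. cbv beta in B1.
      assert (exp (c * Rabs a) <= exp (c * 1))%R by (apply exp_le, Rmult_le_compat_l; lra).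
      pose proof (exp_pos (- (c * Rabs w))).
      assert (M * exp (c * Rabs a) * exp (- (c * Rabs w)) <= M * exp (c * 1) * exp (- (c * Rabs w)))%R
        by (apply Rmult_le_compat_r; [lra | apply Rmult_le_compat_l; lra]).
      unfold M'. lra.
    - intros w Hw. rewrite Cmod_mult, Cmod_wave, !Rmult_1_l. left.
      assert (Hb : ball 0%R d a).
      { unfold ball. cbn. unfold AbsRing_ball, abs, minus, plus, opp. cbn. rewrite Ropp_0, Rplus_0_r. lra. }
      pose proof (Hd a Hb w Hw) as B. cbv beta in B. rewrite Rplus_0_r in B. exact B. }
  apply (f_equal Cmod) in E2. rewrite Cmod_mult, Cmod_R, Cmod_opp, Rabs_pos_eq in E2 by lra.
  pose proof (Cmod_ge_0 (fourier g t)). lra.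
Qed.

(** ** Dividing out a zero *)

(** The value [l] at 0 is meant to be the derivative there. *)
Definition quot (f : R -> C) (l : C) (w : R) : C := if Req_EM_T w 0 then l else / w * f w.

Lemma quot_eq (f : R -> C) l (w : R) : f 0%R = 0 -> w * quot f l w = f w.
Proof.
  intros H0. unfold quot. destruct (Req_EM_T w 0) as [-> | N]; [rewrite H0; ring |].
  field. intros H; apply N, RtoC_inj, H.
Qed.

Lemma rapid_quot f l : rapid f -> f 0%R = 0 -> Rd f 0%R l -> rapid (quot f l).
Proof.
  intros [Hc [M [c [H1 H2]]]] H0 HD. pose proof (Rd_eps_inv f 0%R l HD) as De.
  pose proof (eb_M_pos _ _ _ H2) as PM.
  assert (Dq : forall e, (0 < e)%R -> exists d, (0 < d)%R /\ forall w, (Rabs w < d)%R -> (Cmod (quot f l w - l) <= e)%R).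
  { intros e He. destruct (De e He) as [d [Hd Hw]]. exists d. split; [exact Hd |]. intros w Aw.
    unfold quot. destruct (Req_EM_T w 0) as [-> | N]; [replace (l - l) with (RtoC 0) by ring; rewrite Cmod_0; lra |].
    specialize (Hw w Aw). rewrite Rplus_0_l, H0 in Hw.
    assert (Nw : RtoC w <> 0) by (intros H; apply N, RtoC_inj, H).
    assert (Pw : (0 < Rabs w)%R) by (apply Rabs_pos_lt, N).
    apply (Rmult_le_reg_r (Rabs w)); [exact Pw |]. rewrite <- (Cmod_R w) at 1. rewrite <- Cmod_mult.
    replace ((/ w * f w - l) * w) with (f w - 0 - l * w) by (field; exact Nw). exact Hw. }
  split.
  - intros w. destruct (Req_EM_T w 0) as [-> | N].
    + apply filterlim_locally. intros e. destruct (Dq (e / 2)%R ltac:(pose proof (cond_pos e); lra)) as [d [Hd Hw]].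
      exists (mkposreal d Hd). intros w Bw. cbn in Bw. unfold ball in Bw. cbn in Bw.
      unfold AbsRing_ball, abs, minus, plus, opp in Bw. cbn in Bw. rewrite Ropp_0, Rplus_0_r in Bw.
      apply (C_NormedModule_mixin_compat1 (quot f l 0%R) (quot f l w) e).
      replace (quot f l 0%R) with l by (unfold quot; destruct (Req_EM_T 0 0); [reflexivity | lra]).
      specialize (Hw w Bw). pose proof (cond_pos e). change (Cmod (quot f l w - l) < e)%R. lra.
    + apply (continuous_ext_loc (T := R_UniformSpace) (U := C_UniformSpace) (quot f l) (fun w : R => / w * f w)).
      * exists (mkposreal (Rabs w) (Rabs_pos_lt w N)). intros u Bu. cbn in Bu. unfold ball in Bu. cbn in Bu.
        unfold AbsRing_ball, abs, minus, plus, opp in Bu. cbn in Bu.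
        unfold quot. destruct (Req_EM_T u 0) as [-> | Nu]; [| reflexivity].
        rewrite Rplus_0_l, Rabs_Ropp in Bu. lra.
      * apply contC_mult; [| apply Hc]. apply contC_Cinv; [intros H; apply N, RtoC_inj, H | apply (contC_RtoC (fun w : R => w)), continuous_id].
  - destruct (Dq 1%R ltac:(lra)) as [d [Hd Hw]].
    exists (M / d + (Cmod l + 1) * exp (c * d))%R, c. split; [exact H1 |]. intros w.
    pose proof (exp_pos (- (c * Rabs w))) as Pe. pose proof (Cmod_ge_0 l) as Pl. pose proof (exp_pos (c * d)) as Pcd.
    assert (PMd : (0 <= M / d)%R) by (apply Rdiv_le_0_compat; lra).
    rewrite Rmult_plus_distr_r. destruct (Rlt_dec (Rabs w) d) as [L | L].
    + specialize (Hw w L). apply Rle_trans with ((Cmod l + 1) * 1)%R.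
      * replace (quot f l w) with ((quot f l w - l) + l) by ring. eapply Rle_trans; [apply Cmod_triangle |]. lra.
      * assert (1 <= exp (c * d) * exp (- (c * Rabs w)))%R.
        { rewrite <- exp_plus, <- exp_0 at 1. apply exp_le. nra. }
        assert (0 <= M / d * exp (- (c * Rabs w)))%R by nra. rewrite Rmult_assoc.
        assert ((Cmod l + 1) * 1 <= (Cmod l + 1) * (exp (c * d) * exp (- (c * Rabs w))))%R by (apply Rmult_le_compat_l; lra). lra.
    + assert (Q : (Cmod (quot f l w) <= M / d * exp (- (c * Rabs w)))%R).
      { unfold quot. destruct (Req_EM_T w 0) as [-> | N]; [rewrite Rabs_R0 in L; lra |].
        rewrite Cmod_mult, Cmod_inv, Cmod_R by (intros H; apply N, RtoC_inj, H).
        assert (Iw : (/ Rabs w <= / d)%R) by (apply Rinv_le_contravar; lra).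
        unfold Rdiv. rewrite (Rmult_comm M), Rmult_assoc.
        apply Rmult_le_compat; [apply Rlt_le, Rinv_0_lt_compat; lra | apply Cmod_ge_0 | exact Iw | apply H2]. }
      assert (0 <= (Cmod l + 1) * exp (c * d) * exp (- (c * Rabs w)))%R by (apply Rmult_le_pos; nra). lra.
Qed.

(** Multiplication by w is differentiation of the transform. *)
Lemma Rd_fourier_quot f l t : rapid f -> f 0%R = 0 -> Rd f 0%R l -> Rd (fourier (quot f l)) t (4 * Ci * fourier f t).
Proof.
  intros Gf H0 HD. pose proof (rapid_quot f l Gf H0 HD) as Gq.
  destruct (rapid_common f (quot f l) Gf Gq) as [M [c [Hc [Ef Eq]]]].
  pose proof (eb_M_pos _ _ _ Ef) as PM.
  unfold fourier. rewrite <- CI_scal by apply (rapid_wave f t Gf).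
  apply (CI_param_Rd (fun t w => wave t w * quot f l w) (fun t w => 4 * Ci * (wave t w * f w)) t 1 (4 * M) c); [lra | exact Hc | | | |].
  - intros t' w _. rewrite <- (quot_eq f l w H0).
    apply (Rd_eq _ _ ((4 * Ci * w * wave t' w) * quot f l w)); [| ring].
    pose proof (Cd_Rd' (fun z => Cexp (4 * Ci * w * z) * quot f l w) t' (4 * Ci * w * Cexp (4 * Ci * w * t') * quot f l w)) as K.
    assert (Ew : forall t : R, Cexp (4 * Ci * w * t) = wave t w).
    { intros u. unfold wave. f_equal. rewrite !RtoC_mult. ring. }
    rewrite Ew in K. apply (is_derive_ext (V := C_R_NormedModule) (fun u : R => Cexp (4 * Ci * w * u) * quot f l w)); [intros u; rewrite Ew; reflexivity |].
    apply K. eapply Cd_eq; [dtac |]. rewrite Ew. ring.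
  - intros t' w _. unfold joint. apply contC_mult; [apply contC_const |]. apply (contR_snd_joint f t' w), Gf.
  - intros t' _. apply contR_wave, Gq.
  - intros t' _. split; [apply (eb_weaken M c); [lra | lra | apply eb_wave, Eq] |].
    intros w. rewrite Cmod_mult. pose proof (eb_wave M c f t' Ef w) as B. cbv beta in B.
    rewrite Cmod_mult, Cmod_Ci, Cmod_R, Rabs_pos_eq, Rmult_1_r by lra. lra.
Qed.

(** The transform of w q(w) is the derivative of that of q, which tends to 0 at both
    ends. *)
Lemma fourier_vanishing f l : rapid f -> f 0%R = 0 -> Rd f 0%R l ->
  forall e, (0 < e)%R -> exists A, forall a b, (a < - A)%R -> (A < b)%R -> (Cmod (CRI (fourier f) a b) < e)%R.
Proof.
  intros Gf H0 HD e He. pose proof (rapid_quot f l Gf H0 HD) as Gq.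
  destruct (Riemann_Lebesgue _ e Gq He) as [A [PA HA]]. exists A. intros a b Ha Hb.
  pose proof (CRI_derive (fourier (quot f l)) (fun t => 4 * Ci * fourier f t) a b (fun t => Rd_fourier_quot f l t Gf H0 HD)) as E.
  rewrite CRI_scal in E by apply contR_TF, Gf.
  specialize (E (contR_scal _ _ (contR_TF f Gf))).
  assert (B1 : (Cmod (fourier (quot f l) a) < e)%R) by (apply HA; rewrite Rabs_left; lra).
  assert (B2 : (Cmod (fourier (quot f l) b) < e)%R) by (apply HA; rewrite Rabs_pos_eq; lra).
  apply (f_equal Cmod) in E. rewrite !Cmod_mult, Cmod_Ci, Cmod_R, Rabs_pos_eq, Rmult_1_r in E by lra.
  pose proof (Cmod_triangle' (fourier (quot f l) b) (fourier (quot f l) a)). pose proof (Cmod_ge_0 (CRI (fourier f) a b)). lra.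
Qed.

(** ** The reference pair: the hyperbolic secant *)

(** The reflection formula on the imaginary axis. *)
Lemma fourier_sch t : fourier g1 t = PI * sch (2 * PI * t).
Proof.
  pose proof PI_RGT_0 as Ppi.
  assert (Hu : (Rabs (Re (Ci * (4 * t)%R)) < 1)%R) by (replace (Re (Ci * (4 * t)%R)) with 0%R by (cbn; ring); rewrite Rabs_R0; lra).
  pose proof (Gam_pair (Ci * (4 * t)%R) 0 Hu ltac:(rewrite Rabs_R0; lra)) as E. fold (gpair (Ci * (4 * t)%R)) in E.
  replace (Ci * 0%R * (Ci * (4 * t)%R)) with (RtoC 0) in E by ring. rewrite Cexp_0, Cmult_1_l in E.
  assert (ET : fourier g1 t = gpair (Ci * (4 * t)%R)).
  { rewrite E. rewrite <- CI_scal by (apply rapid_pair; [exact Hu | rewrite Rabs_R0; lra]).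
    apply CI_ext. intros w. unfold wave, g1, sch. rewrite ch_0.
    replace (Ci * (4 * t)%R * w) with (Ci * (4 * t * w)%R) by (rewrite !RtoC_mult; ring).
    pose proof (epe_pos w). rewrite RtoC_div by lra. rewrite (Rplus_comm (exp (- w))). unfold Cdiv. ring. }
  rewrite ET. pose proof (reflection (Ci * (4 * t)%R) Hu) as Rf.
  replace (Ci * (PI / 2)%R * (Ci * (4 * t)%R)) with (RtoC (- (2 * PI * t))) in Rf.
  2:{ apply C_eq; cbn; field. }
  rewrite <- RtoC_opp, Ropp_involutive, !Cexp_R, <- RtoC_plus in Rf.
  unfold sch. pose proof (epe_pos (2 * PI * t)) as Pe. rewrite RtoC_div by lra.
  assert (Ne : RtoC (exp (2 * PI * t) + exp (- (2 * PI * t))) <> 0) by (intros H; apply RtoC_inj in H; lra).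
  rewrite (Rplus_comm (exp (- _))) in Rf.
  replace (gpair (Ci * (4 * t)%R)) with (/ RtoC (exp (2 * PI * t) + exp (- (2 * PI * t))) * (RtoC (exp (2 * PI * t) + exp (- (2 * PI * t))) * gpair (Ci * (4 * t)%R)))
    by (field; exact Ne).
  rewrite Rf. field. exact Ne.
Qed.

Lemma CI_TF_sch : CI (fourier g1) = (PI / 2)%R /\ rapid (fourier g1).
Proof.
  pose proof PI_RGT_0 as Ppi.
  assert (G0 : rapid (fun t => g1 (2 * PI * t)%R)) by (apply rapid_lin; [lra | apply rapid_g1]).
  assert (E1 : CI g1 = PI).
  { pose proof (fourier_sch 0) as E. unfold fourier in E. rewrite Rmult_0_r in E.
    replace (sch 0) with 1%R in E by (unfold sch; rewrite Ropp_0, exp_0; field). rewrite Cmult_1_r in E.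
    rewrite <- E. apply CI_ext. intros w. unfold wave. replace (4 * 0 * w)%R with 0%R by ring.
    rewrite Cmult_0_r, Cexp_0. ring. }
  pose proof (CI_lin g1 (2 * PI) ltac:(lra) rapid_g1) as EL. rewrite E1 in EL.
  split.
  - rewrite (CI_ext (fourier g1) (fun t => PI * g1 (2 * PI * t)%R)) by (intros t; apply fourier_sch).
    rewrite CI_scal by exact G0. rewrite RtoC_div by lra. 
    transitivity (/ 2 * (RtoC (2 * PI) * CI (fun x : R => g1 (2 * PI * x)%R))); [rewrite RtoC_mult; field | rewrite EL; field].
  - apply (rapid_ext (fun t => PI * g1 (2 * PI * t)%R)); [intros t; symmetry; apply fourier_sch | apply rapid_scal, G0].
Qed.

(** Subtract the multiple of the hyperbolic secant that has the same value at 0: its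
    transform is explicit and has integral PI / 2, and the difference is w times a
    [rapid] function. *)
Lemma Fourier_inversion g l : rapid g -> Rd g 0%R l ->
  is_RInt_gen (V := C_R_CompleteNormedModule) (fourier g) (Rbar_locally m_infty) (Rbar_locally p_infty) ((PI / 2)%R * g 0%R).
Proof.
  intros Gg HD. destruct CI_TF_sch as [ES GS].
  set (f := fun w => g w - g 0%R * g1 w).
  assert (Gf : rapid f) by (apply rapid_minus; [exact Gg | apply rapid_scal, rapid_g1]).
  assert (S0 : sch 0 = 1%R) by (unfold sch; rewrite Ropp_0, exp_0; field).
  assert (F0 : f 0%R = 0) by (unfold f, g1; rewrite S0; ring).
  assert (Df : exists l', Rd f 0%R l').
  { eexists. apply (is_derive_minus (V := C_R_NormedModule)); [exact HD |].
    apply (Rd_mult (fun _ => g 0%R) g1).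
    - apply (is_derive_const (V := C_R_NormedModule)).
    - apply Rd_RtoC, is_derive_sch. }
  destruct Df as [l' Df].
  assert (ET : forall t, fourier g t = g 0%R * fourier g1 t + fourier f t).
  { intros t. unfold fourier. rewrite <- CI_scal by apply (rapid_wave g1 t rapid_g1).
    rewrite <- CI_plus; [| apply rapid_scal, rapid_wave, rapid_g1 | apply rapid_wave, Gf].
    apply CI_ext. intros w. unfold f. ring. }
  apply is_RInt_gen_criterion; [apply contR_TF, Gg |]. intros e He.
  destruct (fourier_vanishing f l' Gf F0 Df (e / 2)%R ltac:(lra)) as [A1 H1].
  pose proof (rapid_scal (g 0%R) _ GS) as GSg. pose proof GSg as [Cc [M [c [Hc Eb]]]].
  destruct (exp_small c (M / c) (e / 4) Hc ltac:(lra)) as [N HN].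
  exists (Rmax A1 (INR N)). intros a b Ha Hb. pose proof (Rmax_l A1 (INR N)). pose proof (Rmax_r A1 (INR N)).
  pose proof (pos_INR N).
  rewrite (CRI_ext _ _ a b ET), CRI_plus by (try exact Cc; apply contR_TF, Gf).
  replace ((PI / 2)%R * g 0%R) with (CI (fun t => g 0%R * fourier g1 t)) by (rewrite CI_scal by exact GS; rewrite ES; ring).
  pose proof (CI_tail M c _ Cc Hc Eb a b ltac:(lra)) as T.
  pose proof (HN (- a)%R ltac:(lra)) as B1. pose proof (HN b ltac:(lra)) as B2.
  replace (- (c * - a))%R with (c * a)%R in B1 by ring.
  specialize (H1 a b ltac:(lra) ltac:(lra)).
  set (X := CRI (fun t => g 0%R * fourier g1 t) a b) in *. set (Y := CI (fun t => g 0%R * fourier g1 t)) in *.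
  replace (X + CRI (fourier f) a b - Y) with (- (Y - X) + CRI (fourier f) a b) by ring.
  eapply Rle_lt_trans; [apply Cmod_triangle |]. rewrite Cmod_opp. lra.
Qed.

(** * The integral of the product of two parabolic cylinder functions *)

Lemma Gam_half : Gam (/ 2) = sqrt PI.
Proof.
  pose proof PI_RGT_0 as Ppi. pose proof Gam_half_sq as E.
  assert (Q : (0 < Re (/ 2))%R) by (rewrite Re_half; lra).
  assert (P : (0 <= Re (Gam (/ 2)))%R).
  { apply CI_nonneg; [apply rapid_Gk, Q |]. intros x. unfold Gk.
    rewrite Cexp_R, <- RtoC_inv, <- RtoC_mult, <- RtoC_minus, Cexp_R by lra. apply Rlt_le, exp_pos. }
  destruct (Gam (/ 2)) as [a b]. cbn in P. pose proof (f_equal Re E) as E1. pose proof (f_equal Im E) as E2. cbn in E1, E2.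
  assert (b = 0)%R by nra. subst b.
  apply C_eq; cbn; [| reflexivity]. rewrite <- (sqrt_square a) by exact P. f_equal. lra.
Qed.

Section Final.
Variables xi eta : C.
Let P := (1 - Ci) * xi + (1 + Ci) * eta.
Let Q := (1 + Ci) * xi + (1 - Ci) * eta.
Hypothesis HP : (0 < Re P)%R.
Hypothesis HQ : (0 < Re Q)%R.

Lemma sum_squares : P * Q = 2 * (xi * xi + eta * eta).
Proof.
  assert (I2 : Ci * Ci = - (1)) by (apply C_eq; cbn; ring). unfold P, Q. ring [I2].
Qed.

(** The arguments of P and Q are less than PI / 2 in absolute value, so halving P Q =
    2 (xi^2 + eta^2) stays within the domain of the principal logarithm. *)
Lemma log_sum : (- PI < Im (Clog P + Clog Q - ln 2) < PI)%R /\
  Cexp (Clog P + Clog Q - ln 2) = xi * xi + eta * eta.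
Proof.
  split.
  - pose proof (Carg_half P HP) as A. pose proof (Carg_half Q HQ) as B. apply Rabs_lt_between in A, B.
    replace (Im (Clog P + Clog Q - ln 2)) with (Carg P + Carg Q)%R by (cbn; ring). lra.
  - unfold Cminus. rewrite !Cexp_plus, !Cexp_Clog by (apply Cd_neq; assumption).
    rewrite sum_squares, Cexp_opp, Cexp_R, exp_ln by lra. field.
Qed.

Lemma sum_squares_domain : ~ (Im (xi ^ 2 + eta ^ 2) = 0%R /\ (Re (xi ^ 2 + eta ^ 2) <= 0)%R).
Proof.
  destruct log_sum as [A E]. rewrite !Csq, <- E, Re_Cexp, Im_Cexp.
  set (w := Clog P + Clog Q - ln 2) in *. pose proof (exp_pos (Re w)). intros [H1 H2].
  assert (S : sin (Im w) = 0%R) by nra.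
  assert (Iw : Im w = 0%R).
  { destruct (Rtotal_order (Im w) 0) as [L | [L | L]]; [| exact L |].
    - pose proof (sin_lt_0_var (Im w) ltac:(lra) L). lra.
    - pose proof (sin_gt_0 (Im w) L ltac:(lra)). lra. }
  rewrite Iw, cos_0 in H2. lra.
Qed.

Lemma besselK_value : besselK 0 (1 / 4 * (xi ^ 2 + eta ^ 2)) =
  Gam (/ 2) * Cexp (- (/ 4 * (xi * xi + eta * eta))) * tricomiU (/ 2) 1 (Clog P + Clog Q - ln 4).
Proof.
  destruct log_sum as [A E]. rewrite !Csq, <- E.
  set (w := Clog P + Clog Q - ln 2) in *.
  assert (L2 : (ln 4 = ln 2 + ln 2)%R) by (rewrite <- ln_mult by lra; f_equal; lra).
  assert (Ez : 1 / 4 * Cexp w = Cexp (w - ln 4)).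
  { unfold Cminus. rewrite Cexp_plus, Cexp_opp, Cexp_R, exp_ln by lra. field. }
  assert (El : Clog (1 / 4 * Cexp w) = w - ln 4).
  { rewrite Ez. apply Clog_unique. replace (Im (w - ln 4)) with (Im w) by (cbn; ring). exact A. }
  unfold besselK, besselK_log. rewrite El, <- Ez, Gam_half.
  replace (0 * (w - ln 4 + ln 2)) with (RtoC 0) by ring. rewrite Cexp_0.
  replace (1 / 2 + 0) with (/ 2) by field. replace (1 + 2 * 0) with (RtoC 1) by ring.
  replace (w - ln 4 + ln 2) with (Clog P + Clog Q - ln 4) by (unfold w; ring).
  replace (- (1 / 4 * Cexp w)) with (- (/ 4 * Cexp w)) by field. ring.
Qed.

(** The product [gpair (4 s)] from [Gamma_ratio] cancels against the Gamma factors of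
    the two Laplace integrals. *)
Lemma integrand_value s : (Rabs (Re s) < 1 / 4)%R ->
  CGamma (1 / 4 - s) * CGamma (1 / 4 + s) * parcylD (2 * s - 1 / 2) xi * parcylD (- (2 * s) - 1 / 2) eta
  = 2 * / PI * sqrt 2 * Gam (/ 2) * Cexp (- (/ 4 * (xi * xi + eta * eta))) *
    CI (fun w : R => Cexp (4 * s * w) * merged_mean xi eta w).
Proof.
  intros Hs. pose proof (Gamma_ratio s Hs) as ER. destruct (rapid_merged_mean xi eta s Hs HP HQ) as [_ EG].
  apply Rabs_lt_between in Hs.
  replace (1 / 4 - s) with (/ 4 - s) by field. replace (1 / 4 + s) with (/ 4 + s) by field.
  replace (2 * s - 1 / 2) with (- (/ 2 - 2 * s)) by field. replace (- (2 * s) - 1 / 2) with (- (/ 2 + 2 * s)) by field.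
  assert (R4 : forall z, Re (/ 4 + z) = (/ 4 + Re z)%R) by (intros z; rewrite <- RtoC_inv by lra; reflexivity).
  assert (R2 : forall z, Re (/ 2 + z) = (/ 2 + Re z)%R) by (intros z; rewrite <- RtoC_inv by lra; reflexivity).
  assert (Rs : Re (2 * s) = (2 * Re s)%R) by (destruct s; cbn; ring).
  assert (Hm : (0 < Re (/ 2 - 2 * s) < 1)%R) by (unfold Cminus; rewrite R2, re_opp, Rs; lra).
  assert (Hp : (0 < Re (/ 2 + 2 * s) < 1)%R) by (rewrite R2, Rs; lra).
  rewrite !CGamma_Gam by (unfold Cminus; rewrite R4, ?re_opp; lra).
  rewrite !parcylD_eq by assumption. unfold pcLaplace.
  pose proof (Gam_neq_0 _ Hm) as N1. pose proof (Gam_neq_0 _ Hp) as N2. pose proof PI_neq_0 as N3.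
  assert (GP : gpair (4 * s) = Gam (/ 2 - 2 * s) * Gam (/ 2 + 2 * s)).
  { unfold gpair. apply f_equal2; apply (f_equal Gam); field. }
  rewrite GP in ER.
  assert (EE : Cexp (- (/ 4 * (xi * xi + eta * eta))) = Cexp (- (/ 4 * (xi * xi))) * Cexp (- (/ 4 * (eta * eta)))).
  { rewrite <- Cexp_plus. f_equal. ring. }
  rewrite EE.
  transitivity (/ PI * (PI * (Gam (/ 4 - s) * Gam (/ 4 + s))) * / Gam (/ 2 - 2 * s) * / Gam (/ 2 + 2 * s)
    * (Cexp (- (/ 4 * (xi * xi))) * Cexp (- (/ 4 * (eta * eta)))) * (pcInt (/ 2 - 2 * s) 0 xi * pcInt (/ 2 + 2 * s) 0 eta));
    [field; auto |].
  rewrite ER.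
  transitivity (/ PI * sqrt 2 * Gam (/ 2) * (Cexp (- (/ 4 * (xi * xi))) * Cexp (- (/ 4 * (eta * eta)))) *
    (Rhat s * (pcInt (/ 2 - 2 * s) 0 xi * pcInt (/ 2 + 2 * s) 0 eta))); [field; auto |].
  rewrite EG. ring.
Qed.

(** [Fourier_inversion] at w = 0, where the kernel becomes the Macdonald function. *)
Lemma vertical_integral sigma : (Rabs (Re sigma) < 1 / 4)%R ->
  is_vertical_integral
    (fun s : C => CGamma (1 / 4 - s) * CGamma (1 / 4 + s) *
       parcylD (2 * s - 1 / 2) xi * parcylD (- (2 * s) - 1 / 2) eta) sigma
    (Ci * sqrt 2 * PI * besselK 0 (1 / 4 * (xi ^ 2 + eta ^ 2))).
Proof.
  intros Hs. destruct (rapid_merged_mean xi eta sigma Hs HP HQ) as [GG _].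
  destruct (merged_mean_derive xi eta HP HQ) as [l Hl].
  set (k := Ci * (2 * / PI * sqrt 2 * Gam (/ 2) * Cexp (- (/ 4 * (xi * xi + eta * eta))))).
  set (g := fun w : R => k * (Cexp (4 * sigma * w) * merged_mean xi eta w)).
  assert (Gg : rapid g) by (apply rapid_scal, GG).
  assert (Dg : exists l', Rd g 0%R l').
  { eexists. unfold g. apply (Rd_mult (fun _ => k)); [apply (is_derive_const (V := C_R_NormedModule)) |].
    apply Rd_mult; [| exact Hl]. apply (Cd_Rd' (fun z => Cexp (4 * sigma * z))). dtac. }
  destruct Dg as [l' Dg].
  assert (Ek : Ci * sqrt 2 * PI * besselK 0 (1 / 4 * (xi ^ 2 + eta ^ 2)) = (PI / 2)%R * g 0%R).
  { rewrite besselK_value. unfold g. rewrite (merged_mean_0 xi eta HP HQ). fold P Q.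
    rewrite Cmult_0_r, Cexp_0. unfold k. rewrite RtoC_div by lra. field. apply PI_neq_0. }
  unfold is_vertical_integral. rewrite Ek.
  eapply (is_RInt_gen_ext (V := C_R_CompleteNormedModule)); [| exact (Fourier_inversion g l' Gg Dg)].
  apply (Filter_prod _ _ _ (fun _ => True) (fun _ => True)); try (apply filter_forall; auto).
  intros a b _ _ t _. cbn [fst snd].
  assert (Hst : (Rabs (Re (sigma + Ci * t)) < 1 / 4)%R) by (replace (Re (sigma + Ci * t)) with (Re sigma) by (rewrite re_plus; cbn; ring); exact Hs).
  destruct (rapid_merged_mean xi eta (sigma + Ci * t) Hst HP HQ) as [Gt _].
  rewrite (integrand_value _ Hst).
  match goal with |- @eq _ ?l ?r => change (@eq C l r) end.
  transitivity (k * CI (fun w : R => Cexp (4 * (sigma + Ci * t) * w) * merged_mean xi eta w)); [| unfold k; ring].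
  rewrite <- CI_scal by exact Gt. apply CI_ext. intros w. unfold g, wave.
  replace (Cexp (4 * (sigma + Ci * t) * w)) with (Cexp (Ci * (4 * t * w)%R) * Cexp (4 * sigma * w)); [ring |].
  rewrite <- Cexp_plus. f_equal. rewrite !RtoC_mult. ring.
Qed.

End Final.

Theorem corollary11 (xi eta sigma : C)
  (hxieta1 : (0 < Re ((1 - Ci) * xi + (1 + Ci) * eta))%R)
  (hxieta2 : (0 < Re ((1 + Ci) * xi + (1 - Ci) * eta))%R)
  (hsigma : (Rabs (Re sigma) < 1 / 4)%R) :
  ~ (Im (xi ^ 2 + eta ^ 2) = 0%R /\ (Re (xi ^ 2 + eta ^ 2) <= 0)%R) /\
  exists I : C,
    is_vertical_integral
      (fun s : C =>
         CGamma (1 / 4 - s) * CGamma (1 / 4 + s) *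
         parcylD (2 * s - 1 / 2) xi * parcylD (- (2 * s) - 1 / 2) eta)
      sigma I /\
    besselK 0 (1 / 4 * (xi ^ 2 + eta ^ 2)) = 1 / (sqrt 2 * PI * Ci) * I.
Proof.
  split; [apply (sum_squares_domain xi eta hxieta1 hxieta2) |].
  eexists. split; [apply (vertical_integral xi eta hxieta1 hxieta2 sigma hsigma) |].
  assert (S2 : RtoC (sqrt 2) <> 0) by (intros H; apply RtoC_inj in H; pose proof (sqrt_lt_R0 2 ltac:(lra)); lra).
  assert (I0 : Ci <> 0) by (intros H; apply (f_equal snd) in H; cbn in H; lra).
  field. auto using PI_neq_0.
Qed.
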